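(* (i) Let $\mathcal K$ be a weak Kuranishi atlas. Then there is a well defined line bundle $\det(\mathcal K)$ over $\mathcal K$ given by the line bundles $\Lambda^{\mathcal K}_I:=\Lambda^{\max}TU_I\otimes(\Lambda^{\max}E_I)^*\to U_I$ for $I\in\mathcal I_{\mathcal K}$, with the $\Gamma_I$-actions $\Lambda_{d_x\gamma}\otimes(\Lambda_{\gamma^{-1}})^*$ and the transition maps $\widetilde{\mathfrak C}_{IJ}^{-1}:\rho_{IJ}^*(\Lambda^{\mathcal K}_I|_{U_{IJ}})\to\Lambda^{\mathcal K}_J|_{\widetilde U_{IJ}}$ for $I\subsetneq J$. In particular, the latter isomorphisms are independent of the choice of normal bundle $N_{IJ}$. Furthermore, the contractions $\mathfrak C_{ds_I}:\Lambda^{\mathcal K}_I\to\det(ds_I)$ define an isomorphism $\Psi^{s_{\mathcal K}}:=(\mathfrak C_{ds_I})_{I\in\mathcal I_{\mathcal K}}$ from $\det(\mathcal K)$ to $\det(\mathsf s_{\mathcal K})$. (ii) If $\mathcal K$ is a weak Kuranishi cobordism, then the determinant bundle $\det(\mathcal K)$ defined as in (i) can be given a product structure on the collar such that its boundary restrictions are $\det(\mathcal K)|_{\partial^\alpha\mathcal K}=\det(\partial^\alpha\mathcal K)$ for $\alpha=0,1$. Further, the isomorphism $\Psi^{s_{\mathcal K}}:\det(\mathcal K)\to\det(\mathsf s_{\mathcal K})$ defined as in (i) has product structure on the collar with restrictions $\Psi^{s_{\mathcal K}}|_{\partial^\alpha\mathcal K}=\Psi^{s_{\partial^\alpha\mathcal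 K}}$ for $\alpha=0,1$.
   Context: Group quotients. Manifolds are smooth, finite dimensional, second countable. A group quotient $(U,\Gamma)$ is a manifold $U$ with a smooth action of a finite group $\Gamma$; $\underline U:=U/\Gamma$. A group covering $(\widetilde U,\widetilde\Gamma,\rho,\rho^\Gamma)$ of $(U,\Gamma)$ consists of a surjective homomorphism $\rho^\Gamma:\widetilde\Gamma\to\Gamma$, a group quotient $(\widetilde U,\widetilde\Gamma)$ on which $\ker\rho^\Gamma$ acts freely, and a map $\rho:\widetilde U\to U$ that is the quotient map $\widetilde U\to\widetilde U/\ker\rho^\Gamma$ followed by a diffeomorphism $\widetilde U/\ker\rho^\Gamma\cong U$ equivariant for the induced $\Gamma$-actions. Charts and weak atlases. A Kuranishi chart for $X$ is $\mathbf K=(U,E,\Gamma,s,\psi)$: a manifold $U$, a finite dimensional vector space $E$, a finite group $\Gamma$ acting smoothly on $U$ and linearly on $E$, a smooth $\Gamma$-equivariant $s:U\to E$, and a continuous $\psi:s^{-1}(0)\to X$ inducing a homeomorphism $\underline\psi:s^{-1}(0)/\Gamma\to F$ onto an open set $F\subset X$ (the footprint). Its dimension is $\dim U-\dim E$. A weak Kuranishi atlas $\mathcal K=(\mathbf K_I,\widehat\Phi_{IJ})$ of some dimension on a compact metrizable space $X$ consists of: - finitely many basic charts $\mathbf K_i=(U_i,E_i,\Gamma_i,s_i,\psi_i)$, $i=1,\dots,N$, of this dimension with $X=\bigcup_iF_i$; set $\mathcal I_{\mathcal K}=\{\emptyset\ne I\subset\{1,\dots,N\}: F_I:=\bigcap_{i\in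 I}F_i\neq\emptyset\}$; - for each $I\in\mathcal I_{\mathcal K}$ a chart $\mathbf K_I=(U_I,E_I,\Gamma_I,s_I,\psi_I)$ with footprint $F_I$, $\Gamma_I=\prod_{i\in I}\Gamma_i$, $E_I=\prod_{i\in I}E_i$ with product action, $\mathbf K_{\{i\}}=\mathbf K_i$; $\pi_I:U_I\to\underline U_I$; - for $I\subsetneq J$ in $\mathcal I_{\mathcal K}$ a coordinate change $\widehat\Phi_{IJ}$: an open $\underline U_{IJ}\subset\underline U_I$ with $\underline U_{IJ}\cap\underline\psi_I^{-1}(F_I)=\underline\psi_I^{-1}(F_J)$; with $U_{IJ}:=\pi_I^{-1}(\underline U_{IJ})$, a $\Gamma_J$-invariant submanifold $\widetilde U_{IJ}\subset U_J$ on which $\Gamma_{J\setminus I}=\prod_{j\in J\setminus I}\Gamma_j$ acts freely and a group covering $(\widetilde U_{IJ},\Gamma_J,\rho_{IJ},\rho^\Gamma_{IJ})$ of $(U_{IJ},\Gamma_I)$ with $\rho^\Gamma_{IJ}:\Gamma_J\to\Gamma_I$ the natural projection; with the natural inclusion $\widehat\phi_{IJ}:E_I\to E_J$ one requires $s_J=\widehat\phi_{IJ}\circ s_I\circ\rho_{IJ}$ on $\widetilde U_{IJ}$, $\psi_J=\psi_I\circ\rho_{IJ}$ on $s_J^{-1}(0)\cap\widetilde U_{IJ}=\rho_{IJ}^{-1}(s_I^{-1}(0))$, and the index condition: for $u\in\widetilde U_{IJ}$ and $s_{IJ}:=s_I\circ\rho_{IJ}$, $\ker d_us_{IJ}=\ker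 d_us_J$, and whenever $E_I={\rm im}\,d_us_{IJ}\oplus C$ then $E_J={\rm im}\,d_us_J\oplus\widehat\phi_{IJ}(C)$ (equivalently, $d_us_J$ induces an isomorphism $T_uU_J/T_u\widetilde U_{IJ}\to E_J/\widehat\phi_{IJ}(E_I)$); - the weak cocycle condition: for $I\subsetneq J\subsetneq K$, $\rho_{IK}=\rho_{IJ}\circ\rho_{JK}$ on $\widetilde U_{IK}\cap\rho_{JK}^{-1}(\widetilde U_{IJ}\cap U_{JK})$. Weak Kuranishi cobordisms. $A^0_\varepsilon=[0,\varepsilon)$, $A^1_\varepsilon=(1-\varepsilon,1]$. A compact collared cobordism $(Y,\iota^0_Y,\iota^1_Y)$ is a compact metrizable space with disjoint, possibly empty, closed subsets $\partial^0Y,\partial^1Y$ and, for some $\varepsilon>0$, homeomorphisms $\iota^\alpha_Y$ from $A^\alpha_\varepsilon\times\partial^\alpha Y$ onto disjoint open neighbourhoods of $\partial^\alpha Y$ extending the inclusions at $t=\alpha$. A weak Kuranishi cobordism on $Y$ is defined like a weak Kuranishi atlas on $Y$ except: if $F_I$ meets $\partial^0Y\cup\partial^1Y$ then in small collars $F_I$ is of product form $\iota^\alpha_Y(A^\alpha_\delta\times\partial^\alpha F_I)$ or empty, with $\partial^\alpha F_I=F_I\cap\partial^\alpha Y$; $U_I$ is a manifold with boundary $\partial^0U_I\sqcup\partial^1U_I$ ($\partial^\alpha U_I\neq\emptyset$ iff $\partial^\alpha F_I\ne\emptyset$) with $\Gamma_I$-equivariant tubular neighbourhood diffeomorphisms $\iota^\alpha_I:A^\alpha_\varepsilon\times\partial^\alpha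 U_I\to U_I$ and there are charts $\partial^\alpha\mathbf K_I=(\partial^\alpha U_I,E_I,\Gamma_I,s^\alpha_I,\psi^\alpha_I)$ for $\partial^\alpha Y$ with footprint $\partial^\alpha F_I$, $s_I(\iota_I^\alpha(t,x))=s^\alpha_I(x)$ and $\psi_I(\iota^\alpha_I(t,x))=\iota^\alpha_Y(t,\psi^\alpha_I(x))$; all other charts have footprints precompact in $Y\setminus(\partial^0Y\cup\partial^1Y)$ and domains without boundary; if $F_J\cap\partial^\alpha Y\ne\emptyset$ then $\widehat\Phi_{IJ}$ is in a small collar the product of ${\rm id}_{A^\alpha_\varepsilon}$ with a coordinate change $\partial^\alpha\widehat\Phi_{IJ}:\partial^\alpha\mathbf K_I\to\partial^\alpha\mathbf K_J$; if only $F_I$ meets $\partial^\alpha Y$ then $U_{IJ}$ is disjoint from a collar of $\partial^\alpha U_I$. The boundary restrictions form weak Kuranishi atlases $\partial^\alpha\mathcal K$ on $\partial^\alpha Y$. Bundles. A vector bundle $\Lambda=(\Lambda_I,\widetilde\phi^\Lambda_{IJ})$ over $\mathcal K$ consists of a smooth vector bundle $\Lambda_I\to U_I$ with $\Gamma_I$-action covering that on $U_I$ for each $I$, and for $I\subsetneq J$ a smooth $\Gamma_J$-equivariant map $\widetilde\phi^\Lambda_{IJ}:\rho_{IJ}^*(\Lambda_I|_{U_{IJ}})\to\Lambda_J$, linear isomorphic on fibers, covering the inclusion $\widetilde U_{IJ}\subset U_J$ ($\Gamma_J\cong\Gamma_I\times\Gamma_{J\setminus I}$ acting on the pullback by the action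 of $\Gamma_I$ and the identification of fibers along $\Gamma_{J\setminus I}$-orbits), with $\widetilde\phi^\Lambda_{IK}=\widetilde\phi^\Lambda_{JK}\circ\rho_{JK}^*(\widetilde\phi^\Lambda_{IJ})$ on $\rho_{JK}^{-1}(\widetilde U_{IJ})\cap\widetilde U_{IK}$ for $I\subsetneq J\subsetneq K$. Over a cobordism, a bundle (with product structure on the collar) also comes with restricted bundles $\Lambda|_{\partial^\alpha\mathcal K}=(\Lambda^\alpha_I,\widetilde\phi^{\Lambda,\alpha}_{IJ})$ over $\partial^\alpha\mathcal K$ and $\Gamma_I$-equivariant bundle isomorphisms $\widetilde\iota^{\Lambda,\alpha}_I:A^\alpha_\varepsilon\times\Lambda^\alpha_I\to\Lambda_I|_{{\rm im}\,\iota^\alpha_I}$ covering $\iota^\alpha_I$ (for some $\varepsilon>0$) that intertwine ${\rm id}\times\widetilde\phi^{\Lambda,\alpha}_{IJ}$ with $\widetilde\phi^\Lambda_{IJ}$. An isomorphism $\Psi:\Lambda\to\Lambda'$ is a family of $\Gamma_I$-equivariant bundle isomorphisms $\Psi_I:\Lambda_I\to\Lambda_I'$ over ${\rm id}_{U_I}$ with $\widetilde\phi^{\Lambda'}_{IJ}\circ\rho_{IJ}^*(\Psi_I)=\Psi_J\circ\widetilde\phi^\Lambda_{IJ}$; over a cobordism it has product structure with restrictions $\Psi|_{\partial^\alpha\mathcal K}=(\Psi^\alpha_I)$ if $\widetilde\iota'^{\Lambda,\alpha}_I\circ({\rm id}\times\Psi_I^\alpha)=\Psi_I\circ\widetilde\iota^{\Lambda,\alpha}_I$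 near the boundary. Determinants. For an isomorphism $F$ let $\Lambda_F$ be the induced map on top exterior powers. For linear $D:V\to W$, $\det D=\Lambda^{\max}\ker D\otimes(\Lambda^{\max}(W/{\rm im}D))^*$. For linear $F:V\to W$ and an isomorphism $\phi:K\to\ker F$, $\mathfrak C^\phi_F:\Lambda^{\max}V\otimes(\Lambda^{\max}W)^*\to\Lambda^{\max}K\otimes(\Lambda^{\max}(W/F(V)))^*$ is $(v_1\wedge\dots\wedge v_n)\otimes(w_1\wedge\dots\wedge w_m)^*\mapsto(\phi^{-1}(v_1)\wedge\dots\wedge\phi^{-1}(v_k))\otimes([w_1]\wedge\dots\wedge[w_{m-n+k}])^*$, where $v_1,\dots,v_k$ span $\ker F$ and $w_{m-n+i}=F(v_i)$ for $i=k+1,\dots,n$; $\mathfrak C_D:=\mathfrak C_D^{\phi}$ with $\phi$ the inclusion of $\ker D$. $\det(\mathsf s_{\mathcal K})$ is the line bundle over $\mathcal K$ with local bundles $\det(ds_I)=\bigcup_{x\in U_I}\det(d_xs_I)$, $\Gamma_I$-action $\Lambda_{d_x\gamma}\otimes(\Lambda_{[\gamma]^{-1}})^*$ ($[\gamma]$ the induced map on cokernels), and transition maps $\det(d_{\rho_{IJ}(u)}s_I)\to\det(d_us_J)$ induced by $(d_u\rho_{IJ})^{-1}:\ker d_{\rho_{IJ}(u)}s_I\to\ker d_us_{IJ}=\ker d_us_J$ and by the isomorphism of cokernels $[\widehat\phi_{IJ}]$, i.e. by $(\Lambda_{[\widehat\phi_{IJ}]^{-1}})^*$. Its smooth structure near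 $x_0\in U_I$ is given by the trivializations $\Lambda^{\max}\ker(d_xs_I\oplus R)\to\det(d_xs_I)$, where $R:\mathbb R^N\to E_I$ is injective with image covering ${\rm coker}\,d_xs_I$ for $x$ near $x_0$, $\bar v_1\wedge\dots\wedge\bar v_n\mapsto(v_1\wedge\dots\wedge v_k)\otimes([R(e_1)]\wedge\dots\wedge[R(e_{N-n+k})])^*$, with $\bar v_i=(v_i,r_i)$ a basis of $\ker(d_xs_I\oplus R)$ such that $v_1,\dots,v_k$ span $\ker d_xs_I$, and $e_1,\dots,e_N$ a basis of $\mathbb R^N$ with $e_1\wedge\dots\wedge e_N=1$ and $R(e_{N-n+i})=d_xs_I(v_i)$ for $i>k$. Over a cobordism $\det(\mathsf s_{\mathcal K})$ has restrictions $\det(\mathsf s_{\partial^\alpha\mathcal K})$ with collar isomorphisms $\det(d_xs^\alpha_I)\to\det(d_{\iota^\alpha_I(t,x)}s_I)$, $\eta\otimes\theta\mapsto\Lambda_{d\iota_I^\alpha}(1\wedge\eta)\otimes\theta$, $1\in T_tA^\alpha_\varepsilon$. The maps $\widetilde{\mathfrak C}_{IJ}$. For $I\subsetneq J$ choose a $\Gamma_J$-equivariant smooth normal bundle $N_{IJ}=\bigcup_yN_{IJ,y}$, $N_{IJ,y}\subset T_yU_J$, of $\widetilde U_{IJ}\subset U_J$. For $y\in\widetilde U_{IJ}$, $x=\rho_{IJ}(y)$, let ${\rm pr}_{N_{IJ}}(y):E_J\to d_ys_J(N_{IJ,y})\subset E_J$ be the projection with kernel $\widehat\phi_{IJ}(E_I)$,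 $F_y={\rm pr}_{N_{IJ}}(y)\circ d_ys_J:T_yU_J\to E_J$ (with image $d_ys_J(N_{IJ,y})$ and kernel $T_y\widetilde U_{IJ}$), and $\phi_y:T_y\widetilde U_{IJ}\to\ker F_y$ the identification. Then $\widetilde{\mathfrak C}_{IJ}(y):\Lambda^{\max}T_yU_J\otimes(\Lambda^{\max}E_J)^*\to\rho_{IJ}^*(\Lambda^{\max}T_xU_I)\otimes(\Lambda^{\max}E_I)^*$ is $\mathfrak C^{\phi_y}_{F_y}$ followed by the isomorphism induced by $d_y\rho_{IJ}:T_y\widetilde U_{IJ}\to T_xU_I$ and by the isomorphism $E_I\to E_J/{\rm im}\,F_y$ induced by $\widehat\phi_{IJ}$. *)

(* Defs.v *)
From HB Require Import structures.
From mathcomp Require Import all_boot all_order all_algebra all_fingroup.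
From mathcomp Require Import all_classical all_reals all_analysis.

Set Implicit Arguments.
Unset Strict Implicit.
Unset Printing Implicit Defensive.

Import Order.TTheory GRing.Theory Num.Theory numFieldNormedType.Exports.

Local Open Scope classical_set_scope.
Local Open Scope ring_scope.

Definition vcoord (F : fieldType) (W : vectType F) (w : W) : 'rV[F]_(\dim {: W}) :=
  \row_i coord (vbasis {: W}) i w.

Arguments vcoord {F W} w.

Definition prodV (R : fieldType) (N : nat) (E : 'I_N -> vectType R) : Type :=
  {dffun forall i : 'I_N, E i}.

Section ProdV.
Variables (R : fieldType) (N : nat) (E : 'I_N -> vectType R).
Local Notation ET := (prodV E).

HB.instance Definition _ := Choice.copy ET {dffun forall i : 'I_N, E i}.

Definition prodV_of (f : forall i, E i) : ET := finfun f.

Lemma prodV_ofE (f : forall i, E i) i : prodV_of f i = f i.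
Proof. exact: ffunE. Qed.

Lemma prodVP (e e' : ET) : (forall i, e i = e' i) -> e = e'.
Proof. by move=> h; apply/ffunP. Qed.

Let add (e e' : ET) := prodV_of (fun i => e i + e' i).
Let opp (e : ET) := prodV_of (fun i => - e i).
Let zero := prodV_of (fun i => 0).

Fact prodV_addA : associative add.
Proof. by move=> a b c; apply: prodVP => i; rewrite !prodV_ofE addrA. Qed.
Fact prodV_addC : commutative add.
Proof. by move=> a b; apply: prodVP => i; rewrite !prodV_ofE addrC. Qed.
Fact prodV_add0 : left_id zero add.
Proof. by move=> a; apply: prodVP => i; rewrite !prodV_ofE add0r. Qed.
Fact prodV_addN : left_inverse zero opp add.
Proof. by move=> a; apply: prodVP => i; rewrite !prodV_ofE addNr. Qed.

HB.instance Definition _ :=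
  GRing.isZmodule.Build ET prodV_addA prodV_addC prodV_add0 prodV_addN.

Let scale (a : R) (e : ET) := prodV_of (fun i => a *: e i).

Fact prodV_scaleA a b e : scale a (scale b e) = scale (a * b) e.
Proof. by apply: prodVP => i; rewrite !prodV_ofE scalerA. Qed.
Fact prodV_scale1 : left_id 1 scale.
Proof. by move=> e; apply: prodVP => i; rewrite !prodV_ofE scale1r. Qed.
Fact prodV_scaleDr : right_distributive scale +%R.
Proof. by move=> a b c; apply: prodVP => i; rewrite !prodV_ofE scalerDr. Qed.
Fact prodV_scaleDl e : {morph scale^~ e : a b / a + b}.
Proof. by move=> a b; apply: prodVP => i; rewrite !prodV_ofE scalerDl. Qed.

HB.instance Definition _ := GRing.Zmodule_isLmodule.Build R ET
  prodV_scaleA prodV_scale1 prodV_scaleDr prodV_scaleDl.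

Lemma prodV_linE a (e e' : ET) i : (a *: e + e') i = a *: e i + e' i.
Proof. by rewrite [LHS]prodV_ofE prodV_ofE. Qed.

Fact prodV_vect_iso : Vector.axiom (\sum_i \dim {: E i}) ET.
Proof.
pose un i (r : 'rV[R]_(\dim {: E i})) : E i := \sum_j r 0 j *: (vbasis {: E i})`_j.
exists (fun e : ET => \mxrow_i vcoord (e i)).
  by move=> a e e'; apply/rowP => k; rewrite !mxE prodV_linE linearP.
exists (fun r => prodV_of (fun i => un i (submxrow r i))).
  move=> e; apply: prodVP => i; rewrite prodV_ofE mxrowK /un.
  rewrite [RHS](coord_vbasis (memvf (e i))).
  by apply: eq_bigr => j _; rewrite mxE.
move=> r; rewrite -[RHS]submxrowK; apply/mxrowP => i.
rewrite !mxrowK prodV_ofE; apply/rowP => j.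
by rewrite mxE coord_sum_free // (basis_free (vbasisP _)).
Qed.

HB.instance Definition _ := Lmodule_hasFinDim.Build R ET prodV_vect_iso.
End ProdV.

Section DetLine.
Variables (R : realType) (V W : vectType R).
Implicit Types (K : {vspace V}) (H Z : {vspace W}) (v : seq V) (w : seq W).

(* w is a list of representatives of a basis of H / Z, for Z <= H *)
Definition qbasis_of H Z w : bool :=
  [&& free w, (<<w>> :&: Z == 0)%VS & (<<w>> + Z == H)%VS].

Definition dframe K H Z v w : bool := basis_of K v && qbasis_of H Z w.

(* An element c of the line  Lambda^max K (x) (Lambda^max (H/Z))^*  is given by
   its coefficients: c (v, w) is the scalar such that
     c = c (v, w) . (v_1 /\ ... /\ v_n) (x) ([w_1] /\ ... /\ [w_m])^*,
   v being a basis of K and w representing a basis of H/Z.  If v' = A v and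
   w' = B w mod Z, then v'_1 /\ ... /\ v'_n = det A . v_1 /\ ... /\ v_n and
   ([w'_1] /\ ... )^* = (det B)^-1 . ([w_1] /\ ... )^*, whence the
   transformation rule below. *)
Definition det_homog K H Z (c : seq V * seq W -> R^o) : Prop :=
  (forall v w, ~~ dframe K H Z v w -> c (v, w) = 0) /\
  (forall v w v' w' (A : 'M[R]_(size v)) (B : 'M[R]_(size w)),
     dframe K H Z v w -> dframe K H Z v' w' ->
     (forall i : 'I_(size v), v'`_i = \sum_j A i j *: v`_j) ->
     (forall i : 'I_(size w), w'`_i - \sum_j B i j *: w`_j \in Z) ->
     c (v, w) * \det B = c (v', w') * \det A).

Definition det_pred K H Z : {pred seq V * seq W -> R^o} :=
  fun c => `[< det_homog K H Z c >].

Fact det_pred_closed K H Z : subsemimod_closed (det_pred K H Z).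
Proof.
have addE (c c' : seq V * seq W -> R^o) q : (c + c') q = c q + c' q :> R by [].
have scaleE (a : R) (c : seq V * seq W -> R^o) q : (a *: c) q = a * c q :> R by [].
split; first split.
- by apply/asboolP; split=> *; rewrite ?mul0r.
- move=> c c' /asboolP[h1 h2] /asboolP[h1' h2']; apply/asboolP; split.
    by move=> v w n; rewrite addE (h1 _ _ n) (h1' _ _ n) addr0.
  move=> v w v' w' A B f f' a b; rewrite !addE !mulrDl.
  by rewrite (h2 _ _ _ _ A B f f' a b) (h2' _ _ _ _ A B f f' a b).
- move=> a c /asboolP[h1 h2]; apply/asboolP; split.
    by move=> v w n; rewrite scaleE (h1 _ _ n) mulr0.
  move=> v w v' w' A B f f' e b; rewrite !scaleE -!mulrA.
  by rewrite (h2 _ _ _ _ A B f f' e b).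
Qed.

HB.instance Definition _ K H Z :=
  GRing.isSubSemiModClosed.Build R _ (det_pred K H Z) (det_pred_closed K H Z).

Record detline K H Z := DetLine {
  detcoef :> seq V * seq W -> R^o;
  _ : detcoef \in det_pred K H Z }.

HB.instance Definition _ K H Z := [isSub for @detcoef K H Z].
HB.instance Definition _ K H Z := [Choice of detline K H Z by <:].
HB.instance Definition _ K H Z :=
  [SubChoice_isSubLmodule of detline K H Z by <:].

(* (v_1 /\ ... /\ v_n) (x) ([w_1] /\ ... /\ [w_m])^* if (v, w) is a frame,
   and 0 otherwise *)
Definition wedge K H Z v w : detline K H Z :=
  xget 0 [set c : detline K H Z | c (v, w) = 1].

End DetLine.
Arguments wedge {R V W} K H Z v w.

(* The linear map that sends wedge v w to wedge v' w' for frames (v, w) and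
   (v', w') related by Q; such maps are only used when this prescription does
   not depend on the related pair of frames. *)
Definition linemap (R : realType) (V W V' W' : vectType R)
    (K : {vspace V}) (H Z : {vspace W}) (K' : {vspace V'}) (H' Z' : {vspace W'})
    (Q : seq V -> seq W -> seq V' -> seq W' -> Prop) (c : detline K H Z) :
    detline K' H' Z' :=
  let q := xget (([::], [::]), ([::], [::]))
    [set q : (seq V * seq W) * (seq V' * seq W') |
      [/\ dframe K H Z q.1.1 q.1.2, dframe K' H' Z' q.2.1 q.2.2 &
          Q q.1.1 q.1.2 q.2.1 q.2.2]] in
  c q.1 *: wedge K' H' Z' q.2.1 q.2.2.

Arguments linemap {R V W V' W' K H Z K' H' Z'} Q c.

(* The contraction C_F^phi, where phi maps K isomorphically onto ker F and
   F : V -> W takes values in H. *)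
Definition contraction (R : realType) (V W U : vectType R) (H : {vspace W})
    (F : 'Hom(V, W)) (K : {vspace U}) (phi : 'Hom(U, V)) :
    detline (fullv : {vspace V}) H 0 -> detline K H (limg F) :=
  linemap (fun v w v' w' =>
    exists v2, v = [seq phi a | a <- v'] ++ v2 /\ w = w' ++ [seq F a | a <- v2]).

Section Smooth.
Variable R : realType.

Definition compact_metrizable (X : topologicalType) : Prop :=
  compact [set: X] /\ exists d : X -> X -> R,
    [/\ forall x y, d x y = 0 <-> x = y, forall x y, d x y = d y x,
        forall x y z, d x z <= d x y + d y z &
        forall x A, nbhs x A <-> exists2 e, 0 < e & [set y | d x y < e] `<=` A].

Definition smooth_open (n m : nat) (O : set 'rV[R]_n)
    (g : 'rV[R]_n -> 'rV[R]_m) : Prop :=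
  forall (vs : seq 'rV[R]_n) p, O p ->
    differentiable (foldr (fun v h => 'D_v h) g vs) p.

Definition smooth_within (n m : nat) (H : set 'rV[R]_n)
    (g : 'rV[R]_n -> 'rV[R]_m) (p : 'rV[R]_n) : Prop :=
  exists O G, [/\ open O, O p, smooth_open O G &
    forall q, O q -> H q -> G q = g q :> 'rV[R]_m].

Definition halfspace (n : nat) : set 'rV[R]_n :=
  [set p | forall i : 'I_n, i = 0%N :> nat -> 0 <= p 0 i].

(* A topological space with, for each point x, a preferred chart
   chart x : cdom x -> cmodel with inverse cinv x, cmodel being a subset of R^n.
   The atlas is the family of all preferred charts. *)
Record charted := Charted {
  cpt :> topologicalType;
  cdim : nat;
  cmodel : set 'rV[R]_cdim;
  cdom : cpt -> set cpt;
  chart : cpt -> cpt -> 'rV[R]_cdim;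
  cinv : cpt -> 'rV[R]_cdim -> cpt }.

Section Maps.
Variable M : charted.

(* P holds for all points of M near x; only points with a coordinate vector in
   cmodel M are concerned, which matters for collars *)
Definition nearM (x : M) (P : M -> Prop) : Prop :=
  \forall p \near chart x x, cmodel p -> P (cinv x p).

Definition smoothv (W : vectType R) (f : M -> W) (x : M) : Prop :=
  smooth_within (@cmodel M) (vcoord \o f \o cinv x) (chart x x).

(* The tangent space of M at x is R^n, identified through the preferred chart
   at x; dv f x : T_x M -> W is the Frechet derivative at x. *)
Definition dv (W : vectType R) (f : M -> W) (x : M) : 'Hom('rV[R]_(cdim M), W) :=
  xget 0 [set L : 'Hom('rV[R]_(cdim M), W) | forall e : R, 0 < e ->
    \forall h \near (0 : 'rV[R]_(cdim M)), cmodel (chart x x + h) ->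
      `|vcoord (f (cinv x (chart x x + h)) - f x - L h)| <= e * `|h|].

Definition bdry : set M := [set x | ~ interior (@cmodel M) (chart x x)].

Record is_manifold_with_boundary : Prop := {
  mfd_hausdorff : hausdorff_space M;
  mfd_countable : @second_countable M;
  mfd_model : @cmodel M = setT \/ @cmodel M = @halfspace (cdim M);
  mfd_dom : forall x : M, open (cdom x) /\ cdom x x;
  mfd_chart : forall x y : M, cdom x y ->
    [/\ cmodel (chart x y), cinv x (chart x y) = y &
        {for y, continuous (chart x)}];
  mfd_cinv : forall x y : M, cdom x y ->
    \forall p \near chart x y, cmodel p ->
      cdom x (cinv x p) /\ chart x (cinv x p) = p;
  mfd_cinv_cont : forall x y : M, cdom x y -> forall O, nbhs y O ->
    \forall p \near chart x y, cmodel p -> O (cinv x p);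
  mfd_smooth : forall x y z : M, cdom x z -> cdom y z ->
    smooth_within (@cmodel M) (chart y \o cinv x) (chart x z) }.

End Maps.

Local Notation tangent M := 'rV[R]_(cdim M).

Definition smooth_map (M N : charted) (f : M -> N) (x : M) : Prop :=
  (forall O, nbhs (f x) O -> nearM x (fun y => O (f y))) /\
  smoothv (chart (f x) \o f) x.

Definition dm (M N : charted) (f : M -> N) (x : M) : 'Hom(tangent M, tangent N) :=
  dv (chart (f x) \o f) x.

Section ManifoldMaps.
Variables M N : charted.

(* X y is a tangent vector of N at f y *)
Definition smooth_field_along (f : M -> N) (X : M -> tangent N) (x : M) : Prop :=
  smoothv (fun y => dv (chart (f x)) (f y) (X y)) x.

Definition local_diffeo (A : set M) (f : M -> N) : Prop :=
  forall x, A x -> smooth_map f x /\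
    exists g : N -> M, [/\ g (f x) = x, smooth_map g (f x),
      nearM x (fun y => g (f y) = y) &
      nearM (f x) (fun y => A (g y) /\ f (g y) = y)].

Definition smooth_embedding (f : M -> N) : Prop :=
  [/\ injective f, forall x, smooth_map f x, forall x, lker (dm f x) = 0%VS &
    forall x O, nbhs x O ->
      exists2 O', nbhs (f x) O' & forall y, O' (f y) -> O y].

End ManifoldMaps.

(* A^alpha_e, with false and true standing for alpha = 0 and alpha = 1 *)
Definition colA (a : bool) (e : R) : set R :=
  if a then `]1 - e, 1]%classic else `[0, e[%classic.

Definition endpoint (a : bool) : R := if a then 1 else 0.

(* The product A^alpha_e x M; only points (t, x) with t in colA a e matter. *)
Definition collar (a : bool) (e : R) (M : charted) : charted :=
  @Charted (R * M)%type (1 + cdim M)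
    [set p | colA a e (lsubmx p 0 0) /\ cmodel (rsubmx p)]
    (fun z => [set w | cdom z.2 w.2])
    (fun z w => row_mx (const_mx w.1) (chart z.2 w.2))
    (fun z p => (lsubmx p 0 0, cinv z.2 (rsubmx p))).

(* A bundle is a family of vector spaces; its smooth structure is given by the
   set of local frames (O, b), where b_i is a section over O. *)
Record vbundle (M : charted) := VBundle {
  fib : M -> lmodType R;
  rk : nat;
  frames : set (set M * (forall x, 'I_rk -> fib x)) }.

Arguments fib {M} v x.
Arguments rk {M} v.
Arguments frames {M} v.

(* Phi is a bundle map r^* LM -> LN covering f, where f : S -> N, r : S -> M *)
Definition smooth_bmap (S M N : charted) (r : S -> M) (f : S -> N)
    (LM : vbundle M) (LN : vbundle N)
    (Phi : forall u, fib LM (r u) -> fib LN (f u)) (u0 : S) : Prop :=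
  forall F F', frames LM F -> frames LN F' -> F.1 (r u0) -> F'.1 (f u0) ->
  exists A : S -> 'M[R]_(rk LM, rk LN), smoothv A u0 /\
    nearM u0 (fun u => forall i,
      Phi u (F.2 (r u) i) = \sum_j A u i j *: F'.2 (f u) j).

Record is_vbundle (M : charted) (L : vbundle M) : Prop := {
  vb_open : forall F, frames L F -> open F.1;
  vb_cover : forall x, exists2 F, frames L F & F.1 x;
  vb_basis : forall F x, frames L F -> F.1 x -> forall l : fib L x,
    exists! c : 'rV[R]_(rk L), l = \sum_i c 0 i *: F.2 x i;
  vb_compat : forall x, @smooth_bmap M M M id id L L (fun _ l => l) x }.

Definition lin_iso (V W : lmodType R) (f : V -> W) : Prop :=
  (forall a u v, f (a *: u + v) = a *: f u + f v) /\ bijective f.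

End Smooth.

Arguments halfspace {R} n.

(* The obstruction spaces E_i and isotropy groups Gamma_i of the basic charts,
   with the action of Gamma_i on E_i. *)
Record kbasic (R : realType) := KBasic {
  kN : nat;
  kG : 'I_kN -> finGroupType;
  kE : 'I_kN -> vectType R;
  kact : forall i, kG i -> kE i -> kE i }.

Section Kuranishi.
Variables (R : realType) (B : kbasic R).
Local Notation N := (kN B).
Local Notation tangent M := 'rV[R]_(cdim M).
Implicit Types I J L : {set 'I_N}.

Definition is_kbasic : Prop := forall i : 'I_N,
  [/\ forall g a (e e' : kE i), kact g (a *: e + e') = a *: kact g e + kact g e',
      forall e : kE i, kact 1%g e = e &
      forall (g h : kG i) (e : kE i), kact (g * h)%g e = kact g (kact h e)].

(* The products over I are realized inside the products GT and ET over all
   indices, as the elements that are trivial outside I. The inclusions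
   E_I -> E_J, for I in J, are then identities. *)
Definition GT : finGroupType := {dffun forall i : 'I_N, kG i}.
Definition ET : vectType R := prodV (@kE R B).

Definition restrG I (g : GT) : GT :=
  [ffun i => (if i \in I then g i else 1%g) : kG i].

Definition Gam I : {set GT} := [set g | restrG I g == g]%SET.

Definition restrE I (e : ET) : ET := prodV_of (fun i => if i \in I then e i else 0).

Definition Esp I : {vspace ET} := lker (linfun (restrE (~: I)%SET)).

Definition actE (g : GT) (e : ET) : ET := prodV_of (fun i => kact (g i) (e i)).

(* Charts and coordinate changes of an atlas on X. Data with indices outside
   the index set idx below, or with I not a proper subset of J, and the values
   of psi outside the zero set of s are irrelevant. The submanifold
   tilde U_IJ of U_J is the image of the embedding kemb : ktU I J -> U_J. *)
Record kdata (X : topologicalType) := KData {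
  kU : {set 'I_N} -> charted R;
  kaU : forall I, GT -> kU I -> kU I;
  ks : forall I, kU I -> ET;
  kpsi : forall I, kU I -> X;
  kUIJ : forall I J, set (kU I);
  ktU : {set 'I_N} -> {set 'I_N} -> charted R;
  kemb : forall I J, ktU I J -> kU J;
  krho : forall I J, ktU I J -> kU I }.

Section Atlas.
Variables (X : topologicalType) (K : kdata X).

Definition zeros I : set (kU K I) := [set x | ks x = 0].
Arguments zeros : clear implicits.

Definition footprint I : set X := [set kpsi x | x in zeros I].

Definition footI I : set X := [set p | forall i, i \in I -> footprint [set i]%SET p].

Definition idx I : Prop := (I != finset.set0) /\ (footI I !=set0).

Record is_chart I : Prop := {
  ch_act1 : forall x : kU K I, kaU 1%g x = x;
  ch_actM : forall g h (x : kU K I), g \in Gam I -> h \in Gam I ->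
    kaU (g * h)%g x = kaU g (kaU h x);
  ch_act_smooth : forall g (x : kU K I), g \in Gam I -> smooth_map (@kaU X K I g) x;
  ch_s_val : forall x : kU K I, ks x \in Esp I;
  ch_s_smooth : forall x : kU K I, smoothv (@ks X K I) x;
  ch_s_equiv : forall g (x : kU K I), g \in Gam I -> ks (kaU g x) = actE g (ks x);
  ch_psi_cont : forall x, zeros I x -> forall O, nbhs (kpsi x) O ->
    nbhs x [set y : kU K I | zeros I y -> O (kpsi y)];
  ch_psi_orbit : forall x y : kU K I, zeros I x -> zeros I y ->
    kpsi x = kpsi y <-> exists2 g, g \in Gam I & y = kaU g x;
  ch_psi_open : open (footprint I);
  (* the induced bijection from the quotient of the zero set by Gamma_I to the
     footprint is a homeomorphism *)
  ch_psi_quot : forall A, A `<=` footprint I ->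
    (exists2 O : set (kU K I), open O &
       forall x, zeros I x -> A (kpsi x) <-> O x) -> open A }.

Definition sIJ I J : ktU K I J -> ET := fun u => ks (krho u).

Record is_coord_change I J : Prop := {
  cc_UIJ_open : open (@kUIJ X K I J);
  cc_UIJ_inv : forall g (x : kU K I), g \in Gam I ->
    kUIJ J x -> kUIJ J (kaU g x);
  cc_UIJ_foot : forall x : kU K I, zeros I x ->
    kUIJ J x <-> footprint J (kpsi x);
  cc_tU : is_manifold_with_boundary (ktU K I J);
  cc_emb : smooth_embedding (@kemb X K I J);
  cc_tU_inv : forall g (u : ktU K I J), g \in Gam J ->
    exists u' : ktU K I J, kemb u' = kaU g (kemb u);
  cc_free : forall g (u : ktU K I J), g \in Gam J -> restrG I g = 1%g ->
    kaU g (kemb u) = kemb u -> g = 1%g;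
  (* krho is the quotient map by the kernel of Gamma_J -> Gamma_I followed by a
     diffeomorphism onto U_IJ: the smooth structure of the quotient is the one
     for which the quotient map is a local diffeomorphism *)
  cc_rho_image : range (@krho X K I J) = @kUIJ X K I J;
  cc_rho_fibres : forall u u' : ktU K I J, krho u = krho u' <->
    exists g, [/\ g \in Gam J, restrG I g = 1%g & kemb u' = kaU g (kemb u)];
  cc_rho_diffeo : local_diffeo setT (@krho X K I J);
  cc_rho_equiv : forall g (u u' : ktU K I J), g \in Gam J ->
    kemb u' = kaU g (kemb u) -> krho u' = kaU (restrG I g) (krho u);
  cc_s : forall u : ktU K I J, ks (kemb u) = ks (krho u);
  cc_psi : forall u : ktU K I J, zeros J (kemb u) -> kpsi (kemb u) = kpsi (krho u);
  cc_index_ker : forall u : ktU K I J,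
    (dm (@kemb X K I J) u @: lker (dv (@sIJ I J) u))%VS = lker (dv (@ks X K J) (kemb u));
  cc_index_coker : forall (u : ktU K I J) (C : {vspace ET}),
    (limg (dv (@sIJ I J) u) + C)%VS = Esp I ->
    (limg (dv (@sIJ I J) u) :&: C)%VS = 0%VS ->
    (limg (dv (@ks X K J) (kemb u)) + C)%VS = Esp J /\
    (limg (dv (@ks X K J) (kemb u)) :&: C)%VS = 0%VS }.

(* The conditions common to atlases and cobordisms: the domains may have
   boundary. *)
Record is_watlas (d : int) : Prop := {
  wa_basic : is_kbasic;
  wa_cover : forall p : X, exists i, footprint [set i]%SET p;
  wa_dim : forall i, idx [set i]%SET ->
    (cdim (kU K [set i]%SET))%:Z - (\dim (Esp [set i]%SET))%:Z = d;
  wa_mfd : forall I, idx I -> is_manifold_with_boundary (kU K I);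
  wa_chart : forall I, idx I -> is_chart I;
  wa_foot : forall I, idx I -> footprint I = footI I;
  wa_change : forall I J, idx I -> idx J -> (I \proper J)%SET -> is_coord_change I J;
  wa_cocycle : forall I J L, idx I -> idx J -> idx L ->
    (I \proper J)%SET -> (J \proper L)%SET ->
    forall (u : ktU K I L) (v : ktU K J L) (w : ktU K I J),
      kemb u = kemb v -> krho v = kemb w -> krho u = krho w }.

Definition is_weak_atlas (d : int) : Prop :=
  [/\ is_watlas d, forall I, idx I -> @bdry R (kU K I) = set0 &
      forall I J, idx I -> idx J -> (I \proper J)%SET ->
        @bdry R (ktU K I J) = set0].

(* kb_act g x y is meaningful if y = g x, and kb_tr u x y if x = krho u and
   y = kemb u. *)
Record kbundle := KBundle {
  kb : forall I, vbundle (kU K I);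
  kb_act : forall I, GT -> forall x y, fib (kb I) x -> fib (kb I) y;
  kb_tr : forall I J, ktU K I J -> forall x y, fib (kb I) x -> fib (kb J) y }.

Record is_kbundle (Lam : kbundle) : Prop := {
  kb_vbundle : forall I, idx I -> is_vbundle (kb Lam I);
  kb_act_lin : forall I g (x : kU K I), idx I -> g \in Gam I ->
    lin_iso (@kb_act Lam I g x (kaU g x));
  kb_act_smooth : forall I g (x : kU K I), idx I -> g \in Gam I ->
    @smooth_bmap R _ _ _ id (@kaU X K I g) (kb Lam I) (kb Lam I)
      (fun x => @kb_act Lam I g x (kaU g x)) x;
  kb_act1 : forall I (x : kU K I) (l : fib (kb Lam I) x), idx I ->
    kb_act 1%g x l = l;
  kb_actM : forall I g h (x : kU K I) (l : fib (kb Lam I) x), idx I ->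
    g \in Gam I -> h \in Gam I ->
    kb_act (g * h)%g (kaU (g * h)%g x) l =
    kb_act g (kaU (g * h)%g x) (kb_act h (kaU h x) l);
  kb_tr_lin : forall I J (u : ktU K I J), idx I -> idx J -> (I \proper J)%SET ->
    lin_iso (@kb_tr Lam I J u (krho u) (kemb u));
  kb_tr_smooth : forall I J (u : ktU K I J), idx I -> idx J -> (I \proper J)%SET ->
    @smooth_bmap R _ _ _ (@krho X K I J) (@kemb X K I J) (kb Lam I) (kb Lam J)
      (fun u => @kb_tr Lam I J u (krho u) (kemb u)) u;
  kb_tr_equiv : forall I J g (u u' : ktU K I J) (l : fib (kb Lam I) (krho u)),
    idx I -> idx J -> (I \proper J)%SET -> g \in Gam J ->
    kemb u' = kaU g (kemb u) ->
    kb_tr u' (kemb u') (kb_act (restrG I g) (krho u') l) =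
    kb_act g (kemb u') (kb_tr u (kemb u) l);
  kb_cocycle : forall I J L (u : ktU K I L) (v : ktU K J L) (w : ktU K I J)
      (l : fib (kb Lam I) (krho w)),
    idx I -> idx J -> idx L -> (I \proper J)%SET -> (J \proper L)%SET ->
    kemb u = kemb v -> krho v = kemb w ->
    kb_tr u (kemb u) l = kb_tr v (kemb u) (kb_tr w (kemb w) l) }.

Definition is_line_kbundle (Lam : kbundle) : Prop :=
  is_kbundle Lam /\ forall I, rk (kb Lam I) = 1%N.

Record is_kiso (Lam Lam' : kbundle)
    (Psi : forall I x, fib (kb Lam I) x -> fib (kb Lam' I) x) : Prop := {
  ki_lin : forall I x, idx I -> lin_iso (@Psi I x);
  ki_smooth : forall I x, idx I ->
    @smooth_bmap R _ _ _ id id (kb Lam I) (kb Lam' I) (@Psi I) x;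
  ki_equiv : forall I g x (l : fib (kb Lam I) x), idx I -> g \in Gam I ->
    Psi I (kaU g x) (kb_act g (kaU g x) l) = kb_act g (kaU g x) (Psi I x l);
  ki_tr : forall I J (u : ktU K I J) (l : fib (kb Lam I) (krho u)),
    idx I -> idx J -> (I \proper J)%SET ->
    kb_tr u (kemb u) (Psi I (krho u) l) = Psi J (kemb u) (kb_tr u (kemb u) l) }.

Definition normal_family := forall I J (u : ktU K I J), {vspace tangent (kU K J)}.

Record is_normal (Nb : normal_family) I J : Prop := {
  nb_compl : forall u : ktU K I J,
    (limg (dm (@kemb X K I J) u) + Nb I J u)%VS = fullv /\
    (limg (dm (@kemb X K I J) u) :&: Nb I J u)%VS = 0%VS;
  nb_equiv : forall g (u u' : ktU K I J), g \in Gam J ->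
    kemb u' = kaU g (kemb u) ->
    Nb I J u' = (dm (@kaU X K J g) (kemb u) @: Nb I J u)%VS;
  nb_smooth : forall u0 : ktU K I J,
    exists k (Y : 'I_k -> ktU K I J -> tangent (kU K J)),
      (forall i, smooth_field_along (@kemb X K I J) (Y i) u0) /\
      nearM u0 (fun u => basis_of (Nb I J u) [seq Y i u | i <- enum 'I_k]) }.

Definition is_normal_choice (Nb : normal_family) : Prop :=
  forall I J, idx I -> idx J -> (I \proper J)%SET -> is_normal Nb I J.

(* Lambda^max T_x U_I (x) (Lambda^max E_I)^* *)
Definition detK_fib I (x : kU K I) : lmodType R :=
  detline (fullv : {vspace tangent (kU K I)}) (Esp I) 0.

(* frames X_1 /\ ... /\ X_n (x) (w_1 /\ ... /\ w_m)^* from smooth local frames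
   X_1, ..., X_n of T U_I and bases w of E_I *)
Definition detK_frames I :
    set (set (kU K I) * (forall x : kU K I, 'I_1 -> detK_fib x)) :=
  [set F | exists (Y : 'I_(cdim (kU K I)) -> kU K I -> tangent (kU K I)) (w : seq ET),
    let Ys x := [seq Y i x | i <- enum 'I_(cdim (kU K I))] in
    [/\ open F.1, basis_of (Esp I) w,
        forall x, F.1 x -> basis_of fullv (Ys x) /\
          forall i, smooth_field_along id (Y i) x &
        F.2 = fun x _ => wedge fullv (Esp I) 0 (Ys x) w]].

Definition detK_vb I : vbundle (kU K I) := VBundle (@detK_frames I).

Definition detK_act I (g : GT) (x y : kU K I) : detK_fib x -> detK_fib y :=
  linemap (fun v w v' w' =>
    v' = [seq dm (@kaU X K I g) x a | a <- v] /\ w' = [seq actE g a | a <- w]).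

(* pr_N(y) o d_y s_J *)
Definition detK_F (Nb : normal_family) I J (u : ktU K I J) :
    'Hom(tangent (kU K J), ET) :=
  let ds := dv (@ks X K J) (kemb u) in
  (daddv_pi (ds @: Nb I J u) (Esp I) \o ds)%VF.

(* tilde C_IJ at y = kemb u *)
Definition Ctilde (Nb : normal_family) I J (u : ktU K I J) :
    detK_fib (kemb u) -> detK_fib (krho u) := fun c =>
  let F := detK_F Nb u in
  linemap (fun v w v' w' =>
      v' = [seq dm (@krho X K I J) u a | a <- v] /\
      size w = size w' /\ forall i, w`_i - w'`_i \in limg F)
    (contraction F fullv (dm (@kemb X K I J) u) c :
      detline (fullv : {vspace tangent (ktU K I J)}) (Esp J) (limg F)).

Arguments Ctilde Nb {I J} u c.

(* tilde C_IJ^-1 *)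
Definition detK_tr (Nb : normal_family) I J (u : ktU K I J) (x : kU K I) (y : kU K J)
    (c : detK_fib x) : detK_fib y :=
  xget 0 [set c' : detK_fib y | Ctilde Nb u c' = c].

Arguments detK_act : clear implicits.
Arguments detK_tr : clear implicits.

Definition detK (Nb : normal_family) : kbundle :=
  @KBundle detK_vb detK_act (detK_tr Nb).

(* det (d_x s_I) *)
Definition detS_fib I (x : kU K I) : lmodType R :=
  let ds := dv (@ks X K I) x in detline (lker ds) (Esp I) (limg ds).

(* d_x s_I (+) Q : T_x U_I x R^m -> E_I *)
Definition stab I m (Q : 'Hom('rV[R]_m, ET)) (x : kU K I) :
    'Hom((tangent (kU K I) * 'rV[R]_m)%type, ET) :=
  linfun (fun p => dv (@ks X K I) x p.1 + Q p.2).

(* Lambda^max ker (d_x s_I (+) Q) -> det (d_x s_I) *)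
Definition stab_triv I m (Q : 'Hom('rV[R]_m, ET)) (x : kU K I) :
    detline (lker (stab Q x)) (0 : {vspace 'rV[R]_0}) 0 -> detS_fib x :=
  linemap (fun vb _ v w => exists vb1 vb2 e1 (e2 : seq 'rV[R]_m),
    [/\ vb = vb1 ++ vb2, v = [seq p.1 | p <- vb1], w = [seq Q e | e <- e1],
        \det (\matrix_(i < m) (e1 ++ e2)`_i) = 1 /\ size (e1 ++ e2) = m &
        [seq Q e | e <- e2] = [seq dv (@ks X K I) x p.1 | p <- vb2]]).

(* local frames of det (ds_I) obtained from Q : R^m -> E_I and from smooth
   local frames (Y_j, q_j) of ker (ds_I (+) Q) *)
Definition detS_frames I :
    set (set (kU K I) * (forall x : kU K I, 'I_1 -> detS_fib x)) :=
  [set F | exists m (Q : 'Hom('rV[R]_m, ET)) k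
      (Y : 'I_k -> kU K I -> tangent (kU K I)) (q : 'I_k -> kU K I -> 'rV[R]_m),
    let b x := [seq (Y j x, q j x) | j <- enum 'I_k] in
    [/\ open F.1, lker Q = 0%VS /\ (limg Q <= Esp I)%VS,
        forall x, F.1 x -> (limg (dv (@ks X K I) x) + limg Q)%VS = Esp I,
        forall x, F.1 x -> basis_of (lker (stab Q x)) (b x) /\
          forall j, smooth_field_along id (Y j) x /\ smoothv (q j) x &
        F.2 = fun x _ => stab_triv (wedge (lker (stab Q x)) 0 0 (b x) [::])]].

Definition detS_vb I : vbundle (kU K I) := VBundle (@detS_frames I).

Definition detS_act I (g : GT) (x y : kU K I) : detS_fib x -> detS_fib y :=
  linemap (fun v w v' w' =>
    v' = [seq dm (@kaU X K I g) x a | a <- v] /\ w' = [seq actE g a | a <- w]).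

Definition detS_tr I J (u : ktU K I J) (x : kU K I) (y : kU K J) :
    detS_fib x -> detS_fib y :=
  linemap (fun v w v' w' => w' = w /\ exists v0,
    v = [seq dm (@krho X K I J) u a | a <- v0] /\
    v' = [seq dm (@kemb X K I J) u a | a <- v0]).

Arguments detS_act : clear implicits.
Arguments detS_tr : clear implicits.

Definition detS : kbundle := @KBundle detS_vb detS_act detS_tr.

(* the contractions C_{d_x s_I} *)
Definition PsiK I (x : kU K I) : detK_fib x -> detS_fib x :=
  let ds := dv (@ks X K I) x in contraction ds (lker ds) \1%VF.

Arguments PsiK : clear implicits.

End Atlas.

(* A collared space Y with boundary parts cY a and collars ciY, the data of an
   atlas on Y, the boundary charts and coordinate changes cbK a, and the
   collars ciU of the domains; ceps is a common width of all collars. *)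
Record cobdata (Y : topologicalType) := CobData {
  cK :> kdata Y;
  ceps : R;
  cY : bool -> topologicalType;
  ciY : forall a, R -> cY a -> Y;
  cbK : forall a, kdata (cY a);
  ciU : forall a I, R -> kU (cbK a) I -> kU cK I }.

Section Cobordism.
Variables (Y : topologicalType) (C : cobdata Y).

Definition cbdY a : set Y := [set @ciY Y C a (endpoint R a) b | b in setT].

Record is_collared : Prop := {
  cl_eps : 0 < ceps C;
  cl_closed : forall a, closed (cbdY a);
  cl_inj : forall a t t' (b b' : cY C a), colA a (ceps C) t -> colA a (ceps C) t' ->
    ciY t b = ciY t' b' -> t = t' /\ b = b';
  cl_cont : forall a t (b : cY C a), colA a (ceps C) t -> forall O, nbhs (ciY t b) O ->
    nbhs (t, b) [set z : R * cY C a | colA a (ceps C) z.1 -> O (ciY z.1 z.2)];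
  cl_open : forall a (O : set (R * cY C a)), open O ->
    open [set ciY z.1 z.2 | z in [set z | O z /\ colA a (ceps C) z.1]];
  cl_disj : forall t t' (b : cY C false) (b' : cY C true),
    colA false (ceps C) t -> colA true (ceps C) t' -> ciY t b <> ciY t' b' }.

Definition cfoot a I : set (cY C a) :=
  [set b | footprint C I (ciY (endpoint R a) b)].

Definition ciU' a I : collar a (ceps C) (kU (cbK C a) I) -> kU C I :=
  fun z => ciU z.1 z.2.

Record is_cob_chart I : Prop := {
  co_foot_collar : forall a t (b : cY C a), colA a (ceps C) t ->
    footprint C I (ciY t b) <-> cfoot I b;
  co_foot_int : (forall a, @cfoot a I = set0) ->
    (exists2 A, compact A & footprint C I `<=` A /\ forall a, A `&` cbdY a = set0) /\
    @bdry R (kU C I) = set0;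
  co_empty : forall a, (exists x : kU (cbK C a) I, True) <-> @cfoot a I !=set0;
  co_bdry : @bdry R (kU C I) =
    [set x | exists a (y : kU (cbK C a) I), x = ciU (endpoint R a) y];
  co_bdry_disj : forall (x : kU (cbK C false) I) (y : kU (cbK C true) I),
    ciU (endpoint R false) x <> ciU (endpoint R true) y;
  co_inj : forall a t t' (x x' : kU (cbK C a) I),
    colA a (ceps C) t -> colA a (ceps C) t' ->
    ciU t x = ciU t' x' -> t = t' /\ x = x';
  co_diffeo : forall a, 
    @local_diffeo R (collar a (ceps C) (kU (cbK C a) I)) _
      [set z | colA a (ceps C) z.1] (@ciU' a I);
  co_equiv : forall a t g (x : kU (cbK C a) I), colA a (ceps C) t -> g \in Gam I ->
    ciU t (kaU g x) = kaU g (ciU t x);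
  co_s : forall a t (x : kU (cbK C a) I), colA a (ceps C) t ->
    ks (ciU t x) = ks x;
  co_psi : forall a t (x : kU (cbK C a) I), colA a (ceps C) t -> ks x = 0 ->
    kpsi (ciU t x) = ciY t (kpsi x) }.

Record is_cob_change I J : Prop := {
  cx_UIJ : forall a t (x : kU (cbK C a) I), colA a (ceps C) t -> @cfoot a J !=set0 ->
    kUIJ J (ciU t x) <-> kUIJ J x;
  cx_tU : forall a t (u : ktU (cbK C a) I J), colA a (ceps C) t -> @cfoot a J !=set0 ->
    exists u' : ktU C I J, kemb u' = ciU t (kemb u) /\ krho u' = ciU t (krho u);
  cx_tU_inv : forall a t (y : kU (cbK C a) J) (u' : ktU C I J), colA a (ceps C) t ->
    kemb u' = ciU t y -> exists u : ktU (cbK C a) I J, kemb u = y;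
  cx_away : forall a t (x : kU (cbK C a) I), colA a (ceps C) t -> @cfoot a J = set0 ->
    ~ kUIJ J (ciU t x) }.

Record is_weak_cobordism (d : int) : Prop := {
  cb_collared : is_collared;
  cb_watlas : is_watlas C d;
  cb_chart : forall I, idx C I -> is_cob_chart I;
  cb_change : forall I J, idx C I -> idx C J -> (I \proper J)%SET -> is_cob_change I J;
  cb_basic_foot : forall a i,
    footprint (cbK C a) [set i]%SET = @cfoot a [set i]%SET;
  cb_foot : forall a I, idx C I -> footprint (cbK C a) I = @cfoot a I;
  cb_bdry : forall a, is_weak_atlas (cbK C a) (d - 1) }.

(* collar isomorphisms A^a x Lam^a_I -> Lam_I of a product structure *)
Definition collar_maps (Lam : kbundle C) (Lamb : forall a, kbundle (cbK C a)) :=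
  forall a I (t : R) (x : kU (cbK C a) I),
    fib (kb (Lamb a) I) x -> fib (kb Lam I) (ciU t x).

Record is_product_on (Lam : kbundle C) (Lamb : forall a, kbundle (cbK C a))
    (iL : collar_maps Lam Lamb) (e : R) : Prop := {
  ps_lin : forall a I t (x : kU (cbK C a) I), idx (cbK C a) I -> colA a e t ->
    lin_iso (@iL a I t x);
  ps_smooth : forall a I t (x : kU (cbK C a) I), idx (cbK C a) I -> colA a e t ->
    @smooth_bmap R (collar a (ceps C) (kU (cbK C a) I)) _ _ snd (@ciU' a I)
      (kb (Lamb a) I) (kb Lam I) (fun z => iL a I z.1 z.2) (t, x);
  ps_equiv : forall a I t g (x : kU (cbK C a) I) (l : fib (kb (Lamb a) I) x),
    idx (cbK C a) I -> colA a e t -> g \in Gam I ->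
    iL a I t (kaU g x) (kb_act g (kaU g x) l) =
    kb_act g (ciU t (kaU g x)) (iL a I t x l);
  ps_tr : forall a I J t (u : ktU (cbK C a) I J) (u' : ktU C I J)
      (l : fib (kb (Lamb a) I) (krho u)),
    idx (cbK C a) I -> idx (cbK C a) J -> (I \proper J)%SET -> colA a e t ->
    kemb u' = ciU t (kemb u) -> krho u' = ciU t (krho u) ->
    iL a J t (kemb u) (kb_tr u (kemb u) l) =
    kb_tr u' (ciU t (kemb u)) (iL a I t (krho u) l) }.

Definition is_product (Lam : kbundle C) (Lamb : forall a, kbundle (cbK C a))
    (iL : collar_maps Lam Lamb) : Prop :=
  exists2 e, 0 < e <= ceps C & is_product_on iL e.

(* Psi has product structure with restrictions Psib *)
Definition kiso_product (Lam Lam' : kbundle C)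
    (Lamb Lamb' : forall a, kbundle (cbK C a))
    (iL : collar_maps Lam Lamb) (iL' : collar_maps Lam' Lamb')
    (Psi : forall I x, fib (kb Lam I) x -> fib (kb Lam' I) x)
    (Psib : forall a I x, fib (kb (Lamb a) I) x -> fib (kb (Lamb' a) I) x) : Prop :=
  exists2 e, 0 < e <= ceps C &
    forall a I t x l, idx (cbK C a) I -> colA a e t ->
      iL' a I t x (Psib a I x l) = Psi I (ciU t x) (iL a I t x l).

(* eta (x) theta |-> Lambda_{d iota} (1 /\ eta) (x) theta *)
Definition detS_collar : collar_maps (detS C) (fun a => detS (cbK C a)) :=
  fun a I t x =>
    let di := dm (@ciU' a I) (t, x) in
    linemap (fun v w v' w' => w' = w /\
      v' = di (row_mx 1 0) :: [seq di (row_mx 0 b) | b <- v]).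

End Cobordism.
End Kuranishi.

Arguments Ctilde {R B X K} Nb {I J} u c.
Arguments PsiK {R B X} K I x c.
Arguments detS_collar {R B Y} C a I t x c.

(* Main.v *)
(* Every map in sight is a map of lines determined by its value on one frame, so
   the algebraic identities reduce to following adapted frames: with tangent
   frames a of tilde U_IJ, complements v2, and bases w of E_I,
     tilde C_IJ (demb a, v2) (x) (w, ds v2)^* = (drho a) (x) w^*,
   which does not involve the normal bundle, and similarly for the contractions
   C_ds. Smoothness follows since a change of smooth frames is a determinant of
   smooth functions. The structure of det s is transported from that of det K
   through the isomorphisms C_ds.
   The cocycle condition for the derivatives holds on an open set only after one
   knows that the triple overlaps of the tilde U_IJ are open in tilde U_IL: by
   the index condition, tilde U_IJ is locally the set of y with s_J(y) in E_I.
   At boundary points this is reduced to the boundary atlases by the collars. *)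

Require Import Defs.
From HB Require Import structures.
From mathcomp Require Import all_boot all_order all_algebra all_fingroup.
From mathcomp Require Import all_classical all_reals all_analysis.
From mathcomp Require Import ring lra zify.

Set Implicit Arguments.
Unset Strict Implicit.
Unset Printing Implicit Defensive.

Import Order.TTheory GRing.Theory Num.Theory numFieldNormedType.Exports.

Local Open Scope classical_set_scope.
Local Open Scope ring_scope.

(** * Smooth functions on open subsets of R^n *)

(** A frame is adapted to a map when the map can be read off from it: kernel vectors come first for
    a contraction, vectors of tilde U_IJ first for tilde C_IJ. The index condition enters mainly as
    [ds_EI]: the derivative of s_J at v lies in E_I exactly when v is tangent to tilde U_IJ. Hence
    E_I together with the image under ds_J of any completing family [v2] frames E_J. Three obstacles
    shape the analysis. Domains may have boundary, and the models of collars are neither open nor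
    half-spaces; so derivatives are taken within a model set and owe their uniqueness to its shape
    ([solid]). The action of the group on tilde U_IJ, the triple overlaps and the collars of tilde
    U_IJ are given only by the existence of points; lifts chosen point by point have to be proved
    differentiable, which follows by cancelling an immersion ([wd_cancel]). Finally every point has
    its own preferred chart as a model of its tangent space; smoothness of a field at a point is
    therefore read in the one chart at that point, and fields with constant coordinates there extend
    given vectors smoothly. *)

Lemma mxnorm_le (R : realType) n (v : 'rV[R]_n) e :
  0 <= e -> (forall i, `|v 0 i| <= e) -> `|v| <= e.
Proof.
move=> e0 h; rewrite /Num.Def.normr/= mx_normrE; apply: bigmax_le => // -[i j] _.
by rewrite ord1 h.
Qed.

Lemma mxcoord_le (R : realType) n (v : 'rV[R]_n) i : `|v 0 i| <= `|v|.
Proof.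
rewrite [in leRHS]/Num.Def.normr/= mx_normrE.
exact: (le_bigmax _ (fun ij : 'I_1 * 'I_n => `|v ij.1 ij.2|) (0, i)).
Qed.

Lemma linear_rV_continuous (R : realType) n (V : normedModType R)
  (l : {linear 'rV[R]_n -> V}) : continuous l.
Proof.
have -> : l = (fun p => \sum_i p 0 i *: l (delta_mx 0 i)) :> ('rV[R]_n -> V).
  apply/funext => p; rewrite [in LHS](row_sum_delta p) linear_sum /=.
  by apply: eq_bigr => i _; rewrite linearZ.
apply: continuous_big => [|i _]; first exact: add_continuous.
move=> p; apply: (@cvgZr_tmp R V _ _ (nbhs_filter p)); exact: (@coord_continuous R 1 n 0 i p).
Qed.

Definition entry (R : pzRingType) m (i : 'I_m) (p : 'rV[R]_m) : R := p 0 i.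

Lemma entry_is_linear (R : pzRingType) m (i : 'I_m) : linear (@entry R m i : 'rV[R]_m -> R^o).
Proof. by move=> a p q; rewrite /entry !mxE. Qed.

HB.instance Definition _ (R : pzRingType) m i :=
  GRing.isLinear.Build R 'rV[R]_m R^o *:%R (@entry R m i) (@entry_is_linear R m i).

Section Smooth.
Variable R : realType.

Definition smo n (V : normedModType R) (O : set 'rV[R]_n) (f : 'rV[R]_n -> V) :=
  forall (vs : seq 'rV[R]_n) p, O p ->
    differentiable (foldr (fun v h => 'D_v h) f vs) p.

(** Truncation of [smo] at order k. The Leibniz and chain rules turn one derivative into a sum of
    products, which the list of directions in [smo] does not follow; induction on k, for all
    functions at once, does. *)
Fixpoint smk k n (V : normedModType R) (O : set 'rV[R]_n) (f : 'rV[R]_n -> V) : Prop :=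
  (forall p, O p -> differentiable f p) /\
  if k is k'.+1 then forall v, smk k' O ('D_v f) else True.

Lemma smoP n (V : normedModType R) (O : set 'rV[R]_n) (f : 'rV[R]_n -> V) :
  smo O f <-> forall k, smk k O f.
Proof.
split=> [sf k|sf vs].
  elim: k f sf => [|k IH] f sf; split=> //; try by move=> p; exact: (sf [::]).
  by move=> v; apply: IH => vs p /(sf (rcons vs v)); rewrite foldr_rcons.
elim/last_ind: vs f sf => [|vs v IH] f sf p Op /=.
  by case: (sf 0%N) => h _; apply: h.
rewrite foldr_rcons; apply: IH => // k.
by case: (sf k.+1) => _; apply.
Qed.

Lemma smk_diff k n (V : normedModType R) (O : set 'rV[R]_n) (f : 'rV[R]_n -> V) p :
  smk k O f -> O p -> differentiable f p.
Proof. by case: k => [|k] [h _]; apply: h. Qed.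

Lemma smkW k n (V : normedModType R) (O : set 'rV[R]_n) (f : 'rV[R]_n -> V) :
  smk k.+1 O f -> smk k O f.
Proof.
elim: k f => [|k IH] f [h1 h2]; first by split.
by split=> // v; apply: IH.
Qed.

Lemma smk_sub k n (V : normedModType R) (O O' : set 'rV[R]_n) (f : 'rV[R]_n -> V) :
  O' `<=` O -> smk k O f -> smk k O' f.
Proof.
move=> s; elim: k f => [|k IH] f [h1 h2]; (split; first by move=> p /s /h1) => //.
by move=> v; exact: IH (h2 v).
Qed.

Lemma diff_eps (V W : normedModType R) (f : V -> W) p :
  differentiable f p -> forall e : R, 0 < e ->
  \forall h \near 0, `|f (p + h) - f p - 'd f p h| <= e * `|h|.
Proof.
move=> df e e0.
have /eqaddoP fl := diff_locally df.
near=> h; rewrite -addrA -opprD [p + h]addrC.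
by near: h; apply: fl.
Unshelve. all: by end_near. Qed.

Lemma eps_diff (V W : normedModType R) (f : V -> W) (L : {linear V -> W}) p :
  continuous L -> (forall e : R, 0 < e ->
    \forall h \near 0, `|f (p + h) - f p - L h| <= e * `|h|) ->
  differentiable f p /\ 'd f p = L :> (V -> W).
Proof.
move=> Lc fL.
have fl : f \o shift p = cst (f p) + L +o_ 0 id.
  apply/eqaddoP => e e0; near=> h.
  suff -> : (f \o shift p - (cst (f p) + L)) h = f (p + h) - f p - L h.
    by near: h; apply: fL.
  by rewrite -addrA -opprD [p + h]addrC.
have dL := diff_unique Lc fl.
by split => //; apply/diff_locallyP; rewrite dL.
Unshelve. all: by end_near. Qed.

Lemma near_eq_differentiable (V W : normedModType R) (f g : V -> W) p :
  (\forall q \near p, f q = g q) -> differentiable f p -> differentiable g p.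
Proof.
move=> fg df.
have [//|//|] := @eps_diff _ _ g ('d f p) p.
  exact: diff_continuous.
move=> e e0; have fgp := nbhs_singleton fg.
move: fg; rewrite nbhs0P => fg; near=> h.
rewrite -fgp -(near fg h) //.
by near: h; apply: diff_eps.
Unshelve. all: by end_near. Qed.

Lemma open_near (T : topologicalType) (O : set T) p : open O -> O p -> \forall q \near p, O q.
Proof. by move=> oO Op; apply: open_nbhs_nbhs. Qed.

Lemma smk_ext k n (V : normedModType R) (O : set 'rV[R]_n) (f g : 'rV[R]_n -> V) :
  open O -> (forall p, O p -> f p = g p) -> smk k O f -> smk k O g.
Proof.
move=> oO; elim: k f g => [|k IH] f g fg [h1 h2].
  split=> // p Op; apply: near_eq_differentiable (h1 p Op).
  by have := open_near oO Op; apply: filterS => q /fg.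
split=> [p Op|v].
  apply: near_eq_differentiable (h1 p Op).
  by have := open_near oO Op; apply: filterS => q /fg.
apply: IH (h2 v) => p Op; apply: near_eq_derive.
by have := open_near oO Op; apply: filterS => q /fg.
Qed.

Lemma smk_lin k n (V W : normedModType R) (O : set 'rV[R]_n) (f : 'rV[R]_n -> V)
    (l : {linear V -> W}) :
  open O -> continuous l -> smk k O f -> smk k O (l \o f).
Proof.
move=> oO lc; elim: k f => [|k IH] f [h1 h2].
  split=> // p Op; apply: differentiable_comp; first exact: h1.
  exact: linear_differentiable.
have dl q : differentiable l q by exact: linear_differentiable.
split=> [p Op|v]; first by apply: differentiable_comp; [exact: h1 | exact: dl].
apply: smk_ext (IH _ (h2 v)) => // p Op /=.
have dlf : differentiable (l \o f) p by apply: differentiable_comp; [exact: h1 | exact: dl].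
rewrite (deriveE v dlf) (deriveE v (h1 p Op)) (diff_comp (h1 p Op) (dl _)) /=.
by have -> : 'd l (f p) = l :> (V -> W) by exact: diff_lin.
Qed.

Lemma smk_cst k n (V : normedModType R) (O : set 'rV[R]_n) (c : V) :
  smk k O (fun=> c).
Proof.
elim: k c => [|k IH] c; (split; first by move=> p _; exact: differentiable_cst) => // v.
have -> : 'D_v (fun=> c) = (fun=> 0) :> ('rV[R]_n -> V).
  by apply/funext => q; rewrite derive_cst.
exact: IH.
Qed.

Lemma smk_add k n (V : normedModType R) (O : set 'rV[R]_n) (f g : 'rV[R]_n -> V) :
  open O -> smk k O f -> smk k O g -> smk k O (fun p => f p + g p).
Proof.
move=> oO; elim: k f g => [|k IH] f g sf sg.
  by split=> // p Op; apply: differentiableD; apply: smk_diff Op; eassumption.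
have dD p : O p -> differentiable (fun p => f p + g p) p.
  by move=> Op; apply: differentiableD; apply: smk_diff Op; eassumption.
split=> // v; case: sf sg => f1 f2 [g1 g2].
apply: (smk_ext oO _ (IH _ _ (f2 v) (g2 v))) => p Op.
by rewrite deriveD //; apply: diff_derivable; [exact: f1|exact: g1].
Qed.

Lemma smk_mul k n (O : set 'rV[R]_n) (f g : 'rV[R]_n -> R) :
  open O -> smk k O f -> smk k O g -> smk k O (fun p => f p * g p).
Proof.
move=> oO; elim: k f g => [|k IH] f g sf sg.
  by split=> // p Op; apply: differentiableM; apply: smk_diff Op; eassumption.
have dD p : O p -> differentiable (fun p => f p * g p) p.
  by move=> Op; apply: differentiableM; apply: smk_diff Op; eassumption.
split=> // v; have sf' := smkW sf; have sg' := smkW sg.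
case: sf sg => f1 f2 [g1 g2].
apply: (smk_ext oO _ (smk_add oO (IH _ _ sf' (g2 v)) (IH _ _ sg' (f2 v)))) => p Op.
by rewrite deriveM //; apply: diff_derivable; [exact: f1|exact: g1].
Qed.

Lemma smk_scalel k n (V : normedModType R) (O : set 'rV[R]_n) (f : 'rV[R]_n -> R) (w : V) :
  open O -> smk k O f -> smk k O (fun p => f p *: w).
Proof.
move=> oO; elim: k f => [|k IH] f [f1 f2].
  by split=> // p Op; apply: differentiableZl; exact: f1.
have dZ p : O p -> differentiable (fun p => f p *: w) p.
  by move=> Op; apply: differentiableZl; exact: f1.
split=> // v; apply: (smk_ext oO _ (IH _ (f2 v))) => p Op.
by rewrite (deriveE v (dZ p Op)) (deriveE v (f1 p Op)) (diffZl w (f1 p Op)).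
Qed.

Lemma smk_sum k n (V : normedModType R) (O : set 'rV[R]_n) (I : Type) (r : seq I)
    (P : pred I) (f : I -> 'rV[R]_n -> V) :
  open O -> (forall i, P i -> smk k O (f i)) ->
  smk k O (fun p => \sum_(i <- r | P i) f i p).
Proof.
move=> oO sf; elim: r => [|i r IH].
  by apply: smk_ext (smk_cst k O 0) => // p _; rewrite big_nil.
case Pi: (P i).
  by apply: smk_ext (smk_add oO (sf i Pi) IH) => // p _; rewrite big_cons Pi.
by apply: smk_ext IH => // p _; rewrite big_cons Pi.
Qed.

Lemma smk_inv k n (O : set 'rV[R]_n) (f : 'rV[R]_n -> R) :
  open O -> (forall p, O p -> f p != 0) -> smk k O f -> smk k O (fun p => (f p)^-1).
Proof.
move=> oO f0; elim: k => [|k IH] sf.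
  by split=> // p Op; apply: differentiableV; [exact: smk_diff sf Op|exact: f0].
split=> [p Op|v]; first by apply: differentiableV; [exact: smk_diff sf Op|exact: f0].
have sV := IH (smkW sf); case: sf => f1 f2.
apply: (smk_ext oO _ (smk_mul oO (smk_mul oO (smk_cst k O (-1 : R)) (smk_mul oO sV sV)) (f2 v))).
move=> p Op; rewrite deriveV ?f0 //; last by apply: diff_derivable; exact: f1.
by rewrite mulN1r -expr2 exprVn.
Qed.

(** The chain rule writes the derivative of [g \o f] along v as the sum over i of the i-th
    coordinate of ['D_v f] times the i-th partial derivative of g composed with f. The induction
    hypothesis applies to the second factor, with the partial derivative in place of g. *)
Lemma smk_comp k n m (O : set 'rV[R]_n) (O' : set 'rV[R]_m)
    (f : 'rV[R]_n -> 'rV[R]_m) (g : 'rV[R]_m -> R) :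
  open O -> open O' -> (forall p, O p -> O' (f p)) ->
  smk k O f -> smk k O' g -> smk k O (g \o f).
Proof.
move=> oO oO' OO'; elim: k g => [|k IH] g sf sg.
  split=> // p Op; apply: differentiable_comp; first exact: smk_diff sf Op.
  by apply: smk_diff sg _; apply: OO'.
have sf' := smkW sf; case: sf sg => f1 f2 [g1 g2].
split=> [p Op|v].
  by apply: differentiable_comp; [exact: f1|apply: g1; exact: OO'].
have s i : smk k O (fun p => 'D_v f p 0 i * 'D_(delta_mx 0 i) g (f p)).
  apply: smk_mul => //; last exact: (IH _ sf' (g2 _)).
  apply: (@smk_lin k n _ R^o O ('D_v f) (@entry R m i)) => //.
    exact: (@linear_rV_continuous R m R^o (@entry R m i)).
  exact: f2.
apply: (smk_ext oO _ (@smk_sum k n _ O _ (index_enum _) predT _ oO (fun i _ => s i))).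
move=> p Op; have Op' := OO' _ Op.
have dgf : differentiable (g \o f) p.
  by apply: differentiable_comp; [exact: f1|apply: g1; exact: OO'].
rewrite (deriveE v dgf) (diff_comp (f1 p Op) (g1 _ Op')) /= -(deriveE v (f1 p Op)).
rewrite [in RHS](row_sum_delta ('D_v f p)) linear_sum.
by apply: eq_bigr => i _; rewrite linearZ /= (deriveE _ (g1 _ Op')).
Qed.

End Smooth.

(** * Derivatives within convex sets *)

Lemma vcoord_is_linear (F : fieldType) (W : vectType F) : linear (@vcoord F W).
Proof. by move=> a u v; apply/rowP => i; rewrite !mxE linearP. Qed.

HB.instance Definition _ (F : fieldType) (W : vectType F) :=
  GRing.isLinear.Build F W _ *:%R (@vcoord F W) (@vcoord_is_linear F W).

Definition ofcoord (F : fieldType) (W : vectType F) (r : 'rV[F]_(\dim {: W})) : W :=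
  \sum_i r 0 i *: (vbasis {: W})`_i.

Lemma ofcoord_is_linear (F : fieldType) (W : vectType F) : linear (@ofcoord F W).
Proof.
move=> a u v; rewrite /ofcoord scaler_sumr -big_split /=.
by apply: eq_bigr => i _; rewrite !mxE scalerDl scalerA.
Qed.

HB.instance Definition _ (F : fieldType) (W : vectType F) :=
  GRing.isLinear.Build F _ W *:%R (@ofcoord F W) (@ofcoord_is_linear F W).

Lemma vcoordK (F : fieldType) (W : vectType F) : cancel (@vcoord F W) (@ofcoord F W).
Proof.
move=> w; rewrite [RHS](coord_vbasis (memvf w)).
by apply: eq_bigr => i _; rewrite mxE.
Qed.

Section WithinDerivative.
Variable R : realType.
Implicit Types (V W : vectType R).

Lemma lin_bound n m (f : {linear 'rV[R]_n -> 'rV[R]_m}) :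
  exists2 C : R, 0 < C & forall h, `|f h| <= C * `|h|.
Proof. exact/linear_lipschitz/linear_rV_continuous. Qed.

Lemma hom_bound V W (l : 'Hom(V, W)) :
  exists2 C : R, 0 < C & forall v, `|vcoord (l v)| <= C * `|vcoord v|.
Proof.
have [C C0 h] := lin_bound (@vcoord R W \o l \o @ofcoord R V).
by exists C => // v; rewrite -{1}(vcoordK v); exact: h.
Qed.

Lemma vcoord_bound n : exists2 C : R, 0 < C & forall h : 'rV[R]_n, `|vcoord h| <= C * `|h|.
Proof. exact: lin_bound. Qed.

Lemma ofcoord_bound n : exists2 C : R, 0 < C & forall h : 'rV[R]_n, `|h| <= C * `|vcoord h|.
Proof.
have [C C0 h] := lin_bound (@ofcoord R 'rV[R]_n).
by exists C => // v; rewrite -{1}(vcoordK v); exact: h.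
Qed.

Lemma hom_rV_bound n W (l : 'Hom('rV[R]_n, W)) :
  exists2 C : R, 0 < C & forall h, `|vcoord (l h)| <= C * `|h|.
Proof. exact: (lin_bound (@vcoord R W \o l)). Qed.

(** Differentiability within H, as an estimate and in coordinates of W: in this form boundary points
    of a half-space and points of a collar obey the same rules as interior points, and [dv] is an
    instance. *)
Definition wd n W (H : set 'rV[R]_n) (F : 'rV[R]_n -> W) (p : 'rV[R]_n)
    (L : 'Hom('rV[R]_n, W)) : Prop :=
  forall e : R, 0 < e -> \forall h \near (0 : 'rV[R]_n), H (p + h) ->
    `|vcoord (F (p + h) - F p - L h)| <= e * `|h|.

Lemma wd_rV n m (H : set 'rV[R]_n) (F : 'rV[R]_n -> 'rV[R]_m) p L :
  wd H F p L <-> forall e : R, 0 < e -> \forall h \near (0 : 'rV[R]_n), H (p + h) ->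
    `|F (p + h) - F p - L h| <= e * `|h|.
Proof.
split=> hF e e0.
  have [C C0 hC] := ofcoord_bound m.
  have e1 : 0 < e / C by rewrite divr_gt0.
  apply: filterS (hF _ e1) => h hh /hh {}hh; apply: le_trans (hC _) _.
  by rewrite mulrC -ler_pdivlMr // mulrAC.
have [C C0 hC] := vcoord_bound m.
have e1 : 0 < e / C by rewrite divr_gt0.
apply: filterS (hF _ e1) => h hh /hh {}hh; apply: le_trans (hC _) _.
by rewrite mulrC -ler_pdivlMr // mulrAC.
Qed.

(* H contains the convex hull of each of its points and a fixed ball. *)
Definition solid n (H : set 'rV[R]_n) : Prop :=
  exists q, exists2 r : R, 0 < r & forall p q' (t : R), H p -> `|q' - q| < r ->
    0 <= t <= 1 -> H (p + t *: (q' - p)).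

Lemma near_line n (v : 'rV[R]_n) (P : 'rV[R]_n -> Prop) :
  (\forall h \near (0 : 'rV[R]_n), P h) -> exists2 d : R, 0 < d & forall t, 0 <= t < d -> P (t *: v).
Proof.
move=> /nbhs_ballP[d d0 hd]; exists (d / (1 + `|v|)).
  by rewrite divr_gt0 // ltr_pwDl.
move=> t /andP[t0 td]; apply: hd; rewrite -ball_normE /= sub0r normrN normrZ ger0_norm //.
have : t * (1 + `|v|) < d by rewrite -ltr_pdivlMr // ltr_pwDl.
by apply: le_lt_trans; rewrite mulrDr mulr1 lerDr.
Qed.

Lemma le_eps0 (x c : R) : 0 <= x -> (forall e, 0 < e -> x <= e * c) -> x = 0.
Proof.
move=> x0 h; apply/eqP; rewrite eq_le x0 andbT leNgt; apply/negP => xp.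
have c1 : 0 < 1 + `|c| by rewrite ltr_pwDl.
have := h (x / (1 + `|c|) / 2) _; rewrite !divr_gt0 // => /(_ isT).
have : c <= 1 + `|c| by rewrite (le_trans (ler_norm c)) // lerDr.
have xx : 0 < x / (1 + `|c|) / 2 by rewrite !divr_gt0.
rewrite -(ler_pM2l xx) => /[swap] /le_trans /[apply].
by rewrite mulrAC divfK ?gt_eqF // ler_pdivlMr // mulrDr mulr1 gerDl leNgt xp.
Qed.

Lemma vcoord_norm0 W (w : W) : `|vcoord w| = 0 -> w = 0.
Proof. by move=> /normr0_eq0 e; rewrite -(vcoordK w) e linear0. Qed.

(** For q' in the ball provided by [solid] the segment from p to q' stays in H, so both derivatives
    agree on q' - p. These vectors fill a ball, and differences of two of them give all
    directions. *)
Lemma wd_unique n W (H : set 'rV[R]_n) (F : 'rV[R]_n -> W) p L L' :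
  solid H -> H p -> wd H F p L -> wd H F p L' -> L = L'.
Proof.
move=> [q [r r0 hH]] Hp hL hL'.
have agree q' : `|q' - q| < r -> L (q' - p) = L' (q' - p).
  move=> q'r; apply/subr0_eq/vcoord_norm0; apply: (@le_eps0 _ (2 * `|q' - p|)) => // e e0.
  have [d d0 hd] := near_line (q' - p) (hL _ e0).
  have [d' d'0 hd'] := near_line (q' - p) (hL' _ e0).
  (* Strictly below both radii, so that both estimates apply, and at most 1, so that the point stays
     on the segment inside H. *)
  pose t := Num.min (Num.min d d' / 2) 1.
  have t0 : 0 < t by rewrite lt_min ltr01 andbT divr_gt0 // lt_min d0.
  have tm : t < Num.min d d'.
    apply: (@le_lt_trans _ _ (Num.min d d' / 2)); first by rewrite ge_min lexx.
    by rewrite gtr_pMr ?invf_lt1 ?ltr1n // lt_min d0.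
  have /andP[td td'] : (t < d) && (t < d') by rewrite -lt_min.
  have Hpt : H (p + t *: (q' - p)) by apply: hH => //; rewrite ltW //= ge_min lexx orbT.
  have := hd t _ Hpt; rewrite ltW // => /(_ td) h1.
  have := hd' t _ Hpt; rewrite ltW // => /(_ td') h2.
  rewrite -(ler_pM2l t0) -[t in leLHS](ger0_norm (ltW t0)) -normrZ -linearZ /=.
  rewrite scalerBr -!linearZ /=.
  set A := F _ - F _ in h1 h2.
  have -> : L (t *: (q' - p)) - L' (t *: (q' - p)) =
    (A - L' (t *: (q' - p))) - (A - L (t *: (q' - p))).
    by rewrite opprB [RHS]addrC addrA subrK.
  rewrite linearB; apply: le_trans (ler_normB _ _) _.
  apply: le_trans (lerD h2 h1) _; rewrite normrZ ger0_norm ?(ltW t0) //.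
  by rewrite le_eqVlt; apply/orP; left; apply/eqP; ring.
apply/lfunP => h; rewrite (row_sum_delta h) !linear_sum; apply: eq_bigr => i _.
rewrite !linearZ /=; congr (_ *: _).
have d : `|r / 2 *: (delta_mx 0 i : 'rV[R]_n)| < r.
  apply: (@le_lt_trans _ _ (r / 2)); last by rewrite gtr_pMr ?invf_lt1 ?ltr1n.
  have r2 : 0 <= r / 2 by rewrite divr_ge0 // ltW.
  apply: mxnorm_le => // j.
  by rewrite !mxE eqxx /= normrM (ger0_norm r2) normr_nat ler_piMr // lern1 leq_b1.
set v := r / 2 *: _ in d.
have h1 : L (q + v - p) = L' (q + v - p) by apply: agree; rewrite [q + v]addrC addrK.
have h2 : L (q - p) = L' (q - p) by apply: agree; rewrite subrr normr0.
have : L v = L' v.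
  have -> : v = q + v - p - (q - p) by rewrite opprB addrA subrK [q + v]addrC addrK.
  by rewrite [L _]linearB [L' _]linearB; congr (_ - _).
rewrite !linearZ /=; apply: scalerI.
by rewrite mulf_neq0 ?invr_neq0 // gt_eqF.
Qed.

Lemma wd_bound n W (H : set 'rV[R]_n) (F : 'rV[R]_n -> W) p L : wd H F p L ->
  exists2 C : R, 0 < C & \forall h \near (0 : 'rV[R]_n), H (p + h) ->
    `|vcoord (F (p + h) - F p)| <= C * `|h|.
Proof.
move=> hF; have [C C0 hC] := hom_rV_bound L.
exists (1 + C); first by rewrite addr_gt0.
apply: filterS (hF _ ltr01) => h hh /hh {}hh.
rewrite -[F _ - F p](subrK (L h)) linearD mulrDl.
by apply: le_trans (ler_normD _ _) _; apply: lerD (hC _).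
Qed.

Lemma near_small n (C e : R) : 0 < C -> 0 < e ->
  \forall h \near (0 : 'rV[R]_n), C * `|h| < e.
Proof.
move=> C0 e0; apply/nbhs_ballP; exists (e / C); first by rewrite /= divr_gt0.
by move=> h; rewrite -ball_normE /= sub0r normrN ltr_pdivlMr // mulrC.
Qed.

Lemma wd_cont n m (H : set 'rV[R]_n) (F : 'rV[R]_n -> 'rV[R]_m) p L (P : 'rV[R]_m -> Prop) :
  wd H F p L -> (\forall k \near (0 : 'rV[R]_m), P k) ->
  \forall h \near (0 : 'rV[R]_n), H (p + h) -> P (F (p + h) - F p).
Proof.
move=> hF /nbhs_ballP[d d0 hd].
have [C C0 hC] := wd_bound hF; have [C' C'0 hC'] := ofcoord_bound m.
have CC : 0 < C' * C by rewrite mulr_gt0.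
near=> h => Hh; apply: hd; rewrite -ball_normE /= sub0r normrN.
apply: le_lt_trans (hC' _) _.
apply: (@le_lt_trans _ _ (C' * (C * `|h|))).
  by rewrite ler_pM2l //; move: Hh; near: h.
by rewrite mulrA; near: h; exact: near_small.
Unshelve. all: by end_near. Qed.

Lemma wd_ext n W (H : set 'rV[R]_n) (F G : 'rV[R]_n -> W) p L :
  (\forall q \near p, H q -> F q = G q) -> H p -> wd H F p L -> wd H G p L.
Proof.
move=> FG Hp hF e e0; have e1 := nbhs_singleton FG Hp.
move: FG; rewrite nbhs0P => FG.
by near=> h => Hh; rewrite -e1 -(near FG h) //; move: Hh; near: h; apply: hF.
Unshelve. all: by end_near. Qed.

Lemma wd_comp n m W (H : set 'rV[R]_n) (H' : set 'rV[R]_m)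
    (F : 'rV[R]_n -> 'rV[R]_m) (G : 'rV[R]_m -> W) p L M :
  wd H F p L -> wd H' G (F p) M ->
  (\forall q \near p, H q -> H' (F q)) -> wd H (G \o F) p (M \o L)%VF.
Proof.
move=> hF hG; rewrite nbhs0P => HH' e e0.
have [C C0 hC] := wd_bound hF; have [C1 C10 hC1] := ofcoord_bound m.
have [C2 C20 hC2] := hom_bound M.
(* One half of e pays for the remainder of G, whose argument moves by at most [C1 * C] times the
   norm of h; the other half pays for the image under M of the remainder of F. *)
have e1 : 0 < e / 2 / (C1 * C) by rewrite !divr_gt0 // mulr_gt0.
have e2 : 0 < e / 2 / C2 by rewrite !divr_gt0.
near=> h => Hh.
have hF1 : `|vcoord (F (p + h) - F p)| <= C * `|h| by move: Hh; near: h.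
have hF2 : `|vcoord (F (p + h) - F p - L h)| <= e / 2 / C2 * `|h|.
  by move: Hh; near: h; apply: hF.
have H'F : H' (F (p + h)) by move: Hh; near: h.
have hG1 : `|vcoord (G (F p + (F (p + h) - F p)) - G (F p) - M (F (p + h) - F p))|
    <= e / 2 / (C1 * C) * `|F (p + h) - F p|.
  suff : H' (F p + (F (p + h) - F p)) -> `|vcoord (G (F p + (F (p + h) - F p)) - G (F p)
    - M (F (p + h) - F p))| <= e / 2 / (C1 * C) * `|F (p + h) - F p|.
    by apply; rewrite addrC subrK.
  move: Hh; near: h; exact: (wd_cont hF (hG _ e1)).
rewrite [F p + _]addrC subrK in hG1.
rewrite comp_lfunE /=.
have -> : G (F (p + h)) - G (F p) - M (L h) =
  (G (F (p + h)) - G (F p) - M (F (p + h) - F p)) + M (F (p + h) - F p - L h).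
  by rewrite [M (_ - L h)]linearB addrA subrK.
rewrite linearD; apply: le_trans (ler_normD _ _) _.
have -> : e * `|h| = e / 2 * `|h| + e / 2 * `|h| by field.
apply: lerD.
  apply: le_trans hG1 _.
  rewrite mulrAC ler_pdivrMr ?mulr_gt0 // -[leRHS]mulrA ler_pM2l ?divr_gt0 //.
  by apply: le_trans (hC1 _) _; rewrite [leRHS]mulrC -[leRHS]mulrA ler_pM2l.
apply: le_trans (hC2 _) _.
by rewrite mulrC -ler_pdivlMr // mulrAC.
Unshelve. all: by end_near. Qed.

Lemma wd_lin n W W' (H : set 'rV[R]_n) (F : 'rV[R]_n -> W) p L (l : 'Hom(W, W')) :
  wd H F p L -> wd H (l \o F) p (l \o L)%VF.
Proof.
move=> hF e e0; have [C C0 hC] := hom_bound l.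
have e1 : 0 < e / C by rewrite divr_gt0.
apply: filterS (hF _ e1) => h hh /hh {}hh.
rewrite comp_lfunE /= -!linearB; apply: le_trans (hC _) _.
by rewrite mulrC -ler_pdivlMr // mulrAC.
Qed.

Lemma wd_id n (H : set 'rV[R]_n) p : wd H id p \1%VF.
Proof.
move=> e e0; near=> h => _; rewrite /= id_lfunE [p + h]addrC addrK subrr linear0 normr0.
by rewrite mulr_ge0 // ltW.
Unshelve. all: by end_near. Qed.

(* Continuity of V enters only to make the remainder of E at V p small
   relative to V (p + h) - V p, whose size injectivity of M then controls. *)
Lemma wd_cancel n m k (H : set 'rV[R]_n) (H' : set 'rV[R]_m)
    (V : 'rV[R]_n -> 'rV[R]_m) (E : 'rV[R]_m -> 'rV[R]_k) (K : 'rV[R]_n -> 'rV[R]_k) p L M :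
  (forall P : 'rV[R]_m -> Prop, (\forall q \near V p, P q) ->
     \forall q \near p, H q -> P (V q)) ->
  (\forall q \near p, H q -> H' (V q)) -> H p ->
  (\forall q \near p, H q -> E (V q) = K q) ->
  wd H' E (V p) M -> lker M = 0%VS -> wd H K p L ->
  exists D, wd H V p D.
Proof.
move=> cV HH' Hp EK hE M0 hK; pose M' := (M^-1)%VF; exists (M' \o L)%VF.
have MK : cancel M M' by apply/lker0_lfunK/eqP.
have Ep := nbhs_singleton EK Hp.
move: (HH') (EK); rewrite nbhs0P => H0; rewrite nbhs0P => EK0.
have cV0 (P : 'rV[R]_m -> Prop) : (\forall k \near (0 : 'rV[R]_m), P k) ->
    \forall h \near (0 : 'rV[R]_n), H (p + h) -> P (V (p + h) - V p).
  move=> hP; rewrite -(nbhs0P (fun q => H q -> P (V q - V p))).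
  apply: (cV (fun q => P (q - V p))); rewrite nbhs0P.
  by apply: filterS hP => q; rewrite [V p + q]addrC addrK.
have [C C0 hC] := hom_bound M'.
have [C1 C10 hC1] := ofcoord_bound m.
have [C2 C20 hC2] := hom_rV_bound (M' \o L)%VF.
have est e1 e2 : 0 < e1 -> 0 < e2 -> \forall h \near (0 : 'rV[R]_n), H (p + h) ->
    `|vcoord (V (p + h) - V p - (M' \o L)%VF h)| <=
    C * (e1 * `|h| + e2 * `|V (p + h) - V p|).
  move=> e10 e20; near=> h => Hh.
  have hEh : `|vcoord (E (V p + (V (p + h) - V p)) - E (V p) - M (V (p + h) - V p))|
      <= e2 * `|V (p + h) - V p|.
    suff : H' (V p + (V (p + h) - V p)) -> `|vcoord (E (V p + (V (p + h) - V p)) -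
        E (V p) - M (V (p + h) - V p))| <= e2 * `|V (p + h) - V p|.
      by apply; rewrite addrC subrK; move: Hh; near: h.
    move: Hh; near: h; exact: (cV0 _ (hE _ e20)).
  have hKh : `|vcoord (K (p + h) - K p - L h)| <= e1 * `|h|.
    by move: Hh; near: h; apply: hK.
  rewrite [V p + _]addrC subrK Ep in hEh.
  have EKh : E (V (p + h)) = K (p + h) by move: Hh; near: h.
  rewrite EKh in hEh.
  rewrite comp_lfunE /= -[V _ - V p]MK -linearB; apply: le_trans (hC _) _.
  rewrite ler_pM2l // MK.
  have -> : M (V (p + h) - V p) - L h = (K (p + h) - K p - L h) -
    (K (p + h) - K p - M (V (p + h) - V p)).
    by rewrite opprB [RHS]addrC addrA subrK.
  rewrite linearB; apply: le_trans (ler_normB _ _) _; exact: lerD.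
have CC1 : 0 < C1 * C by rewrite mulr_gt0.
(* With this value the increment of V occurs on the right of its own estimate with coefficient one
   half and can be absorbed on the left; [C3] is the constant that results. *)
have e2 : 0 < (C1 * C)^-1 / 2 by rewrite divr_gt0 // invr_gt0.
pose C3 := 2 * (C1 * C2 + C1 * C).
have C30 : 0 < C3 by rewrite mulr_gt0 // addr_gt0 // mulr_gt0.
have bnd : \forall h \near (0 : 'rV[R]_n), H (p + h) ->
    `|V (p + h) - V p| <= C3 * `|h|.
  near=> h => Hh.
  have h1 : `|vcoord (V (p + h) - V p - (M' \o L)%VF h)| <=
    C * (1 * `|h| + (C1 * C)^-1 / 2 * `|V (p + h) - V p|).
    by move: Hh; near: h; apply: est.
  have h2 : `|V (p + h) - V p| <= C1 * (C * (1 * `|h| + (C1 * C)^-1 / 2 *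
      `|V (p + h) - V p|) + C2 * `|h|).
    apply: le_trans (hC1 _) _; rewrite ler_pM2l //.
    rewrite -[X in vcoord X](subrK ((M' \o L)%VF h)) linearD.
    by apply: le_trans (ler_normD _ _) _; apply: lerD h1 (hC2 _).
  rewrite -subr_ge0 in h2.
  have -> : C3 * `|h| = `|V (p + h) - V p| + 2 * (C1 * (C * (1 * `|h| + (C1 * C)^-1 / 2 *
      `|V (p + h) - V p|) + C2 * `|h|) - `|V (p + h) - V p|).
    by rewrite /C3; field; rewrite ?mulf_neq0 ?gt_eqF.
  by rewrite lerDl mulr_ge0.
move=> e e0.
have e1 : 0 < e / 2 / C by rewrite !divr_gt0.
have e3 : 0 < e / 2 / C / C3 by rewrite !divr_gt0.
near=> h => Hh.
have h1 : `|vcoord (V (p + h) - V p - (M' \o L)%VF h)| <=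
    C * (e / 2 / C * `|h| + e / 2 / C / C3 * `|V (p + h) - V p|).
  by move: Hh; near: h; apply: est.
apply: le_trans h1 _.
have -> : e * `|h| = C * (e / 2 / C * `|h| + e / 2 / C / C3 * (C3 * `|h|)).
  have C3n : C3 != 0 by rewrite gt_eqF.
  have Cn : C != 0 by rewrite gt_eqF.
  by clearbody C3; field; rewrite Cn C3n.
rewrite ler_pM2l // lerD2l ler_pM2l //.
by move: Hh; near: h.
Unshelve. all: by end_near. Qed.

Lemma wd_diff n m (H : set 'rV[R]_n) (G : 'rV[R]_n -> 'rV[R]_m) p :
  differentiable G p -> wd H G p (linfun ('d G p)).
Proof.
move=> dG; apply/wd_rV => e e0.
by apply: filterS (diff_eps dG e0) => h hh _; rewrite lfunE.
Qed.

End WithinDerivative.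

(** * Determinant lines *)

Section Combinations.
Variables (R : realType) (W : vectType R).
Implicit Types (Z H : {vspace W}) (s t w : seq W).

(* t is, modulo Z, the family of linear combinations of s with coefficients A *)
Definition combZ Z n m (A : 'M[R]_(m, n)) t s : Prop :=
  forall i : 'I_m, t`_i - \sum_j A i j *: s`_j \in Z.

Lemma combZ0 n m (A : 'M[R]_(m, n)) t s :
  combZ 0 A t s <-> forall i : 'I_m, t`_i = \sum_j A i j *: s`_j.
Proof.
by split=> h i; have := h i; rewrite memv0 subr_eq0 => /eqP.
Qed.

Lemma combZ_comp Z n m p (A : 'M[R]_(m, n)) (B : 'M[R]_(p, m)) s t u :
  combZ Z A t s -> combZ Z B u t -> combZ Z (B *m A) u s.
Proof.
move=> hA hB i.
have -> : \sum_j (B *m A) i j *: s`_j = \sum_k B i k *: (\sum_j A k j *: s`_j).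
  under eq_bigr do rewrite mxE scaler_suml.
  rewrite exchange_big /=; apply: eq_bigr => k _; rewrite scaler_sumr.
  by apply: eq_bigr => j _; rewrite scalerA.
rewrite -[u`_i](subrK (\sum_k B i k *: t`_k)) -addrA; apply: rpredD => //.
rewrite -sumrB; apply: rpred_sum => k _.
by rewrite -scalerBr rpredZ.
Qed.

Lemma combZ1 Z n s : combZ Z (1%:M : 'M[R]_n) s s.
Proof.
move=> i; rewrite (bigD1 i) //= mxE eqxx scale1r big1 ?addr0 ?subrr ?mem0v //.
by move=> j /negPf ji; rewrite mxE eq_sym ji scale0r.
Qed.

Lemma comb_in_span n (f : 'I_n -> R) s : size s = n -> \sum_j f j *: s`_j \in << s >>%VS.
Proof.
move=> sn; apply: rpred_sum => j _; apply: rpredZ; apply: memv_span.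
by rewrite mem_nth // sn.
Qed.

Lemma combZ_uniq Z n m (A A' : 'M[R]_(m, n)) t s : size s = n -> free s ->
  (<< s >> :&: Z = 0)%VS -> combZ Z A t s -> combZ Z A' t s -> A = A'.
Proof.
move=> sn fs sZ hA hA'; subst n; apply/matrixP => i.
have : \sum_j (A i j - A' i j) *: s`_j \in (<< s >> :&: Z)%VS.
  rewrite memv_cap comb_in_span //=.
  have -> : \sum_j (A i j - A' i j) *: s`_j =
    (t`_i - \sum_j A' i j *: s`_j) - (t`_i - \sum_j A i j *: s`_j).
    rewrite opprB [RHS]addrC addrA subrK -sumrB.
    by apply: eq_bigr => j _; rewrite scalerBl.
  by rewrite rpredB.
rewrite sZ memv0 => /eqP e j.
have /freeP h : free (in_tuple s) by [].
by apply/subr0_eq; exact: (h (fun j => A i j - A' i j) e j).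
Qed.

Lemma combZ_exist Z m t s : (forall i, (i < m)%N -> t`_i \in (<< s >> + Z)%VS) ->
  exists A : 'M[R]_(m, size s), combZ Z A t s.
Proof.
move=> h.
have {}h (i : 'I_m) : exists r : 'rV[R]_(size s), t`_i - \sum_j r 0 j *: s`_j \in Z.
  have /memv_addP[x xs [z zZ ->]] := h i (ltn_ord i).
  exists (\row_j coord (in_tuple s) j x).
  under eq_bigr do rewrite mxE.
  by rewrite -(coord_span (X := in_tuple s) xs) [x + z]addrC addrK.
exists (\matrix_(i, j) sval (cid (h i)) 0 j) => i.
under eq_bigr do rewrite mxE.
exact: (svalP (cid (h i))).
Qed.

Lemma combZ_exist_n Z m n t s : size s = n ->
  (forall i, (i < m)%N -> t`_i \in (<< s >> + Z)%VS) ->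
  exists A : 'M[R]_(m, n), combZ Z A t s.
Proof. by move=> <-; exact: combZ_exist. Qed.

Lemma sum_cat n1 n2 (r : 'I_(n1 + n2) -> R) s1 s2 : size s1 = n1 ->
  \sum_j r j *: (s1 ++ s2)`_j =
  \sum_j r (lshift n2 j) *: s1`_j + \sum_j r (rshift n1 j) *: s2`_j.
Proof.
move=> s1n; rewrite big_split_ord /=; congr (_ + _).
  by apply: eq_bigr => j _; rewrite nth_cat s1n ltn_ord.
by apply: eq_bigr => j _; rewrite nth_cat s1n ltnNge leq_addr /= addKn.
Qed.

Lemma combZ_block Z n1 n2 m1 m2 (A : 'M[R]_(m1, n1)) (B : 'M[R]_(m1, n2))
    (C : 'M[R]_(m2, n1)) (D : 'M[R]_(m2, n2)) s1 s2 t1 t2 :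
  size s1 = n1 -> size t1 = m1 ->
  (forall i : 'I_m1, t1`_i - (\sum_j A i j *: s1`_j + \sum_j B i j *: s2`_j) \in Z) ->
  (forall i : 'I_m2, t2`_i - (\sum_j C i j *: s1`_j + \sum_j D i j *: s2`_j) \in Z) ->
  combZ Z (block_mx A B C D) (t1 ++ t2) (s1 ++ s2).
Proof.
move=> s1n t1m h1 h2 i; rewrite (sum_cat _ _ s1n).
case: (split_ordP i) => k ->.
  rewrite nth_cat t1m /= ltn_ord.
  congr (_ - (_ + _) \in Z): (h1 k); apply: eq_bigr => j _.
    by rewrite block_mxEul.
  by rewrite block_mxEur.
rewrite nth_cat t1m /= ltnNge leq_addr /= addKn.
congr (_ - (_ + _) \in Z): (h2 k); apply: eq_bigr => j _.
  by rewrite block_mxEdl.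
by rewrite block_mxEdr.
Qed.

Lemma qbasisP H Z w : reflect [/\ free w, (<<w>> :&: Z = 0)%VS & (<<w>> + Z = H)%VS]
  (qbasis_of H Z w).
Proof. by apply: (iffP and3P) => -[? /eqP ? /eqP ?]; split => //; apply/eqP. Qed.

Lemma qbasis0 H w : qbasis_of H 0 w = basis_of H w.
Proof.
by rewrite /qbasis_of capv0 eqxx addv0 /basis_of andbC.
Qed.

Lemma size_qbasis H Z w : qbasis_of H Z w -> size w = (\dim H - \dim Z)%N.
Proof.
case/qbasisP => f c <-; rewrite dimv_disjoint_sum // addnK.
by move: f; rewrite /free => /eqP.
Qed.

Lemma qbasis_comb H Z w w' n m : qbasis_of H Z w -> (forall i, (i < m)%N -> w'`_i \in H) ->
  size w = n -> exists A : 'M[R]_(m, n), combZ Z A w' w.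
Proof. by move=> /qbasisP[_ _ e] h wn; apply: combZ_exist_n => //; rewrite e. Qed.

Lemma qbasis_mem H Z w i : qbasis_of H Z w -> (i < size w)%N -> w`_i \in H.
Proof.
case/qbasisP => _ _ <- iw; rewrite -[w`_i]addr0 memv_add ?mem0v //.
by rewrite memv_span // mem_nth.
Qed.

Lemma qbasis_change H Z w w' n : qbasis_of H Z w -> qbasis_of H Z w' -> size w = n ->
  exists2 A : 'M[R]_n, A \in unitmx & combZ Z A w' w.
Proof.
move=> bw bw' wn; have w'n : size w' = n by rewrite (size_qbasis bw') -(size_qbasis bw).
have [A hA] : exists A : 'M[R]_n, combZ Z A w' w.
  by apply: qbasis_comb bw _ wn => i i_n; apply: qbasis_mem bw' _; rewrite w'n.
have [A' hA'] : exists A : 'M[R]_n, combZ Z A w w'.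
  by apply: qbasis_comb bw' _ w'n => i i_n; apply: qbasis_mem bw _; rewrite wn.
exists A => //; case/qbasisP: bw' => f c _.
have := combZ_uniq w'n f c (combZ_comp hA' hA) (@combZ1 Z n w').
by move=> /mulmx1_unit[].
Qed.

Lemma qbasis_unit H Z w w' n (A : 'M[R]_n) : qbasis_of H Z w -> qbasis_of H Z w' ->
  size w = n -> combZ Z A w' w -> \det A != 0.
Proof.
move=> bw bw' wn hA; have [A' A'u hA'] := qbasis_change bw bw' wn.
case/qbasisP: bw => f c _; rewrite (combZ_uniq wn f c hA hA').
by move: A'u; rewrite unitmxE unitfE.
Qed.

Lemma qbasis_exists H Z : (Z <= H)%VS -> exists w, qbasis_of H Z w.
Proof.
move=> ZH; exists (vbasis (H :\: Z)%VS); apply/qbasisP.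
have b := vbasisP (H :\: Z)%VS; rewrite (span_basis b); split.
- exact: basis_free b.
- exact: capv_diff.
- by rewrite addv_diff; apply/addv_idPl.
Qed.

End Combinations.

Section DetLines.
Variables (R : realType) (V W : vectType R).
Implicit Types (K : {vspace V}) (H Z : {vspace W}) (v : seq V) (w : seq W).

Lemma dframeP K H Z v w : reflect (qbasis_of K 0 v /\ qbasis_of H Z w) (dframe K H Z v w).
Proof. by rewrite qbasis0; apply: andP. Qed.

Lemma dframe_exists K H Z : (Z <= H)%VS -> exists v w, dframe K H Z v w.
Proof.
move=> ZH; have [w bw] := qbasis_exists ZH.
by exists (vbasis K), w; rewrite /dframe vbasisP.
Qed.

Lemma detlineP K H Z (c : detline K H Z) : det_homog K H Z c.
Proof. by case: c => c hc; apply/asboolP. Qed.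

Lemma det_homog_comb K H Z (c : detline K H Z) v w v' w' n m (A : 'M[R]_n) (B : 'M[R]_m) :
  dframe K H Z v w -> dframe K H Z v' w' -> size v = n -> size w = m ->
  combZ 0 A v' v -> combZ Z B w' w -> c (v, w) * \det B = c (v', w') * \det A.
Proof.
move=> f f' vn wm /combZ0 hA hB; subst n m.
by have [_ h] := detlineP c; apply: h.
Qed.

Lemma detcoefD K H Z (c c' : detline K H Z) q : (c + c') q = c q + c' q.
Proof. by []. Qed.

Lemma detcoefZ K H Z a (c : detline K H Z) q : (a *: c) q = a * c q.
Proof. by []. Qed.

Lemma detline_eq K H Z (c c' : detline K H Z) v w :
  dframe K H Z v w -> c (v, w) = c' (v, w) -> c = c'.
Proof.
move=> f e; apply/val_inj/funext => -[v' w'] /=.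
case f' : (dframe K H Z v' w'); last first.
  have [h _] := detlineP c; have [h' _] := detlineP c'.
  by rewrite h ?f' // h' ?f'.
have [bv bw] := dframeP _ _ _ _ _ f; have [bv' bw'] := dframeP _ _ _ _ _ f'.
have [A Au hA] := qbasis_change bv bv' erefl.
have [B Bu hB] := qbasis_change bw bw' erefl.
have h1 := det_homog_comb c f f' erefl erefl hA hB.
have h2 := det_homog_comb c' f f' erefl erefl hA hB.
have dA : \det A != 0 by rewrite -unitfE -unitmxE.
by apply: (mulIf dA); rewrite -h1 -h2 e.
Qed.

(** By the transformation rule the coefficient at another frame can only be [\det B / \det A], with
    A and B expressing that frame in v and w. Uniqueness of A and B makes this a definition, and
    multiplicativity of determinants gives the rule between any two frames. *)
Lemma wedge_witness K H Z v w : dframe K H Z v w -> exists c : detline K H Z, c (v, w) = 1.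
Proof.
move=> f; have [bv bw] := dframeP _ _ _ _ _ f.
pose c (q : seq V * seq W) : R^o := if dframe K H Z q.1 q.2 then
  xget 0 [set x : R | exists (A : 'M[R]_(size v)) (B : 'M[R]_(size w)),
    [/\ combZ 0 A q.1 v, combZ Z B q.2 w & x = \det B / \det A]] else 0.
have cE v' w' (A : 'M[R]_(size v)) (B : 'M[R]_(size w)) : dframe K H Z v' w' ->
    combZ 0 A v' v -> combZ Z B w' w -> c (v', w') = \det B / \det A.
  move=> f' hA hB; rewrite /c f'; case: xgetP => [x _ [A' [B' [hA' hB' ->]]]|/(_ (\det B / \det A))[]].
    have [fv cv _] := qbasisP _ _ _ bv; have [fw cw _] := qbasisP _ _ _ bw.
    by rewrite (combZ_uniq erefl fv cv hA hA') (combZ_uniq erefl fw cw hB hB').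
  by exists A, B.
have hc : c \in det_pred K H Z.
  apply/asboolP; split=> [v1 w1 /negPf f1|v1 w1 v2 w2 A B f1 f2 /combZ0 hA hB].
    by rewrite /c /= f1.
  have [bv1 bw1] := dframeP _ _ _ _ _ f1; have [bv2 bw2] := dframeP _ _ _ _ _ f2.
  have [A1 A1u hA1] := qbasis_change bv bv1 erefl.
  have [B1 B1u hB1] := qbasis_change bw bw1 erefl.
  have ev : size v1 = size v by rewrite (size_qbasis bv) (size_qbasis bv1).
  have ew : size w1 = size w by rewrite (size_qbasis bw) (size_qbasis bw1).
  have dA : \det A != 0 by apply: qbasis_unit bv1 bv2 erefl hA.
  move: A B hA hB dA; rewrite ev ew => A B hA hB dA.
  rewrite (cE _ _ _ _ f1 hA1 hB1).
  rewrite (cE _ _ _ _ f2 (combZ_comp hA1 hA) (combZ_comp hB1 hB)) !det_mulmx.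
  have dA1 : \det A1 != 0 by rewrite -unitfE -unitmxE.
  by field; rewrite dA dA1.
exists (DetLine hc); rewrite /= (cE _ _ _ _ f (@combZ1 _ _ _ _ v) (@combZ1 _ _ _ _ w)).
by rewrite !det1 divr1.
Qed.

Lemma wedge1 K H Z v w : dframe K H Z v w -> wedge K H Z v w (v, w) = 1.
Proof.
move=> f; rewrite /wedge; case: xgetP => [c _ //|n].
by have [c c1] := wedge_witness f; case: (n c).
Qed.

Lemma wedgeE K H Z v w (c : detline K H Z) : dframe K H Z v w -> c = c (v, w) *: wedge K H Z v w.
Proof. by move=> f; apply: (detline_eq f); rewrite detcoefZ wedge1 // mulr1. Qed.

Lemma wedge_inj K H Z v w (a b : R) : dframe K H Z v w ->
  a *: wedge K H Z v w = b *: wedge K H Z v w -> a = b.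
Proof.
move=> f /(congr1 (fun c : detline K H Z => c (v, w))).
by rewrite !detcoefZ wedge1 // !mulr1.
Qed.

Lemma wedge_change K H Z v w v' w' n m (A : 'M[R]_n) (B : 'M[R]_m) :
  dframe K H Z v w -> dframe K H Z v' w' -> size v = n -> size w = m ->
  combZ 0 A v' v -> combZ Z B w' w ->
  wedge K H Z v' w' = (\det A / \det B) *: wedge K H Z v w.
Proof.
move=> f f' vn wm hA hB; apply: (detline_eq f'); rewrite wedge1 // detcoefZ.
have := det_homog_comb (wedge K H Z v w) f f' vn wm hA hB; rewrite wedge1 // mul1r => e.
have [bv bw] := dframeP _ _ _ _ _ f; have [bv' bw'] := dframeP _ _ _ _ _ f'.
have dB := qbasis_unit bw bw' wm hB.
by rewrite mulrAC [_ * wedge _ _ _ _ _ _]mulrC -e divff.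
Qed.

Lemma wedge_ratio K H Z v w v' w' : dframe K H Z v w -> dframe K H Z v' w' ->
  exists2 r : R, r != 0 & wedge K H Z v' w' = r *: wedge K H Z v w.
Proof.
move=> f f'; have [bv bw] := dframeP _ _ _ _ _ f; have [bv' bw'] := dframeP _ _ _ _ _ f'.
have [A Au hA] := qbasis_change bv bv' erefl.
have [B Bu hB] := qbasis_change bw bw' erefl.
exists (\det A / \det B); last exact: wedge_change hA hB.
by move: Au Bu; rewrite !unitmxE !unitfE => ? ?; rewrite mulf_neq0 ?invr_neq0.
Qed.

End DetLines.

Section LineMaps.
Variables (R : realType) (V W V' W' : vectType R).
Variables (K : {vspace V}) (H Z : {vspace W}) (K' : {vspace V'}) (H' Z' : {vspace W'}).
Implicit Types (Q : seq V -> seq W -> seq V' -> seq W' -> Prop).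
Local Notation map_of Q := (@linemap R V W V' W' K H Z K' H' Z' Q).

Definition related Q v w v' w' := [/\ dframe K H Z v w, dframe K' H' Z' v' w' & Q v w v' w'].

Lemma linemap_linear Q a u v : map_of Q (a *: u + v) = a *: map_of Q u + map_of Q v.
Proof. by rewrite /linemap detcoefD detcoefZ scalerDl scalerA. Qed.

Lemma linemapZ Q a u : map_of Q (a *: u) = a *: map_of Q u.
Proof. by rewrite /linemap detcoefZ scalerA. Qed.

(** [linemap] evaluates at an arbitrary related pair of frames. The choice is harmless when two
    related pairs always differ by the same scalar in the source and in the target; all explicit
    maps of lines are computed through this criterion. *)
Lemma linemap_wedge Q v w v' w' :
  (forall v1 w1 v1' w1' v2 w2 v2' w2', related Q v1 w1 v1' w1' -> related Q v2 w2 v2' w2' ->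
     exists2 r, wedge K H Z v2 w2 = r *: wedge K H Z v1 w1 &
       wedge K' H' Z' v2' w2' = r *: wedge K' H' Z' v1' w1') ->
  related Q v w v' w' -> map_of Q (wedge K H Z v w) = wedge K' H' Z' v' w'.
Proof.
move=> coh r; have [f f' _] := r.
rewrite /linemap; case: xgetP => [[[v1 w1] [v1' w1']] _ /= r1|/(_ ((v, w), (v', w')))[]]; last exact: r.
have [s e ->] := coh _ _ _ _ _ _ _ _ r1 r; have [f1 _ _] := r1.
by rewrite e detcoefZ wedge1 // mulr1.
Qed.

End LineMaps.

Lemma size_basis_seq (R : fieldType) (V : vectType R) (U : {vspace V}) X :
  basis_of U X -> size X = \dim U.
Proof. by case/andP => /eqP <-; rewrite /free => /eqP. Qed.

Lemma sum_mx0 (R : pzRingType) (V : lmodType R) m n (i : 'I_m) (s : seq V) :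
  \sum_j (0 : 'M[R]_(m, n)) i j *: s`_j = 0.
Proof. by rewrite big1 // => j _; rewrite mxE scale0r. Qed.

(** * Maps of lines given by operations on frames *)

Section MapFrames.
Variables (R : realType).
Implicit Types V W : vectType R.

Lemma nth_map_lin V W (f : {linear V -> W}) (s : seq V) i : [seq f x | x <- s]`_i = f s`_i.
Proof.
have [si|si] := ltnP i (size s); first exact: nth_map.
by rewrite !nth_default ?size_map // linear0.
Qed.

Lemma combZ_map V W (f : {linear V -> W}) (Z : {vspace V}) (Z' : {vspace W}) n m (A : 'M[R]_(m, n)) t s :
  (forall z, z \in Z -> f z \in Z') ->
  combZ Z A t s -> combZ Z' A [seq f x | x <- t] [seq f x | x <- s].
Proof.
move=> fZ h i; have := fZ _ (h i); rewrite linearB linear_sum nth_map_lin.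
by under eq_bigr do rewrite linearZ -nth_map_lin.
Qed.

Lemma combZ_map0 V W (f : {linear V -> W}) n m (A : 'M[R]_(m, n)) t s :
  combZ 0 A t s -> combZ 0 A [seq f x | x <- t] [seq f x | x <- s].
Proof. by apply: combZ_map => z; rewrite !memv0 => /eqP ->; rewrite linear0. Qed.

Lemma combZ_map_inj V W (f : 'Hom(V, W)) n m (A : 'M[R]_(m, n)) t s :
  lker f = 0%VS -> combZ 0 A [seq f x | x <- t] [seq f x | x <- s] -> combZ 0 A t s.
Proof.
move=> f0 h i; have := h i; rewrite nth_map_lin.
under eq_bigr do rewrite nth_map_lin -linearZ.
by rewrite -linear_sum -linearB memv0 -memv_ker f0.
Qed.

Lemma map_frame V W V' W' (f : 'Hom(V, V')) (g : 'Hom(W, W')) (K : {vspace V})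
    (H Z : {vspace W}) K' H' Z' v w :
  (lker f :&: K = 0)%VS -> (f @: K = K')%VS -> lker g = 0%VS ->
  (g @: H = H')%VS -> (g @: Z = Z')%VS -> dframe K H Z v w ->
  dframe K' H' Z' [seq f a | a <- v] [seq g a | a <- w].
Proof.
move=> fK <- g0 <- <- /andP[bv /qbasisP[fw cw sw]]; apply/andP; split.
  by apply: limg_basis_of bv; rewrite capvC.
have g0' : lker g == 0%VS by apply/eqP.
apply/qbasisP; rewrite -limg_span; split.
- have : basis_of (g @: << w >>) [seq g a | a <- w].
    by apply: limg_basis_of; rewrite ?g0 ?capv0 // /basis_of eqxx.
  by apply: basis_free.
- by rewrite -lker0_img_cap // cw limg0.
- by rewrite -limgD sw.
Qed.

(** The coherence condition in terms of matrices: a change of source frame by A and B has to induce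
    a change of target frame by matrices with the same quotient of determinants. *)
Lemma linemap_comb V W V' W' (K : {vspace V}) (H Z : {vspace W})
    (K' : {vspace V'}) (H' Z' : {vspace W'}) Q v w v' w' :
  (forall v1 w1 v1' w1' v2 w2 v2' w2' (A : 'M[R]_(size v1)) (B : 'M[R]_(size w1)),
     related K H Z K' H' Z' Q v1 w1 v1' w1' -> related K H Z K' H' Z' Q v2 w2 v2' w2' ->
     combZ 0 A v2 v1 -> combZ Z B w2 w1 ->
     exists n m (A' : 'M[R]_n) (B' : 'M[R]_m), [/\ size v1' = n /\ size w1' = m,
       combZ 0 A' v2' v1', combZ Z' B' w2' w1' & \det A / \det B = \det A' / \det B']) ->
  related K H Z K' H' Z' Q v w v' w' ->
  linemap Q (wedge K H Z v w) = wedge K' H' Z' v' w'.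
Proof.
move=> h r; apply: linemap_wedge r => v1 w1 v1' w1' v2 w2 v2' w2' r1 r2.
have [f1 f1' _] := r1; have [f2 f2' _] := r2.
have [bv1 bw1] := dframeP _ _ _ _ _ f1; have [bv2 bw2] := dframeP _ _ _ _ _ f2.
have [A _ hA] := qbasis_change bv1 bv2 erefl.
have [B _ hB] := qbasis_change bw1 bw2 erefl.
have [n [m [A' [B' [[en em] hA' hB' e]]]]] := h _ _ _ _ _ _ _ _ _ _ r1 r2 hA hB.
exists (\det A / \det B); first exact: wedge_change hA hB.
by rewrite e; apply: wedge_change hA' hB'.
Qed.

Lemma linemap_map V W V' W' (f : 'Hom(V, V')) (g : W -> W') (G : 'Hom(W, W'))
    (K : {vspace V}) (H Z : {vspace W}) K' H' Z' v w :
  g =1 G -> (lker f :&: K = 0)%VS -> (f @: K = K')%VS -> lker G = 0%VS ->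
  (G @: H = H')%VS -> (G @: Z = Z')%VS -> dframe K H Z v w ->
  linemap (fun v w v' w' => v' = [seq f a | a <- v] /\ w' = [seq g a | a <- w])
    (wedge K H Z v w) = wedge K' H' Z' [seq f a | a <- v] [seq G a | a <- w].
Proof.
move=> gG fK fK' G0 GH GZ fr.
apply: linemap_comb; last first.
  by split=> //; [exact: map_frame fr | rewrite (eq_map gG)].
move=> v1 w1 v1' w1' v2 w2 v2' w2' A B [f1 _ [-> ->]] [f2 _ [-> ->]] hA hB.
exists (size v1), (size w1), A, B; rewrite !size_map; split=> //.
  exact: combZ_map0.
rewrite !(eq_map gG); apply: combZ_map hB => z zZ.
by rewrite -GZ memv_img.
Qed.

(* The collar isomorphism of det (ds): a fixed vector is wedged in front. *)
Lemma linemap_cons V W V' (e0 : V') (f : 'Hom(V, V')) (K : {vspace V}) (H Z : {vspace W}) K' v w :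
  (forall v, basis_of K v -> basis_of K' (e0 :: [seq f a | a <- v])) ->
  dframe K H Z v w ->
  linemap (fun v w v' w' => w' = w /\ v' = e0 :: [seq f a | a <- v])
    (wedge K H Z v w) = wedge K' H Z (e0 :: [seq f a | a <- v]) w.
Proof.
move=> bK fr.
apply: linemap_comb; last first.
  by split=> //; move: fr => /andP[b1 b2]; rewrite /dframe b2 bK.
move=> v1 w1 v1' w1' v2 w2 v2' w2' A B [f1 _ [-> ->]] [f2 _ [-> ->]] hA hB.
exists (1 + size v1)%N, (size w1), (block_mx 1%:M 0 0 A), B; rewrite /= size_map; split=> //.
  apply: (@combZ_block _ _ _ 1 _ 1 _ _ _ _ _ [:: e0] _ [:: e0] _) => // i.
    rewrite ord1 /= big_ord_recl big_ord0 mxE scale1r addr0.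
    by rewrite sum_mx0 addr0 subrr mem0v.
  rewrite sum_mx0 add0r.
  exact: (combZ_map0 f hA).
by rewrite det_ublock det1 mul1r.
Qed.

(* The transition maps of det (ds): a span of isomorphisms between the kernels. *)
Lemma linemap_span (U : vectType R) V W V' (K : {vspace V}) (H Z : {vspace W})
    (K' : {vspace V'}) (H' Z' : {vspace W}) (r : 'Hom(U, V)) (f : 'Hom(U, V')) v0 w :
  lker r = 0%VS -> (Z <= Z')%VS ->
  dframe K H Z [seq r a | a <- v0] w -> dframe K' H' Z' [seq f a | a <- v0] w ->
  linemap (fun v w v' w' => w' = w /\ exists v0,
      v = [seq r a | a <- v0] /\ v' = [seq f a | a <- v0])
    (wedge K H Z [seq r a | a <- v0] w) = wedge K' H' Z' [seq f a | a <- v0] w.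
Proof.
move=> r0 ZZ fr fr'; apply: linemap_comb; last by split=> //; split=> //; exists v0.
move=> v1 w1 v1' w1' v2 w2 v2' w2' A B.
case=> f1 _ [-> [x1 [ev1 ->]]] [f2 _ [-> [x2 [ev2 ->]]]] hA hB.
exists (size v1), (size w1), A, B; split=> //.
- by rewrite ev1 !size_map.
- rewrite ev2 in hA; move: A hA; rewrite ev1 size_map => A hA.
  by apply: combZ_map0; apply: combZ_map_inj hA.
- by move=> i; apply: subvP ZZ _ (hB i).
Qed.

End MapFrames.

(** * Contractions on adapted frames *)

Section Contraction.
Variables (R : realType) (V W U : vectType R) (H : {vspace W}).
Variables (F : 'Hom(V, W)) (K : {vspace U}) (phi : 'Hom(U, V)).
Hypothesis phi_inj : lker phi = 0%VS.
Hypothesis phi_ker : (phi @: K = lker F)%VS.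
Hypothesis F_im : (limg F <= H)%VS.

Lemma basis_cat_span (v1 v2 : seq V) : basis_of fullv (v1 ++ v2) ->
  (<< v1 >> <= lker F)%VS -> (<< [seq F a | a <- v2] >> = limg F)%VS.
Proof.
move=> /andP[/eqP s _] k; rewrite -limg_span -s span_cat limgD.
by move: k; rewrite lkerE => /eqP ->; rewrite add0v.
Qed.

(** By rank and nullity the length of [v2] is the dimension of the image of F, so the family spans
    and has the right size. *)
Lemma contraction_frame v' v2 w' : basis_of K v' ->
  basis_of fullv ([seq phi a | a <- v'] ++ v2) -> qbasis_of H (limg F) w' ->
  basis_of H (w' ++ [seq F a | a <- v2]).
Proof.
move=> bv' bv bw'; rewrite basisEdim.
have kv : (<< [seq phi a | a <- v'] >> = lker F)%VS.
  by rewrite -limg_span (span_basis bv').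
have sF : (<< [seq F a | a <- v2] >> = limg F)%VS.
  by apply: basis_cat_span bv _; rewrite kv.
have [_ _ e] := qbasisP _ _ _ bw'.
rewrite span_cat sF e subvv /= size_cat size_map (size_qbasis bw').
have s2 : size v2 = \dim (limg F).
  have := limg_ker_dim F fullv; rewrite capfv => e2.
  have : size ([seq phi a | a <- v'] ++ v2) = \dim {:V} by exact: size_basis_seq bv.
  rewrite size_cat size_map (size_basis_seq bv').
  have -> : \dim K = \dim (lker F).
    by rewrite -phi_ker limg_dim_eq // phi_inj capv0.
  by rewrite -e2 => /addnI.
by rewrite s2 subnK // dimvS.
Qed.

(** The matrices between two adapted frames are block triangular: [A'] and [B'] change v' and w',
    and one and the same block changes [v2] and its image under F. The determinant of this block
    occurs in both factors and cancels. *)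
Lemma contraction_wedge v' v2 w' : basis_of K v' ->
  basis_of fullv ([seq phi a | a <- v'] ++ v2) -> qbasis_of H (limg F) w' ->
  Defs.contraction F K phi (wedge fullv H 0 ([seq phi a | a <- v'] ++ v2)
    (w' ++ [seq F a | a <- v2])) = wedge K H (limg F) v' w'.
Proof.
move=> bv' bv bw'; apply: linemap_comb; last first.
  split; last by exists v2.
    by rewrite /dframe bv qbasis0 (contraction_frame bv' bv bw').
  by rewrite /dframe bv' bw'.
move=> v1 w1 v1' w1' v2_ w2 v2' w2' A B.
case=> f1 /andP[bv1' bw1'] [x1 [ev1 ew1]] [f2 /andP[bv2' bw2'] [x2 [ev2 ew2]]] hA hB.
subst v1 w1 v2_ w2.
move: f1 f2 => /andP[bv1 bw1] /andP[bv2 bw2].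
have [A' _ hA'] : exists2 A' : 'M[R]_(size v1'), A' \in unitmx & combZ 0 A' v2' v1'.
  by apply: qbasis_change => //; rewrite qbasis0; [exact: bv1'|exact: bv2'].
have [B' _ hB'] := qbasis_change bw1' bw2' (erefl (size w1')).
exists (size v1'), (size w1'), A', B'; split=> //.
have s1 : size v1' = size v2' by rewrite (size_basis_seq bv1') (size_basis_seq bv2').
have sw : size w1' = size w2' by rewrite (size_qbasis bw1') (size_qbasis bw2').
have sx : size x1 = size x2.
  have := size_basis_seq bv1; rewrite -(size_basis_seq bv2) !size_cat !size_map s1.
  exact: addnI.
(* F kills the part of [x2] along the image of [v1'], so the right half of [CD] also expresses the
   images of [x2] under F by those of [x1]. *)
have [CD hCD] : exists CD : 'M[R]_(size x1, size v1' + size x1),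
    combZ 0 CD x2 ([seq phi a | a <- v1'] ++ x1).
  apply: combZ_exist_n; first by rewrite size_cat size_map.
  by move=> i _; rewrite (span_basis bv1) addv0 memvf.
(* [w2'] is a combination of [w1'] only modulo the image of F; the discrepancy fills the
   off-diagonal block [M], which the determinant ignores. *)
have [M hM] : exists M : 'M[R]_(size w1', size x1),
    forall i : 'I_(size w1'), w2'`_i - \sum_j B' i j *: w1'`_j = \sum_j M i j *: [seq F a | a <- x1]`_j.
  have sF : (<< [seq F a | a <- x1] >> = limg F)%VS.
    by apply: basis_cat_span bv1 _; rewrite -limg_span (span_basis bv1') phi_ker.
  have [M /combZ0 hM] : exists M : 'M[R]_(size w1', size x1),
     combZ 0 M [seq w2'`_i - \sum_j B' i j *: w1'`_j | i : 'I_(size w1') <- enum 'I_(size w1')] [seq F a | a <- x1].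
    apply: combZ_exist_n; first by rewrite size_map.
    move=> i iw; rewrite (nth_map (Ordinal iw)) ?size_enum_ord // addv0 sF.
    exact: hB'.
  by exists M => i; rewrite -hM (nth_map i) ?size_enum_ord // nth_ord_enum.
have hA2 : combZ 0 (block_mx A' 0 (lsubmx CD) (rsubmx CD))
    ([seq phi a | a <- v2'] ++ x2) ([seq phi a | a <- v1'] ++ x1).
  apply: combZ_block; rewrite ?size_map // => i.
    rewrite sum_mx0 addr0.
    exact: (combZ_map0 phi hA' i).
  have h := hCD i; rewrite sum_cat ?size_map // in h.
  by congr (_ - (_ + _) \in (0 : {vspace V})%VS): h; apply: eq_bigr => j _; rewrite mxE.
have hB2 : combZ 0 (block_mx B' M 0 (rsubmx CD))
    (w2' ++ [seq F a | a <- x2]) (w1' ++ [seq F a | a <- x1]).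
  apply: (@combZ_block _ _ 0 _ _ _ _ B' M 0 (rsubmx CD)) => [//|//|i|i].
    by rewrite opprD addrA -hM subrr mem0v.
  rewrite sum_mx0 add0r.
  have h := combZ_map0 F hCD i; rewrite map_cat sum_cat ?size_map // big1 ?add0r in h.
    by congr (_ - _ \in (0 : {vspace W})%VS): h; apply: eq_bigr => j _; rewrite mxE.
  move=> j _; rewrite nth_map_lin; suff : [seq phi a | a <- v1']`_j \in lker F.
    rewrite memv_ker => /eqP h1. by apply/eqP; rewrite scaler_eq0; apply/orP; right; exact/eqP.
  rewrite nth_map_lin -phi_ker memv_img //.
  by rewrite -(span_basis bv1') memv_span // mem_nth.
have := bv1; have := bv2; rewrite -!qbasis0 => qv2 qv1.
have sv : size ([seq phi a | a <- v1'] ++ x1) = (size v1' + size x1)%N.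
  by rewrite size_cat size_map.
have swx : size (w1' ++ [seq F a | a <- x1]) = (size w1' + size x1)%N.
  by rewrite size_cat size_map.
move: A B hA hB; rewrite sv swx => A B hA hB.
have [fv cv _] := qbasisP _ _ _ qv1.
have [fw cw _] : [/\ _, _ & _] := qbasisP _ _ _ bw1.
rewrite (combZ_uniq sv fv cv hA hA2) (combZ_uniq swx fw cw hB hB2).
rewrite det_lblock det_ublock.
have : \det (block_mx A' 0 (lsubmx CD) (rsubmx CD)) != 0.
  exact: qbasis_unit qv1 qv2 sv hA2.
rewrite det_lblock mulf_eq0 negb_or => /andP[_ dD].
by rewrite invfM mulrACA [X in _ * X]divff // mulr1.
Qed.

End Contraction.

Lemma complete_basis (R : realType) (V : vectType R) (U : {vspace V}) (s : seq V) :
  free s -> (<< s >> <= U)%VS -> exists s2, basis_of U (s ++ s2).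
Proof.
move=> fs sU; exists (vbasis (U :\: << s >>)%VS); rewrite basisEfree; apply/and3P; split.
- rewrite cat_free fs (basis_free (vbasisP _)) /=; apply/directv_addP.
  by rewrite (span_basis (vbasisP _)) capvC capv_diff.
- by rewrite span_cat (span_basis (vbasisP _)) subv_add sU diffvSl.
- rewrite size_cat size_tuple; move: fs; rewrite /free => /eqP <-.
  rewrite -dimv_disjoint_sum; last by rewrite capvC capv_diff.
  by rewrite addvC addv_diff (addv_idPl sU).
Qed.

(** * The linear algebra of tilde C_IJ *)

Section Ctilde.
Variables (R : realType) (Tu Ty Tx E : vectType R).
Variables (e : 'Hom(Tu, Ty)) (rho : 'Hom(Tu, Tx)) (ds : 'Hom(Ty, E)) (EI EJ : {vspace E}).
Hypothesis e_inj : lker e = 0%VS.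
Hypothesis rho_inj : lker rho = 0%VS.
Hypothesis rho_sur : limg rho = fullv.
Hypothesis EIJ : (EI <= EJ)%VS.
Hypothesis ds_EJ : (limg ds <= EJ)%VS.
Hypothesis ds_EI : forall x, (ds x \in EI) = (x \in limg e).
Hypothesis ds_sum : (limg ds + EI)%VS = EJ.

(** The family spans because ds maps the image of e into EI. Its size is right because the image of
    ds meets EI exactly in the image under ds of [limg e], so that rank and nullity on the whole
    space and on [limg e] can be compared. *)
Lemma normal_frame a v2 w : basis_of fullv a -> basis_of fullv ([seq e x | x <- a] ++ v2) ->
  basis_of EI w -> basis_of EJ (w ++ [seq ds x | x <- v2]).
Proof.
move=> ba bv bw; rewrite basisEdim size_cat size_map span_cat (span_basis bw).
have sa : (<< [seq e x | x <- a] >> = limg e)%VS by rewrite -limg_span (span_basis ba).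
have ee : (ds @: limg e <= EI)%VS.
  by apply/subvP => _ /memv_imgP[x xe ->]; rewrite ds_EI.
apply/andP; split.
  rewrite -ds_sum subv_add addvSl andbT.
  move: bv => /andP[/eqP sv _]; rewrite -limg_span -sv span_cat limgD sa.
  by rewrite subv_add (subv_trans ee (addvSl _ _)) addvSr.
have := size_basis_seq bv; rewrite size_cat size_map (size_basis_seq ba) (size_basis_seq bw) => s2.
have d1 : \dim (limg e) = \dim {: Tu} by rewrite limg_dim_eq // e_inj capv0.
have d2 := limg_ker_dim ds fullv; rewrite capfv in d2.
have ke : (lker ds <= limg e)%VS.
  by apply/subvP => x; rewrite -ds_EI memv_ker => /eqP ->; rewrite mem0v.
have d3 := limg_ker_dim ds (limg e).
rewrite (capv_idPr ke) in d3.
have d4 : (limg ds :&: EI = ds @: limg e)%VS.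
  apply/vspaceP => y; rewrite memv_cap; apply/andP/idP => [[/memv_imgP[x _ ->]]|].
    by rewrite ds_EI => xe; apply: memv_img.
  move=> /memv_imgP[x xe ->]; rewrite ds_EI xe memv_img ?memvf //.
have d5 := dimv_sum_cap (limg ds) EI.
rewrite ds_sum d4 in d5.
have d6 : (\dim (ds @: limg e) <= \dim EI)%N by apply: dimvS.
rewrite -d1 -d3 -d2 -addnA in s2.
rewrite -(leq_add2r (\dim (ds @: limg e))) d5 -(addnI s2).
by rewrite addnC [X in (_ <= X)%N]addnC addnCA addnA addnAC leqnn.
Qed.

Lemma normal_complete a : basis_of fullv a -> exists v2, basis_of fullv ([seq e x | x <- a] ++ v2).
Proof.
move=> ba; apply: complete_basis (subvf _).
by apply: basis_free (limg_basis_of _ ba); rewrite e_inj capv0.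
Qed.

Variable N : {vspace Ty}.
Hypothesis N_sum : (limg e + N)%VS = fullv.
Hypothesis N_cap : (limg e :&: N)%VS = 0%VS.

Let F : 'Hom(Ty, E) := (daddv_pi (ds @: N) EI \o ds)%VF.

Let N_EI : (ds @: N :&: EI = 0)%VS.
Proof.
apply/eqP; rewrite -subv0; apply/subvP => y; rewrite memv_cap => /andP[/memv_imgP[x xN ->]].
rewrite ds_EI => xe; have : x \in (limg e :&: N)%VS by rewrite memv_cap xe.
by rewrite N_cap memv0 => /eqP ->; rewrite linear0 mem0v.
Qed.

Let N_sumE x : ds x \in (ds @: N + EI)%VS.
Proof.
have : x \in (limg e + N)%VS by rewrite N_sum memvf.
case/memv_addP => y ye [z zN ->]; rewrite linearD addrC memv_add ?memv_img //.
by rewrite ds_EI.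
Qed.

Let F_ds x : ds x - F x \in EI.
Proof.
rewrite /F comp_lfunE -{1}(daddv_pi_add N_EI (N_sumE x)) addrC addKr.
exact: memv_pi.
Qed.

Let F_im : limg F = (ds @: N)%VS.
Proof.
apply/eqP; rewrite eqEsubv; apply/andP; split; apply/subvP => y /memv_imgP[x xN ->].
  by rewrite /F comp_lfunE memv_pi.
rewrite -(daddv_pi_id N_EI (memv_img ds xN)).
by have := memv_img F (memvf x); rewrite /F comp_lfunE.
Qed.

Let F_ker : lker F = limg e.
Proof.
apply/vspaceP => x; rewrite -ds_EI memv_ker; apply/eqP/idP => [Fx|dx].
  by have := F_ds x; rewrite Fx subr0.
have : F x \in (ds @: N :&: EI)%VS.
  rewrite memv_cap; apply/andP; split; first by rewrite /F comp_lfunE memv_pi.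
  by rewrite -[F x](subKr (ds x)) rpredB.
by rewrite N_EI memv0 => /eqP.
Qed.

Let F_le : (limg F <= EJ)%VS.
Proof. by rewrite F_im; apply: subv_trans ds_EJ; apply: limgS; apply: subvf. Qed.

Let F_cap : (EI :&: limg F = 0)%VS.
Proof. by rewrite F_im capvC N_EI. Qed.

Let F_sum : (EI + limg F = EJ)%VS.
Proof.
apply/eqP; rewrite eqEsubv subv_add EIJ F_le /= -ds_sum subv_add addvSl andbT F_im addvC.
by apply/subvP => y /memv_imgP[x _ ->].
Qed.

Let w_qbasis w : basis_of EI w -> qbasis_of EJ (limg F) w.
Proof.
by move=> bw; apply/qbasisP; rewrite (span_basis bw) F_cap F_sum (basis_free bw).
Qed.

(** [Ctilde] with abstract vector spaces in place of the tangent and obstruction spaces; at the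
    derivatives of an atlas the two agree by conversion. *)
Definition Ct (c : detline fullv EJ 0) : detline (fullv : {vspace Tx}) EI 0 :=
  linemap (fun v w v' w' =>
      v' = [seq rho a | a <- v] /\
      size w = size w' /\ forall i, w`_i - w'`_i \in limg F)
    (Defs.contraction F fullv e c : detline (fullv : {vspace Tu}) EJ (limg F)).

(** The contraction asks for the images of [v2] under F, whereas the frame contains those under ds.
    The differences lie in EI and are combinations of w, so the replacement is a unipotent change of
    frame; this is where N drops out. *)
Lemma Ct_wedge a v2 w : basis_of fullv a -> basis_of fullv ([seq e x | x <- a] ++ v2) ->
  basis_of EI w ->
  Ct (wedge fullv EJ 0 ([seq e x | x <- a] ++ v2) (w ++ [seq ds x | x <- v2])) =
  wedge fullv EI 0 [seq rho x | x <- a] w.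
Proof.
move=> ba bv bw; have bE := normal_frame ba bv bw.
have e_im : (e @: fullv)%VS = lker F by rewrite F_ker.
have bE' := contraction_frame e_inj e_im F_le ba bv (w_qbasis bw).
have -> : wedge fullv EJ 0 ([seq e x | x <- a] ++ v2) (w ++ [seq ds x | x <- v2]) =
  wedge fullv EJ 0 ([seq e x | x <- a] ++ v2) (w ++ [seq F x | x <- v2]).
  have [C hC] : exists C : 'M[R]_(size v2, size w), combZ 0 C [seq ds x - F x | x <- v2] w.
    apply: combZ_exist => i i2; rewrite addv0 (span_basis bw).
    by rewrite (nth_map 0).
  have s1 : size (w ++ [seq F x | x <- v2]) = (size w + size v2)%N.
    by rewrite size_cat size_map.
  rewrite (@wedge_change _ _ _ fullv EJ 0 ([seq e x | x <- a] ++ v2) (w ++ [seq F x | x <- v2])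
    ([seq e x | x <- a] ++ v2) _ _ _ 1%:M (block_mx 1%:M 0 C 1%:M) _ _ erefl s1).
  - by rewrite det_lblock !det1 mulr1 divr1 scale1r.
  - by rewrite /dframe bv qbasis0.
  - by rewrite /dframe bv qbasis0.
  - exact: combZ1.
  - apply: (@combZ_block _ _ 0 _ _ _ _ 1%:M 0 C 1%:M) => [//|//|i|i].
      by rewrite sum_mx0 addr0; exact: (combZ1 0 w i).
    have h := hC i; rewrite (nth_map 0) // in h.
    have h1 := combZ1 0 [seq F x | x <- v2] i.
    rewrite !(nth_map 0) //; rewrite (nth_map 0) // in h1.
    rewrite memv0 subr_eq0 in h1; rewrite -(eqP h1) opprD addrA addrAC.
    exact: h.
rewrite /Ct contraction_wedge //; last exact: w_qbasis.
apply: linemap_comb; last first.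
  split; last by split=> //; split=> // i; rewrite subrr mem0v.
    by rewrite /dframe ba w_qbasis.
  rewrite /dframe qbasis0 bw andbT -rho_sur; apply: limg_basis_of ba.
  by rewrite rho_inj capv0.
move=> v1 w1 v1' w1' v2_ w2 v2' w2' A B.
case=> /andP[_ qw1] /andP[_ qw1'] [-> [s1 h1]] [/andP[_ qw2] /andP[_ qw2'] [-> [s2 h2]]] hA hB.
exists (size v1), (size w1), A, B; rewrite size_map; split=> //.
  exact: combZ_map0.
(* The relation between the frames of E_I is known modulo the image of F only. It holds exactly
   because all its terms lie in E_I, which meets that image in 0. *)
move=> i; rewrite -F_cap memv_cap.
have sw : size w1 = size w2 by rewrite (size_qbasis qw1) (size_qbasis qw2).
have inEI w3 k : qbasis_of EI 0 w3 -> w3`_k \in EI.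
  move=> q3; have [k3|k3] := ltnP k (size w3); first exact: qbasis_mem q3 k3.
  by rewrite nth_default ?mem0v.
apply/andP; split.
  by apply: rpredB; [exact: inEI|apply: rpred_sum => j _; apply: rpredZ; exact: inEI].
have -> : w2'`_i - \sum_j B i j *: w1'`_j = (w2`_i - \sum_j B i j *: w1`_j)
   - (w2`_i - w2'`_i) + \sum_j B i j *: (w1`_j - w1'`_j).
  have -> : \sum_j B i j *: (w1`_j - w1'`_j) = \sum_j B i j *: w1`_j - \sum_j B i j *: w1'`_j.
    by rewrite -sumrB; apply: eq_bigr => j _; rewrite scalerBr.
  have telesc (x y s s' : E) : x - s' = (y - s) - (y - x) + (s - s').
    by rewrite opprB addrA [y - s + _]addrC addrA !subrK.
  exact: telesc.
apply: rpredD; first by apply: rpredB; [exact: hB|exact: h2].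
by apply: rpred_sum => j _; apply: rpredZ; exact: h1.
Qed.

End Ctilde.

Section LineIso.
Variables (R : realType) (V W V' W' : vectType R).
Variables (K : {vspace V}) (H Z : {vspace W}) (K' : {vspace V'}) (H' Z' : {vspace W'}).

Lemma line_iso (T : detline K H Z -> detline K' H' Z') v w v' w' :
  (forall a x y, T (a *: x + y) = a *: T x + T y) ->
  dframe K H Z v w -> dframe K' H' Z' v' w' -> T (wedge K H Z v w) = wedge K' H' Z' v' w' ->
  lin_iso T.
Proof.
move=> lT f f' e; split=> //.
have T0 : T 0 = 0.
  by have := lT (-1) 0 0; rewrite scaler0 addr0 scaleN1r addNr.
have TZ a x : T (a *: x) = a *: T x by rewrite -[a *: x]addr0 lT T0 addr0.
exists (fun c : detline K' H' Z' => c (v', w') *: wedge K H Z v w) => c.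
  by rewrite {1}(wedgeE c f) TZ e detcoefZ wedge1 // mulr1 -wedgeE.
by rewrite TZ e -wedgeE.
Qed.

Lemma line_eq (T T' : detline K H Z -> detline K' H' Z') v w :
  (forall a x, T (a *: x) = a *: T x) -> (forall a x, T' (a *: x) = a *: T' x) ->
  dframe K H Z v w -> T (wedge K H Z v w) = T' (wedge K H Z v w) -> T =1 T'.
Proof. by move=> h h' f e c; rewrite (wedgeE c f) h h' e. Qed.

End LineIso.

Lemma lin_isoZ (R : realType) (V W : lmodType R) (f : V -> W) a x :
  lin_iso f -> f (a *: x) = a *: f x.
Proof.
case=> lf _; have f0 : f 0 = 0.
  by have := lf (-1) 0 0; rewrite scaler0 addr0 scaleN1r addNr.
by rewrite -[a *: x]addr0 lf f0 addr0.
Qed.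

Lemma lin_iso_inj (R : realType) (V W : lmodType R) (f : V -> W) :
  lin_iso f -> injective f.
Proof. by case=> _ /bij_inj. Qed.

Lemma lin_iso_sur (R : realType) (V W : lmodType R) (f : V -> W) y :
  lin_iso f -> exists x, f x = y.
Proof. by case=> _ [g _ gK]; exists (g y). Qed.

(** * Stabilized kernels and the trivializations of det (ds) *)

Section Stabilization.
Variables (R : realType) (T E : vectType R) (m : nat).
Variables (ds : 'Hom(T, E)) (Q : 'Hom('rV[R]_m, E)) (H : {vspace E}).
Hypothesis Q_inj : lker Q = 0%VS.
Hypothesis Q_H : (limg Q <= H)%VS.
Hypothesis ds_H : (limg ds <= H)%VS.
Hypothesis sum_H : (limg ds + limg Q = H)%VS.

Definition stabilize : 'Hom((T * 'rV[R]_m)%type, E) := linfun (fun p => ds p.1 + Q p.2).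

Lemma stabilizeE p : stabilize p = ds p.1 + Q p.2.
Proof.
have lf : linear (fun p : T * 'rV[R]_m => ds p.1 + Q p.2).
  by move=> a x y /=; rewrite !linearP scalerDr addrACA.
pose f : {linear (T * 'rV[R]_m)%type -> E} := HB.pack (fun p : T * 'rV[R]_m => ds p.1 + Q p.2)
  (GRing.isLinear.Build R _ _ _ _ lf).
exact: (lfunE f p).
Qed.

Definition unit_rows : seq 'rV[R]_m := [seq delta_mx 0 i | i : 'I_m].

Lemma size_unit_rows : size unit_rows = m.
Proof. by rewrite size_map -cardE card_ord. Qed.

Lemma unit_rows_basis : basis_of fullv unit_rows.
Proof.
rewrite basisEdim size_unit_rows dimvf dim_matrix mul1r leqnn andbT.
apply/subvP => x _; rewrite (row_sum_delta x); apply: rpred_sum => i _.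
by apply/rpredZ/memv_span/map_f; rewrite mem_enum.
Qed.

(** Up to the span of [v3], any x has its image under ds in the image of Q, and such a vector is the
    first component of an element of the kernel of the stabilization. Rank and nullity bound the
    size. *)
Lemma stab_frame b v3 : basis_of (lker stabilize) b ->
  basis_of H ([seq Q a | a <- unit_rows] ++ [seq ds a | a <- v3]) ->
  basis_of fullv ([seq p.1 | p <- b] ++ v3).
Proof.
move=> bb bH; rewrite basisEdim; apply/andP; split.
  apply/subvP => x _; have : ds x \in H by apply: subvP ds_H _ (memv_img _ (memvf _)).
  rewrite -(span_basis bH) !span_cat -!limg_span (span_basis unit_rows_basis).
  move=> /memv_addP[_ /memv_imgP[r _ ->] [_ /memv_imgP[t tv ->] e]]; rewrite -[x](subrK t) memv_add //.
  have : (x - t, - r) \in lker stabilize.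
    have {}e : ds (x - t) = Q r.
      by rewrite [LHS]linearB; apply/eqP; rewrite subr_eq; exact/eqP.
    by rewrite memv_ker stabilizeE /= e [Q (- r)]linearN subrr.
  rewrite -(span_basis bb).
  move=> /(memv_img (linfun (@fst T 'rV[R]_m))); rewrite limg_span lfunE.
  have -> : [seq linfun (@fst T 'rV[R]_m) i | i <- b] = [seq p.1 | p <- b].
    by apply: eq_map => p; rewrite lfunE.
  by [].
rewrite size_cat size_map (size_basis_seq bb).
have := size_basis_seq bH; rewrite size_cat (size_map Q) (size_map ds) size_unit_rows => sH.
have := limg_ker_dim stabilize fullv; rewrite capfv.
have -> : limg stabilize = H.
  apply/eqP; rewrite eqEsubv; apply/andP; split.
    apply/subvP => _ /memv_imgP[p _ ->]; rewrite stabilizeE -sum_H.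
    by apply: memv_add; apply: memv_img; apply: memvf.
  rewrite -sum_H; apply/subvP => _ /memv_addP[_ /memv_imgP[x _ ->] [_ /memv_imgP[r _ ->] ->]].
  have -> : ds x + Q r = stabilize (x, r) by rewrite stabilizeE.
  by apply: memv_img; apply: memvf.
rewrite -sH.
have -> : \dim {: (T * 'rV[R]_m)%type} = (\dim {: T} + m)%N.
  rewrite !dimvf -[m in RHS](mul1r m) -(dim_matrix R 1 m).
  done.
move=> e.
by rewrite -(leq_add2r m) -e -addnA [(size v3 + m)%N]addnC.
Qed.

End Stabilization.

Lemma dframe_nil (R : realType) (V W : vectType R) (K : {vspace V}) (v : seq V) (w : seq W) :
  dframe K (0 : {vspace W}) 0 v w = basis_of K v && (w == [::]).
Proof.
rewrite /dframe qbasis0; congr (_ && _); apply/idP/eqP => [bw|->].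
  by apply/nilP; rewrite /nilp (size_basis_seq bw) dimv0.
by rewrite /basis_of span_nil eqxx nil_free.
Qed.

Section StabTriv.
Variables (R : realType) (T E : vectType R) (m : nat).
Variables (ds : 'Hom(T, E)) (Q : 'Hom('rV[R]_m, E)) (H : {vspace E}).
Hypothesis Q_inj : lker Q = 0%VS.
Hypothesis Q_H : (limg Q <= H)%VS.
Hypothesis ds_H : (limg ds <= H)%VS.
Hypothesis sum_H : (limg ds + limg Q)%VS = H.
Local Notation S := (stabilize ds Q).
Local Notation Qs := [seq Q a | a <- @unit_rows R m].
Local Notation P := (0%VS : {vspace 'rV[R]_0}).

(** The preimage under the contraction C_ds of the trivialization of det (ds) at the kernel frame b:
    [v3] completes the frame of the domain and, through ds, that of H. *)
Definition stab_lift v3 (b : seq (T * 'rV[R]_m)) : detline fullv H 0 :=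
  wedge fullv H 0 ([seq p.1 | p <- b] ++ v3) (Qs ++ [seq ds a | a <- v3]).

Definition stab_rel (vb : seq (T * 'rV[R]_m)) (_ : seq 'rV[R]_0) v w :=
  exists vb1 vb2 e1 (e2 : seq 'rV[R]_m),
    [/\ vb = vb1 ++ vb2, v = [seq p.1 | p <- vb1], w = [seq Q e | e <- e1],
        \det (\matrix_(i < m) (e1 ++ e2)`_i) = 1 /\ size (e1 ++ e2) = m &
        [seq Q e | e <- e2] = [seq ds p.1 | p <- vb2]].

Variable v3 : seq T.
Hypothesis bH : basis_of H (Qs ++ [seq ds a | a <- v3]).

Let psi : detline (fullv : {vspace T}) H 0 -> detline (lker ds) H (limg ds) :=
  Defs.contraction ds (lker ds) \1%VF.

Lemma stab_lift_frame b : basis_of (lker S) b ->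
  dframe fullv H 0 ([seq p.1 | p <- b] ++ v3) (Qs ++ [seq ds a | a <- v3]).
Proof. by move=> bb; rewrite /dframe qbasis0 bH (stab_frame ds_H sum_H bb bH). Qed.

Lemma stab_lift_change b b' r : basis_of (lker S) b -> basis_of (lker S) b' ->
  wedge (lker S) P 0 b' [::] = r *: wedge (lker S) P 0 b [::] ->
  stab_lift v3 b' = r *: stab_lift v3 b.
Proof.
move=> bb bb' e.
have f : dframe (lker S) P 0 b [::] by rewrite dframe_nil bb.
have f' : dframe (lker S) P 0 b' [::] by rewrite dframe_nil bb'.
have [A _ hA] : exists2 A : 'M[R]_(size b), A \in unitmx & combZ 0 A b' b.
  by apply: qbasis_change => //; rewrite qbasis0; [exact: bb|exact: bb'].
have := wedge_change f f' erefl erefl hA (@combZ1 _ _ 0 0 [::]).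
rewrite det1 divr1 e => /(wedge_inj f) ->.
have hA1 : combZ 0 A [seq p.1 | p <- b'] [seq p.1 | p <- b] := combZ_map0 (@fst T 'rV[R]_m) hA.
have sb : size b' = size b by rewrite (size_basis_seq bb) (size_basis_seq bb').
have hA2 : combZ 0 (block_mx A 0 0 (1%:M : 'M[R]_(size v3)))
    ([seq p.1 | p <- b'] ++ v3) ([seq p.1 | p <- b] ++ v3).
  apply: (@combZ_block _ _ 0 _ _ _ _ A 0 0 1%:M); rewrite ?size_map // => i.
    by rewrite sum_mx0 addr0; exact: hA1.
  by rewrite sum_mx0 add0r; exact: combZ1.
have sz : size ([seq p.1 | p <- b] ++ v3) = (size b + size v3)%N by rewrite size_cat size_map.
rewrite /stab_lift (wedge_change (stab_lift_frame bb) (stab_lift_frame bb') sz erefl hA2 (combZ1 _ _)).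
by rewrite det_ublock !det1 mulr1 divr1.
Qed.

(** With [vb] split as in the relation, v followed by the first components of [vb2] and by [v3] is
    adapted to the contraction. Its partner in H differs from the one in [stab_lift] only by the
    matrix of [e1 ++ e2], whose determinant is normalized to 1. *)
Lemma stab_rel_lift vb u v w : basis_of (lker S) vb -> basis_of (lker ds) v ->
  qbasis_of H (limg ds) w -> stab_rel vb u v w ->
  psi (stab_lift v3 vb) = wedge (lker ds) H (limg ds) v w.
Proof.
move=> bvb bv bw [vb1 [vb2 [e1 [e2 [evb ev ew [dete sze] eQ]]]]].
have bt : basis_of fullv ([seq p.1 | p <- vb] ++ v3) by apply: stab_frame bvb bH.
have idv : [seq \1%VF a | a <- v] = v by rewrite map_id_in // => x _; rewrite id_lfunE.
have idk : ((\1%VF : 'Hom(T, T)) @: lker ds)%VS = lker ds by rewrite lim1g.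
have inj1 : lker (\1%VF : 'Hom(T, T)) = 0%VS.
  by apply/eqP; rewrite -subv0; apply/subvP => x; rewrite memv_ker id_lfunE memv0.
have e0 : [seq p.1 | p <- vb] ++ v3 = [seq \1%VF a | a <- v] ++ ([seq p.1 | p <- vb2] ++ v3).
  by rewrite idv evb map_cat ev catA.
rewrite e0 in bt.
have e' : w ++ [seq ds a | a <- [seq p.1 | p <- vb2] ++ v3] =
    [seq Q e | e <- e1 ++ e2] ++ [seq ds a | a <- v3].
  by rewrite map_cat ew map_cat eQ -catA -map_comp.
have bc := contraction_frame inj1 idk ds_H bv bt bw.
rewrite -(contraction_wedge inj1 idk ds_H bv bt bw) /psi /stab_lift e0 e'.
rewrite e' in bc.
congr (Defs.contraction _ _ _ _).
have hE : combZ 0 (block_mx (\matrix_(i < m) (e1 ++ e2)`_i) 0 0 (1%:M : 'M[R]_(size v3)))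
   ([seq Q e | e <- e1 ++ e2] ++ [seq ds a | a <- v3]) (Qs ++ [seq ds a | a <- v3]).
  apply: (@combZ_block _ _ 0 _ _ _ _ (\matrix_(i < m) (e1 ++ e2)`_i) 0 0 1%:M).
  - by rewrite size_map size_unit_rows.
  - by rewrite size_map.
  - move=> i; rewrite sum_mx0 addr0.
    have h : combZ 0 (\matrix_(i < m) (e1 ++ e2)`_i) (e1 ++ e2) (@unit_rows R m).
      move=> k; rewrite [X in X - _](row_sum_delta _).
      suff -> : \sum_j (\matrix_(i < m) (e1 ++ e2)`_i) k j *: (@unit_rows R m)`_j =
        \sum_j (e1 ++ e2)`_k 0 j *: delta_mx 0 j by rewrite subrr mem0v.
      apply: eq_bigr => j _; rewrite mxE (nth_map j) ?size_enum_ord // nth_ord_enum.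
      by [].
    exact: (combZ_map0 Q h i).
  - by move=> i; rewrite sum_mx0 add0r; exact: combZ1.
have f1 : dframe fullv H 0 ([seq \1%VF a | a <- v] ++ ([seq p.1 | p <- vb2] ++ v3))
    (Qs ++ [seq ds a | a <- v3]) by rewrite /dframe bt qbasis0.
have f2 : dframe fullv H 0 ([seq \1%VF a | a <- v] ++ ([seq p.1 | p <- vb2] ++ v3))
    ([seq Q e | e <- e1 ++ e2] ++ [seq ds a | a <- v3]) by rewrite /dframe bt qbasis0.
have sz : size (Qs ++ [seq ds a | a <- v3]) = (m + size v3)%N.
  by rewrite size_cat (size_map Q) (size_map ds) size_unit_rows.
rewrite (wedge_change f1 f2 erefl sz (combZ1 _ _) hE).
by rewrite det_ublock !det1 dete mulr1 divr1 scale1r.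
Qed.

End StabTriv.

Lemma span_scale_head (F : fieldType) (V : vectType F) (a : F) (x : V) s :
  a != 0 -> (<< a *: x :: s >> = << x :: s >>)%VS.
Proof.
move=> a0; rewrite !span_cons; congr (_ + _)%VS; apply/eqP; rewrite eqEsubv -!memvE.
by rewrite memvZ ?memv_line //= -{1}[x](scalerK a0) memvZ ?memv_line.
Qed.

Lemma free_scale_head (F : fieldType) (V : vectType F) (a : F) (x : V) s :
  a != 0 -> free (a *: x :: s) = free (x :: s).
Proof. by move=> a0; rewrite /free span_scale_head. Qed.

Section StabTrivExists.
Variables (R : realType) (T E : vectType R) (m : nat).
Variables (ds : 'Hom(T, E)) (Q : 'Hom('rV[R]_m, E)) (H : {vspace E}).
Hypothesis Q_inj : lker Q = 0%VS.
Hypothesis Q_H : (limg Q <= H)%VS.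
Hypothesis ds_H : (limg ds <= H)%VS.
Hypothesis sum_H : (limg ds + limg Q)%VS = H.
Local Notation S := (stabilize ds Q).

Let Q0 r : Q r = 0 -> r = 0.
Proof. by move=> e; apply/eqP; rewrite -memv0 -Q_inj memv_ker e. Qed.

(** The relation has to be inhabited, or [linemap] would return a default value. The kernel of ds,
    with zero second components, is completed to a frame of the stabilized kernel. The second
    components of the added vectors are independent, because a kernel vector whose second component
    vanishes comes from the kernel of ds; [e1] completes them to a basis. *)
Lemma stab_rel_exists : exists vb v w,
  [/\ basis_of (lker S) vb, basis_of (lker ds) v, qbasis_of H (limg ds) w &
      stab_rel ds Q vb [::] v w].
Proof.
pose v : seq T := vbasis (lker ds).
have bv : basis_of (lker ds) v by exact: vbasisP.
pose i1 : 'Hom(T, (T * 'rV[R]_m)%type) := linfun (fun x => (x, 0)).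
have i1E x : i1 x = (x, 0).
  have lf : linear (fun x : T => (x, 0 : 'rV[R]_m)).
    by move=> a y z; congr (_, _); rewrite /= scaler0 addr0.
  pose f : {linear T -> (T * 'rV[R]_m)%type} := HB.pack (fun x : T => (x, 0 : 'rV[R]_m))
    (GRing.isLinear.Build R _ _ _ _ lf).
  exact: (lfunE f x).
pose vb1 := [seq i1 x | x <- v].
have i1_inj : lker i1 = 0%VS.
  apply/eqP; rewrite -subv0; apply/subvP => x; rewrite memv_ker i1E memv0.
  by move=> /eqP[->].
have vb1_basis : basis_of (i1 @: lker ds) vb1 by apply: limg_basis_of bv; rewrite i1_inj capv0.
have [vb2 bvb] : exists vb2, basis_of (lker S) (vb1 ++ vb2).
  apply: complete_basis; first exact: basis_free vb1_basis.
  rewrite (span_basis vb1_basis); apply/subvP => _ /memv_imgP[x xk ->].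
  by rewrite i1E memv_ker stabilizeE /= linear0 addr0 -memv_ker.
(* The sign turns the kernel equation [ds p.1 + Q p.2 = 0] into [Q (n2 p) = ds p.1]. *)
pose n2 : 'Hom((T * 'rV[R]_m)%type, 'rV[R]_m) := (- linfun (@snd T 'rV[R]_m))%R.
have n2E p : n2 p = - p.2 by rewrite /n2 opp_lfunE lfunE.
pose e2 := [seq n2 p | p <- vb2].
have e2Q : [seq Q r | r <- e2] = [seq ds p.1 | p <- vb2].
  rewrite /e2 -map_comp; apply/eq_in_map => p pvb2; rewrite /= n2E linearN.
  have : p \in lker S by rewrite -(span_basis bvb) memv_span // mem_cat pvb2 orbT.
  by rewrite memv_ker stabilizeE addr_eq0 => /eqP ->; rewrite ?linearN.
have span2 : (<< vb2 >> <= lker S)%VS.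
  by rewrite -(span_basis bvb) span_cat addvSr.
have n2_ker p : p \in lker S -> n2 p = 0 -> p \in << vb1 >>%VS.
  rewrite memv_ker stabilizeE n2E (span_basis vb1_basis) => /eqP e /eqP.
  rewrite oppr_eq0 => /eqP p2; rewrite p2 linear0 addr0 in e.
  by case: p p2 e => p1 p2 /= -> e; rewrite -i1E memv_img // memv_ker e.
have f2 : free e2.
  have : basis_of (n2 @: << vb2 >>) e2; last exact: basis_free.
  move: (basis_free bvb); rewrite cat_free => /and3P[_ fvb2 /directv_addP d].
  apply: limg_basis_of; last by rewrite /basis_of eqxx.
  apply/eqP; rewrite -subv0 -d; apply/subvP => p; rewrite !memv_cap memv_ker => /andP[p2 /eqP n2p].
  by rewrite p2 andbT n2_ker // (subvP span2).
have [e1 be] : exists e1, basis_of fullv (e2 ++ e1) by apply: complete_basis (subvf _).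
have {}be : basis_of fullv (e1 ++ e2).
  by move: be; rewrite /basis_of /free !span_cat addvC !size_cat addnC.
have qw : qbasis_of H (limg ds) [seq Q e | e <- e1].
  move: (basis_free be); rewrite cat_free => /and3P[fe1 _ /directv_addP d].
  apply/qbasisP; rewrite -limg_span; split.
  - have : basis_of (Q @: << e1 >>) [seq Q a | a <- e1]; last exact: basis_free.
    by apply: limg_basis_of; rewrite ?Q_inj ?capv0 // /basis_of eqxx.
  - apply/eqP; rewrite -subv0; apply/subvP => y; rewrite memv_cap.
    move=> /andP[/memv_imgP[r re1 ->] /memv_imgP[x _ e]].
    have {}e : ds x = Q r by exact: esym e.
    have : (x, - r) \in lker S by rewrite memv_ker stabilizeE /= e [Q (- r)]linearN subrr.
    move=> /(memv_img n2); rewrite -(span_basis bvb) span_cat limgD.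
    have -> : (n2 @: << vb1 >> = 0)%VS.
      apply/eqP; rewrite -lkerE (span_basis vb1_basis); apply/subvP => _ /memv_imgP[z _ ->].
      by rewrite i1E memv_ker n2E oppr0.
    rewrite add0v limg_span n2E opprK => re2.
    have : r \in (<< e1 >> :&: << e2 >>)%VS by rewrite memv_cap re1.
    by rewrite d memv0 => /eqP ->; rewrite linear0 mem0v.
  - apply/eqP; rewrite eqEsubv subv_add ds_H andbT (subv_trans _ Q_H) ?limgS ?subvf //=.
    rewrite -{1}sum_H subv_add addvSr /=.
    have -> : limg Q = (Q @: << e1 >> + Q @: << e2 >>)%VS.
      by rewrite -limgD -span_cat (span_basis be).
    rewrite subv_add addvSl /= limg_span e2Q.
    apply: subv_trans (addvSr _ _); apply/span_subvP => _ /mapP[p _ ->].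
    by rewrite memv_img // memvf.
pose D := \det (\matrix_(i < m) (e1 ++ e2)`_i).
have sz : size (e1 ++ e2) = m by rewrite (size_basis_seq be) dimvf dim_matrix mul1r.
have combM s : size s = m -> combZ 0 (\matrix_(i < m) s`_i) s (@unit_rows R m).
  move=> _ k; rewrite [X in X - _](row_sum_delta _).
  suff -> : \sum_j (\matrix_(i < m) s`_i) k j *: (@unit_rows R m)`_j =
    \sum_j s`_k 0 j *: delta_mx 0 j by rewrite subrr mem0v.
  by apply: eq_bigr => j _; rewrite mxE (nth_map j) ?size_enum_ord // nth_ord_enum.
have D0 : D != 0.
  have := combM _ sz; apply: (@qbasis_unit _ _ fullv); rewrite ?qbasis0 //.
    exact: unit_rows_basis.
  exact: size_unit_rows.
have Di : D^-1 != 0 by rewrite invr_neq0.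
have detS x s : e1 ++ e2 = x :: s -> \det (\matrix_(i < m) (D^-1 *: x :: s)`_i) = 1.
  move=> es; have m0 : (0 < m)%N by rewrite -sz es.
  have -> : \matrix_(i < m) (D^-1 *: x :: s)`_i =
    diag_mx (\row_i (if i == Ordinal m0 then D^-1 else 1)) *m \matrix_(i < m) (e1 ++ e2)`_i.
    apply/matrixP => i j; rewrite mul_diag_mx !mxE es -val_eqE.
    by case: i => -[|k] ki /=; rewrite ?mxE ?mul1r.
  rewrite det_mulmx det_diag (bigD1 (Ordinal m0)) //= mxE eqxx big1 ?mulr1 ?mulVf //.
  by move=> i /negPf ni; rewrite mxE ni.
(* The determinant becomes 1 by rescaling the head of [e1] if there is one, and otherwise the head
   of [vb2] together with that of [e2]. If both lists are empty then m = 0 and the determinant is 1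
   already. *)
case: e1 => [|x e1] in be qw D sz D0 Di detS *; last first.
  exists (vb1 ++ vb2), v, [seq Q e | e <- D^-1 *: x :: e1]; split=> //.
    move: qw; rewrite /qbasis_of /= linearZ.
    by rewrite free_scale_head // span_scale_head.
  exists vb1, vb2, (D^-1 *: x :: e1), e2; split=> //.
    by rewrite /vb1 -map_comp map_id_in // => y _; rewrite /= i1E.
  by split; [exact: detS | exact: sz].
case: vb2 => [|p vb2] in e2 e2Q span2 f2 bvb be qw D sz D0 Di detS *.
  exists vb1, v, [::]; split=> //.
  - by move: bvb; rewrite cats0.
  - exists vb1, [::], [::], [::]; split=> //; rewrite ?cats0 //.
      by rewrite /vb1 -map_comp map_id_in // => y _; rewrite /= i1E.
    by split=> //; move: sz => /= sz; subst m; rewrite det_mx00.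
exists (vb1 ++ (D^-1 *: p :: vb2)), v, [::]; split=> //.
  move: bvb; rewrite /basis_of !span_cat span_scale_head // !cat_free /=.
  by rewrite free_scale_head // span_scale_head.
exists vb1, (D^-1 *: p :: vb2), [::], (D^-1 *: n2 p :: [seq n2 p | p <- vb2]); split=> //.
- by rewrite /vb1 -map_comp map_id_in // => y _; rewrite /= i1E.
- by split; [exact: (detS (n2 p)) | exact: sz].
- move: e2Q => [e2p e2Q] /=; congr (_ :: _); last exact: e2Q.
  have -> : ds (D^-1 *: p.1) = D^-1 *: ds p.1 by rewrite linearZ.
  rewrite [LHS]linearZ.
  by congr (_ *: _); exact: e2p.
Qed.

Definition stab_map (c : detline (lker S) (0%VS : {vspace 'rV[R]_0}) 0) :
  detline (lker ds) H (limg ds) := linemap (stab_rel ds Q) c.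

(** This ties the smooth structure of det (ds) to that of det K: a local frame of the former is the
    contraction of an explicit frame of the latter. An arbitrary b need not split as the relation
    demands; it is compared by a scalar with a frame that does. *)
Lemma stab_map_wedge v3 b :
  basis_of H ([seq Q a | a <- @unit_rows R m] ++ [seq ds a | a <- v3]) ->
  basis_of (lker S) b ->
  stab_map (wedge (lker S) 0 0 b [::]) =
  Defs.contraction ds (lker ds) \1%VF (stab_lift ds Q H v3 b).
Proof.
move=> bH bb; have [vb [v [w [bvb bv bw r]]]] := stab_rel_exists.
have f : dframe (lker S) (0%VS : {vspace 'rV[R]_0}) 0 b [::] by rewrite dframe_nil bb.
have f' : dframe (lker S) (0%VS : {vspace 'rV[R]_0}) 0 vb [::] by rewrite dframe_nil bvb.
have e : stab_map (wedge (lker S) 0 0 vb [::]) =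
    Defs.contraction ds (lker ds) \1%VF (stab_lift ds Q H v3 vb).
  rewrite (stab_rel_lift ds_H sum_H bH bvb bv bw r).
  apply: linemap_wedge; last by split=> //; rewrite /dframe bv.
  move=> v1 w1 v1' w1' v2 w2 v2' w2' [f1 /andP[b1 q1] r1] [f2 /andP[b2 q2] r2].
  have [s _ es] := wedge_ratio f1 f2; exists s => //.
  move: (f1) (f2); rewrite !dframe_nil => /andP[bv1 /eqP w1n] /andP[bv2 /eqP w2n].
  subst w1 w2.
  rewrite -(stab_rel_lift ds_H sum_H bH bv1 b1 q1 r1) -(stab_rel_lift ds_H sum_H bH bv2 b2 q2 r2).
  by rewrite (stab_lift_change ds_H sum_H bH bv1 bv2 es) /Defs.contraction linemapZ.
have [s s0 es] := wedge_ratio f f'.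
have := stab_lift_change ds_H sum_H bH bb bvb es => el.
have : s *: stab_map (wedge (lker S) 0 0 b [::]) =
    s *: Defs.contraction ds (lker ds) \1%VF (stab_lift ds Q H v3 b).
  rewrite /stab_map /Defs.contraction -!linemapZ -es.
  by move: e; rewrite /Defs.contraction el.
by apply: scalerI.
Qed.

End StabTrivExists.

(** * Smooth functions, derivatives and bundles on charted spaces *)

Section SmoothGerms.
Variable R : realType.
Implicit Types M N : charted R.

Lemma nearMS M (x : M) (P Q : M -> Prop) :
  (forall y, P y -> Q y) -> nearM x P -> nearM x Q.
Proof. by move=> PQ; rewrite /nearM; apply: filterS => p h /h; exact: PQ. Qed.

Lemma nearMI M (x : M) (P Q : M -> Prop) :
  nearM x P -> nearM x Q -> nearM x (fun y => P y /\ Q y).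
Proof.
rewrite /nearM => hP hQ; apply: filterS2 hP hQ => p hp hq mp.
by split; [exact: hp|exact: hq].
Qed.

Lemma nearMS2 M (x : M) (P Q S : M -> Prop) :
  (forall y, P y -> Q y -> S y) -> nearM x P -> nearM x Q -> nearM x S.
Proof. by move=> h hP hQ; apply: nearMS (nearMI hP hQ) => y []; apply: h. Qed.

Lemma nearM_self M (x : M) (P : M -> Prop) : cmodel (chart x x) -> cinv x (chart x x) = x ->
  nearM x P -> P x.
Proof. by move=> mx cx /nbhs_singleton /(_ mx); rewrite cx. Qed.

Lemma nearM_forall M (x : M) (P : M -> Prop) : (forall y, P y) -> nearM x P.
Proof. by move=> h; rewrite /nearM; apply: filterE => p _. Qed.

(** The scalar case of [smoothv]: the extension G lives on an open set of coordinate vectors and is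
    compared with f on the model set only, so boundary points are allowed. *)
Definition smR M (f : M -> R) (x : M) : Prop :=
  exists U (G : 'rV[R]_(cdim M) -> R), [/\ open U, U (chart x x), smo U G &
    forall q, U q -> cmodel q -> G q = f (cinv x q)].

Lemma smo_sub n (V : normedModType R) (U U' : set 'rV[R]_n) (f : 'rV[R]_n -> V) :
  U' `<=` U -> smo U f -> smo U' f.
Proof. by move=> s h vs p /s; apply: h. Qed.

Lemma smR_cst M (c : R) (x : M) : smR (fun=> c) x.
Proof.
exists setT, (fun=> c); split=> //; first exact: openT.
by apply/smoP => k; apply: smk_cst.
Qed.

Lemma smR_op2 (op : R -> R -> R) M (f g : M -> R) x :
  (forall n (U : set 'rV[R]_n) k f g, open U -> smk k U f -> smk k U g ->
     smk k U (fun p => op (f p) (g p))) ->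
  smR f x -> smR g x -> smR (fun y => op (f y) (g y)) x.
Proof.
move=> h [U [F [oU Ox sF eF]]] [U' [G [oU' U'x sG eG]]].
exists (U `&` U'), (fun p => op (F p) (G p)); split.
- exact: openI.
- by [].
- apply/smoP => k; apply: h; first exact: openI.
    by have /smoP := smo_sub (@subIsetl _ U U') sF; apply.
  by have /smoP := smo_sub (@subIsetr _ U U') sG; apply.
- by move=> q [Oq U'q] mq; rewrite eF // eG.
Qed.

Lemma smR_add M (f g : M -> R) x : smR f x -> smR g x -> smR (fun y => f y + g y) x.
Proof. by apply: smR_op2 => n U k f1 g1 oU; apply: smk_add. Qed.

Lemma smR_mul M (f g : M -> R) x : smR f x -> smR g x -> smR (fun y => f y * g y) x.
Proof. by apply: smR_op2 => n U k f1 g1 oU; apply: smk_mul. Qed.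

Lemma smR_sum M (I : Type) (r : seq I) (P : pred I) (f : I -> M -> R) x :
  (forall i, P i -> smR (f i) x) -> smR (fun y => \sum_(i <- r | P i) f i y) x.
Proof.
move=> sf; elim: r => [|i r IH].
  have := smR_cst (0 : R) x; congr (smR _ _); apply/funext => y.
  by rewrite big_nil.
case Pi: (P i).
  have := smR_add (sf i Pi) IH; congr (smR _ _); apply/funext => y.
  by rewrite big_cons Pi.
by move: IH; congr (smR _ _); apply/funext => y; rewrite big_cons Pi.
Qed.

Lemma smR_prod M (I : Type) (r : seq I) (P : pred I) (f : I -> M -> R) x :
  (forall i, P i -> smR (f i) x) -> smR (fun y => \prod_(i <- r | P i) f i y) x.
Proof.
move=> sf; elim: r => [|i r IH].
  have := smR_cst (1 : R) x; congr (smR _ _); apply/funext => y.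
  by rewrite big_nil.
case Pi: (P i).
  have := smR_mul (sf i Pi) IH; congr (smR _ _); apply/funext => y.
  by rewrite big_cons Pi.
by move: IH; congr (smR _ _); apply/funext => y; rewrite big_cons Pi.
Qed.

Lemma smR_det M n (A : M -> 'M[R]_n) x :
  (forall i j, smR (fun y => A y i j) x) -> smR (fun y => \det (A y)) x.
Proof.
move=> sA; apply: smR_sum => s _; apply: smR_mul; first exact: smR_cst.
exact: smR_prod.
Qed.

Lemma smR_ext M (f g : M -> R) x : nearM x (fun y => f y = g y) -> smR f x -> smR g x.
Proof.
move=> /nbhs_interior fg [U [F [oU Ox sF eF]]].
pose U' := interior [set p | cmodel p -> f (cinv x p) = g (cinv x p)].
have oU' : open U' by exact: open_interior.
exists (U `&` U'), F; split.
- exact: openI.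
- by split=> //; exact: nbhs_singleton fg.
- exact: smo_sub sF.
- by move=> q [Oq U'q] mq; rewrite eF //; apply: (interior_subset U'q).
Qed.

Lemma smR_inv M (f : M -> R) x : cmodel (chart x x) -> cinv x (chart x x) = x ->
  f x != 0 -> smR f x -> smR (fun y => (f y)^-1) x.
Proof.
move=> mx cx fx [U [F [oU Ox sF eF]]].
pose U' := U `&` [set q | F q != 0].
have oU' : open U'.
  rewrite openE => q [Oq Fq]; apply: filterI; first exact: open_near oU Oq.
  have cF : {for q, continuous F} by apply: differentiable_continuous; exact: (sF [::]).
  have := cF [set y : R | y != 0]; apply.
  by apply: open_nbhs_nbhs; split=> //; exact: open_neq.
exists U', (fun p => (F p)^-1); split=> //.
- by split=> //=; rewrite eF // cx.
- apply/smoP => k; apply: smk_inv => //; first by move=> p [].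
  by have /smoP := smo_sub (@subIsetl _ U [set q | F q != 0]) sF; apply.
- by move=> q [Oq _] mq; rewrite eF.
Qed.

Lemma lin_vcoord (W : vectType R) (l : {linear W -> R^o}) w :
  l w = \sum_i (vcoord w) 0 i * l ((vbasis {: W})`_i).
Proof. by rewrite -{1}(vcoordK w) linear_sum; apply: eq_bigr => i _; rewrite linearZ. Qed.

Lemma smoothvP M (W : vectType R) (f : M -> W) x :
  smoothv f x <-> forall i, smR (fun y => vcoord (f y) 0 i) x.
Proof.
split=> [[U [G [oU Ox sG eG]]] i|h].
  exists U, (fun p => entry i (G p)); split=> //.
    apply/smoP => k; apply: (@smk_lin _ k _ _ R^o U G (@entry R _ i)) => //.
      exact: (@linear_rV_continuous R _ R^o (@entry R _ i)).
    by move/smoP: sG.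
  by move=> q Oq mq; rewrite /entry eG.
have [OG hOG] : exists OG : 'I_(\dim {: W}) -> set 'rV[R]_(cdim M) * ('rV[R]_(cdim M) -> R),
    forall i, [/\ open (OG i).1, (OG i).1 (chart x x), smo (OG i).1 (OG i).2 &
    forall q, (OG i).1 q -> cmodel q -> (OG i).2 q = vcoord (f (cinv x q)) 0 i].
  have h' i : exists og : set 'rV[R]_(cdim M) * ('rV[R]_(cdim M) -> R),
      [/\ open og.1, og.1 (chart x x), smo og.1 og.2 &
      forall q, og.1 q -> cmodel q -> og.2 q = vcoord (f (cinv x q)) 0 i].
    by have [U [G hG]] := h i; exists (U, G).
  by exists (fun i => sval (cid (h' i))) => i; exact: (svalP (cid (h' i))).
pose U := \bigcap_(i in [set: 'I_(\dim {: W})]) (OG i).1.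
have oU : open U.
  rewrite openE => q Oq.
  have : \forall q' \near q, forall i, (OG i).1 q'.
    apply: (@filter_forall _ _ (fun i => (OG i).1) (nbhs q) (nbhs_filter q)) => i.
    have [oi _ _ _] := hOG i.
    by apply: open_nbhs_nbhs; split=> //; exact: (Oq i Logic.I).
  by apply: filterS => q' h' i _.
exists U, (fun p => \sum_i (OG i).2 p *: delta_mx 0 i); split=> //.
- by move=> i _; have [] := hOG i.
- apply/smoP => k; apply: smk_sum => // i _.
  have [_ _ sG _] := hOG i.
  apply: smk_scalel => //.
  have sU : U `<=` (OG i).1 by move=> q; apply.
  by move/smoP: (smo_sub sU sG).
- move=> q Oq mq; rewrite [RHS]row_sum_delta; apply: eq_bigr => i _.
  by have [_ _ _ ->] := hOG i => //; exact: Oq.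
Qed.

Lemma smoothv_lin M (W W' : vectType R) (f : M -> W) (l : {linear W -> W'}) x :
  smoothv f x -> smoothv (l \o f) x.
Proof.
move=> /smoothvP h; apply/smoothvP => i.
have e : (fun y => vcoord ((l \o f) y) 0 i) =
    (fun y => \sum_j vcoord (f y) 0 j * vcoord (l ((vbasis {: W})`_j)) 0 i).
  apply/funext => y /=; rewrite -{1}(vcoordK (f y)) !linear_sum summxE.
  by apply: eq_bigr => j _; rewrite !linearZ mxE.
by rewrite e; apply: smR_sum => j _; apply: smR_mul => //; exact: smR_cst.
Qed.

Lemma smoothv_ext M (W : vectType R) (f g : M -> W) x :
  nearM x (fun y => f y = g y) -> smoothv f x -> smoothv g x.
Proof.
move=> fg /smoothvP h; apply/smoothvP => i; apply: smR_ext (h i).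
by apply: nearMS fg => y ->.
Qed.

Lemma smoothv_cst M (W : vectType R) (c : W) (x : M) : smoothv (fun=> c) x.
Proof. by apply/smoothvP => i; exact: smR_cst. Qed.

Lemma smoothv_scale M (W : vectType R) (k : M -> R) (f : M -> W) x :
  smR k x -> smoothv f x -> smoothv (fun y => k y *: f y) x.
Proof.
move=> sk /smoothvP h; apply/smoothvP => i.
have -> : (fun y => vcoord (k y *: f y) 0 i) = (fun y => k y * vcoord (f y) 0 i).
  by apply/funext => y; rewrite linearZ mxE.
exact: smR_mul.
Qed.

Lemma smoothv_add M (W : vectType R) (f g : M -> W) x :
  smoothv f x -> smoothv g x -> smoothv (fun y => f y + g y) x.
Proof.
move=> /smoothvP hf /smoothvP hg; apply/smoothvP => i.
have -> : (fun y => vcoord (f y + g y) 0 i) = (fun y => vcoord (f y) 0 i + vcoord (g y) 0 i).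
  by apply/funext => y; rewrite linearD mxE.
exact: smR_add.
Qed.

Lemma smoothv_sum M (W : vectType R) (I : Type) (r : seq I) (f : I -> M -> W) x :
  (forall i, smoothv (f i) x) -> smoothv (fun y => \sum_(i <- r) f i y) x.
Proof.
move=> sf; elim: r => [|i r IH].
  have := smoothv_cst (0 : W) x; congr (smoothv _ _); apply/funext => y.
  by rewrite big_nil.
have := smoothv_add (sf i) IH; congr (smoothv _ _); apply/funext => y.
by rewrite big_cons.
Qed.

Lemma smoothv_smR M (W : vectType R) (f : M -> W) (l : {linear W -> R^o}) x :
  smoothv f x -> smR (fun y => l (f y)) x.
Proof.
move=> /smoothvP h.
have -> : (fun y => l (f y)) = (fun y => \sum_i (vcoord (f y)) 0 i * l ((vbasis {: W})`_i)).
  by apply/funext => y; rewrite lin_vcoord.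
by apply: smR_sum => i _; apply: smR_mul => //; exact: smR_cst.
Qed.

Lemma smoothv_entry M n (f : M -> 'rV[R]_n) x i : smoothv f x -> smR (fun y => f y 0 i) x.
Proof. exact: (@smoothv_smR M _ f (@entry R n i)). Qed.

Lemma smoothv_rows M n (f : M -> 'rV[R]_n) x :
  (forall i, smR (fun y => f y 0 i) x) -> smoothv f x.
Proof.
move=> h.
have -> : f = (fun y => \sum_i f y 0 i *: delta_mx 0 i).
  by apply/funext => y; rewrite -row_sum_delta.
by apply: smoothv_sum => i; apply: smoothv_scale => //; exact: smoothv_cst.
Qed.

End SmoothGerms.

Section Calculus.
Variable R : realType.
Implicit Types M N S : charted R.

(** Conditions at a single point. A collar satisfies them over its parameter interval although it is
    not a manifold in the sense of [is_manifold_with_boundary], whose models are whole spaces and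
    half-spaces. The same reason stands behind [mfd_at]. *)
Record good M (x : M) : Prop := {
  gd_solid : solid (@cmodel R M);
  gd_model : cmodel (chart x x);
  gd_inv : cinv x (chart x x) = x;
  gd_chart : \forall p \near chart x x, cmodel p -> chart x (cinv x p) = p }.

Lemma nearM_near M (x : M) (P : M -> Prop) :
  nearM x P -> \forall p \near chart x x, cmodel p -> P (cinv x p).
Proof. by []. Qed.

Lemma near_self M (x : M) (P : M -> Prop) : good x -> nearM x P -> P x.
Proof. by move=> g; apply: nearM_self; [exact: gd_model|exact: gd_inv]. Qed.

Lemma good_coord M (x : M) : good x ->
  nearM x (fun y => cmodel (chart x y) /\ cinv x (chart x y) = y).
Proof. by move=> g; rewrite /nearM; apply: filterS (gd_chart g) => p h mp; rewrite h. Qed.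

Lemma good_near_chart M (x : M) (P : 'rV[R]_(cdim M) -> Prop) : good x ->
  (\forall p \near chart x x, cmodel p -> P p) -> nearM x (fun y => P (chart x y)).
Proof.
by move=> g hP; rewrite /nearM; apply: filterS2 (gd_chart g) hP => p h hp mp; rewrite h //; exact: hp.
Qed.

Definition isd M (W : vectType R) (f : M -> W) (x : M) (L : 'Hom('rV[R]_(cdim M), W)) :=
  wd (@cmodel R M) (f \o cinv x) (chart x x) L.

Lemma dv_isd M (W : vectType R) (f : M -> W) x L : good x -> isd f x L -> dv f x = L.
Proof.
move=> g h; rewrite /dv; case: xgetP => [L' _ h'|/(_ L)[]].
  apply: wd_unique (gd_solid g) (gd_model g) _ h => e /h'.
  by apply: filterS => v hv mv; rewrite /= (gd_inv g); exact: hv.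
by move=> e /h; apply: filterS => v hv /hv; rewrite /= (gd_inv g).
Qed.

Lemma isd_ext M (W : vectType R) (f f' : M -> W) x L : good x ->
  nearM x (fun y => f y = f' y) -> isd f x L -> isd f' x L.
Proof. by move=> g e; apply: wd_ext => //; exact: gd_model. Qed.

Lemma smooth_within_wd n m (H : set 'rV[R]_n) (F : 'rV[R]_n -> 'rV[R]_m) p : H p ->
  smooth_within H F p -> exists L, wd H F p L.
Proof.
move=> Hp [U [G [oU Up sG eG]]]; exists (linfun ('d G p)).
apply: (@wd_ext _ _ _ _ G) => //; last by apply: wd_diff; exact: (sG [::]).
by have := open_near oU Up; apply: filterS => q Uq; exact: eG.
Qed.

Lemma smoothv_isd M (W : vectType R) (f : M -> W) x : good x -> smoothv f x -> isd f x (dv f x).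
Proof.
move=> g sf; suff [L hL] : exists L, isd f x L by rewrite (dv_isd g hL).
have [L hL] := smooth_within_wd (gd_model g) sf.
exists (linfun (@ofcoord R W) \o L)%VF.
have := wd_lin (linfun (@ofcoord R W)) hL; apply: wd_ext; last exact: gd_model.
by apply: filterE => q _ /=; rewrite lfunE /= vcoordK.
Qed.

Lemma isd_chart M (x : M) : good x -> isd (chart x) x \1%VF.
Proof.
move=> g; apply: (@wd_ext _ _ _ _ id); last exact: wd_id; last exact: gd_model.
by apply: filterS (gd_chart g) => p h /h /= ->.
Qed.

(** Continuity at x phrased with [nearM], so that on a collar only points over the parameter
    interval are tested. *)
Definition ncont M N (f : M -> N) (x : M) :=
  forall P : N -> Prop, nearM (f x) P -> nearM x (fun y => P (f y)).

Lemma ncont_id M (x : M) : ncont id x. Proof. by []. Qed.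

Lemma ncont_comp M N S (f : M -> N) (g : N -> S) x : ncont f x -> ncont g (f x) -> ncont (g \o f) x.
Proof. by move=> cf cg P /cg /cf. Qed.

Lemma isd_comp M N (W : vectType R) (f : M -> N) (g : N -> W) x D L :
  good x -> good (f x) -> ncont f x -> isd (chart (f x) \o f) x D -> isd g (f x) L ->
  isd (g \o f) x (L \o D)%VF.
Proof.
move=> gx gf cf hD hL.
have e : (chart (f x) \o f \o cinv x) (chart x x) = chart (f x) (f x) by rewrite /= (gd_inv gx).
have := cf _ (good_coord gf) => hc.
apply: (@wd_ext _ _ _ _ ((g \o cinv (f x)) \o (chart (f x) \o f \o cinv x))).
- by apply: filterS (nearM_near hc) => q h /h[_] /= ->.
- exact: gd_model.
- apply: wd_comp hD _ _; first by rewrite e; exact: hL.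
  by apply: filterS (nearM_near hc) => q h /h[].
Qed.

Lemma isd_lin M (W W' : vectType R) (f : M -> W) (l : 'Hom(W, W')) x L :
  isd f x L -> isd (l \o f) x (l \o L)%VF.
Proof. exact: wd_lin. Qed.

Lemma dm_id M (x : M) : good x -> dm id x = \1%VF.
Proof. by move=> g; apply: dv_isd => //; exact: isd_chart. Qed.

Record mfd_at M (x : M) : Prop := {
  ma_good : nearM x (@good M);
  ma_chart : nearM x (fun y => smoothv (chart x) y);
  ma_back : nearM x (fun y => smooth_within (@cmodel R M) (chart y \o cinv x) (chart x y));
  ma_near : forall P : M -> Prop, nearM x P -> nearM x (fun y => nearM y P) }.

(** Near y the transition [chart y \o cinv x] undoes [chart x], so the chain rule provides a left
    inverse of the derivative of [chart x]. *)
Lemma chart_inj M (x : M) : good x -> mfd_at x -> nearM x (fun y => lker (dv (chart x) y) = 0%VS).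
Proof.
move=> gx [mg mc mb mn].
apply: nearMS2 (nearMI mg mc) (nearMI mb (nearMI (good_coord gx) (mn _ (good_coord gx)))).
move=> y [gy cy] [by_ [[my iy] ny]].
have [L hL] := smooth_within_wd my by_.
have hT := smoothv_isd gy cy.
have : isd (chart y) y (L \o dv (chart x) y)%VF.
  apply: (@wd_ext _ _ _ _ ((chart y \o cinv x) \o (chart x \o cinv y))).
  - by apply: filterS (nearM_near ny) => q h /h[_] /= ->.
  - exact: gd_model.
  - apply: (wd_comp (H' := @cmodel R M) hT); first by rewrite /= (gd_inv gy).
    by apply: filterS (nearM_near ny) => q h /h[].
move=> /(dv_isd gy); rewrite (dv_isd gy (isd_chart gy)) => e.
apply/eqP; rewrite -subv0; apply/subvP => v; rewrite memv_ker memv0 => /eqP Tv.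
have := congr1 (fun h : 'Hom(_, _) => h v) e.
by rewrite id_lfunE comp_lfunE Tv linear0 => ->.
Qed.

(* dv f y factors through the derivative of a fixed chart, with a first factor
   that depends smoothly on y. *)
Lemma smoothv_near M (W : vectType R) (f : M -> W) (x : M) :
  good x -> mfd_at x -> smoothv f x ->
  exists D : M -> 'Hom('rV[R]_(cdim M), W),
    nearM x (fun y => isd f y (D y \o dv (chart x) y)%VF) /\
    forall c, smoothv (fun y => D y c) x.
Proof.
move=> gx [mg mc mb mn] [U [G [oU Ux sG eG]]].
pose U' := U `&` interior [set p | cmodel p -> chart x (cinv x p) = p].
have oU' : open U' by apply: openI => //; exact: open_interior.
have U'x : U' (chart x x) by split=> //; exact: (nbhs_singleton (nbhs_interior (gd_chart gx))).
pose D y := (linfun (@ofcoord R W) \o linfun ('d G (chart x y)))%VF.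
have nU : nearM x (fun y => U (chart x y)).
  apply: (@good_near_chart _ _ U) => //.
  by apply: filterS (open_near oU Ux) => p Up _.
exists D; split.
  have nP := nearMI nU (good_coord gx).
  apply: nearMS2 (nearMI mg mc) (nearMI nP (mn _ nP)) => y [gy cy] [[Uy [my iy]] ny].
  have hT := smoothv_isd gy cy.
  have dG : differentiable G (chart x y) by exact: (sG [::]).
  have : wd (@cmodel R M) (G \o (chart x \o cinv y)) (chart y y)
      (linfun ('d G (chart x y)) \o dv (chart x) y)%VF.
    apply: (wd_comp (H' := setT) hT); last by apply: filterE.
    by rewrite /= (gd_inv gy); exact: wd_diff.
  move=> /(wd_lin (linfun (@ofcoord R W))); rewrite comp_lfunA.
  apply: wd_ext; last exact: gd_model.
  by apply: filterS (nearM_near ny) => q h /h[Uq [mq iq]] /=; rewrite eG //= iq lfunE /= vcoordK.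
move=> c.
have s1 : smoothv (fun y => 'D_c G (chart x y)) x.
  apply: smoothv_rows => i; exists U', (fun p => entry i ('D_c G p)); split; [exact: oU'|exact: U'x| |].
    apply/smoP => k; apply: (@smk_lin _ k _ _ R^o U' ('D_c G) (@entry R _ i)) => //.
      exact: (@linear_rV_continuous R _ R^o (@entry R _ i)).
    have /smoP/(_ k.+1)[_] := sG; move=> /(_ c).
    by apply: smk_sub => q [].
  by move=> q [_ /interior_subset hq] mq; rewrite /entry hq.
have := smoothv_lin (@ofcoord R W) s1; apply: smoothv_ext.
apply: nearMS nU => y Uy; rewrite /D comp_lfunE !lfunE /=; congr ofcoord.
by rewrite deriveE //; exact: (sG [::]).
Qed.

Lemma smR_comp M N (r : M -> N) (f : N -> R) (u : M) :
  good u -> good (r u) -> ncont r u -> smoothv (chart (r u) \o r) u ->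
  smR f (r u) -> smR (f \o r) u.
Proof.
move=> gu gr cr [U [K [oU Uu sK eK]]] [U' [F [oU' U'r sF eF]]].
pose K' := @ofcoord R 'rV[R]_(cdim N) \o K.
have sK' k : smk k U K'.
  by apply: smk_lin => //; [exact: linear_rV_continuous|move/smoP: sK].
have eK' q : U q -> cmodel q -> K' q = chart (r u) (r (cinv u q)).
  by move=> Uq mq; rewrite /K' /= eK //= vcoordK.
have nr := cr _ (good_coord gr).
pose P := interior [set q | cmodel q -> cmodel (chart (r u) (r (cinv u q))) /\
   cinv (r u) (chart (r u) (r (cinv u q))) = r (cinv u q)].
pose O := (U `&` K' @^-1` U') `&` P.
have cK q : U q -> {for q, continuous K'}.
  by move=> Uq; apply: differentiable_continuous; exact: smk_diff (sK' 0%N) Uq.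
have oO : open O.
  apply: openI; last exact: open_interior.
  rewrite openE => q [Uq U'q]; apply: filterI; first exact: open_near oU Uq.
  by apply: (cK q Uq); exact: open_near oU' U'q.
exists O, (F \o K'); split=> //.
- split; last exact: nbhs_singleton (nbhs_interior nr).
  by split=> //=; rewrite /= eK' ?(gd_inv gu) //; exact: gd_model.
- apply/smoP => k; apply: (smk_comp oO oU').
  + by move=> p [[]].
  + by apply: smk_sub (sK' k) => p [[]].
  + by move/smoP: sF.
- move=> q [[Uq U'q] /interior_subset hq] mq; have [m1 i1] := hq mq.
  rewrite /= in U'q; rewrite /= eF ?eK' //; last by rewrite -eK'.
  by rewrite i1.
Qed.

Lemma smoothv_comp M N (W : vectType R) (r : M -> N) (f : N -> W) (u : M) :
  good u -> good (r u) -> ncont r u -> smoothv (chart (r u) \o r) u ->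
  smoothv f (r u) -> smoothv (f \o r) u.
Proof.
move=> gu gr cr sr /smoothvP sf; apply/smoothvP => i.
exact: (smR_comp gu gr cr sr (sf i)).
Qed.

(** By [smoothv_near] the derivative of f factors through that of the chart at r u; the value is
    then linear in the coordinates of X in this chart, with smooth coefficients. *)
Lemma smooth_apply M N (W : vectType R) (r : M -> N) (X : M -> 'rV[R]_(cdim N)) (f : N -> W) (u : M) :
  good u -> good (r u) -> mfd_at (r u) -> ncont r u -> smoothv (chart (r u) \o r) u ->
  smooth_field_along r X u -> smoothv f (r u) -> smoothv (fun v => dv f (r v) (X v)) u.
Proof.
move=> gu gr mr cr sr sX sf.
have [D [hD sD]] := smoothv_near gr mr sf.
apply: (@smoothv_ext _ _ _ (fun v => \sum_i dv (chart (r u)) (r v) (X v) 0 i *: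
    D (r v) (delta_mx 0 i))).
  apply: nearMS (cr _ (nearMI (ma_good mr) hD)) => v [gv hv].
  rewrite (dv_isd gv hv) comp_lfunE [X in _ = D _ X]row_sum_delta linear_sum.
  by apply: eq_bigr => i _; rewrite linearZ.
apply: smoothv_sum => i; apply: smoothv_scale; first exact: smoothv_entry.
exact: (smoothv_comp gu gr cr sr (sD _)).
Qed.

Lemma smooth_push M N (r : M -> N) (X : M -> 'rV[R]_(cdim M)) (u : M) :
  good u -> mfd_at u -> good (r u) -> mfd_at (r u) ->
  nearM u (fun v => ncont r v /\ smoothv (chart (r v) \o r) v) ->
  smooth_field_along id X u -> smooth_field_along r (fun v => dm r v (X v)) u.
Proof.
move=> gu mu gr mr nr sX; have [cr sr] := near_self gu nr.
have sid : smoothv (chart u \o id) u by exact: near_self gu (ma_chart mu).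
have := smooth_apply gu gu mu (@ncont_id _ u) sid sX sr.
apply: smoothv_ext.
have nc := cr _ (ma_chart mr); have ng := cr _ (ma_good mr).
apply: nearMS2 (nearMI (ma_good mu) nr) (nearMI nc ng) => v [gv [cv sv]] [cv' gv'].
have := isd_comp gv gv' cv (smoothv_isd gv sv) (smoothv_isd gv' cv').
by move=> /(dv_isd gv) ->; rewrite comp_lfunE.
Qed.

End Calculus.

(** * Manifolds with boundary and their collars *)

Section Instances.
Variable R : realType.
Implicit Types M N S : charted R.

Lemma solid_setT n : solid [set: 'rV[R]_n].
Proof. by exists 0, 1. Qed.

Lemma conv_ge0 (s t u : R) : 0 <= s -> 0 <= u -> 0 <= t <= 1 -> 0 <= s + t * (u - s).
Proof.
move=> s0 u0 /andP[t0 t1]; have -> : s + t * (u - s) = (1 - t) * s + t * u by ring.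
by rewrite addr_ge0 // mulr_ge0 // subr_ge0.
Qed.

Lemma solid_halfspace n : solid (@halfspace R n).
Proof.
exists (const_mx 1), 1 => // p q t hp hq ht i i0; rewrite !mxE; apply: conv_ge0 => //.
  exact: hp.
have := le_lt_trans (mxcoord_le _ i) hq; rewrite !mxE ltr_norml => /andP[h _].
by lra.
Qed.

Lemma solid_collar (a : bool) (e : R) n (H : set 'rV[R]_n) : 0 < e -> solid H ->
  solid [set p : 'rV[R]_(1 + n) | colA a e (lsubmx p 0 0) /\ H (rsubmx p)].
Proof.
move=> e0 [q [r r0 hH]].
(* The midpoint of the parameter interval; a radius of at most e / 4 keeps the first coordinates of
   the ball strictly inside the interval, whichever end is closed. *)
pose m : R := if a then 1 - e / 2 else e / 2.
exists (row_mx (const_mx m) q), (Num.min r (e / 4)).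
  by rewrite lt_min r0 divr_gt0.
move=> p q' t [p1 p2] hq ht; move: hq; rewrite lt_min => /andP[hq hqe].
have ls : lsubmx (p + t *: (q' - p)) 0 0 = lsubmx p 0 0 + t * (lsubmx q' 0 0 - lsubmx p 0 0).
  by rewrite !mxE.
have rs : rsubmx (p + t *: (q' - p)) = rsubmx p + t *: (rsubmx q' - rsubmx p).
  by rewrite linearD linearZ linearB.
have lq : `|lsubmx q' 0 0 - m| < e / 4.
  apply: le_lt_trans hqe; have := mxcoord_le (q' - row_mx (const_mx m) q) (lshift n 0).
  have -> : (q' - row_mx (const_mx m) q) 0 (lshift n 0) = lsubmx q' 0 0 - m.
    by rewrite mxE [X in _ + X]mxE row_mxEl !mxE.
  by [].
have rq : `|rsubmx q' - q| < r.
  apply: le_lt_trans hq; apply: mxnorm_le => // i.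
  have := mxcoord_le (q' - row_mx (const_mx m) q) (rshift 1 i).
  have -> : (q' - row_mx (const_mx m) q) 0 (rshift 1 i) = (rsubmx q' - q) 0 i.
    by rewrite mxE [X in _ + X]mxE row_mxEr !mxE.
  by [].
split=> /=; last by rewrite rs; apply: hH.
rewrite ls; set s := lsubmx p 0 0 in p1 *; set u := lsubmx q' 0 0 in lq *.
case/andP: ht => t0 t1.
have c1 : s + t * (u - s) = (1 - t) * s + t * u by ring.
have ct : 0 <= 1 - t by rewrite subr_ge0.
move: lq; rewrite ltr_norml /m => /andP[l1 l2].
case: (a) p1 l1 l2; rewrite /colA /= !in_itv /= => /andP[s1 s2] l1 l2; apply/andP; split.
- rewrite c1; have [->|tn] := eqVneq t 1; first by lra.
  have ct' : 0 < 1 - t by rewrite subr_gt0 lt_neqAle tn.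
  nra.
- by rewrite c1; nra.
- by rewrite c1; nra.
- rewrite c1; have [->|tn] := eqVneq t 1; first by lra.
  have ct' : 0 < 1 - t by rewrite subr_gt0 lt_neqAle tn.
  nra.
Qed.

Lemma smooth_within_lin n m k (H : set 'rV[R]_n) (F : 'rV[R]_n -> 'rV[R]_m)
    (l : {linear 'rV[R]_m -> 'rV[R]_k}) p :
  smooth_within H F p -> smooth_within H (l \o F) p.
Proof.
move=> [U [G [oU Up sG eG]]]; exists U, (l \o G); split=> //.
  apply/smoP => j; apply: smk_lin => //; first exact: linear_rV_continuous.
  by move/smoP: sG.
by move=> q Uq Hq /=; rewrite eG.
Qed.

Section Manifold.
Variable M : charted R.
Hypothesis mM : is_manifold_with_boundary M.

Lemma mfd_good (x : M) : good x.
Proof.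
have [_ xx] := mfd_dom mM x; have [m1 i1 _] := mfd_chart mM xx.
split=> //.
  by case: (mfd_model mM) => ->; [exact: solid_setT|exact: solid_halfspace].
by apply: filterS (mfd_cinv mM xx) => p h /h[].
Qed.

Lemma nearM_nbhs (x : M) (P : M -> Prop) : nearM x P <-> nbhs x P.
Proof.
have [ox xx] := mfd_dom mM x; have [_ _ cx] := mfd_chart mM xx.
split=> [h|]; last exact: mfd_cinv_cont.
have h1 : nbhs x (fun y => cmodel (chart x y) -> P (cinv x (chart x y))) by exact: cx h.
have h2 : nbhs x (cdom x) by exact: open_nbhs_nbhs.
apply: filterS2 h1 h2 => y hy xy; have [my iy _] := mfd_chart mM xy.
by rewrite -iy; exact: hy.
Qed.

Lemma mfd_mfd_at (x : M) : mfd_at x.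
Proof.
have [ox xx] := mfd_dom mM x.
have nd : nearM x (cdom x) by apply/nearM_nbhs; exact: open_nbhs_nbhs.
split.
- by apply: nearM_forall; exact: mfd_good.
- apply: nearMS nd => y xy; have [_ yy] := mfd_dom mM y.
  by have := mfd_smooth mM yy xy; exact: (smooth_within_lin (@vcoord R _)).
- apply: nearMS nd => y xy; have [_ yy] := mfd_dom mM y.
  by have := mfd_smooth mM xy yy.
- move=> P /nearM_nbhs/nbhs_interior h; apply/nearM_nbhs.
  by apply: filterS h => y hy; apply/nearM_nbhs.
Qed.

Lemma smooth_map_ncont N (f : N -> M) (x : N) : smooth_map f x -> ncont f x.
Proof. by move=> [h _] P /nearM_nbhs /h. Qed.

End Manifold.

Lemma near_lin n m (l : {linear 'rV[R]_n -> 'rV[R]_m}) p (P : 'rV[R]_m -> Prop) :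
  (\forall q \near l p, P q) -> \forall q \near p, P (l q).
Proof. by move=> h; have /(_ _ h) := @linear_rV_continuous R n 'rV[R]_m l p. Qed.

Lemma smo_rows n m (U : set 'rV[R]_n) (G : 'rV[R]_n -> 'rV[R]_m) : open U ->
  (forall i, smo U (fun p => G p 0 i)) -> smo U G.
Proof.
move=> oU h; apply/smoP => k.
apply: (smk_ext oU (f := fun p => \sum_i G p 0 i *: delta_mx 0 i)).
  by move=> p _; rewrite -row_sum_delta.
by apply: smk_sum => // i _; apply: smk_scalel => //; move/smoP: (h i).
Qed.

Lemma smk_linear k n m (U : set 'rV[R]_n) (l : {linear 'rV[R]_n -> 'rV[R]_m}) :
  open U -> smk k U l.
Proof.
move=> oU; have -> : l = l \o id :> ('rV[R]_n -> 'rV[R]_m) by [].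
apply: smk_lin => //; first exact: linear_rV_continuous.
case: k => [|k]; (split; first by move=> p _; exact: (ex_diff (df := id))) => // v.
have -> : 'D_v id = (fun=> v) :> ('rV[R]_n -> 'rV[R]_n).
  by apply/funext => q; rewrite derive_id.
exact: smk_cst.
Qed.

Lemma smooth_within_prod n (H : set 'rV[R]_n) (T : set R) m (F : 'rV[R]_n -> 'rV[R]_m) (p : 'rV[R]_(1 + n)) :
  smooth_within H F (rsubmx p) ->
  smooth_within [set p | T (lsubmx p 0 0) /\ H (rsubmx p)]
    (fun p => row_mx (const_mx (lsubmx p 0 0)) (F (rsubmx p)) : 'rV[R]_(1 + m)) p.
Proof.
move=> [U [G [oU Up sG eG]]].
pose rs : {linear 'rV[R]_(1 + n) -> 'rV[R]_n} := rsubmx.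
pose U' := rs @^-1` U.
have oU' : open U'.
  by rewrite openE => q Uq; apply: (@near_lin _ _ rs); exact: open_near oU Uq.
exists U', (fun p => row_mx (const_mx (lsubmx p 0 0)) (G (rsubmx p)) : 'rV[R]_(1 + m)); split=> //.
- apply: smo_rows => // i; case: (split_ordP i) => j ->.
    have -> : (fun q : 'rV[R]_(1 + n) => (row_mx (const_mx (lsubmx q 0 0)) (G (rsubmx q)) : 'rV[R]_(1 + m)) 0 (lshift m j)) =
       entry 0 \o (lsubmx : _ -> 'rV[R]_1).
      by apply/funext => q; rewrite row_mxEl mxE.
    apply/smoP => k; apply: (@smk_lin _ k _ _ R^o U' lsubmx (@entry R 1 0)) => //.
      exact: (@linear_rV_continuous R _ R^o (@entry R 1 0)).
    exact: (@smk_linear k _ _ U' lsubmx oU').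
  have -> : (fun q : 'rV[R]_(1 + n) => (row_mx (const_mx (lsubmx q 0 0)) (G (rsubmx q)) : 'rV[R]_(1 + m)) 0 (rshift 1 j)) =
      (fun q => G q 0 j) \o rsubmx.
    by apply/funext => q; rewrite row_mxEr.
  apply/smoP => k; apply: (smk_comp oU' oU) => //.
    exact: (@smk_linear k _ _ U' rsubmx oU').
  apply: (@smk_lin _ k _ _ R^o U G (@entry R m j)) => //.
    exact: (@linear_rV_continuous R _ R^o (@entry R m j)).
  by move/smoP: sG.
- by move=> q Uq [_ Hq]; rewrite eG.
Qed.

Section Collar.
Variables (M : charted R) (a : bool) (e : R).
Hypothesis mM : is_manifold_with_boundary M.
Hypothesis e0 : 0 < e.
Local Notation C := (collar a e M).

Lemma row_mx1K (p : 'rV[R]_(1 + cdim M)) : row_mx (const_mx (lsubmx p 0 0)) (rsubmx p) = p.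
Proof.
rewrite -[RHS]hsubmxK; congr row_mx; apply/rowP => i; by rewrite ord1 mxE.
Qed.

Lemma collar_nearA (z : C) : nearM z (fun w : C => colA a e w.1).
Proof. by rewrite /nearM; apply: filterE => p []. Qed.

Lemma collar_good (z : C) : colA a e z.1 -> good z.
Proof.
move=> Az; have g := mfd_good mM z.2.
have lz : lsubmx (chart z z) 0 0 = z.1 by rewrite row_mxKl mxE.
have rz : rsubmx (chart z z) = chart z.2 z.2 by rewrite row_mxKr.
split.
- exact: solid_collar e0 (gd_solid g).
- by split; [rewrite lz|rewrite rz; exact: gd_model].
- by rewrite /= lz rz (gd_inv g); case: (z).
- have h : \forall q \near rsubmx (chart z z), cmodel q -> chart z.2 (cinv z.2 q) = q.
    by rewrite rz; exact: gd_chart.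
  have := @near_lin _ _ rsubmx _ _ h; apply: filterS => p hp [_ mp] /=.
  by rewrite hp // row_mx1K.
Qed.

(** Chart neighbourhoods of a collar match the product topology, since balls for the norm on row
    vectors are products of balls in the two blocks. *)
Lemma collar_nearM (z : C) (P : C -> Prop) : colA a e z.1 ->
  nearM z P <-> nbhs z (fun w : C => colA a e w.1 -> P w).
Proof.
move=> Az; have g := collar_good Az.
have [ox xx] := mfd_dom mM z.2; have [_ _ cx] := mfd_chart mM xx.
split.
  move=> /nbhs_ballP[d d0 hd].
  have n1 : nbhs z.1 (ball z.1 d) by exact: nbhsx_ballx.
  have n2 : nbhs z.2 (fun y => cdom z.2 y /\ ball (chart z.2 z.2) d (chart z.2 y)).
    by apply: filterI; [exact: open_nbhs_nbhs|apply: cx; exact: nbhsx_ballx].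
  exists (ball z.1 d, fun y => cdom z.2 y /\ ball (chart z.2 z.2) d (chart z.2 y)) => //.
  move=> [t y] /= [bt [zy by_]] At; have [my iy _] := mfd_chart mM zy.
  have := hd (chart z (t, y)); rewrite /= row_mxKl row_mxKr mxE iy; apply=> //.
  rewrite -ball_normE /=; rewrite -ball_normE /= in bt; rewrite -ball_normE /= in by_.
  have : `|(row_mx (const_mx z.1) (chart z.2 z.2) : 'rV[R]_(1 + cdim M)) - row_mx (const_mx t) (chart z.2 y)| <=
     Num.max `|z.1 - t| `|chart z.2 z.2 - chart z.2 y|.
    apply: mxnorm_le; first by rewrite le_max normr_ge0.
    move=> i; rewrite opp_row_mx add_row_mx; case: (split_ordP i) => j ->.
      by rewrite row_mxEl !mxE le_max lexx.
    by rewrite row_mxEr le_max mxcoord_le orbT.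
  by move=> /le_lt_trans; apply; rewrite gt_max bt.
move=> [[Q1 Q2] /= [n1 n2] hQ].
have lz : lsubmx (chart z z) 0 0 = z.1 by rewrite row_mxKl mxE.
have rz : rsubmx (chart z z) = chart z.2 z.2 by rewrite row_mxKr.
have h1 : \forall p \near chart z z, Q1 (lsubmx p 0 0).
  have h0 : nbhs ((lsubmx (chart z z)) 0 0) Q1 by rewrite lz.
  have h' : \forall q \near (lsubmx (chart z z) : 'rV[R]_1), Q1 ((q : 'rV[R]_1) 0 0).
    by have /(_ _ h0) := @coord_continuous R 1 1 0 0 (lsubmx (chart z z)).
  by have := @near_lin _ _ lsubmx _ _ h'.
have h2 : \forall p \near chart z z, cmodel (rsubmx p) -> Q2 (cinv z.2 (rsubmx p)).
  have h' : \forall q \near rsubmx (chart z z), cmodel q -> Q2 (cinv z.2 q).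
    by rewrite rz; exact: mfd_cinv_cont mM _ _ xx _ n2.
  by have := @near_lin _ _ rsubmx _ _ h'.
by rewrite /nearM; apply: filterS2 h1 h2 => p q1 q2 [Ap mp]; apply: hQ => //; split=> //; exact: q2.
Qed.

Lemma collar_mfd_at (z : C) : colA a e z.1 -> mfd_at z.
Proof.
move=> Az; have [ox xx] := mfd_dom mM z.2.
have nd : nearM z (fun w : C => colA a e w.1 /\ cdom z.2 w.2).
  apply/collar_nearM => //; exists (setT, cdom z.2).
    by split; [exact: filterT|exact: open_nbhs_nbhs].
  by move=> w [_ h] Aw.
split.
- by apply: nearMS (collar_nearA z) => w; exact: collar_good.
- apply: nearMS nd => w [Aw zw]; have [_ ww] := mfd_dom mM w.2.
  have h : smooth_within (@cmodel R M) (chart z.2 \o cinv w.2) (rsubmx (chart w w)).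
    by rewrite row_mxKr; have := mfd_smooth mM ww zw.
  have this := smooth_within_prod (colA a e) h.
  by move: this; exact: (smooth_within_lin (@vcoord R _)).
- apply: nearMS nd => w [Aw zw]; have [_ ww] := mfd_dom mM w.2.
  have h : smooth_within (@cmodel R M) (chart w.2 \o cinv z.2) (rsubmx (chart z w)).
    by rewrite row_mxKr; have := mfd_smooth mM zw ww.
  by have := smooth_within_prod (colA a e) h.
- move=> P /(collar_nearM _ Az)/nbhs_interior h; apply/collar_nearM => //.
  by apply: filterS h => w hw Aw; apply/collar_nearM.
Qed.

End Collar.

End Instances.

(** * Local diffeomorphisms, lifts through embeddings, products with an interval *)

Section Maps.
Variable R : realType.
Implicit Types M N S : charted R.

Lemma hom_id_lker (U V : vectType R) (f : 'Hom(U, V)) (g : 'Hom(V, U)) :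
  (g \o f)%VF = \1%VF -> lker f = 0%VS.
Proof.
move=> e; apply/eqP; rewrite -subv0; apply/subvP => v; rewrite memv_ker memv0 => /eqP fv.
have := congr1 (fun h : 'Hom(_, _) => h v) e.
by rewrite id_lfunE comp_lfunE fv linear0 => ->.
Qed.

Lemma hom_id_limg (U V : vectType R) (f : 'Hom(U, V)) (g : 'Hom(V, U)) :
  (f \o g)%VF = \1%VF -> limg f = fullv.
Proof.
move=> e; apply/eqP; rewrite eqEsubv subvf; apply/subvP => v _.
have := congr1 (fun h : 'Hom(_, _) => h v) e.
by rewrite id_lfunE comp_lfunE => <-; apply: memv_img; exact: memvf.
Qed.

(** Both composites of f with its local inverse g are identities near the points, so the chain rule
    inverts the derivative on both sides. The set A restricts the claim to the parameter interval
    when M is a collar. *)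
Lemma local_diffeo_facts M N (A : set M) (f : M -> N) (x : M) : good x ->
  (forall P : M -> Prop, nearM x P -> nbhs x (fun w => A w -> P w)) ->
  is_manifold_with_boundary N -> local_diffeo A f -> A x ->
  [/\ ncont f x, smoothv (chart (f x) \o f) x, lker (dm f x) = 0%VS, limg (dm f x) = fullv &
      forall P : M -> Prop, nearM x P -> nearM (f x) (fun y => exists w, [/\ A w, P w & f w = y])].
Proof.
move=> gx hN mN df Ax; have [sf [g [gfx sg gf fg]]] := df x Ax.
have cf := smooth_map_ncont mN sf; have [_ sf'] := sf.
have [cg0 sg'] := sg; rewrite gfx in cg0 sg'.
have gfx' := mfd_good mN (f x).
have cg P : nearM x P -> nearM (f x) (fun y => P (g y)).
  move=> /hN /cg0; apply: nearMS2 fg => y [Agy _]; exact.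
have h1 := smoothv_isd gx sf'; have h2 := smoothv_isd gfx' sg'.
split=> //.
- have := isd_comp gx gfx' cf h1 h2 => h3.
  have : isd (chart x) x (dv (chart x \o g) (f x) \o dm f x)%VF.
    by apply: isd_ext h3 => //; apply: nearMS gf => y /= ->.
  by move=> /(dv_isd gx); rewrite (dv_isd gx (isd_chart gx)) => /esym /hom_id_lker.
- have cg' : ncont g (f x) by move=> P; rewrite gfx; exact: cg.
  have gg : good (g (f x)) by rewrite gfx.
  have h2' : isd (chart (g (f x)) \o g) (f x) (dv (chart x \o g) (f x)) by rewrite gfx.
  have h1' : isd (chart (f x) \o f) (g (f x)) (dm f x) by rewrite gfx.
  have h3 := isd_comp gfx' gg cg' h2' h1'.
  have : isd (chart (f x)) (f x) (dm f x \o dv (chart x \o g) (f x))%VF.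
    by apply: isd_ext h3 => //; apply: nearMS fg => y [_ /= ->].
  by move=> /(dv_isd gfx'); rewrite (dv_isd gfx' (isd_chart gfx')) => /esym /hom_id_limg.
- move=> P /cg; apply: nearMS2 fg => y [Agy fgy] Pg.
  by exists (g y).
Qed.

Lemma local_diffeo_mfd M N (f : M -> N) (x : M) :
  is_manifold_with_boundary M -> is_manifold_with_boundary N -> local_diffeo setT f ->
  [/\ ncont f x, smoothv (chart (f x) \o f) x, lker (dm f x) = 0%VS, limg (dm f x) = fullv &
      forall P : M -> Prop, nearM x P -> nearM (f x) (fun y => exists2 w, P w & f w = y)].
Proof.
move=> mM mN df.
have [||//|//|//|h1 h2 h3 h4 h5] := @local_diffeo_facts M N setT f x.
- exact: mfd_good.
- by move=> P /(nearM_nbhs mM); apply: filterS => w h _.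
- by split=> // P /h5; apply: nearMS => y [w [_ Pw e]]; exists w.
Qed.

(** For lifts V of a map K through an immersion E. The lifts used for group actions, triple overlaps
    and collars are chosen point by point, so their differentiability is not given; it is inherited
    from K by [wd_cancel]. *)
Lemma cancel_isd M N S (V : M -> N) (E : N -> S) (K : M -> S) (x : M) L :
  good x -> good (V x) -> good (E (V x)) -> ncont V x -> ncont E (V x) ->
  smoothv (chart (E (V x)) \o E) (V x) -> lker (dm E (V x)) = 0%VS ->
  nearM x (fun y => E (V y) = K y) -> isd (chart (E (V x)) \o K) x L ->
  isd (chart (V x) \o V) x (dm V x) /\ (dm E (V x) \o dm V x)%VF = L.
Proof.
move=> gx gv ge cV cE sE kE EK hL.
have hE := smoothv_isd gv sE.
have [D hD] : exists D, isd (chart (V x) \o V) x D.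
  have e0 : (chart (V x) \o V \o cinv x) (chart x x) = chart (V x) (V x) by rewrite /= (gd_inv gx).
  have nc := cV _ (good_coord gv).
  apply: (@wd_cancel _ _ _ _ _ (@cmodel R N) (chart (V x) \o V \o cinv x)
    (chart (E (V x)) \o E \o cinv (V x)) (chart (E (V x)) \o K \o cinv x) _ L (dm E (V x))).
  - rewrite e0 => P hP.
    have hP' : \forall p \near chart (V x) (V x), cmodel p -> P p by apply: filterS hP.
    exact: cV _ (@good_near_chart R N (V x) P gv hP').
  - by move: nc; rewrite /nearM; apply: filterS => q h /h[].
  - exact: gd_model.
  - have := nearMI nc EK; rewrite /nearM; apply: filterS => q h /h[[_ iq] eq] /=.
    by rewrite iq eq.
  - by rewrite e0.
  - exact: kE.
  - exact: hL.
have eD := dv_isd gx hD; move: hD; rewrite -eD => hD; split; first exact: hD.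
have h3 := isd_comp gx gv cV hD hE.
have h4 : isd (chart (E (V x)) \o K) x (dm E (V x) \o dm V x)%VF.
  by apply: isd_ext h3 => //; apply: nearMS EK => y /= ->.
by rewrite -(dv_isd gx h4) (dv_isd gx hL).
Qed.

(** Continuity of a lift comes from E being a homeomorphism onto its image, before any
    differentiability is known. *)
Lemma embedding_ncont M N S (V : M -> N) (E : N -> S) (K : M -> S) (x : M) :
  is_manifold_with_boundary N -> is_manifold_with_boundary S -> smooth_embedding E ->
  nearM x (fun y => E (V y) = K y) -> E (V x) = K x -> ncont K x -> ncont V x.
Proof.
move=> mN mS [_ _ _ emb] EK ex cK P /(nearM_nbhs mN) /emb [Q nQ hQ].
have : nearM x (fun y => Q (K y)) by apply: cK; rewrite -ex; apply/nearM_nbhs.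
by apply: nearMS2 EK => y e Oy; apply: hQ; rewrite e.
Qed.

Lemma wd_linear n m (H : set 'rV[R]_n) (l : {linear 'rV[R]_n -> 'rV[R]_m}) p :
  wd H l p (linfun l).
Proof.
move=> e e0; near=> h => _.
have -> : l (p + h) - l p - linfun l h = 0.
  by rewrite lfunE [l _]linearD -addrA -opprD subrr.
rewrite linear0 normr0.
by rewrite mulr_ge0 // ltW.
Unshelve. all: by end_near. Qed.

Definition collar_map (a : bool) (e : R) M N (f : M -> N) (z : collar a e M) : collar a e N :=
  (z.1, f z.2).

Definition hom_collar n m (L : 'Hom('rV[R]_n, 'rV[R]_m)) : 'Hom('rV[R]_(1 + n), 'rV[R]_(1 + m)) :=
  linfun (fun p => row_mx (lsubmx p : 'rV[R]_1) (L (rsubmx p))).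

Lemma hom_collarE n m (L : 'Hom('rV[R]_n, 'rV[R]_m)) p :
  hom_collar L p = row_mx (lsubmx p : 'rV[R]_1) (L (rsubmx p)).
Proof.
have lf : linear (fun p : 'rV[R]_(1 + n) => row_mx (lsubmx p : 'rV[R]_1) (L (rsubmx p))).
  by move=> c u v; rewrite linearP /= linearP linearP scale_row_mx add_row_mx.
pose f : {linear 'rV[R]_(1 + n) -> 'rV[R]_(1 + m)} :=
  HB.pack (fun p : 'rV[R]_(1 + n) => row_mx (lsubmx p : 'rV[R]_1) (L (rsubmx p)))
  (GRing.isLinear.Build R _ _ _ _ lf).
exact: (lfunE f p).
Qed.

Lemma hom_collar_row n m (L : 'Hom('rV[R]_n, 'rV[R]_m)) (s : 'rV[R]_1) b :
  hom_collar L (row_mx s b) = row_mx s (L b).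
Proof. by rewrite hom_collarE row_mxKl row_mxKr. Qed.

Lemma rsubmx_le n (h : 'rV[R]_(1 + n)) : `|rsubmx h| <= `|h|.
Proof. by apply: mxnorm_le => // i; rewrite mxE mxcoord_le. Qed.

Lemma wd_collar n m (T : set R) (H : set 'rV[R]_n) (F : 'rV[R]_n -> 'rV[R]_m) (p : 'rV[R]_(1 + n)) L :
  wd H F (rsubmx p) L ->
  wd [set p | T (lsubmx p 0 0) /\ H (rsubmx p)]
    (fun p => row_mx (const_mx (lsubmx p 0 0)) (F (rsubmx p)) : 'rV[R]_(1 + m)) p (hom_collar L).
Proof.
move=> /wd_rV hF; apply/wd_rV => e e0.
have hF1 : \forall k \near rsubmx (0 : 'rV[R]_(1 + n)), H (rsubmx p + k) ->
    `|F (rsubmx p + k) - F (rsubmx p) - L k| <= e * `|k|.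
  by rewrite linear0; exact: hF.
have := @near_lin R _ _ rsubmx _ _ hF1; apply: filterS => h hh [_ Hh].
rewrite hom_collarE !opp_row_mx !add_row_mx.
have -> : const_mx (lsubmx (p + h) 0 0) - const_mx (lsubmx p 0 0) - lsubmx h = 0 :> 'rV[R]_1.
  by apply/rowP => i; rewrite ord1 !mxE [p 0 _ + _]addrC addrK subrr.
have rD : rsubmx (p + h) = rsubmx p + rsubmx h by rewrite linearD.
rewrite rD in Hh *; apply: (@le_trans _ _ (e * `|rsubmx h|)); last first.
  by rewrite ler_pM2l // rsubmx_le.
apply: le_trans (hh Hh); apply: mxnorm_le => // i.
case: (split_ordP i) => j ->; first by rewrite row_mxEl mxE normr0.
by rewrite row_mxEr mxcoord_le.
Qed.

Section CollarMaps.
Variables (a : bool) (e : R).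
Hypothesis e0 : 0 < e.

Lemma collar_map_ncont M N (f : M -> N) (z : collar a e M) :
  is_manifold_with_boundary M -> is_manifold_with_boundary N ->
  ncont f z.2 -> colA a e z.1 -> ncont (collar_map (a := a) (e := e) f) z.
Proof.
move=> mM mN cf Az P; have Az' : colA a e (collar_map (a := a) (e := e) f z).1 by [].
move=> /(collar_nearM mN e0 P Az') [[Q1 Q2] /= [n1 n2] hQ].
apply/(collar_nearM mM e0 _ Az).
exists (Q1, fun y => Q2 (f y)) => /=.
  by split=> //; apply/(nearM_nbhs mM); apply: cf; apply/(nearM_nbhs mN).
by move=> w [q1 q2] Aw; apply: (hQ (w.1, f w.2)).
Qed.

Lemma collar_map_isd M N (f : M -> N) (z : collar a e M) L :
  is_manifold_with_boundary M -> colA a e z.1 ->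
  isd (chart (f z.2) \o f) z.2 L ->
  isd (chart (collar_map (a := a) (e := e) f z) \o collar_map (a := a) (e := e) f) z (hom_collar L).
Proof.
move=> mM Az hL.
have h : wd (@cmodel R M) (chart (f z.2) \o f \o cinv z.2) (rsubmx (chart z z)) L.
  by rewrite row_mxKr; exact: hL.
exact: (@wd_collar _ _ (colA a e) _ _ _ _ h).
Qed.

Lemma snd_ncont M (z : collar a e M) : is_manifold_with_boundary M -> colA a e z.1 ->
  ncont (snd : collar a e M -> M) z.
Proof.
move=> mM Az P /(nearM_nbhs mM) h; apply/(collar_nearM mM e0 _ Az).
exists (setT, P); first by split=> //; exact: filterT.
by move=> w [_ Pw] _.
Qed.

Lemma snd_smooth M (z : collar a e M) : is_manifold_with_boundary M -> colA a e z.1 ->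
  smoothv (chart z.2 \o (snd : collar a e M -> M)) z.
Proof.
move=> mM Az; apply: (@smoothv_ext _ _ _ (fun w => rsubmx (chart z w))).
  by apply: nearM_forall => w; rewrite row_mxKr.
have gz := collar_good mM e0 Az.
have s := near_self gz (ma_chart (collar_mfd_at mM e0 Az)).
exact: (smoothv_lin rsubmx s).
Qed.

Lemma snd_isd M (W : vectType R) (f : M -> W) (z : collar a e M) L :
  is_manifold_with_boundary M -> colA a e z.1 -> isd f z.2 L ->
  isd (f \o (snd : collar a e M -> M)) z (L \o linfun (rsubmx : 'rV_(1 + cdim M) -> 'rV_(cdim M)))%VF.
Proof.
move=> mM Az hL.
apply: (@wd_comp R _ _ _ _ (@cmodel R M) (rsubmx : 'rV_(1 + cdim M) -> 'rV_(cdim M)) (f \o cinv z.2)).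
- exact: wd_linear.
- by rewrite /= row_mxKr.
- by apply: filterE => p [].
Qed.

End CollarMaps.

End Maps.

(** * Pointwise properties of the transition maps *)

Section Basic.
Variables (R : realType) (B : kbasic R).
Local Notation N := (kN B).
Implicit Types I J : {set 'I_N}.

Lemma restrE_linear I : linear (@restrE R B I : ET B -> ET B).
Proof.
move=> a u v; apply: prodVP => i; rewrite prodV_linE !prodV_ofE.
by case: (i \in I); rewrite ?prodV_linE // scaler0 addr0.
Qed.

Lemma lfun_ofE (V W : vectType R) (f : V -> W) : linear f -> linfun f =1 f.
Proof.
move=> lf v.
pose g : {linear V -> W} := HB.pack f (GRing.isLinear.Build R _ _ _ f lf).
exact: (lfunE g v).
Qed.

Lemma prodV0 (i : 'I_N) : (0 : ET B) i = 0.
Proof. exact: prodV_ofE. Qed.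

Lemma mem_Esp I (e : ET B) : e \in Esp I <-> forall i, i \notin I -> e i = 0.
Proof.
rewrite memv_ker (lfun_ofE (restrE_linear _)); split=> [/eqP h i iI|h].
  by have := congr1 (fun e : ET B => e i) h; rewrite prodV_ofE prodV0 finset.in_setC iI.
apply/eqP/prodVP => i; rewrite prodV_ofE prodV0 finset.in_setC.
by case iI: (i \in I) => //=; rewrite h ?iI.
Qed.

Lemma Esp_sub I J : (I \subset J)%SET -> (Esp I <= @Esp R B J)%VS.
Proof.
move=> IJ; apply/subvP => e /mem_Esp h; apply/mem_Esp => i iJ; apply: h.
by apply: contra iJ; exact: (fintype.subsetP IJ).
Qed.

Lemma in_Gam I (g : GT B) : (g \in Gam I) = (restrG I g == g).
Proof. by rewrite inE. Qed.

Lemma GamP I (g : GT B) : g \in Gam I <-> forall i, i \notin I -> g i = 1%g.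
Proof.
rewrite in_Gam; split=> [/eqP h i iI|h].
  by have := congr1 (fun g : GT B => g i) h; rewrite ffunE (negPf iI).
by apply/eqP/ffunP => i; rewrite ffunE; case iI: (i \in I) => //; rewrite h ?iI.
Qed.

Lemma GT1 (i : 'I_N) : (1%g : GT B) i = 1%g.
Proof. by rewrite ffunE. Qed.

Lemma GTM (g h : GT B) (i : 'I_N) : (g * h)%g i = (g i * h i)%g.
Proof. by rewrite ffunE. Qed.

Lemma GTV (g : GT B) (i : 'I_N) : (g^-1)%g i = (g i)^-1%g.
Proof. by rewrite ffunE. Qed.

Lemma Gam1 I : (1%g : GT B) \in Gam I.
Proof. by apply/GamP => i _; rewrite GT1. Qed.

Lemma GamM I (g h : GT B) : g \in Gam I -> h \in Gam I -> (g * h)%g \in Gam I.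
Proof. by move=> /GamP hg /GamP hh; apply/GamP => i iI; rewrite GTM hg // hh // mulg1. Qed.

Lemma GamV I (g : GT B) : g \in Gam I -> (g^-1)%g \in Gam I.
Proof. by move=> /GamP hg; apply/GamP => i iI; rewrite GTV hg // invg1. Qed.

Lemma restrG_Gam I (g : GT B) : restrG I g \in Gam I.
Proof. by apply/GamP => i iI; rewrite ffunE (negPf iI). Qed.

Hypothesis kB : is_kbasic B.

Lemma actE_linear (g : GT B) : linear (@actE R B g).
Proof.
move=> a u v; apply: prodVP => i; rewrite [LHS]prodV_ofE [RHS]prodV_linE !prodV_ofE.
by have [h _ _] := kB i; rewrite -h -prodV_linE.
Qed.

Lemma kact0 (i : 'I_N) (g : kG i) : kact g (0 : kE i) = 0.
Proof.
have [h _ _] := kB i; have := h g 0 0 0; rewrite scaler0 addr0 scale0r add0r => e.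
have := h g (-1) 0 0; rewrite scaler0 addr0 scaleN1r addNr; exact.
Qed.

Definition actH (g : GT B) : 'End(ET B) := linfun (@actE R B g).

Lemma actHE g : actE g =1 actH g.
Proof. by move=> e; rewrite (lfun_ofE (actE_linear g)). Qed.

Lemma actE1 e : actE (1%g : GT B) e = e.
Proof. by apply: prodVP => i; rewrite prodV_ofE GT1; have [_ h _] := kB i; exact: h. Qed.

Lemma actEM g h e : actE (g * h : GT B)%g e = actE g (actE h e).
Proof.
by apply: prodVP => i; rewrite !prodV_ofE GTM; have [_ _ ->] := kB i.
Qed.

Lemma actEVK g e : actE (g^-1 : GT B)%g (actE g e) = e.
Proof. by rewrite -actEM mulVg actE1. Qed.

Lemma actEKV g e : actE g (actE (g^-1 : GT B)%g e) = e.
Proof. by rewrite -actEM mulgV actE1. Qed.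

Lemma actH_inj g : lker (actH g) = 0%VS.
Proof.
apply/eqP; rewrite -subv0; apply/subvP => e; rewrite memv_ker memv0 -actHE => /eqP h.
by rewrite -(actEVK g e) h actHE linear0.
Qed.

Lemma actE_Esp I g e : e \in Esp I -> actE g e \in Esp I.
Proof. by move=> /mem_Esp h; apply/mem_Esp => i iI; rewrite prodV_ofE h // kact0. Qed.

Lemma actH_Esp I g : (actH g @: Esp I)%VS = Esp I.
Proof.
apply/eqP; rewrite eqEsubv; apply/andP; split; apply/subvP => e.
  by move=> /memv_imgP[f fI ->]; rewrite -actHE; exact: actE_Esp.
by move=> eI; rewrite -(actEKV g e) actHE memv_img // actE_Esp.
Qed.

Lemma actE_restr I g e : e \in Esp I -> actE (restrG I g) e = actE g e.
Proof.
move=> /mem_Esp h; apply: prodVP => i; rewrite !prodV_ofE ffunE.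
by case iI: (i \in I) => //; rewrite h ?iI // !kact0.
Qed.

End Basic.

(** * Derivatives of the data of an atlas *)

Section AtlasCalculus.
Variables (R : realType) (B : kbasic R) (X : topologicalType) (K : kdata B X) (d : int).
Hypothesis wK : is_watlas K d.
Local Notation N := (kN B).
Implicit Types I J L : {set 'I_N}.
Local Notation tangent M := 'rV[R]_(cdim M).

Lemma isd_cst (M : charted R) (W : vectType R) (c : W) (x : M) : isd (fun=> c) x 0.
Proof.
move=> e e0; apply: filterE => h _.
rewrite /= subrr zero_lfunE subr0 linear0 normr0.
by rewrite mulr_ge0 // ltW.
Qed.

Section Chart.
Variable I : {set 'I_N}.
Hypothesis iI : idx K I.
Let mI := wa_mfd wK iI.
Let hI := wa_chart wK iI.

Lemma U_good (x : kU K I) : good x. Proof. exact: mfd_good. Qed.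
Lemma U_at (x : kU K I) : mfd_at x. Proof. exact: mfd_mfd_at. Qed.

Lemma s_isd (x : kU K I) : isd (@ks R B X K I) x (dv (@ks R B X K I) x).
Proof. apply: smoothv_isd; [exact: U_good|exact: ch_s_smooth]. Qed.

(** E_I is the kernel of a linear map that vanishes along s_I; differentiating this identity
    confines the derivative as well. *)
Lemma s_limg (x : kU K I) : (limg (dv (@ks R B X K I) x) <= Esp I)%VS.
Proof.
have h := isd_lin (linfun (@restrE R B (~: I)%SET)) (s_isd x).
have h0 : isd (fun _ : kU K I => 0 : ET B) x (linfun (@restrE R B (~: I)%SET) \o dv (@ks R B X K I) x)%VF.
  apply: isd_ext h; first exact: U_good.
  apply: nearM_forall => y; apply/eqP; rewrite -memv_ker; exact: ch_s_val.
have e : (linfun (@restrE R B (~: I)%SET) \o dv (@ks R B X K I) x)%VF = 0.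
  by rewrite -(dv_isd (U_good x) h0) (dv_isd (U_good x) (@isd_cst _ _ _ _)).
apply/subvP => _ /memv_imgP[v _ ->]; rewrite memv_ker.
have := congr1 (fun h : 'Hom(_, _) => h v) e.
by rewrite comp_lfunE zero_lfunE => ->.
Qed.

Lemma act_ncont g (x : kU K I) : g \in Gam I -> ncont (@kaU R B X K I g) x.
Proof. by move=> gI; apply: smooth_map_ncont => //; exact: ch_act_smooth. Qed.

Lemma act_smooth g (x : kU K I) : g \in Gam I -> smoothv (chart (kaU g x) \o @kaU R B X K I g) x.
Proof. by move=> gI; have [] := ch_act_smooth hI x gI. Qed.

Lemma act_isd g (x : kU K I) : g \in Gam I ->
  isd (chart (kaU g x) \o @kaU R B X K I g) x (dm (@kaU R B X K I g) x).
Proof. by move=> gI; apply: smoothv_isd; [exact: U_good|exact: act_smooth]. Qed.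

Lemma kaU1 : @kaU R B X K I 1%g = id.
Proof. by apply/funext => x; exact: ch_act1. Qed.

Lemma kaUM g h : g \in Gam I -> h \in Gam I ->
  @kaU R B X K I (g * h)%g = @kaU R B X K I g \o @kaU R B X K I h.
Proof. by move=> gI hI'; apply/funext => x; exact: ch_actM. Qed.

Lemma dm_actM g h (x : kU K I) : g \in Gam I -> h \in Gam I ->
  dm (@kaU R B X K I (g * h)%g) x =
  (dm (@kaU R B X K I g) (kaU h x) \o dm (@kaU R B X K I h) x)%VF.
Proof.
move=> gI hI'; apply: dv_isd; first exact: U_good.
rewrite (kaUM gI hI'); apply: (isd_comp (f := @kaU R B X K I h)
  (g := chart (kaU g (kaU h x)) \o @kaU R B X K I g)).
- exact: U_good.
- exact: U_good.
- exact: act_ncont.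
- exact: act_isd.
- exact: act_isd.
Qed.

Lemma dm_act1 (x : kU K I) : dm (@kaU R B X K I 1%g) x = \1%VF.
Proof. by rewrite kaU1; apply: dm_id; exact: U_good. Qed.

Lemma dm_act_inj g (x : kU K I) : g \in Gam I -> lker (dm (@kaU R B X K I g) x) = 0%VS.
Proof.
move=> gI; apply: (hom_id_lker (g := dm (@kaU R B X K I g^-1%g) (kaU g x))).
by rewrite -dm_actM ?GamV // mulVg dm_act1.
Qed.

Lemma dm_act_sur g (x : kU K I) : g \in Gam I -> limg (dm (@kaU R B X K I g) x) = fullv.
Proof. by move=> gI; apply: lker0_limgf; apply/eqP; exact: dm_act_inj. Qed.

Lemma ds_act g (x : kU K I) : g \in Gam I ->
  (dv (@ks R B X K I) (kaU g x) \o dm (@kaU R B X K I g) x)%VF =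
  (actH g \o dv (@ks R B X K I) x)%VF.
Proof.
move=> gI; have h1 := isd_comp (U_good x) (U_good _) (@act_ncont g x gI) (@act_isd g x gI) (@s_isd (kaU g x)).
rewrite -(dv_isd (U_good x) h1); apply: dv_isd; first exact: U_good.
have := isd_lin (actH g) (@s_isd x); apply: isd_ext; first exact: U_good.
apply: nearM_forall => y /=; rewrite -(actHE (wa_basic wK)).
by rewrite (ch_s_equiv hI y gI).
Qed.

End Chart.

Section Change.
Variables I J : {set 'I_N}.
Hypotheses (iI : idx K I) (iJ : idx K J) (IJ : (I \proper J)%SET).
Let hIJ := wa_change wK iI iJ IJ.
Let mI := wa_mfd wK iI.
Let mJ := wa_mfd wK iJ.
Let mu := cc_tU hIJ.
Variable u : ktU K I J.
Local Notation emb := (@kemb R B X K I J).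
Local Notation rho := (@krho R B X K I J).
Local Notation sJ := (@ks R B X K J).
Local Notation sI := (@ks R B X K I).

Lemma tU_good : good u. Proof. exact: mfd_good. Qed.
Lemma tU_at : mfd_at u. Proof. exact: mfd_mfd_at. Qed.

Lemma emb_ncont : ncont emb u.
Proof. by have [_ h _ _] := cc_emb hIJ; apply: smooth_map_ncont => //. Qed.

Lemma emb_smooth : smoothv (chart (emb u) \o emb) u.
Proof. by have [_ h _ _] := cc_emb hIJ; have [] := h u. Qed.

Lemma emb_isd : isd (chart (emb u) \o emb) u (dm emb u).
Proof. exact: smoothv_isd tU_good emb_smooth. Qed.

Lemma emb_inj : lker (dm emb u) = 0%VS.
Proof. by have [_ _ h _] := cc_emb hIJ. Qed.

Lemma rho_facts : [/\ ncont rho u, smoothv (chart (rho u) \o rho) u, lker (dm rho u) = 0%VS,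
  limg (dm rho u) = fullv &
  forall P : ktU K I J -> Prop, nearM u P -> nearM (rho u) (fun y => exists2 w, P w & rho w = y)].
Proof. exact: local_diffeo_mfd (cc_rho_diffeo hIJ). Qed.

Lemma rho_isd : isd (chart (rho u) \o rho) u (dm rho u).
Proof. by have [_ h _ _ _] := rho_facts; exact: smoothv_isd tU_good h. Qed.

Lemma ds_rho : dv (@sIJ R B X K I J) u = (dv sI (rho u) \o dm rho u)%VF.
Proof.
have [h _ _ _ _] := rho_facts.
apply: (dv_isd tU_good); exact: isd_comp tU_good (U_good iI _) h rho_isd (s_isd iI _).
Qed.

Lemma ds_emb : dv (@sIJ R B X K I J) u = (dv sJ (emb u) \o dm emb u)%VF.
Proof.
have h := isd_comp tU_good (U_good iJ _) emb_ncont emb_isd (@s_isd _ iJ (emb u)).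
apply: (dv_isd tU_good); apply: isd_ext h; first exact: tU_good.
by apply: nearM_forall => y /=; rewrite (cc_s hIJ).
Qed.

Lemma ds_emb_rho a : dv sJ (emb u) (dm emb u a) = dv sI (rho u) (dm rho u a).
Proof. by rewrite -!comp_lfunE -ds_emb -ds_rho. Qed.

Lemma limg_sIJ : limg (dv (@sIJ R B X K I J) u) = limg (dv sI (rho u)).
Proof. by have [_ _ _ h _] := rho_facts; rewrite ds_rho limg_comp h. Qed.

Lemma E_sub : (Esp I <= @Esp R B J)%VS.
Proof. by apply: Esp_sub; exact: proper_sub IJ. Qed.

Lemma coker_compl : exists C : {vspace ET B}, [/\ (limg (dv sI (rho u)) + C = Esp I)%VS,
  (limg (dv sI (rho u)) :&: C = 0)%VS, (limg (dv sJ (emb u)) + C = Esp J)%VS &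
  (limg (dv sJ (emb u)) :&: C = 0)%VS].
Proof.
pose C := (Esp I :\: limg (dv sI (rho u)))%VS.
have e1 : (limg (dv sI (rho u)) + C = Esp I)%VS.
  by rewrite addvC addv_diff; apply/addv_idPl; exact: s_limg.
have e2 : (limg (dv sI (rho u)) :&: C = 0)%VS by rewrite capvC capv_diff.
exists C; have := @cc_index_coker _ _ _ _ _ _ hIJ u C.
by rewrite limg_sIJ => /(_ e1 e2)[].
Qed.

(** The form in which the index condition is used. A complement C of the image of ds_I in E_I is
    also one of the image of ds_J in E_J. If the image of x lies in E_I, subtracting a tangent
    vector of tilde U_IJ leaves a value in C and in the image of ds_J, hence 0; and the kernel of
    ds_J is tangent to tilde U_IJ. *)
Lemma ds_EI x : (dv sJ (emb u) x \in Esp I) = (x \in limg (dm emb u)).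
Proof.
apply/idP/idP => [|/memv_imgP[a _ ->]]; last first.
  by rewrite ds_emb_rho; apply: subvP (s_limg iI (rho u)) _ (memv_img _ (memvf _)).
have [C [e1 e2 e3 e4]] := coker_compl.
rewrite -e1 => /memv_addP[_ /memv_imgP[b _ ->] [c cC e]].
have [_ _ _ hs _] := rho_facts.
have : b \in limg (dm rho u) by rewrite hs memvf.
case/memv_imgP => a _ eb; rewrite eb -ds_emb_rho in e.
have ec : dv sJ (emb u) (x - dm emb u a) = c.
  by rewrite [LHS]linearB /=; apply/eqP; rewrite subr_eq addrC; apply/eqP.
have : c \in (limg (dv sJ (emb u)) :&: C)%VS.
  by rewrite memv_cap cC andbT -ec memv_img // memvf.
rewrite e4 memv0 => /eqP c0.
have : x - dm emb u a \in lker (dv sJ (emb u)) by rewrite memv_ker ec c0.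
rewrite -(cc_index_ker hIJ) => /memv_imgP[b' _ eb'].
by rewrite -[x](subrK (dm emb u a)) eb' rpredD // memv_img // memvf.
Qed.

Lemma ds_sum : (limg (dv sJ (emb u)) + Esp I = Esp J)%VS.
Proof.
have [C [e1 e2 e3 e4]] := coker_compl.
apply/eqP; rewrite eqEsubv subv_add (s_limg iJ) E_sub /= -{1}e3 addvS //.
by rewrite -e1 addvSr.
Qed.

Lemma lker_ds : (dm emb u @: lker (dv (@sIJ R B X K I J) u) = lker (dv sJ (emb u)))%VS.
Proof. exact: cc_index_ker. Qed.

Variable Nb : normal_family K.
Hypothesis hNb : is_normal_choice Nb.

Lemma Ctilde_wedge a v2 w : basis_of fullv a ->
  basis_of fullv ([seq dm emb u x | x <- a] ++ v2) -> basis_of (Esp I) w ->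
  Ctilde Nb u (wedge fullv (Esp J) 0 ([seq dm emb u x | x <- a] ++ v2)
    (w ++ [seq dv sJ (emb u) x | x <- v2])) =
  wedge fullv (Esp I) 0 [seq dm rho u x | x <- a] w.
Proof.
move=> ba bv bw; have [_ _ h3 h4 _] := rho_facts.
have [n1 n2] := nb_compl (hNb iI iJ IJ) u.
exact: (Ct_wedge emb_inj h3 h4 E_sub (s_limg iJ _) ds_EI ds_sum n1 n2 ba bv bw).
Qed.

Lemma tr_frames a v2 w : basis_of fullv a ->
  basis_of fullv ([seq dm emb u x | x <- a] ++ v2) -> basis_of (Esp I) w ->
  dframe fullv (Esp J) 0 ([seq dm emb u x | x <- a] ++ v2)
    (w ++ [seq dv sJ (emb u) x | x <- v2]) /\
  dframe fullv (@Esp R B I) 0 [seq dm rho u x | x <- a] w.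
Proof.
move=> ba bv bw; have [_ _ h3 h4 _] := rho_facts.
rewrite /dframe bv !qbasis0 bw (normal_frame emb_inj ds_EI ds_sum ba bv bw) andbT.
split=> //; have := @limg_basis_of _ _ _ (dm rho u) _ _ _ ba.
by rewrite h4 h3 capv0 andbT; apply.
Qed.

Lemma tr_frame_exists a : basis_of fullv a ->
  exists v2, basis_of fullv ([seq dm emb u x | x <- a] ++ v2).
Proof. exact: (normal_complete emb_inj). Qed.

Lemma CtildeD a c c' : Ctilde Nb u (a *: c + c') = a *: Ctilde Nb u c + Ctilde Nb u c'.
Proof. by rewrite /Ctilde /Defs.contraction !linemap_linear. Qed.

Lemma Ctilde_iso : lin_iso (Ctilde Nb u).
Proof.
have ba : basis_of fullv (vbasis {: tangent (ktU K I J)}) by exact: vbasisP.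
have [v2 bv] := tr_frame_exists ba.
have bw : basis_of (@Esp R B I) (vbasis (Esp I)) by exact: vbasisP.
have [f1 f2] := tr_frames ba bv bw.
by apply: line_iso f1 f2 _; [exact: CtildeD|exact: Ctilde_wedge].
Qed.

Lemma tr_Ctilde c : @detK_tr R B X K Nb I J u (krho u) (kemb u) (Ctilde Nb u c) = c.
Proof.
rewrite /detK_tr; case: xgetP => [c' _ /= /(lin_iso_inj Ctilde_iso)//|/(_ c)[]//].
Qed.

Lemma Ctilde_tr c : Ctilde Nb u (@detK_tr R B X K Nb I J u (krho u) (kemb u) c) = c.
Proof. by have [c' <-] := lin_iso_sur c Ctilde_iso; rewrite tr_Ctilde. Qed.

Lemma tr_wedge a v2 w : basis_of fullv a ->
  basis_of fullv ([seq dm emb u x | x <- a] ++ v2) -> basis_of (Esp I) w ->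
  @detK_tr R B X K Nb I J u (krho u) (kemb u) (wedge fullv (Esp I) 0 [seq dm rho u x | x <- a] w) =
  wedge fullv (Esp J) 0 ([seq dm emb u x | x <- a] ++ v2)
    (w ++ [seq dv sJ (emb u) x | x <- v2]).
Proof. by move=> ba bv bw; rewrite -(Ctilde_wedge ba bv bw) tr_Ctilde. Qed.

Lemma tr_iso : lin_iso (@detK_tr R B X K Nb I J u (krho u) (kemb u)).
Proof.
have := Ctilde_iso => -[lC bC]; split.
  move=> a c c'; apply: (lin_iso_inj Ctilde_iso).
  by rewrite lC !Ctilde_tr.
by exists (Ctilde Nb u) => c; [exact: Ctilde_tr|exact: tr_Ctilde].
Qed.

End Change.

Lemma Ctilde_indep Nb Nb' I J (u : ktU K I J) c :
  is_normal_choice Nb -> is_normal_choice Nb' ->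
  idx K I -> idx K J -> (I \proper J)%SET -> Ctilde Nb u c = Ctilde Nb' u c.
Proof.
move=> hN hN' iI iJ IJ.
have ba : basis_of fullv (vbasis {: tangent (ktU K I J)}) by exact: vbasisP.
have [v2 bv] := tr_frame_exists iI iJ IJ u ba.
have bw : basis_of (@Esp R B I) (vbasis (Esp I)) by exact: vbasisP.
have [f1 f2] := tr_frames iI iJ IJ ba bv bw.
apply: (line_eq _ _ f1).
- by move=> a x; exact: lin_isoZ (Ctilde_iso iI iJ IJ u hN).
- by move=> a x; exact: lin_isoZ (Ctilde_iso iI iJ IJ u hN').
- by rewrite !Ctilde_wedge.
Qed.

End AtlasCalculus.

(** * Tangent maps of lifted actions and of triple overlaps *)

Section TangentMaps.
Variables (R : realType) (B : kbasic R) (X : topologicalType) (K : kdata B X) (d : int).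
Hypothesis wK : is_watlas K d.
Local Notation N := (kN B).
Implicit Types I J L : {set 'I_N}.
Local Notation emb := (@kemb R B X K _ _).
Local Notation rho := (@krho R B X K _ _).

(** A is the derivative at u of the action of g on tilde U_IJ. This action is available only through
    its image in U_J, so it is built as a lift V through the embedding; equivariance of [krho] then
    gives the second identity. *)
Lemma equiv_tangent I J g (u u' : ktU K I J) :
  idx K I -> idx K J -> (I \proper J)%SET -> g \in Gam J -> kemb u' = kaU g (kemb u) ->
  exists A : 'End('rV[R]_(cdim (ktU K I J))),
    (dm emb u' \o A = dm (@kaU R B X K J g) (kemb u) \o dm emb u)%VF /\
    (dm rho u' \o A = dm (@kaU R B X K I (restrG I g)) (krho u) \o dm rho u)%VF.
Proof.
move=> iI iJ IJ gJ euu'; have hIJ := wa_change wK iI iJ IJ.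
have mu := cc_tU hIJ; have mI := wa_mfd wK iI; have mJ := wa_mfd wK iJ.
have [emb_in _ _ _] := cc_emb hIJ.
pose V y := sval (cid (cc_tU_inv hIJ y gJ)).
have hV y : kemb (V y) = kaU g (kemb y) by exact: (svalP (cid (cc_tU_inv hIJ y gJ))).
have Vu : V u = u' by apply: emb_in; rewrite hV.
have gr : restrG I g \in Gam I by exact: restrG_Gam.
have cK : ncont (@kaU R B X K J g \o emb) u.
  exact: ncont_comp (emb_ncont wK iI iJ IJ (u:=u)) (act_ncont wK iJ (x:=kemb u) gJ).
have cV : ncont V u.
  apply: embedding_ncont mu mJ (cc_emb hIJ) _ _ cK; last exact: hV.
  by apply: nearM_forall; exact: hV.
have hK : isd (chart (kemb (V u)) \o (@kaU R B X K J g \o emb)) u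
    (dm (@kaU R B X K J g) (kemb u) \o dm emb u)%VF.
  rewrite hV; exact: (isd_comp (mfd_good mu u) (mfd_good mJ (kemb u)) (emb_ncont wK iI iJ IJ (u:=u))
    (emb_isd wK iI iJ IJ u) (act_isd wK iJ (kemb u) gJ)).
have := cancel_isd (mfd_good mu u) (mfd_good mu (V u)) (mfd_good mJ (kemb (V u))) cV
  (emb_ncont wK iI iJ IJ (u:=V u)) (emb_smooth wK iI iJ IJ (V u))
  (emb_inj wK iI iJ IJ (V u)) (nearM_forall u hV) hK.
move=> [dV0 eV]; rewrite Vu in eV; exists (dm V u); split; first exact: eV.
have [cr _ _ _ _] := rho_facts wK iI iJ IJ u.
have cV' := cV; have gV := mfd_good mu (V u).
have h1 : isd (chart (krho (V u)) \o (rho \o V)) u (dm rho (V u) \o dm V u)%VF.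
  exact: (isd_comp (mfd_good mu u) gV cV' dV0 (rho_isd wK iI iJ IJ (V u))).
have er y : krho (V y) = kaU (restrG I g) (krho y) by apply: cc_rho_equiv hIJ _ _ _ gJ (hV y).
have h2 : isd (chart (kaU (restrG I g) (krho u)) \o (@kaU R B X K I (restrG I g) \o rho)) u
   (dm (@kaU R B X K I (restrG I g)) (krho u) \o dm rho u)%VF.
  exact: (isd_comp (mfd_good mu u) (mfd_good mI (krho u)) cr (rho_isd wK iI iJ IJ u)
    (act_isd wK iI (krho u) gr)).
have : isd (chart (kaU (restrG I g) (krho u)) \o (@kaU R B X K I (restrG I g) \o rho)) u
   (dm rho (V u) \o dm V u)%VF.
  rewrite -er; apply: isd_ext h1; first exact: mfd_good.
  by apply: nearM_forall => y /=; rewrite (er y).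
by move=> /(dv_isd (mfd_good mu u)); rewrite (dv_isd (mfd_good mu u) h2) Vu.
Qed.

Definition local_agree := forall I J L, idx K I -> idx K J -> idx K L ->
  (I \proper J)%SET -> (J \proper L)%SET ->
  forall (u : ktU K I L) (v : ktU K J L) (w : ktU K I J),
    kemb u = kemb v -> krho v = kemb w ->
    nearM u (fun u1 => exists (v1 : ktU K J L) (w1 : ktU K I J),
      kemb u1 = kemb v1 /\ krho v1 = kemb w1).

Hypothesis la : local_agree.

Lemma cocycle_tangent I J L (u : ktU K I L) (v : ktU K J L) (w : ktU K I J) :
  idx K I -> idx K J -> idx K L -> (I \proper J)%SET -> (J \proper L)%SET ->
  kemb u = kemb v -> krho v = kemb w ->
  exists A D, [/\ (dm emb v \o A = dm emb u)%VF, (dm emb w \o D = dm rho v \o A)%VF &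
    (dm rho w \o D = dm rho u)%VF].
Proof.
move=> iI iJ iL IJ JL euv evw.
have IL : (I \proper L)%SET by exact: proper_trans IJ JL.
have hIJ := wa_change wK iI iJ IJ; have hJL := wa_change wK iJ iL JL.
have hIL := wa_change wK iI iL IL.
have mI := wa_mfd wK iI; have mJ := wa_mfd wK iJ; have mL := wa_mfd wK iL.
have mu := cc_tU hIL; have mv := cc_tU hJL; have mw := cc_tU hIJ.
have [ein_v _ _ _] := cc_emb hJL; have [ein_w _ _ _] := cc_emb hIJ.
pose P (u1 : ktU K I L) (q : ktU K J L * ktU K I J) := kemb u1 = kemb q.1 /\ krho q.1 = kemb q.2 :> kU K J.
(* The default [(v, w)] outside the overlap is immaterial: only the germ at u is differentiated. *)
pose Q (u1 : ktU K I L) := if pselect (exists q, P u1 q) is left h then sval (cid h) else (v, w).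
pose V (u1 : ktU K I L) := (Q u1).1; pose W (u1 : ktU K I L) := (Q u1).2.
have near_P : nearM u (fun u1 => P u1 (Q u1)).
  apply: nearMS (la iI iJ iL IJ JL euv evw) => u1 [v1 [w1 [e1 e2]]].
  rewrite /Q; case: pselect => [h|[]]; first exact: (svalP (cid h)).
  by exists (v1, w1).
have [eV eW] := near_self (mfd_good mu u) near_P.
have Vu : V u = v by apply: ein_v; rewrite -euv -eV.
have Wu : W u = w by apply: ein_w; rewrite -evw -Vu -eW.
have cu := emb_ncont wK iI iL IL (u:=u).
have nV : nearM u (fun u1 => kemb (V u1) = kemb u1) by apply: nearMS near_P => u1 [->].
have cV : ncont V u.
  by apply: embedding_ncont mv mL (cc_emb hJL) nV _ cu; rewrite Vu.
have hK : isd (chart (kemb (V u)) \o emb) u (dm emb u).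
  rewrite Vu -euv; exact: (emb_isd wK iI iL IL _).
have [dV eqV] := cancel_isd (mfd_good mu u) (mfd_good mv (V u)) (mfd_good mL (kemb (V u))) cV
  (emb_ncont wK iJ iL JL (u:=V u)) (emb_smooth wK iJ iL JL (V u))
  (emb_inj wK iJ iL JL (V u)) nV hK.
have [cr _ _ _ _] := rho_facts wK iJ iL JL (V u).
have crV : ncont (rho \o V) u by exact: ncont_comp cV cr.
have nW : nearM u (fun u1 => kemb (W u1) = krho (V u1)) by apply: nearMS near_P => u1 [_ ->].
have cW : ncont W u.
  by apply: embedding_ncont mw mJ (cc_emb hIJ) nW _ crV; rewrite Vu Wu.
have hrV : isd (chart (kemb (W u)) \o (rho \o V)) u (dm rho (V u) \o dm V u)%VF.
  have -> : kemb (W u) = krho (V u) by rewrite Vu Wu.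
  apply: (isd_comp (f := V) (g := chart (krho (V u)) \o rho)) => //.
  - exact: mfd_good.
  - exact: mfd_good.
  - exact: (rho_isd wK iJ iL JL _).
have [dW eqW] := cancel_isd (mfd_good mu u) (mfd_good mw (W u)) (mfd_good mJ (kemb (W u))) cW
  (emb_ncont wK iI iJ IJ (u:=W u)) (emb_smooth wK iI iJ IJ (W u))
  (emb_inj wK iI iJ IJ (W u)) nW hrV.
have [crw _ _ _ _] := rho_facts wK iI iJ IJ (W u).
have h1 : isd (chart (krho (W u)) \o (rho \o W)) u (dm rho (W u) \o dm W u)%VF.
  apply: (isd_comp (f := W) (g := chart (krho (W u)) \o rho)) => //.
  - exact: mfd_good.
  - exact: mfd_good.
  - exact: (rho_isd wK iI iJ IJ _).
have nR : nearM u (fun u1 => krho (W u1) = krho u1).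
  apply: nearMS near_P => u1 [e1 e2]; apply/esym.
  exact: (wa_cocycle wK iI iJ iL IJ JL e1 e2).
have eR : krho w = krho u by rewrite -Wu; exact: near_self (mfd_good mu u) nR.
have h2 : isd (chart (krho (W u)) \o rho) u (dm rho (W u) \o dm W u)%VF.
  by apply: isd_ext h1; [exact: mfd_good|apply: nearMS nR => u1 /= ->].
rewrite Wu eR in h2.
exists (dm V u), (dm W u); rewrite Vu in eqV eqW; rewrite Wu in eqW.
split=> //; apply/esym; exact: dv_isd (mfd_good mu u) h2.
Qed.

End TangentMaps.

(** * Group actions and the contractions C_ds on frames *)

Section Pointwise.
Variables (R : realType) (B : kbasic R) (X : topologicalType) (K : kdata B X) (d : int).
Hypothesis wK : is_watlas K d.
Local Notation N := (kN B).
Implicit Types I J L : {set 'I_N}.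
Local Notation emb := (@kemb R B X K _ _).
Local Notation rho := (@krho R B X K _ _).
Local Notation ds I := (dv (@ks R B X K I)).
Local Notation dact I g := (dm (@kaU R B X K I g)).
Local Notation kact I g x := (@detK_act R B X K I g x (kaU g x)).
Local Notation sact I g x := (@detS_act R B X K I g x (kaU g x)).
Local Notation str I J u := (@detS_tr R B X K I J u (krho u) (kemb u)).

Lemma lker_id (V : vectType R) : lker (\1%VF : 'End(V)) = 0%VS.
Proof. by apply/eqP; rewrite -subv0; apply/subvP => x; rewrite memv_ker id_lfunE memv0. Qed.

Lemma map_id_lfun (V : vectType R) (s : seq V) : [seq (\1%VF : 'End(V)) a | a <- s] = s.
Proof. by rewrite map_id_in // => x _; rewrite id_lfunE. Qed.

Section Chart.
Variable I : {set 'I_N}.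
Hypothesis iI : idx K I.

Lemma PsiK_frames (x : kU K I) v' v2 w' : basis_of (lker (ds I x)) v' ->
  basis_of fullv (v' ++ v2) -> qbasis_of (Esp I) (limg (ds I x)) w' ->
  dframe fullv (@Esp R B I) 0 (v' ++ v2) (w' ++ [seq ds I x a | a <- v2]) /\
  dframe (lker (ds I x)) (Esp I) (limg (ds I x)) v' w'.
Proof.
move=> bv' bv bw'; rewrite /dframe bv bv' bw' qbasis0; split=> //=.
have := @contraction_frame _ _ _ _ _ (ds I x) _ \1%VF (lker_id _) (lim1g _)
  (s_limg wK iI x) v' v2 w' bv'.
by rewrite map_id_lfun; apply.
Qed.

Lemma PsiK_wedge (x : kU K I) v' v2 w' : basis_of (lker (ds I x)) v' ->
  basis_of fullv (v' ++ v2) -> qbasis_of (Esp I) (limg (ds I x)) w' ->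
  PsiK K I x (wedge fullv (Esp I) 0 (v' ++ v2) (w' ++ [seq ds I x a | a <- v2])) =
  wedge (lker (ds I x)) (Esp I) (limg (ds I x)) v' w'.
Proof.
move=> bv' bv bw'.
have := @contraction_wedge _ _ _ _ _ (ds I x) _ \1%VF (lker_id _) (lim1g _)
  (s_limg wK iI x) v' v2 w' bv'.
by rewrite map_id_lfun; apply.
Qed.

Lemma PsiK_frame_exists (x : kU K I) : exists v' v2 w',
  [/\ basis_of (lker (ds I x)) v', basis_of fullv (v' ++ v2) &
      qbasis_of (Esp I) (limg (ds I x)) w'].
Proof.
have [w' bw'] := qbasis_exists (s_limg wK iI x).
have bv' : basis_of (lker (ds I x)) (vbasis (lker (ds I x))) by exact: vbasisP.
have [v2 bv] := complete_basis (basis_free bv') (subvf _).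
by exists (vbasis (lker (ds I x))), v2, w'.
Qed.

Lemma PsiKD (x : kU K I) a c c' : PsiK K I x (a *: c + c') = a *: PsiK K I x c + PsiK K I x c'.
Proof. exact: linemap_linear. Qed.

Lemma PsiK_iso (x : kU K I) : lin_iso (PsiK K I x).
Proof.
have [v' [v2 [w' [bv' bv bw']]]] := PsiK_frame_exists x.
have [f1 f2] := PsiK_frames bv' bv bw'.
by apply: line_iso f1 f2 _; [exact: PsiKD|exact: PsiK_wedge].
Qed.

Lemma detK_frame_exists : exists v w, dframe (fullv : {vspace 'rV[R]_(cdim (kU K I))}) (@Esp R B I) 0 v w.
Proof. by apply: dframe_exists; rewrite sub0v. Qed.

Section Act.
Variables (g : GT B) (x : kU K I).
Hypothesis gI : g \in Gam I.

Lemma act_frame v w : dframe fullv (Esp I) 0 v w ->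
  dframe fullv (Esp I) 0 [seq dact I g x a | a <- v] [seq actH g a | a <- w].
Proof.
apply: map_frame.
- by rewrite capvf (dm_act_inj wK iI x gI).
- exact: (dm_act_sur wK iI x gI).
- exact: (actH_inj (wa_basic wK) g).
- exact: (actH_Esp (wa_basic wK) I g).
- exact: limg0.
Qed.

Lemma act_wedge v w : dframe fullv (Esp I) 0 v w ->
  kact I g x (wedge fullv (Esp I) 0 v w) =
  wedge fullv (Esp I) 0 [seq dact I g x a | a <- v] [seq actH g a | a <- w].
Proof.
apply: linemap_map.
- exact: (actHE (wa_basic wK) g).
- by rewrite capvf (dm_act_inj wK iI x gI).
- exact: (dm_act_sur wK iI x gI).
- exact: (actH_inj (wa_basic wK) g).
- exact: (actH_Esp (wa_basic wK) I g).
- exact: limg0.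
Qed.

Lemma act_iso : lin_iso (kact I g x).
Proof.
have [v [w f]] := detK_frame_exists.
by apply: line_iso f (act_frame f) (act_wedge f) => a c c'; exact: linemap_linear.
Qed.

Lemma lker_act : (dact I g x @: lker (ds I x) = lker (ds I (kaU g x)))%VS.
Proof.
have e v : ds I (kaU g x) (dact I g x v) = actH g (ds I x v).
  by rewrite -!comp_lfunE (ds_act wK iI x gI).
apply/eqP; rewrite eqEsubv; apply/andP; split; apply/subvP => v.
  by case/memv_imgP => a; rewrite memv_ker => /eqP ak ->; rewrite memv_ker e ak linear0.
have : v \in limg (dact I g x) by rewrite (dm_act_sur wK iI x gI) memvf.
case/memv_imgP => a _ ->; rewrite memv_ker e => h; apply: memv_img.
have : ds I x a \in lker (actH g) by rewrite memv_ker.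
by rewrite (actH_inj (wa_basic wK) g) memv0 memv_ker.
Qed.

Lemma limg_act : (actH g @: limg (ds I x) = limg (ds I (kaU g x)))%VS.
Proof.
by rewrite -limg_comp -(ds_act wK iI x gI) limg_comp (dm_act_sur wK iI x gI).
Qed.

Lemma sact_wedge v w : dframe (lker (ds I x)) (Esp I) (limg (ds I x)) v w ->
  sact I g x (wedge (lker (ds I x)) (Esp I) (limg (ds I x)) v w) =
  wedge (lker (ds I (kaU g x))) (Esp I) (limg (ds I (kaU g x)))
    [seq dact I g x a | a <- v] [seq actH g a | a <- w].
Proof.
apply: linemap_map.
- exact: (actHE (wa_basic wK) g).
- by rewrite (dm_act_inj wK iI x gI) cap0v.
- exact: lker_act.
- exact: (actH_inj (wa_basic wK) g).
- exact: (actH_Esp (wa_basic wK) I g).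
- exact: limg_act.
Qed.

(** ds intertwines the action on tangent vectors with that on obstruction spaces, so g carries a
    frame adapted to the contraction at x to one adapted at g x. *)
Lemma PsiK_act c : PsiK K I (kaU g x) (kact I g x c) = sact I g x (PsiK K I x c).
Proof.
have [v' [v2 [w' [bv' bv bw']]]] := PsiK_frame_exists x.
have [f1 f2] := PsiK_frames bv' bv bw'.
move: c; apply: (line_eq (T := fun c => PsiK K I (kaU g x) (kact I g x c))
  (T' := fun c => sact I g x (PsiK K I x c)) _ _ f1).
- by move=> a c; rewrite (lin_isoZ _ _ act_iso) (lin_isoZ _ _ (PsiK_iso _)).
- by move=> a c; rewrite (lin_isoZ _ _ (PsiK_iso _)); exact: linemapZ.
rewrite PsiK_wedge // sact_wedge // act_wedge // !map_cat.
have -> : [seq actH g a | a <- [seq ds I x a | a <- v2]] =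
    [seq ds I (kaU g x) a | a <- [seq dact I g x a | a <- v2]].
  rewrite -!map_comp; apply: eq_map => a /=.
  by rewrite -!comp_lfunE (ds_act wK iI x gI).
have /andP[b1 q1] := act_frame f1; rewrite map_cat in b1.
have : dframe (lker (ds I (kaU g x))) (Esp I) (limg (ds I (kaU g x)))
    [seq dact I g x a | a <- v'] [seq actH g a | a <- w'].
  apply: map_frame f2.
  - by rewrite (dm_act_inj wK iI x gI) cap0v.
  - exact: lker_act.
  - exact: (actH_inj (wa_basic wK) g).
  - exact: (actH_Esp (wa_basic wK) I g).
  - exact: limg_act.
by move=> /andP[b2 q2]; rewrite PsiK_wedge.
Qed.

End Act.

Lemma detK_act1 (x : kU K I) c : @detK_act R B X K I 1%g x x c = c.
Proof.
have [v [w f]] := detK_frame_exists.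
move: c; apply: (line_eq (T' := id) _ _ f) => //.
  by move=> a c; exact: linemapZ.
have := act_wedge x (Gam1 I) f; rewrite (kaU1 wK iI) => ->.
rewrite (dm_id (U_good wK iI x)) map_id_lfun; congr wedge.
by rewrite map_id_in // => e _; rewrite -(actHE (wa_basic wK)) (actE1 (wa_basic wK)).
Qed.

Lemma detK_actM g h (x : kU K I) c : g \in Gam I -> h \in Gam I ->
  @detK_act R B X K I (g * h)%g x (kaU (g * h)%g x) c =
  @detK_act R B X K I g (kaU h x) (kaU (g * h)%g x) (kact I h x c).
Proof.
move=> gI hI; have ghI := GamM gI hI.
have [v [w f]] := detK_frame_exists.
have e : kaU (g * h)%g x = kaU g (kaU h x) by rewrite (ch_actM (wa_chart wK iI) x gI hI).
move: c; apply: (line_eq (T := @detK_act R B X K I (g * h)%g x (kaU (g * h)%g x))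
  (T' := fun c => @detK_act R B X K I g (kaU h x) (kaU (g * h)%g x) (kact I h x c)) _ _ f).
- by move=> a c; exact: linemapZ.
- by move=> a c; rewrite (lin_isoZ _ _ (act_iso x hI)); exact: linemapZ.
rewrite act_wedge // act_wedge //; rewrite e; rewrite act_wedge //; last exact: act_frame.
rewrite -!map_comp; congr wedge.
  by apply: eq_map => a /=; rewrite (dm_actM wK iI x gI hI) comp_lfunE.
by apply: eq_map => a /=; rewrite -!(actHE (wa_basic wK)) (actEM (wa_basic wK)).
Qed.

End Chart.

Section Change.
Variables I J : {set 'I_N}.
Hypotheses (iI : idx K I) (iJ : idx K J) (IJ : (I \proper J)%SET).

(** This is the complement form of the index condition, applied to the span of w. *)
Lemma qbasis_change_chart (u : ktU K I J) w :
  qbasis_of (Esp I) (limg (ds I (krho u))) w ->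
  qbasis_of (Esp J) (limg (ds J (kemb u))) w.
Proof.
move=> /qbasisP[fw cw sw].
have hIJ := wa_change wK iI iJ IJ.
have [h1 h2] := @cc_index_coker _ _ _ _ _ _ hIJ u << w >>%VS
  (etrans (congr1 (fun U => U + << w >>)%VS (limg_sIJ wK iI iJ IJ u)) (etrans (addvC _ _) sw))
  (etrans (congr1 (fun U => U :&: << w >>)%VS (limg_sIJ wK iI iJ IJ u)) (etrans (capvC _ _) cw)).
by apply/qbasisP; rewrite capvC h2 addvC h1.
Qed.

Lemma lker_rho (u : ktU K I J) :
  (dm rho u @: lker (dv (@sIJ R B X K I J) u) = lker (ds I (krho u)))%VS.
Proof.
have [_ _ h3 h4 _] := rho_facts wK iI iJ IJ u.
rewrite (ds_rho wK iI iJ IJ u); apply/eqP; rewrite eqEsubv; apply/andP; split; apply/subvP => v.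
  by case/memv_imgP => a; rewrite memv_ker comp_lfunE => ak ->; rewrite memv_ker.
have : v \in limg (dm rho u) by rewrite h4 memvf.
by case/memv_imgP => a _ -> ak; apply: memv_img; rewrite memv_ker comp_lfunE -memv_ker.
Qed.

Lemma str_frames (u : ktU K I J) a' w : basis_of (lker (dv (@sIJ R B X K I J) u)) a' ->
  qbasis_of (Esp I) (limg (ds I (krho u))) w ->
  dframe (lker (ds I (krho u))) (Esp I) (limg (ds I (krho u))) [seq dm rho u a | a <- a'] w /\
  dframe (lker (ds J (kemb u))) (Esp J) (limg (ds J (kemb u))) [seq dm emb u a | a <- a'] w.
Proof.
move=> ba qw; have [_ _ h3 h4 _] := rho_facts wK iI iJ IJ u.
rewrite /dframe qw (qbasis_change_chart qw) !andbT; split.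
  by rewrite -lker_rho; apply: limg_basis_of ba; rewrite h3 capv0.
by rewrite -(lker_ds wK iI iJ IJ u); apply: limg_basis_of ba; rewrite (emb_inj wK iI iJ IJ u) capv0.
Qed.

Lemma limg_ds_sub (u : ktU K I J) : (limg (ds I (krho u)) <= limg (ds J (kemb u)))%VS.
Proof.
rewrite -(limg_sIJ wK iI iJ IJ u) (ds_emb wK iI iJ IJ u) limg_comp.
by apply: limgS; exact: subvf.
Qed.

Lemma str_wedge (u : ktU K I J) a' w : basis_of (lker (dv (@sIJ R B X K I J) u)) a' ->
  qbasis_of (Esp I) (limg (ds I (krho u))) w ->
  str I J u (wedge (lker (ds I (krho u))) (Esp I) (limg (ds I (krho u))) [seq dm rho u a | a <- a'] w) =
  wedge (lker (ds J (kemb u))) (Esp J) (limg (ds J (kemb u))) [seq dm emb u a | a <- a'] w.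
Proof.
move=> ba qw; have [f1 f2] := str_frames ba qw.
have [_ _ h3 _ _] := rho_facts wK iI iJ IJ u.
exact: (linemap_span h3 (limg_ds_sub u) f1 f2).
Qed.

Variable Nb : normal_family K.
Hypothesis hNb : is_normal_choice Nb.
Local Notation ktr u := (@detK_tr R B X K Nb I J u (krho u) (kemb u)).

(** One frame serves all four maps: a basis [a'] of the kernel of d s_IJ, completed by [a2] to a
    frame of tilde U_IJ and by [v2] to one of U_J. It is adapted to the transition map, and its
    images are adapted to both contractions, with [a'] as the kernel part in either chart. *)
Lemma PsiK_tr (u : ktU K I J) c :
  str I J u (PsiK K I (krho u) c) = PsiK K J (kemb u) (ktr u c).
Proof.
have [_ _ h3 h4 _] := rho_facts wK iI iJ IJ u.
pose a' : seq _ := vbasis (lker (dv (@sIJ R B X K I J) u)).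
have ba' : basis_of (lker (dv (@sIJ R B X K I J) u)) a' by exact: vbasisP.
have [a2 ba] := complete_basis (basis_free ba') (subvf _).
have [v2 bv] := tr_frame_exists wK iI iJ IJ u ba.
have [w' qw] := qbasis_exists (s_limg wK iI (krho u)).
have br : basis_of fullv [seq dm rho u a | a <- a' ++ a2].
  by have := @limg_basis_of _ _ _ (dm rho u) _ _ _ ba; rewrite h4 h3 capv0; apply.
have [/andP[bk _] f2] := str_frames ba' qw.
rewrite map_cat in br.
have [g1 g2] := PsiK_frames iI bk br qw.
have bw := (andP g1).2; rewrite qbasis0 in bw.
have bw0 : basis_of (Esp I) (w' ++ [seq ds I (krho u) x | x <- [seq dm rho u a | a <- a2]]) by exact: bw.
move: c; apply: (line_eq (T := fun c => str I J u (PsiK K I (krho u) c))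
  (T' := fun c => PsiK K J (kemb u) (ktr u c)) _ _ g1).
- by move=> a c; rewrite (lin_isoZ _ _ (PsiK_iso iI _)); exact: linemapZ.
- by move=> a c; rewrite (lin_isoZ _ _ (tr_iso wK iI iJ IJ u hNb)) (lin_isoZ _ _ (PsiK_iso iJ _)).
rewrite PsiK_wedge // str_wedge // -map_cat (tr_wedge wK iI iJ IJ hNb ba bv bw0).
have -> : [seq ds I (krho u) x | x <- [seq dm rho u a | a <- a2]] =
    [seq ds J (kemb u) x | x <- [seq dm emb u a | a <- a2]].
  by rewrite -!map_comp; apply: eq_map => a /=; rewrite (ds_emb_rho wK iI iJ IJ u).
have [_ /andP[bJ qJ]] := str_frames ba' qw.
rewrite map_cat -!catA -map_cat PsiK_wedge //.
by move: bv; rewrite map_cat -catA.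
Qed.

End Change.

End Pointwise.

(** * Equivariance and cocycle condition for the transition maps of det K *)

Section Transitions.
Variables (R : realType) (B : kbasic R) (X : topologicalType) (K : kdata B X) (d : int).
Hypothesis wK : is_watlas K d.
Local Notation N := (kN B).
Implicit Types I J L : {set 'I_N}.
Local Notation emb := (@kemb R B X K _ _).
Local Notation rho := (@krho R B X K _ _).
Local Notation ds I := (dv (@ks R B X K I)).
Local Notation dact I g := (dm (@kaU R B X K I g)).
Variable Nb : normal_family K.
Hypothesis hNb : is_normal_choice Nb.
Local Notation ktr I J u := (@detK_tr R B X K Nb I J u (krho u) (kemb u)).

Lemma hom_comp_inj (U V W : vectType R) (f : 'Hom(V, W)) (g : 'Hom(U, V)) :
  lker (f \o g)%VF = 0%VS -> lker g = 0%VS.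
Proof.
move=> h; apply/eqP; rewrite -subv0 -h; apply/subvP => v.
by rewrite !memv_ker comp_lfunE => /eqP ->; rewrite linear0.
Qed.

Lemma comp_lker0 (U V W : vectType R) (f : 'Hom(V, W)) (g : 'Hom(U, V)) :
  lker f = 0%VS -> lker g = 0%VS -> lker (f \o g)%VF = 0%VS.
Proof.
move=> hf hg; apply/eqP; rewrite -subv0; apply/subvP => v.
rewrite memv_ker comp_lfunE => h; rewrite -hg memv_ker -memv0 -hf.
by rewrite memv_ker.
Qed.

Lemma basis_map (U V : vectType R) (f : 'Hom(U, V)) s : lker f = 0%VS -> limg f = fullv ->
  basis_of fullv s -> basis_of fullv [seq f a | a <- s].
Proof.
by move=> h1 h2 bs; have := @limg_basis_of _ _ _ f _ _ _ bs; rewrite h1 h2 capv0; apply.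
Qed.

(** The frame at u' is the image of the frame at u under A on tilde U_IJ and under g on the
    complement. The two group elements agree in effect, since g and [restrG I g] act alike on
    E_I. *)
Lemma detK_tr_equiv I J g (u u' : ktU K I J) c : idx K I -> idx K J -> (I \proper J)%SET ->
  g \in Gam J -> kemb u' = kaU g (kemb u) ->
  ktr I J u' (@detK_act R B X K I (restrG I g) (krho u) (krho u') c) =
  @detK_act R B X K J g (kemb u) (kemb u') (ktr I J u c).
Proof.
move=> iI iJ IJ gJ euu'; have hIJ := wa_change wK iI iJ IJ.
have gr : restrG I g \in Gam I by exact: restrG_Gam.
have er := cc_rho_equiv hIJ gJ euu'.
have [A [eA rA]] := equiv_tangent wK iI iJ IJ gJ euu'.
have [_ _ h3 h4 _] := rho_facts wK iI iJ IJ u.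
have A0 : lker A = 0%VS.
  apply: (hom_comp_inj (f := dm emb u')); rewrite eA; apply: comp_lker0.
    exact: (dm_act_inj wK iJ _ gJ).
  exact: (emb_inj wK iI iJ IJ).
pose a : seq _ := vbasis {: 'rV[R]_(cdim (ktU K I J))}.
have ba : basis_of fullv a by exact: vbasisP.
have ba' : basis_of fullv [seq A x | x <- a].
  by apply: basis_map => //; apply: lker0_limgf; apply/eqP.
have [v2 bv] := tr_frame_exists wK iI iJ IJ u ba.
pose w : seq (ET B) := vbasis (Esp I).
have bw : basis_of (Esp I) w by exact: vbasisP.
have [f1 f2] := tr_frames wK iI iJ IJ ba bv bw.
have wI z : z \in w -> z \in Esp I by move=> zw; rewrite -(span_basis bw) memv_span.
have eAa : [seq dm emb u' x | x <- [seq A x | x <- a]] = [seq dact J g (kemb u) x | x <- [seq dm emb u x | x <- a]].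
  by rewrite -!map_comp; apply: eq_map => x /=; rewrite -!comp_lfunE eA.
have rAa : [seq dm rho u' x | x <- [seq A x | x <- a]] = [seq dact I (restrG I g) (krho u) x | x <- [seq dm rho u x | x <- a]].
  by rewrite -!map_comp; apply: eq_map => x /=; rewrite -!comp_lfunE rA.
have bv' : basis_of fullv ([seq dm emb u' x | x <- [seq A x | x <- a]] ++ [seq dact J g (kemb u) x | x <- v2]).
  rewrite eAa -map_cat; apply: basis_map => //.
    exact: (dm_act_inj wK iJ _ gJ).
  exact: (dm_act_sur wK iJ _ gJ).
have bw' : basis_of (Esp I) [seq actH g z | z <- w].
  rewrite -(actH_Esp (wa_basic wK) I g); apply: limg_basis_of bw.
  by rewrite (actH_inj (wa_basic wK) g) capv0.
move: c; apply: (line_eq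
  (T := fun c => ktr I J u' (@detK_act R B X K I (restrG I g) (krho u) (krho u') c))
  (T' := fun c => @detK_act R B X K J g (kemb u) (kemb u') (ktr I J u c)) _ _ f2).
- move=> x c; rewrite -(lin_isoZ _ _ (tr_iso wK iI iJ IJ u' hNb)).
  by congr (ktr I J u' _); exact: linemapZ.
- by move=> x c; rewrite (lin_isoZ _ _ (tr_iso wK iI iJ IJ u hNb)); exact: linemapZ.
have -> : @detK_act R B X K I (restrG I g) (krho u) (krho u')
    (wedge fullv (Esp I) 0 [seq dm rho u x | x <- a] w) =
    wedge fullv (Esp I) 0 [seq dm rho u' x | x <- [seq A x | x <- a]] [seq actH g z | z <- w].
  have := act_wedge wK iI (krho u) gr f2; rewrite rAa => e; apply: etrans e _; congr wedge.
  apply/eq_in_map => z zw; rewrite -!(actHE (wa_basic wK)) (actE_restr (wa_basic wK)) //.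
  exact: wI.
rewrite (tr_wedge wK iI iJ IJ hNb ba' bv' bw') (tr_wedge wK iI iJ IJ hNb ba bv bw).
apply/esym; have := act_wedge wK iJ (kemb u) gJ f1; rewrite !map_cat -eAa => e.
apply: etrans e _; congr wedge; congr (_ ++ _).
rewrite -!map_comp euu'; apply: eq_map => x /=.
by rewrite -!comp_lfunE (ds_act wK iJ _ gJ).
Qed.

Hypothesis la : local_agree K.

(** A frame a of tilde U_IL is carried by D to tilde U_IJ and completed there by [vJ] in U_J. Lifted
    along [krho], this becomes a frame of tilde U_JL that begins with the image of a under A, and
    [vL] completes it in U_L. The direct transition from a, completed by the images of [b2] and
    [vL], ends in the same frame. *)
Lemma detK_cocycle I J L (u : ktU K I L) (v : ktU K J L) (w : ktU K I J) c :
  idx K I -> idx K J -> idx K L -> (I \proper J)%SET -> (J \proper L)%SET ->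
  kemb u = kemb v -> krho v = kemb w ->
  @detK_tr R B X K Nb I L u (krho w) (kemb u) c =
  @detK_tr R B X K Nb J L v (kemb w) (kemb u) (@detK_tr R B X K Nb I J w (krho w) (kemb w) c).
Proof.
move=> iI iJ iL IJ JL euv evw.
have IL : (I \proper L)%SET by exact: proper_trans IJ JL.
have eR : krho u = krho w by exact: (wa_cocycle wK iI iJ iL IJ JL euv evw).
have [A [D [eA eD rD]]] := cocycle_tangent wK la iI iJ iL IJ JL euv evw.
have [_ _ u3 u4 _] := rho_facts wK iI iL IL u.
have [_ _ v3 v4 _] := rho_facts wK iJ iL JL v.
have [_ _ w3 w4 _] := rho_facts wK iI iJ IJ w.
have D0 : lker D = 0%VS by apply: (hom_comp_inj (f := dm rho w)); rewrite rD.
have D1 : limg D = fullv.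
  apply/eqP; rewrite eqEsubv subvf; apply/subvP => t _.
  have : dm rho w t \in limg (dm rho u) by rewrite u4 memvf.
  case/memv_imgP => s _; rewrite -rD comp_lfunE => e.
  have : t - D s \in lker (dm rho w) by rewrite memv_ker linearB /= e subrr.
  by rewrite w3 memv0 subr_eq0 => /eqP ->; rewrite memv_img // memvf.
pose a : seq _ := vbasis {: 'rV[R]_(cdim (ktU K I L))}.
have ba : basis_of fullv a by exact: vbasisP.
have baw : basis_of fullv [seq D x | x <- a] by exact: basis_map.
have [vJ bJ] := tr_frame_exists wK iI iJ IJ w baw.
pose wI : seq (ET B) := vbasis (Esp I).
have bwI : basis_of (Esp I) wI by exact: vbasisP.
have [f1 f2] := tr_frames wK iI iJ IJ baw bJ bwI.
(* [krho] is a local diffeomorphism, so vectors of U_J lift uniquely to tilde U_JL; [b2] is the lift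
   of [vJ]. *)
pose ri := ((dm rho v)^-1)%VF.
have riK : cancel (dm rho v) ri by apply: lker0_lfunK; apply/eqP.
have Kri x : dm rho v (ri x) = x by apply: limg_lfunVK; rewrite v4 memvf.
pose b2 := [seq ri x | x <- vJ].
have eb : [seq dm rho v x | x <- [seq A x | x <- a] ++ b2] = [seq dm emb w x | x <- [seq D x | x <- a]] ++ vJ.
  rewrite map_cat; congr (_ ++ _).
    by rewrite -!map_comp; apply: eq_map => x /=; rewrite -!comp_lfunE eD.
  by rewrite -map_comp map_id_in // => x _ /=; exact: Kri.
have bb : basis_of fullv ([seq A x | x <- a] ++ b2).
  have -> : [seq A x | x <- a] ++ b2 = [seq ri x | x <- [seq dm emb w x | x <- [seq D x | x <- a]] ++ vJ].
    by rewrite -eb -map_comp map_id_in // => x _ /=; exact: riK.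
  apply: basis_map bJ.
    by apply: (hom_id_lker (g := dm rho v)); apply/lfunP => x; rewrite comp_lfunE id_lfunE Kri.
  by apply: (hom_id_limg (g := dm rho v)); apply/lfunP => x; rewrite comp_lfunE id_lfunE riK.
have [vL bL] := tr_frame_exists wK iJ iL JL v bb.
have bwJ : basis_of (Esp J) (wI ++ [seq ds J (kemb w) x | x <- vJ]).
  by move: f1 => /andP[_]; rewrite qbasis0.
have eAa : [seq dm emb v x | x <- [seq A x | x <- a] ++ b2] =
   [seq dm emb u x | x <- a] ++ [seq dm emb v x | x <- b2].
  by rewrite map_cat; congr (_ ++ _); rewrite -map_comp; apply: eq_map => x /=; rewrite -comp_lfunE eA.
have bu : basis_of fullv ([seq dm emb u x | x <- a] ++ ([seq dm emb v x | x <- b2] ++ vL)).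
  by move: bL; rewrite eAa -catA.
move: c; apply: (line_eq (T := @detK_tr R B X K Nb I L u (krho w) (kemb u))
  (T' := fun c => @detK_tr R B X K Nb J L v (kemb w) (kemb u)
     (@detK_tr R B X K Nb I J w (krho w) (kemb w) c)) _ _ f2).
- by move=> x c; exact: (lin_isoZ x c (tr_iso wK iI iL IL u hNb)).
- move=> x c; have e := lin_isoZ x c (tr_iso wK iI iJ IJ w hNb).
  apply: etrans (congr1 _ e) _.
  exact: (lin_isoZ x _ (tr_iso wK iJ iL JL v hNb)).
have rDa : [seq dm rho w x | x <- [seq D x | x <- a]] = [seq dm rho u x | x <- a].
  by rewrite -map_comp; apply: eq_map => x /=; rewrite -comp_lfunE rD.
have e1 := tr_wedge wK iI iL IL hNb ba bu bwI.
have e2 := tr_wedge wK iI iJ IJ hNb baw bJ bwI.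
have e3 := tr_wedge wK iJ iL JL hNb bb bL bwJ.
rewrite e2 rDa; apply: etrans e1 _.
rewrite -eb; apply: etrans _ (esym e3).
rewrite eAa -!catA; congr wedge.
rewrite map_cat euv; congr (_ ++ (_ ++ _)).
rewrite -evw -map_comp -[in RHS](map_id vJ) -[in RHS](eq_map Kri) -!map_comp.
by apply: eq_map => x /=; rewrite (ds_emb_rho wK iJ iL JL v).
Qed.

End Transitions.

(** * Smooth frames *)

Section FrameMatrices.
Variable R : realType.

Definition mxs n (s : seq 'rV[R]_n) : 'M[R]_n := \matrix_(i < n) s`_i.

Lemma mxs_comb n (s : seq 'rV[R]_n) : combZ 0 (mxs s) s (@unit_rows R n).
Proof.
move=> k; rewrite [X in X - _](row_sum_delta _).
suff -> : \sum_j mxs s k j *: (@unit_rows R n)`_j = \sum_j s`_k 0 j *: delta_mx 0 j.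
  by rewrite subrr mem0v.
by apply: eq_bigr => j _; rewrite mxE (nth_map j) ?size_enum_ord // nth_ord_enum.
Qed.

Lemma mxs_map n (T : 'End('rV[R]_n)) (s : seq 'rV[R]_n) :
  mxs [seq T a | a <- s] = mxs s *m mxs [seq T a | a <- @unit_rows R n].
Proof.
apply/row_matrixP => i; rewrite rowK row_mul rowK nth_map_lin.
rewrite mulmx_sum_row.
have e : T s`_i = \sum_j s`_i 0 j *: T (delta_mx 0 j).
  by rewrite {1}(row_sum_delta s`_i) linear_sum; apply: eq_bigr => j _; rewrite linearZ.
apply: (etrans e); apply: eq_bigr => j _; rewrite !(mxE, rowK); congr (_ *: _).
by rewrite (nth_map 0) ?size_unit_rows // (nth_map j) ?size_enum_ord // nth_ord_enum.
Qed.

Lemma size_basis_rV n (s : seq 'rV[R]_n) : basis_of fullv s -> size s = n.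
Proof. by move=> bs; rewrite (size_basis_seq bs) dimvf dim_matrix mul1r. Qed.

Lemma mxs_basis n (s : seq 'rV[R]_n) : basis_of fullv s -> \det (mxs s) != 0.
Proof.
move=> bs; apply: (@qbasis_unit _ _ fullv 0 (@unit_rows R n) s); rewrite ?qbasis0 //.
- exact: unit_rows_basis.
- exact: size_unit_rows.
- exact: mxs_comb.
Qed.

Lemma basis_mxs n (s : seq 'rV[R]_n) : size s = n -> \det (mxs s) != 0 -> basis_of fullv s.
Proof.
move=> sn d0; rewrite basisEdim sn dimvf dim_matrix mul1r leqnn andbT.
have u : mxs s \in unitmx by rewrite unitmxE unitfE.
apply/subvP => x _; rewrite -[x]mulmx1 -(mulVmx u) mulmxA mulmx_sum_row.
by apply: rpred_sum => i _; rewrite rowK rpredZ // memv_span // mem_nth // sn.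
Qed.

Lemma det_mxs_map n (T : 'End('rV[R]_n)) (s : seq 'rV[R]_n) :
  \det (mxs [seq T a | a <- s]) = \det (mxs s) * \det (mxs [seq T a | a <- @unit_rows R n]).
Proof. by rewrite mxs_map det_mulmx. Qed.

(** The isomorphism T multiplies numerator and denominator by the same determinant. It is inserted
    because vector fields have smooth coordinates only after applying the derivative of a fixed
    chart, which T will be. *)
Lemma wedge_det (E : vectType R) (H : {vspace E}) n (T : 'End('rV[R]_n)) v v' w w' m (C : 'M[R]_m) :
  lker T = 0%VS -> basis_of fullv v -> basis_of fullv v' -> basis_of H w -> basis_of H w' ->
  size w' = m -> combZ 0 C w w' ->
  wedge fullv H 0 v w =
  (\det (mxs [seq T a | a <- v]) / \det (mxs [seq T a | a <- v']) / \det C) *: wedge fullv H 0 v' w'.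
Proof.
move=> T0 bv bv' bw bw' wm hC.
have f : dframe fullv H 0 v w by rewrite /dframe bv qbasis0.
have f' : dframe fullv H 0 v' w' by rewrite /dframe bv' qbasis0.
have d0 := mxs_basis bv'.
have uT : \det (mxs [seq T a | a <- @unit_rows R n]) != 0.
  apply: mxs_basis; have b := unit_rows_basis R n.
  have := @limg_basis_of _ _ _ T _ _ _ b.
  by rewrite T0 capv0 lker0_limgf; [apply|apply/eqP].
have [A _ hA] : exists2 A : 'M[R]_n, A \in unitmx & combZ 0 A v v'.
  by apply: (@qbasis_change _ _ fullv); rewrite ?qbasis0 //; exact: size_basis_rV.
rewrite (wedge_change f' f (size_basis_rV bv') wm hA hC); congr (_ *: _); congr (_ / _).
rewrite (det_mxs_map T v) (det_mxs_map T v').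
have -> : \det (mxs v) = \det A * \det (mxs v').
  rewrite -det_mulmx; congr (\det _).
  apply: (combZ_uniq (size_unit_rows R n) (basis_free (unit_rows_basis R n)) (capv0 _) (mxs_comb v)).
  exact: combZ_comp (mxs_comb v') hA.
by field; rewrite uT d0.
Qed.

Definition coord_mx (E : vectType R) (w' w : seq E) : 'M[R]_(size w') :=
  \matrix_(i, j) coord (in_tuple w') j w`_i.

Lemma coord_mx_comb (E : vectType R) (H : {vspace E}) (w' w : seq E) : basis_of H w' ->
  (forall i, w`_i \in H) -> combZ 0 (coord_mx w' w) w w'.
Proof.
move=> bw h i; under eq_bigr do rewrite mxE.
have := h i; rewrite -(span_basis bw) => /(coord_span (X := in_tuple w')) {1}->.
by rewrite subrr mem0v.
Qed.

Lemma coord_mx_basis (E : vectType R) (H : {vspace E}) (w' w : seq E) :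
  basis_of H w' -> basis_of H w -> \det (coord_mx w' w) != 0.
Proof.
move=> bw' bw; apply: (@qbasis_unit _ _ H 0 w' w); rewrite ?qbasis0 //.
apply: coord_mx_comb bw' _ => i; have [si|si] := ltnP i (size w).
  by rewrite -(span_basis bw) memv_span // mem_nth.
by rewrite nth_default // mem0v.
Qed.

Lemma basis_coord_mx (E : vectType R) (H : {vspace E}) (w' w : seq E) :
  basis_of H w' -> (forall i, w`_i \in H) -> size w = size w' ->
  \det (coord_mx w' w) != 0 -> basis_of H w.
Proof.
move=> bw' h sw d0; rewrite basisEdim sw (size_basis_seq bw') leqnn andbT.
have u : coord_mx w' w \in unitmx by rewrite unitmxE unitfE.
have /combZ0 hc := coord_mx_comb bw' h.
rewrite -{1}(span_basis bw'); apply/span_subvP => x /(nthP 0)[i si <-].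
have -> : w'`_i = \sum_j (invmx (coord_mx w' w)) (Ordinal si) j *: w`_j.
  under eq_bigr do rewrite hc scaler_sumr.
  rewrite exchange_big /=; have := mulVmx u => /matrixP/(_ (Ordinal si)) e.
  transitivity (\sum_j (invmx (coord_mx w' w) *m coord_mx w' w) (Ordinal si) j *: w'`_j).
    under eq_bigr do rewrite e mxE.
    rewrite (bigD1 (Ordinal si)) //= eqxx scale1r big1 ?addr0 // => j /negPf nj.
    by rewrite eq_sym nj scale0r.
  apply: eq_bigr => j _; rewrite mxE scaler_suml; apply: eq_bigr => k _.
  by rewrite scalerA.
by apply: comb_in_span.
Qed.

End FrameMatrices.

Section SmoothFrames.
Variable R : realType.
Implicit Types M N S : charted R.

Definition alls (T : Type) (P : T -> Prop) (s : seq T) : Prop := foldr (fun x Q => P x /\ Q) True s.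

Lemma alls_cat (T : Type) (P : T -> Prop) s s' : alls P s -> alls P s' -> alls P (s ++ s').
Proof. by elim: s => //= x s IH [px ps] ps'; split=> //; exact: IH. Qed.

Lemma alls_map (T T' : Type) (g : T -> T') (P : T -> Prop) (P' : T' -> Prop) s :
  (forall x, P x -> P' (g x)) -> alls P s -> alls P' (map g s).
Proof. by move=> h; elim: s => //= x s IH [px ps]; split; [exact: h|exact: IH]. Qed.

Lemma alls_nth (T : Type) (P : T -> Prop) x0 s i : alls P s -> P x0 -> P (nth x0 s i).
Proof. by elim: s i => [|x s IH] [|i] //= [px ps] p0 //; exact: IH. Qed.

Definition at_pt (S : Type) (T : Type) (s : seq (S -> T)) (u : S) : seq T := [seq x u | x <- s].

Lemma at_pt_cat (S : Type) (T : Type) (s s' : seq (S -> T)) u : at_pt (s ++ s') u = at_pt s u ++ at_pt s' u.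
Proof. exact: map_cat. Qed.

Lemma smR_near0 M (a : M -> R) x : good x -> smR a x -> a x != 0 -> nearM x (fun y => a y != 0).
Proof.
move=> g [U [G [oU Ux sG eG]]] ax.
have cG : {for chart x x, continuous G} by apply: differentiable_continuous; exact: (sG [::]).
have Gx : G (chart x x) != 0 by rewrite eG ?(gd_inv g) //; exact: gd_model.
have h1 : \forall q \near chart x x, G q != 0.
  have := cG [set y : R | y != 0]; apply.
  by apply: open_nbhs_nbhs; split=> //; exact: open_neq.
rewrite /nearM; apply: filterS2 (open_near oU Ux) h1 => q Uq Gq mq.
by rewrite -eG.
Qed.

Section Along.
Variables (S N : charted R) (f : S -> N) (u0 : S).
Hypotheses (gu : good u0) (gf : good (f u0)) (mf : mfd_at (f u0)) (cf : ncont f u0).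
Local Notation T := (fun u => dv (chart (f u0)) (f u)).

Lemma smooth_det_fields (vs : seq (S -> 'rV[R]_(cdim N))) :
  alls (fun X => smooth_field_along f X u0) vs ->
  smR (fun u => \det (mxs [seq T u a | a <- at_pt vs u])) u0.
Proof.
move=> sv; apply: smR_det => i j.
have e : (fun u => mxs [seq T u a | a <- at_pt vs u] i j) =
   (fun u => (T u (nth (fun=> 0) vs i u)) 0 j).
  apply/funext => u; rewrite mxE; congr (_ _ j); rewrite -map_comp.
  have [iv|iv] := ltnP i (size vs); first by rewrite (nth_map (fun=> 0)).
  by rewrite !nth_default ?size_map // linear0.
rewrite e; apply: smoothv_entry; apply: (alls_nth (P := fun X => smooth_field_along f X u0)) => //.
apply: (@smoothv_ext _ _ _ (fun=> 0)); last exact: smoothv_cst.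
by apply: nearM_forall => u; rewrite linear0.
Qed.

Lemma smooth_det_coord (E : vectType R) (w' : seq E) (ws : seq (S -> E)) :
  alls (fun X => smoothv X u0) ws -> smR (fun u => \det (coord_mx w' (at_pt ws u))) u0.
Proof.
move=> sw; apply: smR_det => i j.
have e : (fun u => coord_mx w' (at_pt ws u) i j) =
   (fun u => coord (in_tuple w') j (nth (fun=> 0) ws i u)).
  apply/funext => u; rewrite mxE; congr (coord _ _ _).
  have [iv|iv] := ltnP i (size ws); first by rewrite (nth_map (fun=> 0)).
  by rewrite !nth_default ?size_map.
rewrite e; have := @alls_nth _ (fun X => smoothv X u0) (fun=> 0) ws i sw (@smoothv_cst _ _ _ _ _).
exact: (@smoothv_smR _ _ _ _ (coord (in_tuple w') j)).
Qed.

Lemma near_inj : nearM u0 (fun u => lker (T u) = 0%VS).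
Proof. by apply: (cf (P := fun y => lker (dv (chart (f u0)) y) = 0%VS)); exact: chart_inj. Qed.

Lemma near_basis_fields (vs : seq (S -> 'rV[R]_(cdim N))) :
  alls (fun X => smooth_field_along f X u0) vs -> basis_of fullv (at_pt vs u0) ->
  nearM u0 (fun u => basis_of fullv (at_pt vs u)).
Proof.
move=> sv bv; have i0 := near_self gu near_inj.
have d0 : \det (mxs [seq T u0 a | a <- at_pt vs u0]) != 0.
  apply: mxs_basis; have := @limg_basis_of _ _ _ (T u0) _ _ _ bv.
  by rewrite i0 capv0 lker0_limgf; [apply|apply/eqP].
apply: nearMS (smR_near0 gu (smooth_det_fields sv) d0) => u.
rewrite det_mxs_map mulf_eq0 negb_or => /andP[du _]; apply: basis_mxs => //.
by have := size_basis_rV bv; rewrite !size_map.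
Qed.

Lemma near_basis_coord (E : vectType R) (H : {vspace E}) (ws : seq (S -> E)) :
  alls (fun X => smoothv X u0) ws -> basis_of H (at_pt ws u0) ->
  nearM u0 (fun u => forall i, (at_pt ws u)`_i \in H) ->
  nearM u0 (fun u => basis_of H (at_pt ws u)).
Proof.
move=> sw bw hw.
apply: nearMS2 hw (smR_near0 gu (smooth_det_coord (at_pt ws u0) sw) (coord_mx_basis bw bw)) => u h d.
by apply: basis_coord_mx bw h _ d; rewrite !size_map.
Qed.

(** All smoothness statements about det K rest on this one. The ratio of two frames is a quotient of
    determinants whose entries are smooth, since the vectors are read in the single chart at [f u0];
    nonvanishing of the determinants at [u0] keeps both families bases nearby. *)
Lemma smooth_ratio (E : vectType R) (H : {vspace E}) (vs vs' : seq (S -> 'rV[R]_(cdim N)))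
    (ws : seq (S -> E)) (w' : seq E) :
  alls (fun X => smooth_field_along f X u0) vs -> basis_of fullv (at_pt vs u0) ->
  alls (fun X => smooth_field_along f X u0) vs' -> basis_of fullv (at_pt vs' u0) ->
  alls (fun X => smoothv X u0) ws -> basis_of H (at_pt ws u0) ->
  nearM u0 (fun u => forall i, (at_pt ws u)`_i \in H) -> basis_of H w' ->
  exists a : S -> R, smR a u0 /\
    nearM u0 (fun u => [/\ basis_of fullv (at_pt vs u), basis_of H (at_pt ws u),
      basis_of fullv (at_pt vs' u), a u != 0 &
      wedge fullv H 0 (at_pt vs u) (at_pt ws u) = a u *: wedge fullv H 0 (at_pt vs' u) w']).
Proof.
move=> sv bv sv' bv' sw bw hw bw'.
have n1 := near_basis_fields sv bv; have n2 := near_basis_fields sv' bv'.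
have n3 := near_basis_coord sw bw hw.
pose a u := \det (mxs [seq T u a | a <- at_pt vs u]) / \det (mxs [seq T u a | a <- at_pt vs' u])
  / \det (coord_mx w' (at_pt ws u)).
exists a; split.
  have i0 := near_self gu near_inj.
  apply: smR_mul; first apply: smR_mul.
  - exact: smooth_det_fields.
  - apply: smR_inv; [exact: gd_model|exact: gd_inv| |exact: smooth_det_fields].
    apply: mxs_basis; have := @limg_basis_of _ _ _ (T u0) _ _ _ bv'.
    by rewrite i0 capv0 lker0_limgf; [apply|apply/eqP].
  - apply: smR_inv; [exact: gd_model|exact: gd_inv| |exact: smooth_det_coord].
    exact: coord_mx_basis bw' bw.
apply: nearMS2 (nearMI n1 (nearMI n2 n3)) (nearMI near_inj hw) => u [b1 [b2 b3]] [iu hu].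
have e := wedge_det iu b1 b2 b3 bw' erefl (coord_mx_comb bw' hu).
split=> //; apply/negP => /eqP a0; move: e; rewrite -/(a u) a0 scale0r => e.
have fr : dframe fullv H 0 (at_pt vs u) (at_pt ws u) by rewrite /dframe b1 qbasis0.
have := wedge1 fr; rewrite e => /eqP; rewrite eq_sym.
by apply/negP; exact: oner_neq0.
Qed.

(** The field along f with constant coordinates c in the chart at [f u0]. It extends a vector given
    at [u0], as the complements [v2] and [v3] found at one point have to be extended. *)
Definition cst_field (c : 'rV[R]_(cdim N)) (u : S) : 'rV[R]_(cdim N) := (T u)^-1%VF c.

Lemma cst_field_smooth c : smooth_field_along f (cst_field c) u0.
Proof.
apply: (@smoothv_ext _ _ _ (fun=> c)); last exact: smoothv_cst.
apply: nearMS near_inj => u h; rewrite /cst_field limg_lfunVK //.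
by rewrite lker0_limgf ?memvf //; apply/eqP.
Qed.

Lemma cst_field0 c : cst_field c u0 = c.
Proof.
have e : T u0 = \1%VF by apply: dv_isd gf _; exact: isd_chart.
have h : lker (T u0) == 0%VS by rewrite e lker_id.
by rewrite /cst_field -{2}(lker0_lfunK h c) e id_lfunE.
Qed.

Lemma cst_fields (s : seq 'rV[R]_(cdim N)) : exists vs : seq (S -> 'rV[R]_(cdim N)),
  alls (fun X => smooth_field_along f X u0) vs /\ at_pt vs u0 = s.
Proof.
exists [seq cst_field c | c <- s]; split.
  by elim: s => //= c s IH; split=> //; exact: cst_field_smooth.
by rewrite /at_pt -map_comp map_id_in // => c _ /=; exact: cst_field0.
Qed.

End Along.

End SmoothFrames.

Section InverseFields.
Variable R : realType.
Implicit Types M N S : charted R.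

Definition rows_mx n (D : 'End('rV[R]_n)) : 'M[R]_n := \matrix_(i, j) D (delta_mx 0 i) 0 j.

Lemma rows_mxE n (D : 'End('rV[R]_n)) c : D c = c *m rows_mx D.
Proof.
rewrite mulmx_sum_row {1}(row_sum_delta c) linear_sum; apply: eq_bigr => i _.
by rewrite linearZ; congr (_ *: _); apply/rowP => j; rewrite !mxE.
Qed.

Lemma rows_mx_det n (D : 'End('rV[R]_n)) : lker D = 0%VS -> \det (rows_mx D) != 0.
Proof.
move=> D0; rewrite -unitfE -unitmxE -row_full_unit -sub1mx; apply/row_subP => i.
have iD : limg D = fullv by apply: lker0_limgf; apply/eqP.
have : row i 1%:M \in limg D by rewrite iD memvf.
by move=> /memv_imgP[c _ ->]; rewrite rows_mxE submxMl.
Qed.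

Lemma inv_rows n (D : 'End('rV[R]_n)) c : lker D = 0%VS ->
  (D^-1)%VF c = (\det (rows_mx D))^-1 *: (c *m \adj (rows_mx D)).
Proof.
move=> D0; have d0 := rows_mx_det D0; set r := RHS.
have e : D r = c.
  by rewrite rows_mxE /r -scalemxAl -mulmxA mul_adj_mx mul_mx_scalar scalerA mulVf // scale1r.
by rewrite -e lker0_lfunK //; apply/eqP.
Qed.

(** Cramer's rule presents the inverse as the adjugate divided by the determinant, both polynomial
    in smooth entries. *)
Lemma smooth_inverse M n (D : M -> 'End('rV[R]_n)) (x : M) c : good x ->
  (forall c, smoothv (fun y => D y c) x) -> nearM x (fun y => lker (D y) = 0%VS) ->
  smoothv (fun y => (D y)^-1%VF c) x.
Proof.
move=> gx sD n0; have d0 := rows_mx_det (near_self gx n0).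
apply: (@smoothv_ext _ _ _ (fun y => (\det (rows_mx (D y)))^-1 *: (c *m \adj (rows_mx (D y))))).
  by apply: nearMS n0 => y y0; rewrite inv_rows.
have sM i j : smR (fun y => rows_mx (D y) i j) x.
  apply: (@smR_ext _ _ (fun y => D y (delta_mx 0 i) 0 j)); last exact: smoothv_entry.
  by apply: nearM_forall => y; rewrite mxE.
apply: smoothv_scale.
  by apply: smR_inv; [exact: gd_model|exact: gd_inv|exact: d0|exact: smR_det].
apply: smoothv_rows => j.
apply: (@smR_ext _ _ (fun y => \sum_i c 0 i * ((-1) ^+ (j + i) * \det (row' j (col' i (rows_mx (D y))))))).
  by apply: nearM_forall => y; rewrite mxE; apply: eq_bigr => i _; rewrite mxE.
apply: smR_sum => i _; apply: smR_mul; first exact: smR_cst.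
apply: smR_mul; first exact: smR_cst.
apply: smR_det => i' j'.
apply: (@smR_ext _ _ (fun y => rows_mx (D y) (lift j i') (lift i j'))); last exact: sM.
by apply: nearM_forall => y; rewrite !mxE.
Qed.

Lemma nearM_open M (mM : is_manifold_with_boundary M) (x : M) (P : M -> Prop) : nearM x P ->
  exists2 U : set M, open U /\ U x & U `<=` P.
Proof.
move=> /(nearM_nbhs mM); rewrite nbhsE => -[U [oU Ux] UP].
by exists U.
Qed.

(** These are the coordinate fields of the chart at [x0]. At another point x their smoothness is
    measured in the chart at x, where their coordinates are the unit vectors transformed by the
    inverse of the derivative D of a chart change. *)
Lemma tangent_frame M (mM : is_manifold_with_boundary M) (x0 : M) :
  exists (Y : 'I_(cdim M) -> M -> 'rV[R]_(cdim M)) (U : set M),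
    [/\ open U, U x0 & forall x, U x -> basis_of fullv [seq Y i x | i <- enum 'I_(cdim M)] /\
       forall i, smooth_field_along id (Y i) x].
Proof.
have g0 := mfd_good mM x0; have m0 := mfd_mfd_at mM x0.
pose T y := dv (chart x0) y.
pose Y (i : 'I_(cdim M)) y := (T y)^-1%VF ('e_i : 'rV[R]_(cdim M)).
have nT := chart_inj g0 m0.
have [U [oU Ux] UP] := nearM_open mM (nearMI nT (nearMI (ma_near m0 nT) (ma_chart m0))).
exists Y, U; split=> // x /UP[x0T [nx sx]]; split.
  have e : [seq Y i x | i <- enum 'I_(cdim M)] = [seq (T x)^-1%VF a | a <- unit_rows R (cdim M)].
    exact: (map_comp (T x)^-1%VF (fun i : 'I_(cdim M) => 'e_i) (enum 'I_(cdim M))).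
  rewrite e; apply: basis_map; last exact: unit_rows_basis.
    apply/eqP; rewrite -subv0; apply/subvP => c; rewrite memv_ker memv0 => /eqP c0.
    have iT : limg (T x) = fullv by apply: lker0_limgf; apply/eqP.
    by rewrite -(@limg_lfunVK _ _ _ (T x) c) ?iT ?memvf // c0 linear0.
  apply/eqP; rewrite eqEsubv subvf; apply/subvP => c _.
  by rewrite -(@lker0_lfunK _ _ _ (T x) _ c) ?memv_img ?memvf //; apply/eqP.
move=> i; have gx := mfd_good mM x; have mx := mfd_mfd_at mM x.
have [D [nD sD]] := smoothv_near gx mx sx.
have nE : nearM x (fun y => T y = (D y \o dv (chart x) y)%VF).
  by apply: nearMS2 (ma_good mx) nD => y gy; exact: dv_isd.
have nd : nearM x (fun y => lker (D y) = 0%VS).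
  apply: nearMS (nearMI nE (nearMI nx (chart_inj gx mx))) => y [e [Ty cy]].
  apply/eqP; rewrite -subv0; apply/subvP => c; rewrite memv_ker memv0 => /eqP c0.
  have ic : limg (dv (chart x) y) = fullv by apply: lker0_limgf; rewrite cy.
  have : c \in limg (dv (chart x) y) by rewrite ic memvf.
  move=> /memv_imgP[b _ cb].
  have : b \in lker (T y) by rewrite memv_ker e comp_lfunE -cb c0.
  by rewrite Ty memv0 => /eqP b0; rewrite cb b0 linear0.
apply: smoothv_ext (smooth_inverse ('e_i) gx sD nd).
apply: nearMS (nearMI nE (nearMI nd (nearMI nx (chart_inj gx mx)))) => y [e [Dy [Ty cy]]].
have iT : limg (T y) = fullv by apply: lker0_limgf; rewrite Ty.
have : T y (Y i y) = 'e_i by rewrite limg_lfunVK // iT memvf.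
rewrite e comp_lfunE => <-.
by rewrite lker0_lfunK // Dy.
Qed.

End InverseFields.

(** * Smooth maps of line bundles *)

Section LineBundles.
Variable R : realType.
Implicit Types M N S : charted R.

Lemma smooth_bmap1 S M N (r : S -> M) (f : S -> N)
    (fM : M -> lmodType R) frM (fN : N -> lmodType R) frN
    (Phi : forall u, fM (r u) -> fN (f u)) (u0 : S) :
  @smooth_bmap R S M N r f (@VBundle R M fM 1 frM) (@VBundle R N fN 1 frN) Phi u0 <->
  (forall F F', frM F -> frN F' -> F.1 (r u0) -> F'.1 (f u0) ->
    exists a : S -> R, smR a u0 /\
      nearM u0 (fun u => Phi u (F.2 (r u) 0) = a u *: F'.2 (f u) 0)).
Proof.
split=> h F F' hF hF' Fr Ff; have [A [sA nA]] := h F F' hF hF' Fr Ff.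
  exists (fun u => \tr (A u)); split; first exact: (smoothv_smR (mxtrace : {linear _ -> R^o}) sA).
  by apply: nearMS nA => u /(_ 0) ->; rewrite /mxtrace !big_ord1.
exists (fun u => A u *: 1%:M); split; first by apply: smoothv_scale => //; exact: smoothv_cst.
by apply: nearMS nA => u e i; rewrite big_ord1 !mxE !ord1 eqxx mulr1.
Qed.

Lemma scale_inj (V : lmodType R) (b : V) a c : b != 0 -> a *: b = c *: b -> a = c.
Proof.
move=> b0 e; apply/eqP; rewrite -subr_eq0; apply/negPn/negP => ac.
by move/eqP: b0; apply; rewrite -[b]scale1r -(mulVf ac) -scalerA scalerBl e subrr scaler0.
Qed.
Lemma line_basis (V : lmodType R) (b : 'I_1 -> V) : b 0 != 0 -> (forall l, exists a, l = a *: b 0) ->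
  forall l, exists! c : 'rV[R]_1, l = \sum_i c 0 i *: b i.
Proof.
move=> b0 h l; have [a ->] := h l; exists (const_mx a).
split; first by rewrite big_ord1 mxE.
move=> c; rewrite big_ord1 => e; apply/rowP => i; rewrite mxE ord1.
exact: (scale_inj b0 e).
Qed.

(** [Phi'] is the conjugate of [Phi] by [PM] and [PN], so in local frames its coefficient is that of
    [Phi] times that of [PN], divided by that of [PM]. The last does not vanish, since [PM] is an
    isomorphism and some frame is nonzero at the base point. This carries smoothness from det K to
    det s. *)
Lemma smooth_transfer S M N (r : S -> M) (f : S -> N) (u0 : S)
    (fM : M -> lmodType R) frM (fM' : M -> lmodType R) frM'
    (fN : N -> lmodType R) frN (fN' : N -> lmodType R) frN'
    (PM : forall x, fM x -> fM' x) (PN : forall x, fN x -> fN' x)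
    (Phi : forall u, fM (r u) -> fN (f u)) (Phi' : forall u, fM' (r u) -> fN' (f u)) :
  good u0 -> good (r u0) -> good (f u0) ->
  ncont r u0 -> smoothv (chart (r u0) \o r) u0 -> ncont f u0 -> smoothv (chart (f u0) \o f) u0 ->
  (exists2 F, frM F & F.1 (r u0) /\ F.2 (r u0) 0 != 0) ->
  (exists2 F, frN F & F.1 (f u0)) ->
  (forall x, lin_iso (PM x)) -> (forall x, lin_iso (PN x)) ->
  nearM u0 (fun u => (forall (a : R) l, Phi' u (a *: l) = a *: Phi' u l) /\
     forall l, Phi' u (PM (r u) l) = PN (f u) (Phi u l)) ->
  @smooth_bmap R M M M id id (@VBundle R M fM 1 frM) (@VBundle R M fM' 1 frM') PM (r u0) ->
  @smooth_bmap R N N N id id (@VBundle R N fN 1 frN) (@VBundle R N fN' 1 frN') PN (f u0) ->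
  @smooth_bmap R S M N r f (@VBundle R M fM 1 frM) (@VBundle R N fN 1 frN) Phi u0 ->
  @smooth_bmap R S M N r f (@VBundle R M fM' 1 frM') (@VBundle R N fN' 1 frN') Phi' u0.
Proof.
move=> gu gr gf cr sr cf sf [F hF [Fr F0]] [G hG Gf] iM iN com.
move=> /smooth_bmap1 sM /smooth_bmap1 sN /smooth_bmap1 sP; apply/smooth_bmap1 => F' G' hF' hG' Fr' Gf'.
have [a [sa na]] := sM _ _ hF hF' Fr Fr'.
have [b [sb nb]] := sN _ _ hG hG' Gf Gf'.
have [c [sc nc]] := sP _ _ hF hG Fr Gf.
have a0 : a (r u0) != 0.
  apply/negP => /eqP z; have := near_self gr na; rewrite z scale0r /= => e.
  by move/eqP: F0; apply; apply: (lin_iso_inj (iM _)); rewrite e -[0 in RHS](scale0r 0) lin_isoZ // scale0r.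
have sar := smR_comp gu gr cr sr sa; have sbf := smR_comp gu gf cf sf sb.
exists (fun u => (a (r u))^-1 * c u * b (f u)); split.
  apply: smR_mul => //; apply: smR_mul => //.
  by apply: smR_inv => //; [exact: gd_model|exact: gd_inv].
have nar : nearM u0 (fun u => a (r u) != 0) by apply: (smR_near0 gu sar).
apply: nearMS (nearMI nar (nearMI com (nearMI nc (nearMI (cr _ na) (cf _ nb))))).
move=> u [ar [[Pl Pc] [ec [ea eb]]]] /=.
have -> : F'.2 (r u) 0 = (a (r u))^-1 *: PM (r u) (F.2 (r u) 0) by rewrite ea scalerA mulVf // scale1r.
by rewrite Pl Pc ec (lin_isoZ _ _ (iN _)) eb !scalerA.
Qed.

End LineBundles.

(** * The line bundles det K and det s *)

Section FieldLists.
Variable R : realType.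
Implicit Types M N S : charted R.

Lemma wedge_neq0 (V W : vectType R) (K : {vspace V}) (H Z : {vspace W}) v w :
  dframe K H Z v w -> wedge K H Z v w != 0.
Proof.
move=> f; apply/negP => /eqP e; have := wedge1 f; rewrite e => /eqP; rewrite eq_sym.
by apply/negP; exact: oner_neq0.
Qed.

Lemma detline_basis (V W : vectType R) (K : {vspace V}) (H Z : {vspace W}) (b : 'I_1 -> detline K H Z) v w :
  dframe K H Z v w -> b 0 != 0 -> forall l, exists! c : 'rV[R]_1, l = \sum_i c 0 i *: b i.
Proof.
move=> f b0; apply: (line_basis b0) => l.
have q0 : b 0 (v, w) != 0.
  by apply/negP => /eqP q; move/eqP: b0; apply; rewrite (wedgeE (b 0) f) q scale0r.
exists (l (v, w) / b 0 (v, w)); rewrite {2}(wedgeE (b 0) f) scalerA divfK //.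
exact: wedgeE.
Qed.

Definition enum_fields S (T : Type) k (Y : 'I_k -> S -> T) : seq (S -> T) := [seq Y i | i <- enum 'I_k].

Lemma at_pt_enum S (T : Type) k (Y : 'I_k -> S -> T) u :
  at_pt (enum_fields Y) u = [seq Y i u | i <- enum 'I_k].
Proof. by rewrite /at_pt /enum_fields -map_comp. Qed.

Lemma alls_enum S (T : Type) k (Y : 'I_k -> S -> T) (P : (S -> T) -> Prop) :
  (forall i, P (Y i)) -> alls P (enum_fields Y).
Proof. by move=> h; rewrite /enum_fields; elim: (enum _) => //= i s IH; split. Qed.

Definition csts S (T : Type) (w : seq T) : seq (S -> T) := [seq (fun=> e) | e <- w].

Lemma at_pt_csts S (T : Type) (w : seq T) (u : S) : at_pt (csts S w) u = w.
Proof. by elim: w => //= e w; rewrite /at_pt /= => ->. Qed.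

Lemma alls_csts S (W : vectType R) (w : seq W) (u : S) :
  alls (fun X => smoothv X u) (csts S w).
Proof. by elim: w => //= e w IH; split=> //; exact: smoothv_cst. Qed.

Lemma at_pt_map (S T T' : Type) (g : S -> T -> T') (vs : seq (S -> T)) u :
  at_pt [seq (fun u => g u (X u)) | X <- vs] u = [seq g u x | x <- at_pt vs u].
Proof. by rewrite /at_pt -!map_comp. Qed.

Lemma at_pt_comp (S T T' : Type) (f : S -> T) (vs : seq (T -> T')) u :
  at_pt [seq X \o f | X <- vs] u = at_pt vs (f u).
Proof. by rewrite /at_pt -!map_comp. Qed.

Lemma field_pull S N (f : S -> N) (Y : N -> 'rV[R]_(cdim N)) u0 :
  good u0 -> good (f u0) -> ncont f u0 -> smoothv (chart (f u0) \o f) u0 ->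
  smooth_field_along id Y (f u0) -> smooth_field_along f (Y \o f) u0.
Proof.
move=> gu gf cf sf sY.
exact: (smoothv_comp (f := fun y => dv (chart (f u0)) y (Y y)) gu gf cf sf sY).
Qed.

Lemma mem_nth_sub (V : vectType R) (H : {vspace V}) (s : seq V) :
  basis_of H s -> forall i, s`_i \in H.
Proof.
move=> bs i; have [si|si] := ltnP i (size s).
  by rewrite -(span_basis bs) memv_span // mem_nth.
by rewrite nth_default // mem0v.
Qed.

Lemma mem_nth_cat (V : vectType R) (H : {vspace V}) (s s' : seq V) :
  (forall i, s`_i \in H) -> (forall i, s'`_i \in H) -> forall i, (s ++ s')`_i \in H.
Proof. by move=> h h' i; rewrite nth_cat; case: ifP. Qed.

Lemma mem_nth_map (T : Type) (V : vectType R) (H : {vspace V}) (g : T -> V) (s : seq T) :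
  (forall x, g x \in H) -> forall i, [seq g x | x <- s]`_i \in H.
Proof. by move=> h; elim: s => [|x s IH] [|i] //=; rewrite ?mem0v ?nth_nil ?mem0v. Qed.

End FieldLists.

Section DetBundle.
Variables (R : realType) (B : kbasic R) (X : topologicalType) (K : kdata B X) (d : int).
Hypothesis wK : is_watlas K d.
Local Notation N := (kN B).
Implicit Types I J L : {set 'I_N}.
Local Notation emb := (@kemb R B X K _ _).
Local Notation rho := (@krho R B X K _ _).
Local Notation ds I := (dv (@ks R B X K I)).

Section Chart.
Variable I : {set 'I_N}.
Hypothesis iI : idx K I.

Lemma U_near (x : kU K I) (O : set (kU K I)) : open O -> O x -> nearM x O.
Proof. by move=> oO Ox; apply/(nearM_nbhs (wa_mfd wK iI)); exact: open_nbhs_nbhs. Qed.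

Lemma id_smooth (x : kU K I) : smoothv (chart (id x) \o id) x.
Proof. exact: near_self (U_good wK iI x) (ma_chart (U_at wK iI x)). Qed.

Lemma detK_frame_dframe F (x : kU K I) : detK_frames F -> F.1 x ->
  exists v w, F.2 x 0 = wedge fullv (Esp I) 0 v w /\ dframe fullv (@Esp R B I) 0 v w.
Proof.
move=> [Y [w [_ bw h ->]]] Fx; have [bY _] := h x Fx; do 2 eexists; split; first reflexivity.
by rewrite /dframe bY qbasis0.
Qed.

Lemma detK_cover (x : kU K I) : exists2 F, @detK_frames R B X K I F & F.1 x.
Proof.
have [Y [U [oU Ux h]]] := tangent_frame (wa_mfd wK iI) x.
pose w : seq (ET B) := vbasis (@Esp R B I).
exists (U, fun x (_ : 'I_1) => wedge fullv (Esp I) 0 [seq Y i x | i <- enum 'I_(cdim (kU K I))] w) => //.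
by exists Y, w; split=> //; exact: vbasisP.
Qed.

Lemma detK_compat (x : kU K I) :
  @smooth_bmap R _ _ _ id id (@detK_vb R B X K I) (@detK_vb R B X K I) (fun _ l => l) x.
Proof.
apply/smooth_bmap1 => F F' [Y [w [oF bw h eF]]] [Y' [w' [oF' bw' h' eF']]] Fx Fx'.
have [bY sY] := h x Fx; have [bY' sY'] := h' x Fx'.
have gx := U_good wK iI x; have mx := U_at wK iI x.
have [a [sa na]] : exists a : kU K I -> R, smR a x /\ nearM x (fun u =>
    [/\ basis_of fullv (at_pt (enum_fields Y) u), basis_of (Esp I) (at_pt (csts (kU K I) w) u),
        basis_of fullv (at_pt (enum_fields Y') u), a u != 0 &
        wedge fullv (Esp I) 0 (at_pt (enum_fields Y) u) (at_pt (csts (kU K I) w) u) =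
        a u *: wedge fullv (Esp I) 0 (at_pt (enum_fields Y') u) w']).
  apply: (@smooth_ratio _ _ _ id) => //; rewrite ?at_pt_enum ?at_pt_csts //.
  - exact: alls_enum.
  - exact: alls_enum.
  - exact: alls_csts.
  - by apply: nearM_forall => u; rewrite at_pt_csts; exact: mem_nth_sub.
exists a; split=> //; apply: nearMS na => u [_ _ _ _].
by rewrite !at_pt_enum at_pt_csts eF eF'.
Qed.

Lemma detK_vb_is : is_vbundle (@detK_vb R B X K I).
Proof.
split=> //.
- by move=> F [Y [w []]].
- exact: detK_cover.
- move=> F x hF Fx l /=.
  have [v [w [e f]]] := detK_frame_dframe hF Fx.
  by apply: (detline_basis (b := fun i => F.2 x i) f); rewrite e wedge_neq0.
- exact: detK_compat.
Qed.

End Chart.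
End DetBundle.

Section DetSmooth.
Variables (R : realType) (B : kbasic R) (X : topologicalType) (K : kdata B X) (d : int).
Hypothesis wK : is_watlas K d.
Local Notation N := (kN B).
Implicit Types I J L : {set 'I_N}.
Local Notation emb := (@kemb R B X K _ _).
Local Notation rho := (@krho R B X K _ _).
Local Notation ds I := (dv (@ks R B X K I)).

Lemma alls_push (M N' : charted R) (f : M -> N') (vs : seq (M -> 'rV[R]_(cdim M))) (u0 : M) :
  good u0 -> mfd_at u0 -> good (f u0) -> mfd_at (f u0) ->
  nearM u0 (fun v => ncont f v /\ smoothv (chart (f v) \o f) v) ->
  alls (fun X => smooth_field_along id X u0) vs ->
  alls (fun X => smooth_field_along f X u0) [seq (fun u => dm f u (X u)) | X <- vs].
Proof. by move=> g m gf mf nf; apply: alls_map => Y; exact: smooth_push. Qed.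

Lemma alls_pull (M N' : charted R) (f : M -> N') (vs : seq (N' -> 'rV[R]_(cdim N'))) (u0 : M) :
  good u0 -> good (f u0) -> ncont f u0 -> smoothv (chart (f u0) \o f) u0 ->
  alls (fun X => smooth_field_along id X (f u0)) vs ->
  alls (fun X => smooth_field_along f X u0) [seq X \o f | X <- vs].
Proof. by move=> g gf cf sf; apply: alls_map => Y; exact: field_pull. Qed.

Lemma alls_apply I (M : charted R) (f : M -> kU K I) (vs : seq (M -> 'rV[R]_(cdim (kU K I)))) (u0 : M) :
  idx K I -> good u0 -> ncont f u0 -> smoothv (chart (f u0) \o f) u0 ->
  alls (fun X => smooth_field_along f X u0) vs ->
  alls (fun X => smoothv X u0) [seq (fun u => ds I (f u) (X u)) | X <- vs].
Proof.
move=> iI g cf sf; apply: alls_map => Y sY.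
have sk := ch_s_smooth (wa_chart wK iI) (f u0).
exact: (smooth_apply g (U_good wK iI (f u0)) (U_at wK iI (f u0)) cf sf sY sk).
Qed.

Lemma detK_act_smooth I g (x : kU K I) : idx K I -> g \in Gam I ->
  @smooth_bmap R _ _ _ id (@kaU R B X K I g) (@detK_vb R B X K I) (@detK_vb R B X K I)
      (fun x => @detK_act R B X K I g x (kaU g x)) x.
Proof.
move=> iI gI; apply/smooth_bmap1 => F F' [Y [w [oF bw h eF]]] [Y' [w' [oF' bw' h' eF']]] Fx Fx'.
have [bY sY] := h x Fx; have [bY' sY'] := h' _ Fx'.
have gx := U_good wK iI x; have mx := U_at wK iI x.
have ggx := U_good wK iI (kaU g x); have mgx := U_at wK iI (kaU g x).
have cg := act_ncont wK iI (x:=x) gI; have sg := act_smooth wK iI x gI.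
pose vs := [seq (fun u => dm (@kaU R B X K I g) u (Z u)) | Z <- enum_fields Y].
pose vs' := [seq Z \o (@kaU R B X K I g) | Z <- enum_fields Y'].
have fr : dframe fullv (@Esp R B I) 0 [seq Y i x | i <- enum 'I_(cdim (kU K I))] w.
  by rewrite /dframe bY qbasis0.
have := act_frame wK iI x gI fr => /andP[b1 b2].
have [a [sa na]] : exists a : kU K I -> R, smR a x /\ nearM x (fun u =>
    [/\ basis_of fullv (at_pt vs u), basis_of (Esp I) (at_pt (csts (kU K I) [seq actH g e | e <- w]) u),
        basis_of fullv (at_pt vs' u), a u != 0 &
        wedge fullv (Esp I) 0 (at_pt vs u) (at_pt (csts (kU K I) [seq actH g e | e <- w]) u) =
        a u *: wedge fullv (Esp I) 0 (at_pt vs' u) w']).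
  apply: (@smooth_ratio _ _ _ (@kaU R B X K I g)) => //; rewrite ?at_pt_csts.
  - apply: alls_push => //; last exact: alls_enum.
    by apply: nearM_forall => y; split; [exact: (act_ncont wK iI gI)|exact: (act_smooth wK iI y gI)].
  - rewrite /vs; by rewrite (at_pt_map (fun u => dm (@kaU R B X K I g) u)) at_pt_enum.
  - by apply: alls_pull => //; exact: alls_enum.
  - by rewrite /vs' at_pt_comp at_pt_enum.
  - exact: alls_csts.
  - by rewrite -qbasis0.
  - by apply: nearM_forall => u; rewrite at_pt_csts; apply: mem_nth_sub; rewrite -qbasis0.
exists a; split=> //; apply: nearMS (nearMI na (U_near wK iI oF Fx)) => u [[_ _ _ _ e] Fu].
have [bYu _] := h u Fu; rewrite eF eF' (act_wedge wK iI u gI) /=; last by rewrite /dframe bYu qbasis0.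
by move: e; rewrite /vs /vs' (at_pt_map (fun u => dm (@kaU R B X K I g) u)) at_pt_csts at_pt_comp !at_pt_enum.
Qed.

(** A smooth frame Z of tilde U_IJ, pushed to U_I by [krho] and to U_J by [kemb] and completed there
    by fields [V2], gives two families that the transition map matches. Their ratios a and b to the
    given frames are smooth, and the coefficient of the transition is [b / a]. *)
Lemma detK_tr_smooth (Nb : normal_family K) I J (u0 : ktU K I J) : is_normal_choice Nb ->
  idx K I -> idx K J -> (I \proper J)%SET ->
  @smooth_bmap R _ _ _ (@krho R B X K I J) (@kemb R B X K I J) (@detK_vb R B X K I) (@detK_vb R B X K J)
      (fun u => @detK_tr R B X K Nb I J u (krho u) (kemb u)) u0.
Proof.
move=> hN iI iJ IJ.
apply/smooth_bmap1 => F F' [Y [w [oF bw h eF]]] [Y' [w' [oF' bw' h' eF']]] Fx Fx'.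
have [bY sY] := h _ Fx; have [bY' sY'] := h' _ Fx'.
have gu u := tU_good wK iI iJ IJ u; have mu := tU_at wK iI iJ IJ u0.
have gr := U_good wK iI (krho u0); have mr := U_at wK iI (krho u0).
have ge := U_good wK iJ (kemb u0); have me := U_at wK iJ (kemb u0).
have [cr sr rk0 rfull _] := rho_facts wK iI iJ IJ u0.
have ce u := emb_ncont wK iI iJ IJ (u:=u); have se u := emb_smooth wK iI iJ IJ u.
have [Z [U [oU Ux hZ]]] := tangent_frame (cc_tU (wa_change wK iI iJ IJ)) u0.
have [bZ sZ] := hZ _ Ux.
have [v2 bv2] := tr_frame_exists wK iI iJ IJ u0 bZ.
have [V2 [sV2 eV2]] := cst_fields ge me (ce u0) v2.
pose vr := [seq (fun u => dm (@krho R B X K I J) u (Q u)) | Q <- enum_fields Z].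
pose vr' := [seq Q \o (@krho R B X K I J) | Q <- enum_fields Y].
pose ve := [seq (fun u => dm (@kemb R B X K I J) u (Q u)) | Q <- enum_fields Z] ++ V2.
pose ve' := [seq Q \o (@kemb R B X K I J) | Q <- enum_fields Y'].
pose we := csts (ktU K I J) w ++ [seq (fun u => ds J (kemb u) (Q u)) | Q <- V2].
have eve u : at_pt ve u = [seq dm (@kemb R B X K I J) u a | a <- [seq Z i u | i <- enum 'I_(cdim (ktU K I J))]] ++ at_pt V2 u.
  by rewrite /ve at_pt_cat (at_pt_map (fun u => dm (@kemb R B X K I J) u)) at_pt_enum.
have ewe u : at_pt we u = w ++ [seq ds J (kemb u) a | a <- at_pt V2 u].
  by rewrite /we at_pt_cat at_pt_csts (at_pt_map (fun u => ds J (kemb u))).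
have [/andP[be bwe] _] := tr_frames wK iI iJ IJ bZ bv2 bw.
have [a [sa na]] : exists a : ktU K I J -> R, smR a u0 /\ nearM u0 (fun u =>
    [/\ basis_of fullv (at_pt vr u), basis_of (Esp I) (at_pt (csts (ktU K I J) w) u),
        basis_of fullv (at_pt vr' u), a u != 0 &
        wedge fullv (Esp I) 0 (at_pt vr u) (at_pt (csts (ktU K I J) w) u) =
        a u *: wedge fullv (Esp I) 0 (at_pt vr' u) w]).
  apply: (@smooth_ratio _ _ _ (@krho R B X K I J)) => //; rewrite ?at_pt_csts //.
  - apply: alls_push => //; last exact: alls_enum.
    by apply: nearM_forall => y; have [] := rho_facts wK iI iJ IJ y.
  - by rewrite /vr (at_pt_map (fun u => dm (@krho R B X K I J) u)) at_pt_enum; apply: basis_map.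
  - by apply: alls_pull => //; exact: alls_enum.
  - by rewrite /vr' at_pt_comp at_pt_enum.
  - exact: alls_csts.
  - by apply: nearM_forall => u; rewrite at_pt_csts; apply: mem_nth_sub.
have [b [sb nb]] : exists a : ktU K I J -> R, smR a u0 /\ nearM u0 (fun u =>
    [/\ basis_of fullv (at_pt ve u), basis_of (Esp J) (at_pt we u),
        basis_of fullv (at_pt ve' u), a u != 0 &
        wedge fullv (Esp J) 0 (at_pt ve u) (at_pt we u) =
        a u *: wedge fullv (Esp J) 0 (at_pt ve' u) w']).
  apply: (@smooth_ratio _ _ _ (@kemb R B X K I J)) => //.
  - apply: alls_cat sV2; apply: alls_push => //; last exact: alls_enum.
    by apply: nearM_forall => y.
  - by rewrite eve eV2.
  - by apply: alls_pull => //; exact: alls_enum.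
  - by rewrite /ve' at_pt_comp at_pt_enum.
  - by apply: alls_cat; [exact: alls_csts|exact: alls_apply].
  - by rewrite ewe eV2 -qbasis0.
  - apply: nearM_forall => u; rewrite ewe; apply: mem_nth_cat => i.
      by have /subvP := E_sub IJ; apply; exact: mem_nth_sub.
    apply: mem_nth_map => y; have /subvP := s_limg wK iJ (kemb u); apply.
    by rewrite memv_img ?memvf.
exists (fun u => (a u)^-1 * b u); split.
  apply: smR_mul => //; apply: smR_inv => //; [exact: gd_model|exact: gd_inv|].
  by have [] := near_self (gu _) na.
have nU : nearM u0 U.
  by apply/(nearM_nbhs (cc_tU (wa_change wK iI iJ IJ))); exact: open_nbhs_nbhs.
apply: nearMS (nearMI na (nearMI nb nU)) => u [[r1 r2 r3 r4 r5] [[e1 e2 e3 e4 e5] Uu]].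
have [bZu _] := hZ _ Uu.
have tl := tr_iso wK iI iJ IJ u hN.
move: r5; rewrite /vr /vr' (at_pt_map (fun u => dm (@krho R B X K I J) u)) at_pt_csts at_pt_comp !at_pt_enum => r5.
move: e5 e1; rewrite eve ewe /ve' at_pt_comp at_pt_enum => e5 e1.
have t := tr_wedge wK iI iJ IJ hN bZu e1 bw.
rewrite eF eF' /=.
have -> : wedge fullv (Esp I) 0 [seq Y i (krho u) | i <- enum 'I_(cdim (kU K I))] w =
    (a u)^-1 *: wedge fullv (Esp I) 0 [seq dm (@krho R B X K I J) u a | a <-
      [seq Z i u | i <- enum 'I_(cdim (ktU K I J))]] w.
  by rewrite r5 scalerA mulVf // scale1r.
by rewrite -scalerA -e5 -t; exact: (lin_isoZ _ _ tl).
Qed.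

End DetSmooth.

Lemma stab_complement (R : realType) (T E : vectType R) m (ds : 'Hom(T, E)) (Q : 'Hom('rV[R]_m, E))
    (H : {vspace E}) : lker Q = 0%VS -> (limg ds + limg Q)%VS = H ->
  exists v3, basis_of H ([seq Q a | a <- unit_rows R m] ++ [seq ds a | a <- v3]).
Proof.
move=> Q0 sH.
pose D := (limg ds :\: limg Q)%VS.
have dD : directv (limg Q + D) by apply/directv_addP; rewrite capvC capv_diff.
have eH : (limg Q + D)%VS = H.
  rewrite -sH -(addv_diff_cap (limg ds) (limg Q)) addvC -addvA; congr (_ + _)%VS.
  by apply/esym/addv_idPr; exact: capvSr.
have bQ : basis_of (limg Q) [seq Q a | a <- unit_rows R m].
  by apply: limg_basis_of (unit_rows_basis R m); rewrite Q0 capv0.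
exists [seq (ds^-1)%VF a | a <- vbasis D].
rewrite -eH; apply: cat_basis => //.
have -> : [seq ds a | a <- [seq (ds^-1)%VF a | a <- vbasis D]] = vbasis D.
  rewrite -map_comp map_id_in // => a /vbasis_mem aD /=.
  by rewrite limg_lfunVK //; apply: subvP aD; exact: diffvSl.
exact: vbasisP.
Qed.

(** * The bundle det s and the isomorphism from det K *)

Section DetSBundle.
Variables (R : realType) (B : kbasic R) (X : topologicalType) (K : kdata B X) (d : int).
Hypothesis wK : is_watlas K d.
Local Notation N := (kN B).
Implicit Types I J L : {set 'I_N}.
Local Notation emb := (@kemb R B X K _ _).
Local Notation rho := (@krho R B X K _ _).
Local Notation ds I := (dv (@ks R B X K I)).

Section Chart.
Variable I : {set 'I_N}.
Hypothesis iI : idx K I.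

Lemma stab_triv_wedge m (Q : 'Hom('rV[R]_m, ET B)) (x : kU K I) v3 b :
  lker Q = 0%VS -> (limg Q <= Esp I)%VS -> (limg (ds I x) + limg Q)%VS = Esp I ->
  basis_of (Esp I) ([seq Q a | a <- unit_rows R m] ++ [seq ds I x a | a <- v3]) ->
  basis_of (lker (stab Q x)) b ->
  stab_triv (wedge (lker (stab Q x)) 0 0 b [::]) = PsiK K I x (stab_lift (ds I x) Q (Esp I) v3 b).
Proof.
move=> Q0 QH sH b1 b2.
exact: (@stab_map_wedge _ _ _ _ (ds I x) Q (Esp I) Q0 QH (s_limg wK iI x) sH v3 b b1 b2).
Qed.

(** A local frame of det s is the contraction of [stab_lift], hence of a wedge of smooth fields once
    [v3] is extended. Its smooth ratio a to the given frame of det K is nonzero, so the contraction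
    has coefficient 1 / a. *)
Lemma PsiK_smooth (x : kU K I) :
  @smooth_bmap R _ _ _ id id (@detK_vb R B X K I) (@detS_vb R B X K I) (@PsiK R B X K I) x.
Proof.
apply/smooth_bmap1 => F F' [Y [w [oF bw h eF]]] [m [Q [k [Y' [q [oF' [Q0 QH] sQ h' eF']]]]]] Fx Fx'.
have [bY sY] := h x Fx; have [bY' sY'] := h' _ Fx'.
have gx := U_good wK iI x; have mx := U_at wK iI x.
have [v3 bv3] := stab_complement Q0 (sQ _ Fx').
have [V3 [sV3 eV3]] := cst_fields gx mx (@ncont_id _ _ x) v3.
pose vs := enum_fields Y' ++ V3.
pose ws := csts (kU K I) [seq Q a | a <- unit_rows R m] ++ [seq (fun u => ds I u (Z u)) | Z <- V3].
have evs u : at_pt vs u = [seq p.1 | p <- [seq (Y' j u, q j u) | j <- enum 'I_k]] ++ at_pt V3 u.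
  by rewrite /vs at_pt_cat at_pt_enum -map_comp.
have ews u : at_pt ws u = [seq Q a | a <- unit_rows R m] ++ [seq ds I u a | a <- at_pt V3 u].
  by rewrite /ws at_pt_cat at_pt_csts (at_pt_map (fun u => ds I u)).
have [a [sa na]] : exists a : kU K I -> R, smR a x /\ nearM x (fun u =>
    [/\ basis_of fullv (at_pt vs u), basis_of (Esp I) (at_pt ws u),
        basis_of fullv (at_pt (enum_fields Y) u), a u != 0 &
        wedge fullv (Esp I) 0 (at_pt vs u) (at_pt ws u) =
        a u *: wedge fullv (Esp I) 0 (at_pt (enum_fields Y) u) w]).
  apply: (@smooth_ratio _ _ _ id) => //.
  - apply: alls_cat sV3; apply: alls_enum => j.
    by have [] := sY' j.
  - rewrite evs eV3; exact: (stab_frame (s_limg wK iI x) (sQ _ Fx') bY' bv3).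
  - exact: alls_enum.
  - by rewrite at_pt_enum.
  - apply: alls_cat; first exact: alls_csts.
    by apply: (alls_apply wK (f := id)) => //; exact: (id_smooth wK iI).
  - by rewrite ews eV3.
  - apply: nearM_forall => u; rewrite ews; apply: mem_nth_cat => i.
      by apply: mem_nth_map => y; apply: (subvP QH); rewrite memv_img ?memvf.
    apply: mem_nth_map => y; have /subvP := s_limg wK iI u; apply.
    by rewrite memv_img ?memvf.
exists (fun u => (a u)^-1); split.
  apply: smR_inv => //; [exact: gd_model|exact: gd_inv|].
  by have [] := near_self gx na.
apply: nearMS (nearMI na (U_near wK iI oF' Fx')) => u [[r1 r2 r3 r4 r5] Fu].
have [bu _] := h' u Fu.
rewrite ews in r2.
rewrite eF eF' (stab_triv_wedge Q0 QH (sQ _ Fu) r2 bu) /stab_lift -ews -evs r5 at_pt_enum /=.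
by rewrite (lin_isoZ _ _ (PsiK_iso wK iI u)) scalerA mulVf // scale1r.
Qed.

Lemma detS_frame_iso F (x : kU K I) : detS_frames F -> F.1 x ->
  exists2 c : detK_fib x, c != 0 & F.2 x 0 = PsiK K I x c.
Proof.
move=> [m [Q [k [Y' [q [oF' [Q0 QH] sQ h' eF']]]]]] Fx.
have [bY' sY'] := h' _ Fx.
have [v3 bv3] := stab_complement Q0 (sQ _ Fx).
exists (stab_lift (ds I x) Q (Esp I) v3 [seq (Y' j x, q j x) | j <- enum 'I_k]).
  by apply: wedge_neq0; exact: (stab_lift_frame (s_limg wK iI x) (sQ _ Fx) bv3 bY').
by rewrite eF' (stab_triv_wedge Q0 QH (sQ _ Fx) bv3 bY').
Qed.

Lemma stab_kernel_basis m (Q : 'Hom('rV[R]_m, ET B)) (x : kU K I) s :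
  lker Q = 0%VS -> limg Q = Esp I -> basis_of fullv s ->
  basis_of (lker (stab Q x)) [seq (a, - (Q^-1)%VF (ds I x a)) | a <- s].
Proof.
move=> Q0 QH bs.
pose fn a : ('rV[R]_(cdim (kU K I)) * 'rV[R]_m)%type := (a, - (Q^-1)%VF (ds I x a)).
have lf : linear fn.
  move=> c y z; congr (_, _); rewrite /= !linearP /=.
  by [].
pose f : {linear 'rV[R]_(cdim (kU K I)) -> ('rV[R]_(cdim (kU K I)) * 'rV[R]_m)%type} :=
  HB.pack fn (GRing.isLinear.Build R _ _ _ _ lf).
have fE a : linfun f a = (a, - (Q^-1)%VF (ds I x a)) by exact: (lfunE f a).
have -> : [seq (a, - (Q^-1)%VF (ds I x a)) | a <- s] = [seq linfun f a | a <- s].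
  by apply: eq_map => a; rewrite fE.
have -> : lker (stab Q x) = (linfun f @: fullv)%VS.
  apply/vspaceP => p; apply/idP/idP.
    rewrite memv_ker (stabilizeE (ds I x) Q p) => /eqP e.
    have -> : p = linfun f p.1; last by rewrite memv_img ?memvf.
    rewrite fE; case: p e => a b /= e; congr (_, _).
    have -> : ds I x a = - Q b by apply/eqP; rewrite -addr_eq0 e.
    by rewrite -[- Q b](linearN Q) lker0_lfunK ?opprK // Q0.
  move=> /memv_imgP[a _ ->]; rewrite fE memv_ker (stabilizeE (ds I x) Q) /= (linearN Q) /= limg_lfunVK ?subrr //.
  by rewrite QH; have /subvP := s_limg wK iI x; apply; rewrite memv_img ?memvf.
apply: limg_basis_of => //; apply/eqP; rewrite -subv0; apply/subvP => a /memv_capP[_].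
by rewrite memv_ker fE memv0 => /eqP[->].
Qed.

(** Q is taken to be an isomorphism onto all of E_I. The kernel of the stabilization is then the
    graph of minus [Q^-1] composed with ds, so every smooth tangent frame yields a smooth kernel
    frame. *)
Lemma detS_cover (x : kU K I) : exists2 F, @detS_frames R B X K I F & F.1 x.
Proof.
have [Y [U [oU Ux h]]] := tangent_frame (wa_mfd wK iI) x.
pose m := \dim (@Esp R B I).
pose b : seq (ET B) := vbasis (@Esp R B I).
pose Qf (r : 'rV[R]_m) : ET B := \sum_i r 0 i *: b`_i.
have lf : linear Qf.
  move=> c y z; rewrite /Qf scaler_sumr -big_split; apply: eq_bigr => i _.
  by rewrite !mxE scalerDl scalerA.
pose Q0 : {linear 'rV[R]_m -> ET B} := HB.pack Qf (GRing.isLinear.Build R _ _ _ _ lf).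
pose Q : 'Hom('rV[R]_m, ET B) := linfun Q0.
have QE r : Q r = \sum_i r 0 i *: b`_i by exact: (lfunE Q0 r).
have bb : basis_of (Esp I) b by exact: vbasisP.
have kQ : lker Q = 0%VS.
  apply/eqP; rewrite -subv0; apply/subvP => r; rewrite memv_ker memv0 QE => /eqP e.
  apply/eqP/rowP => i; rewrite mxE.
  by have /freeP := basis_free bb; move/(_ (fun i => r 0 i) e).
have iQ : limg Q = Esp I.
  apply/eqP; rewrite eqEsubv; apply/andP; split; apply/subvP => e.
    move=> /memv_imgP[r _ ->]; rewrite QE; apply: rpred_sum => i _.
    by rewrite rpredZ // (mem_nth_sub bb).
  move=> eE; have -> : e = Q (\row_i coord (vbasis (Esp I)) i e).
    by rewrite QE {1}(coord_vbasis eE); apply: eq_bigr => i _; rewrite mxE.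
  by rewrite memv_img ?memvf.
pose q (i : 'I_(cdim (kU K I))) (u : kU K I) : 'rV[R]_m := - (Q^-1)%VF (ds I u (Y i u)).
exists (U, fun x (_ : 'I_1) => stab_triv (wedge (lker (stab Q x)) 0 0
    [seq (Y j x, q j x) | j <- enum 'I_(cdim (kU K I))] [::])) => //.
exists m, Q, (cdim (kU K I)), Y, q; split=> //.
- by rewrite iQ subvv.
- move=> y _; rewrite iQ; apply/addv_idPr; exact: (s_limg wK iI).
- move=> y Uy; have [bY sY] := h _ Uy; split.
    have := stab_kernel_basis y kQ iQ bY; rewrite -map_comp.
    by congr (basis_of _ _).
  move=> j; split=> //.
  have gy := U_good wK iI y; have my := U_at wK iI y.
  have sd : smoothv (fun u => ds I u (Y j u)) y.
    exact: (smooth_apply gy gy my (@ncont_id _ _ y) (id_smooth wK iI y) (sY j)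
      (ch_s_smooth (wa_chart wK iI) y)).
  exact: (smoothv_lin (\- (Q^-1)%VF)%R sd).
Qed.

Lemma detK_cover_neq0 (x : kU K I) : exists2 F, @detK_frames R B X K I F & F.1 x /\ F.2 x 0 != 0.
Proof.
have [F hF Fx] := detK_cover wK iI x; exists F => //; split=> //.
by have [v [w [-> f]]] := detK_frame_dframe hF Fx; exact: wedge_neq0.
Qed.

(** The identity of det s is the conjugate by [PsiK] of the identity of det K, so two
    trivializations from different Q need not be compared directly. *)
Lemma detS_compat (x : kU K I) :
  @smooth_bmap R _ _ _ id id (@detS_vb R B X K I) (@detS_vb R B X K I) (fun _ l => l) x.
Proof.
have gx := U_good wK iI x; have cx := @ncont_id _ (kU K I) x; have sx := id_smooth wK iI x.
have := @smooth_transfer R _ _ _ id id x _ (@detK_frames R B X K I) _ (@detS_frames R B X K I)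
  _ (@detK_frames R B X K I) _ (@detS_frames R B X K I) (PsiK K I) (PsiK K I) (fun _ l => l) (fun _ l => l)
  gx gx gx cx sx cx sx (detK_cover_neq0 x) (detK_cover wK iI x) (PsiK_iso wK iI) (PsiK_iso wK iI).
apply; [exact: nearM_forall|exact: (@PsiK_smooth x)|exact: (@PsiK_smooth x)|exact: (detK_compat wK iI (x:=x))].
Qed.

Lemma detS_vb_is : is_vbundle (@detS_vb R B X K I).
Proof.
split=> //.
- by move=> F [m [Q [k [Y' [q []]]]]].
- exact: detS_cover.
- move=> F x hF Fx l /=.
  have [c c0 e] := detS_frame_iso hF Fx.
  have [v [w f]] := detK_frame_exists K I.
  have pi := PsiK_iso wK iI x.
  apply: (line_basis (b := fun i => F.2 x i)).
    rewrite e; apply/negP => /eqP z; move/eqP: c0; apply; apply: (lin_iso_inj pi).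
    by rewrite z -[0 in RHS](scale0r 0) (lin_isoZ _ _ pi) scale0r.
  move=> l'; have [c' <-] := lin_iso_sur l' pi.
  have q0 : c (v, w) != 0.
    by apply/negP => /eqP q; move/eqP: c0; apply; rewrite (wedgeE c f) q scale0r.
  exists (c' (v, w) / c (v, w)); rewrite e -(lin_isoZ _ _ pi); congr (PsiK K I x _).
  by rewrite {2}(wedgeE c f) scalerA divfK //; exact: wedgeE.
- exact: detS_compat.
Qed.

Lemma detS_act_smooth g (x : kU K I) : g \in Gam I ->
  @smooth_bmap R _ _ _ id (@kaU R B X K I g) (@detS_vb R B X K I) (@detS_vb R B X K I)
      (fun x => @detS_act R B X K I g x (kaU g x)) x.
Proof.
move=> gI; have gx := U_good wK iI x; have cx := @ncont_id _ (kU K I) x; have sx := id_smooth wK iI x.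
apply: (@smooth_transfer R _ _ _ id (@kaU R B X K I g) x _ _ _ _ _ _ _ _ (PsiK K I) (PsiK K I)
  (fun x => @detK_act R B X K I g x (kaU g x)) (fun x => @detS_act R B X K I g x (kaU g x))
  gx gx (U_good wK iI (kaU g x)) cx sx (act_ncont wK iI gI)
  (act_smooth wK iI x gI) (detK_cover_neq0 x) (detK_cover wK iI (kaU g x))
  (PsiK_iso wK iI) (PsiK_iso wK iI) _ (@PsiK_smooth x) (@PsiK_smooth (kaU g x))
  (detK_act_smooth wK (x:=x) iI gI)).
apply: nearM_forall => y; split; first exact: linemapZ.
by move=> l; rewrite (PsiK_act wK iI gI).
Qed.

End Chart.

Lemma detS_tr_smooth (Nb : normal_family K) I J (u0 : ktU K I J) : is_normal_choice Nb ->
  idx K I -> idx K J -> (I \proper J)%SET ->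
  @smooth_bmap R _ _ _ (@krho R B X K I J) (@kemb R B X K I J) (@detS_vb R B X K I) (@detS_vb R B X K J)
      (fun u => @detS_tr R B X K I J u (krho u) (kemb u)) u0.
Proof.
move=> hN iI iJ IJ; have [cr sr _ _ _] := rho_facts wK iI iJ IJ u0.
apply: (@smooth_transfer R _ _ _ (@krho R B X K I J) (@kemb R B X K I J) u0 _ _ _ _ _ _ _ _
  (PsiK K I) (PsiK K J) (fun u => @detK_tr R B X K Nb I J u (krho u) (kemb u))
  (fun u => @detS_tr R B X K I J u (krho u) (kemb u)) (tU_good wK iI iJ IJ u0) (U_good wK iI (krho u0)) (U_good wK iJ (kemb u0)) cr sr
  (emb_ncont wK iI iJ IJ (u:=u0)) (emb_smooth wK iI iJ IJ u0)
  (detK_cover_neq0 iI (krho u0)) (detK_cover wK iJ (kemb u0))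
  (PsiK_iso wK iI) (PsiK_iso wK iJ) _ (PsiK_smooth iI (x:=krho u0)) (PsiK_smooth iJ (x:=kemb u0))
  (detK_tr_smooth wK (u0:=u0) hN iI iJ IJ)).
apply: nearM_forall => u; split; first exact: linemapZ.
by move=> l; rewrite (PsiK_tr wK iI iJ IJ hN).
Qed.

End DetSBundle.

(** * The bundle axioms for det K and det s *)

Section Assemble.
Variables (R : realType) (B : kbasic R) (X : topologicalType) (K : kdata B X) (d : int).
Hypotheses (wK : is_watlas K d) (la : local_agree K).
Variable Nb : normal_family K.
Hypothesis hN : is_normal_choice Nb.

Lemma detK_is_line_kbundle : is_line_kbundle (detK Nb).
Proof.
split=> //; split.
- exact: (detK_vb_is wK).
- by move=> I g x iI gI; exact: (act_iso wK iI x gI).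
- by move=> I g x iI gI; apply: (detK_act_smooth wK).
- by move=> I x l iI; apply: (detK_act1 wK).
- by move=> I g h x l iI gI hI; apply: (detK_actM wK).
- by move=> I J u iI iJ IJ; exact: (tr_iso wK iI iJ IJ u hN).
- by move=> I J u iI iJ IJ; apply: (detK_tr_smooth wK hN).
- by move=> I J g u u' l iI iJ IJ gJ e; apply: (detK_tr_equiv wK hN).
- by move=> I J L u v w l iI iJ iL IJ JL e1 e2; apply: (detK_cocycle wK hN la).
Qed.

Lemma PsiK_kiso : is_kiso (Lam := detK Nb) (Lam' := detS K) (PsiK K).
Proof.
split.
- by move=> I x iI; exact: (PsiK_iso wK iI x).
- by move=> I x iI; exact: (PsiK_smooth wK iI (x:=x)).
- by move=> I g x l iI gI; exact: (PsiK_act wK iI gI).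
- by move=> I J u l iI iJ IJ; exact: (PsiK_tr wK iI iJ IJ hN).
Qed.

Lemma lin_iso_conj (V W V' W' : lmodType R) (p : V -> V') (q : W -> W') (f : V -> W) (f' : V' -> W') :
  lin_iso p -> lin_iso q -> lin_iso f -> (forall l, f' (p l) = q (f l)) -> lin_iso f'.
Proof.
move=> ip iq [fl fb] h; have [pl pb] := ip; have [ql qb] := iq; split.
  move=> a u v; have [u0 <-] := lin_iso_sur u ip; have [v0 <-] := lin_iso_sur v ip.
  by rewrite -pl !h fl ql.
have [g pK gK] := pb.
have e : f' =1 q \o f \o g by move=> l /=; rewrite -h gK.
apply: eq_bij (fsym e); apply: bij_comp; first exact: bij_comp.
by exists p.
Qed.

Lemma PsiK_act_at I g (x y : kU K I) (c : detK_fib x) : idx K I -> g \in Gam I -> y = kaU g x ->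
  detS_act g y (PsiK K I x c) = PsiK K I y (detK_act g y c).
Proof. by move=> iI gI ->; rewrite (PsiK_act wK iI gI). Qed.

Lemma PsiK_tr_at I J (u : ktU K I J) x y (c : detK_fib x) : idx K I -> idx K J -> (I \proper J)%SET ->
  x = krho u -> y = kemb u -> detS_tr u y (PsiK K I x c) = PsiK K J y (detK_tr Nb u y c).
Proof. by move=> iI iJ IJ ex ey; subst x y; rewrite (PsiK_tr wK iI iJ IJ hN). Qed.

Lemma detS_is_line_kbundle : is_line_kbundle (detS K).
Proof.
have [[_ al _ a1 aM tl _ te tc] _] := detK_is_line_kbundle.
have sur I x (iI : idx K I) (l : detS_fib x) : exists c, PsiK K I x c = l.
  exact: lin_iso_sur (PsiK_iso wK iI x).
split=> //; split.
- exact: (detS_vb_is wK).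
- move=> I g x iI gI.
  by apply: (lin_iso_conj (PsiK_iso wK iI x) (PsiK_iso wK iI (kaU g x)) (al I g x iI gI)) => l;
    exact: PsiK_act_at.
- by move=> I g x iI gI; apply: (detS_act_smooth wK).
- move=> I x l iI /=; have [c <-] := sur _ _ iI l.
  have e : x = kaU 1%g x by rewrite (kaU1 wK iI).
  by rewrite (PsiK_act_at _ iI (Gam1 I) e); congr (PsiK K I x _); exact: a1.
- move=> I g h x l iI gI hI /=; have [c <-] := sur _ _ iI l.
  have e : kaU (g * h)%g x = kaU g (kaU h x) by rewrite (kaUM wK iI).
  rewrite (PsiK_act_at _ iI (GamM gI hI) erefl) (PsiK_act_at _ iI hI erefl) (PsiK_act_at _ iI gI e).
  by congr (PsiK K I _ _); exact: aM.
- move=> I J u iI iJ IJ.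
  by apply: (lin_iso_conj (PsiK_iso wK iI (krho u)) (PsiK_iso wK iJ (kemb u)) (tl I J u iI iJ IJ)) => l;
    exact: PsiK_tr_at.
- by move=> I J u iI iJ IJ; apply: (detS_tr_smooth wK hN).
- move=> I J g u u' l iI iJ IJ gJ e /=; have [c <-] := sur _ _ iI l.
  have er := cc_rho_equiv (wa_change wK iI iJ IJ) gJ e.
  rewrite (PsiK_act_at _ iI (restrG_Gam I g) er) (PsiK_tr_at _ iI iJ IJ erefl erefl).
  rewrite (PsiK_tr_at _ iI iJ IJ erefl erefl) (PsiK_act_at _ iJ gJ e).
  by congr (PsiK K J _ _); exact: te.
- move=> I J L u v w l iI iJ iL IJ JL e1 e2 /=; have [c <-] := sur _ _ iI l.
  have er : krho w = krho u by rewrite (wa_cocycle wK iI iJ iL IJ JL e1 e2).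
  rewrite (PsiK_tr_at _ iI iL (proper_trans IJ JL) er erefl) (PsiK_tr_at _ iI iJ IJ erefl erefl).
  rewrite (PsiK_tr_at _ iJ iL JL (esym e2) e1).
  by congr (PsiK K L _ _); exact: tc.
Qed.

End Assemble.

(** * The image of a coordinate change is locally the preimage of E_I *)

Section InverseFunction.
Variable R : realType.

Lemma mvt_line n (g : 'rV[R]_n -> R^o) q v :
  (forall t : R, 0 <= t <= 1 -> differentiable g (q + t *: v)) ->
  exists2 t : R, 0 <= t <= 1 & g (q + v) - g q = 'd g (q + t *: v) v.
Proof.
move=> dg.
pose l (t : R) : 'rV[R]_n := q + t *: v.
have dl t : is_diff t (l : R^o -> 'rV[R]_n) (fun s => s *: v).
  have -> : (fun s : R^o => s *: v) = (0 : R^o -> 'rV[R]_n) + ( *:%R^~ v).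
    by apply/funext => s; rewrite /= add0r.
  have -> : (l : R^o -> 'rV[R]_n) = cst q + ( *:%R^~ v) by [].
  exact: is_diffD.
have h (t : R) : 0 <= t <= 1 -> is_diff t (g \o l : R^o -> R^o) (fun s => 'd g (l t) (s *: v)).
  move=> t01; apply: DiffDef.
    by apply: differentiable_comp; [exact: ex_diff|exact: dg].
  rewrite diff_comp; [|exact: ex_diff|exact: dg].
  by apply/funext => s /=; rewrite diff_val.
have h2 (t : R) : 0 <= t <= 1 -> is_derive t (1 : R^o) (g \o l : R^o -> R^o) ('d g (l t) v).
  move=> t01; have ht := h t t01; have dt : differentiable (g \o l : R^o -> R^o) t by exact: ex_diff.
  apply: DeriveDef; first exact: diff_derivable.
  by rewrite deriveE // diff_val scale1r.
have [||c c01] := @MVT_segment R (g \o l) (fun t => 'd g (l t) v) 0 1 ler01.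
- by move=> x; rewrite in_itv /= => /andP[x0 x1]; apply: h2; rewrite !ltW.
- apply: derivable_within_continuous => x; rewrite in_itv /= => x01.
  by have := h2 x x01 => ?; exact: ex_derive.
rewrite /l /= scale1r scale0r addr0 subr0 mulr1 => e; exists c => //.
Qed.

(** The partial derivatives of G are continuous at [p0]; the mean value theorem along the segment
    from q to p, applied to each coordinate, makes the error small relative to p - q rather than to
    the distance from [p0]. *)
Lemma strict_diff n m (O : set 'rV[R]_n) (G : 'rV[R]_n -> 'rV[R]_m) p0 : open O -> O p0 ->
  smooth_open O G -> forall e : R, 0 < e -> exists2 r : R, 0 < r &
    forall p q, `|p - p0| < r -> `|q - p0| < r ->
      O p /\ `|G p - G q - 'd G p0 (p - q)| <= e * `|p - q|.
Proof.
move=> oO Op0 sG e e0.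
(* The error is a sum of n terms, one for each direction; dividing by n + 1 keeps the divisor
   nonzero when n = 0. *)
pose e1 := e / n.+1%:R.
have e10 : 0 < e1 by rewrite divr_gt0.
have nO : \forall p \near p0, O p by exact: open_near.
have nD j : \forall p \near p0, `|'D_(delta_mx 0 j) G p - 'D_(delta_mx 0 j) G p0| < e1.
  have c : {for p0, continuous ('D_(delta_mx 0 j) G)}.
    by apply: differentiable_continuous; exact: (sG [:: delta_mx 0 j] p0 Op0).
  have /cvgrPdist_lt/(_ _ e10) := c; apply: filterS => p h; rewrite distrC; exact: h.
have : \forall p \near p0, O p /\ forall j : 'I_n, `|'D_(delta_mx 0 j) G p - 'D_(delta_mx 0 j) G p0| < e1.
  apply: filterI => //.
  exact: (@filter_forall _ _ (fun (j : 'I_n) p => `|'D_(delta_mx 0 j) G p - 'D_(delta_mx 0 j) G p0| < e1)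
    (nbhs p0) (nbhs_filter p0)).
move=> /nbhs_ballP[r /= r0 hr]; exists r => // p q pr qr.
have inb x : `|x - p0| < r -> ball p0 r x by move=> h; rewrite -ball_normE /ball_ /= distrC.
have [Op _] := hr p (inb p pr); split=> //.
set v := p - q.
have seg (t : R) : 0 <= t <= 1 -> ball p0 r (q + t *: v).
  move=> /andP[t0 t1]; apply: inb.
  have -> : q + t *: v - p0 = (1 - t) *: (q - p0) + t *: (p - p0).
    by rewrite /v !scalerBr !scalerBl !scale1r; apply/rowP => i; rewrite !mxE; ring.
  apply: (le_lt_trans (ler_normD _ _)); rewrite !normrZ !ger0_norm ?subr_ge0 //.
  have [->|tn0] := eqVneq t 0; first by rewrite subr0 mul1r mul0r addr0.
  have tp : 0 < t by rewrite lt_def tn0.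
  apply: (@lt_le_trans _ _ ((1 - t) * r + t * r)); last by rewrite -mulrDl subrK mul1r.
  by apply: ler_ltD; [rewrite ler_wpM2l ?subr_ge0 // ltW|rewrite ltr_pM2l].
have dG x : O x -> differentiable G x by exact: (sG [::]).
have dGE x : O x -> forall w, 'd G x w = \sum_j w 0 j *: 'D_(delta_mx 0 j) G x.
  move=> Ox w; rewrite {1}(row_sum_delta w) linear_sum; apply: eq_bigr => j _.
  by rewrite linearZ deriveE //; exact: dG.
apply: mxnorm_le; first by rewrite mulr_ge0 // ltW.
move=> i.
pose l : {linear 'rV[R]_m -> R^o} := entry i.
have cl : continuous l by exact: linear_rV_continuous.
have dent x : O x -> is_diff x (l \o G : 'rV[R]_n -> R^o) (l \o 'd G x).
  move=> Ox; have dl y : differentiable l y by exact: linear_differentiable.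
  apply: DiffDef; first by apply: differentiable_comp; [exact: dG|exact: dl].
  by rewrite diff_comp; [rewrite (diff_lin _ cl)|exact: dG|exact: dl].
have [|t t01 et] := @mvt_line n (l \o G) q v.
  by move=> t t01; have := dent _ (proj1 (hr _ (seg t t01))) => ?; exact: ex_diff.
have Ot := proj1 (hr _ (seg t t01)).
have := dent _ Ot => dd; move: et; rewrite diff_val /= /l /= /entry.
have -> : q + v = p by rewrite /v addrC subrK.
move=> et; have -> : (G p - G q - 'd G p0 v) 0 i = ('d G (q + t *: v) v - 'd G p0 v) 0 i.
  by rewrite ![in LHS]mxE et !mxE.
have d1 := dGE _ Ot v.
have d2 := dGE _ Op0 v.
apply: le_trans (_ : `|(\sum_j v 0 j *: 'D_(delta_mx 0 j) G (q + t *: v) - \sum_j v 0 j *: 'D_(delta_mx 0 j) G p0) 0 i| <= _).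
  have /eqP := congr1 (fun w : 'rV[R]_m => `|w 0 i|) (f_equal2 (fun a b => a - b) d1 d2).
  by rewrite eq_le => /andP[].
rewrite -sumrB summxE.
apply: (le_trans (ler_norm_sum _ _ _)).
have -> : e * `|v| = \sum_(j < n.+1) e1 * `|v|.
  by rewrite sumr_const card_ord -mulrnAl -mulr_natr divfK ?pnatr_eq0.
apply: (@le_trans _ _ (\sum_(j < n) e1 * `|v|)).
  apply: ler_sum => j _; rewrite -scalerBr mxE normrM mulrC.
  apply: ler_pM => //; last exact: mxcoord_le.
  apply: (le_trans (mxcoord_le _ _)); apply: ltW.
  exact: (proj2 (hr _ (seg t t01))).
by rewrite big_ord_recr /= lerDl mulr_ge0 // ltW.
Qed.

End InverseFunction.

HB.instance Definition _ (R : realType) k := Complete.on 'rV[R]_k.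

Section LocalImage.
Variable R : realType.

(** Contraction principle: T halves distances and moves the centre by at most r / 2, so it maps the
    closed ball of radius r, which is complete, into itself. *)
Lemma perturbed_id_onto k (T : 'rV[R]_k -> 'rV[R]_k) p0 (r : R) : 0 < r ->
  (forall p q, `|p - p0| <= r -> `|q - p0| <= r -> `|T p - T q| <= 2^-1 * `|p - q|) ->
  `|T p0 - p0| <= r / 2 -> exists2 p, `|p - p0| <= r & T p = p.
Proof.
move=> r0 hT T0.
pose U : set 'rV[R]_k := [set p | `|p - p0| <= r].
have Up0 : U p0 by rewrite /U /= subrr normr0 ltW.
have hU : {homo T : p / U p >-> U p}.
  move=> p Up; rewrite /U /= -(subrK (T p0) (T p)) -addrA.
  apply: (le_trans (ler_normD _ _)); rewrite [leRHS](splitr r); apply: lerD => //.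
  apply: (le_trans (hT _ _ Up Up0)); rewrite mulrC.
  by rewrite ler_wpM2r ?invr_ge0.
have cU : closed U.
  have -> : U = (fun p => `|p - p0|) @^-1` [set x | x <= r] by [].
  apply: preimage_closed; last exact: (@closed_le R r).
  move=> p _; apply: (@continuous_comp _ _ _ (fun p : 'rV[R]_k => p - p0)); last exact: norm_continuous.
  apply: (@cvgB _ _ _ (nbhs p) _ (fun p => p) (fun=> p0)); last exact: cvg_cst.
  exact: (fun A hA => hA).
have ctr : is_contraction (mkfun_fun hU).
  exists (2^-1)%:nng; split=> /=; first by rewrite invf_lt1 // ltr1n.
  by move=> -[p q] [/= Up Uq]; exact: hT.
have [p Up e] := banach_fixed_point ctr cU (ex_intro _ p0 Up0).
by exists p => //; rewrite [RHS]e.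
Qed.

(* Given a zero q of f, a fixed point argument yields p such that q - G p lies in
   a complement of the image of dG; df is bounded below there, so q = G p. *)
Lemma zero_set_image k n m (U : set 'rV[R]_k) (G : 'rV[R]_k -> 'rV[R]_n) p0
    (V : set 'rV[R]_n) (f : 'rV[R]_n -> 'rV[R]_m) (A : 'Hom('rV[R]_k, 'rV[R]_n)) (L : 'Hom('rV[R]_n, 'rV[R]_m)) :
  open U -> U p0 -> smooth_open U G -> open V -> V (G p0) -> smooth_open V f ->
  (forall a, 'd G p0 a = A a) -> (forall v, 'd f (G p0) v = L v) ->
  lker A = 0%VS -> lker L = limg A -> (\forall p \near p0, f (G p) = 0) ->
  forall O, nbhs p0 O -> \forall q \near G p0, f q = 0 -> exists2 p, O p & q = G p.
Proof.
move=> oU Up0 sG oV Vq0 sf dA dL A0 LA fG O nO.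
pose P : 'Hom('rV[R]_n, 'rV[R]_k) := (A^-1)%VF.
have PA a : P (A a) = a by rewrite lker0_lfunK // A0.
(* D inverts L on the kernel of P: the pseudo-inverse of L is correct up to the kernel of L, which
   is the image of A, and [\1 - A \o P] removes that part. *)
pose D : 'Hom('rV[R]_m, 'rV[R]_n) := ((\1 - (A \o P)) \o L^-1)%VF.
have DL v : P v = 0 -> D (L v) = v.
  move=> Pv; rewrite /D comp_lfunE; set w := (L^-1)%VF (L v).
  have : w - v \in lker L by rewrite memv_ker linearB /= limg_lfunVK ?memv_img ?memvf // subrr.
  rewrite LA => /memv_imgP[a _ wa].
  have -> : w = v + A a by rewrite -wa addrC subrK.
  rewrite add_lfunE id_lfunE opp_lfunE comp_lfunE linearD /= Pv PA add0r.
  by rewrite -addrA subrr addr0.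
have [C C0 hC] := lin_bound D; have [CP CP0 hP] := lin_bound P.
(* This value makes the map sending p to [p - P (G p) + P q] a contraction with factor 1 / 2; the
   next one bounds the norm of [q - G p] by half of itself. *)
have e10 : 0 < (2 * CP)^-1 by rewrite invr_gt0 mulr_gt0.
have e20 : 0 < (2 * C)^-1 by rewrite invr_gt0 mulr_gt0.
have [r1 r10 h1] := strict_diff oU Up0 sG e10.
have [r2 r20 h2] := strict_diff oV Vq0 sf e20.
have cG : {for p0, continuous G}.
  by apply: differentiable_continuous; exact: (sG [::]).
have [r3 /= r30 h3] : exists2 r : R, 0 < r & forall p, `|p - p0| <= r ->
    [/\ `|p - p0| < r1, O p, f (G p) = 0 & `|G p - G p0| < r2].
  have : \forall p \near p0, [/\ `|p - p0| < r1, O p, f (G p) = 0 & `|G p - G p0| < r2].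
    have n1 : \forall p \near p0, `|p - p0| < r1.
      apply/nbhs_ballP; exists r1 => //= p; rewrite -ball_normE /ball_ /= distrC //.
    have n2 : \forall p \near p0, `|G p - G p0| < r2.
      by have /cvgrPdist_lt/(_ _ r20) := cG; apply: filterS => p; rewrite distrC.
    by near=> p; split; near: p.
  move=> /nbhs_ballP[r /= r0 hr]; exists (r / 2); first by rewrite divr_gt0.
  move=> p pr; apply: hr; rewrite -ball_normE /ball_ /= distrC.
  by apply: (le_lt_trans pr); rewrite ltr_pdivrMr // ltr_pMr // ltr1n.
have e30 : 0 < Num.min r2 (r3 / 2 / CP) by rewrite lt_min r20 !divr_gt0.
apply/nbhs_ballP; exists (Num.min r2 (r3 / 2 / CP)) => //= q.
rewrite -ball_normE /ball_ /= distrC lt_min => /andP[q2 q3] fq.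
have [p pr Tp] : exists2 p, `|p - p0| <= r3 & p - P (G p) + P q = p.
  apply: (perturbed_id_onto (T := fun p => p - P (G p) + P q)) => //.
    move=> p p' pr pr'; have [p1 _ _ _] := h3 _ pr; have [p1' _ _ _] := h3 _ pr'.
    have -> : p - P (G p) + P q - (p' - P (G p') + P q) = - P (G p - G p' - A (p - p')).
      by rewrite !(linearB P) /= PA; apply/rowP => i; rewrite !mxE; ring.
    rewrite normrN; apply: (le_trans (hP _)).
    have := (h1 p p' p1 p1').2; rewrite dA => h.
    apply: (@le_trans _ _ (CP * ((2 * CP)^-1 * `|p - p'|))); first by rewrite ler_wpM2l // ltW.
    by rewrite mulrA invfM mulrCA mulfV ?mulr1 // gt_eqF.
  have -> : p0 - P (G p0) + P q - p0 = P (q - G p0).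
    by rewrite linearB /=; apply/rowP => i; rewrite !mxE; ring.
  apply: (le_trans (hP _)); rewrite mulrC -ler_pdivlMr //; exact: ltW.
have [p1 Op fp Gp] := h3 _ pr; exists p => //.
have Pv : P (q - G p) = 0.
  rewrite linearB /=; apply/eqP; rewrite subr_eq0; apply/eqP.
  move/eqP: Tp; rewrite -addrA -subr_eq0 addrAC subrr add0r addrC subr_eq0 => /eqP.
  by [].
have := (h2 q (G p) q2 Gp).2; rewrite fq fp subrr sub0r normrN dL => h.
have b : `|q - G p| <= 2^-1 * `|q - G p|.
  rewrite -{1}(DL _ Pv); apply: (le_trans (hC _)).
  apply: (@le_trans _ _ (C * ((2 * C)^-1 * `|q - G p|))); first by rewrite ler_wpM2l // ltW.
  by rewrite mulrA invfM mulrCA mulfV ?mulr1 // gt_eqF.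
apply/eqP; rewrite -subr_eq0 -normr_le0.
have h0 := normr_ge0 (q - G p); lra.
Unshelve. all: by end_near.
Qed.

End LocalImage.

Section ManifoldImage.
Variable R : realType.
Implicit Types M N : charted R.

Lemma interior_rep M m (f : M -> 'rV[R]_m) (x : M) : good x ->
  interior (@cmodel R M) (chart x x) -> smoothv f x ->
  exists U G, [/\ open U, U (chart x x), smooth_open U G,
    forall q, U q -> cmodel q /\ G q = f (cinv x q) &
    forall a, 'd G (chart x x) a = dv f x a].
Proof.
move=> gx ix sf.
have [U [G [oU Ux sG eG]]] := smooth_within_lin (@ofcoord R 'rV[R]_m) sf.
exists (U `&` interior (@cmodel R M)), G; split.
- by apply: openI => //; exact: open_interior.
- by [].
- by move=> vs p [Up _]; exact: sG.
- move=> q [Uq /interior_subset mq]; split=> //.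
  by rewrite eG //= vcoordK.
- move=> a; have dG : differentiable G (chart x x) by exact: (sG [::]).
  have hw := @wd_diff _ _ _ (@cmodel R M) _ _ dG.
  have hi : isd f x (linfun 'd G (chart x x)).
    apply: wd_ext hw; last exact: gd_model.
    by apply: filterS (open_near oU Ux) => q Uq mq; rewrite eG //= vcoordK.
  by rewrite (dv_isd gx hi) lfunE.
Qed.

Lemma zero_set_image_mfd M N (h : M -> N) (x : M) (E : vectType R) (f : N -> E) :
  good x -> good (h x) -> interior (@cmodel R M) (chart x x) ->
  interior (@cmodel R N) (chart (h x) (h x)) ->
  ncont h x -> smoothv (chart (h x) \o h) x -> smoothv f (h x) ->
  nearM x (fun y => f (h y) = 0) -> lker (dm h x) = 0%VS ->
  lker (dv f (h x)) = limg (dm h x) ->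
  forall P : M -> Prop, nearM x P -> nearM (h x) (fun y => f y = 0 -> exists2 z, P z & h z = y).
Proof.
move=> gx gh ix ih ch sh sf fh h0 fk P nP.
have svf : smoothv (vcoord \o f) (h x) by exact: (smoothv_lin (@vcoord R E) sf).
have [U [G [oU Ux sG eG dG]]] := interior_rep gx ix sh.
have [V [F [oV Vx sF eF dF]]] := interior_rep gh ih svf.
have Gx : G (chart x x) = chart (h x) (h x) by rewrite (eG _ Ux).2 /= (gd_inv gx).
have dvf : dv (vcoord \o f) (h x) = (linfun vcoord \o dv f (h x))%VF.
  apply: dv_isd => //.
  have := isd_lin (linfun (@vcoord R E)) (smoothv_isd gh sf).
  by apply: isd_ext => //; apply: nearM_forall => q /=; rewrite lfunE.
pose Q y := P y /\ cinv (h x) (chart (h x) (h y)) = h y /\ V (chart (h x) (h y)) /\ f (h y) = 0.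
have nQ : nearM x Q.
  apply: nearMI => //; apply: nearMI.
    by apply: (ch (fun y => cinv (h x) (chart (h x) y) = y)); apply: nearMS (good_coord gh) => y [].
  apply: nearMI => //; apply: (ch (fun y => V (chart (h x) y))).
  apply: (@good_near_chart _ _ _ (fun p => V p)) => //.
  by apply: filterS (open_near oV Vx) => p Vp _.
have GE p : U p -> G p = chart (h x) (h (cinv x p)) by move=> /eG[].
have nU : \forall p \near chart x x, U p /\ Q (cinv x p).
  apply: filterS2 (open_near oU Ux) nQ => p Up hq; split=> //; apply: hq.
  exact: (eG _ Up).1.
rewrite -Gx in Vx.
have k0 : lker (dm h x) = 0%VS by [].
have kF : lker (dv (vcoord \o f) (h x)) = limg (dm h x).
  rewrite -fk dvf; apply/vspaceP => v; rewrite !memv_ker comp_lfunE lfunE /=.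
  apply/eqP/eqP => [e|->]; last by rewrite linear0.
  by rewrite -[LHS]vcoordK e linear0.
have fG : \forall p \near chart x x, F (G p) = 0.
  apply: filterS nU => p [Up [_ [eh [Vh fh0]]]].
  by rewrite (GE _ Up) (eF _ Vh).2 /= eh fh0 linear0.
have dF' v : 'd F (G (chart x x)) v = dv (vcoord \o f) (h x) v by rewrite Gx dF.
have key := zero_set_image oU Ux sG oV Vx sF dG dF' h0 kF fG nU.
rewrite Gx in key Vx.
rewrite /nearM; apply: filterS2 key (open_near oV Vx) => q hq Vq mq fq.
have [|p [Up [Pp [eh _]]] qe] := hq.
  by rewrite (eF _ Vq).2 /= fq linear0.
by exists (cinv x p) => //; rewrite -eh -(GE _ Up) -qe.
Qed.

End ManifoldImage.

Section InteriorImage.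
Variables (R : realType) (B : kbasic R) (X : topologicalType) (K : kdata B X) (d : int).
Hypothesis wK : is_watlas K d.
Local Notation N := (kN B).
Implicit Types I J : {set 'I_N}.

(** Applied to the parametrization h of tilde U_IJ and to the part f of s_J transverse to E_I. The
    index condition [ds_EI] says that the kernel of the derivative of f is exactly the image of that
    of h, so the zeros of f near [kemb u] are points of tilde U_IJ. *)
Lemma tU_image_interior I J (u : ktU K I J) : idx K I -> idx K J -> (I \proper J)%SET ->
  ~ @bdry R (kU K I) (krho u) -> ~ @bdry R (kU K J) (kemb u) ->
  nearM (kemb u) (fun y : kU K J => ks y \in Esp I -> exists u' : ktU K I J, kemb u' = y).
Proof.
move=> iI iJ IJ /contrapT bI /contrapT bJ.
have hc := wa_change wK iI iJ IJ.
have [_ [g [gu sg g1 g2]]] := cc_rho_diffeo hc (x:=u) Logic.I.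
have gx := U_good wK iI (krho u).
have gy := U_good wK iJ (kemb u).
have gt := tU_good wK iI iJ IJ u.
have cg : ncont g (krho u) by exact: (smooth_map_ncont (cc_tU hc) sg).
have [cr sr r0 rf _] := rho_facts wK iI iJ IJ u.
have ce := emb_ncont wK iI iJ IJ (u:=u); have se := emb_smooth wK iI iJ IJ u.
have e0 := emb_inj wK iI iJ IJ u.
(* The parametrization starts from U_I, by means of a local inverse of [krho], because interiority
   is available at [krho u]. *)
pose h := @kemb R B X K I J \o g.
have sgv := sg.2.
have ch : ncont h (krho u) by apply: ncont_comp => //; rewrite gu.
have hu : h (krho u) = kemb u by rewrite /h /= gu.
have E2 : (dm (@krho R B X K I J) u \o dm g (krho u))%VF = \1%VF.
  have ig := smoothv_isd gx sgv.
  have ir : isd (chart (krho u) \o @krho R B X K I J) (g (krho u)) (dm (@krho R B X K I J) u).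
    by rewrite gu; exact: (rho_isd wK iI iJ IJ u).
  have gg : good (g (krho u)) by rewrite gu.
  have h1 := isd_comp gx gg cg ig ir.
  have h2 : isd (chart (krho u)) (krho u) (dm (@krho R B X K I J) u \o dm g (krho u))%VF.
    by apply: isd_ext h1 => //; apply: nearMS g2 => y [_ /= ->].
  by rewrite -(dv_isd gx h2) (dv_isd gx (isd_chart gx)).
have dmh : dm h (krho u) = (dm (@kemb R B X K I J) u \o dm g (krho u))%VF.
  have ig := smoothv_isd gx sgv.
  have gg : good (g (krho u)) by rewrite gu.
  have ie : isd (chart (kemb u) \o @kemb R B X K I J) (g (krho u)) (dm (@kemb R B X K I J) u).
    by rewrite gu; exact: (emb_isd wK iI iJ IJ u).
  by rewrite /dm hu; apply: dv_isd => //; exact: (isd_comp gx gg cg ig ie).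
have kg : lker (dm g (krho u)) = 0%VS by exact: (hom_id_lker E2).
have lg : limg (dm g (krho u)) = fullv.
  apply/eqP; rewrite eqEsubv subvf; apply/subvP => b _.
  have -> : b = dm g (krho u) (dm (@krho R B X K I J) u b); last by rewrite memv_img ?memvf.
  have r00 : lker (dm (@krho R B X K I J) u) == 0%VS by rewrite r0.
  apply: (lker0P r00).
  have := congr1 (fun L : 'Hom(_, _) => L (dm (@krho R B X K I J) u b)) E2.
  by rewrite comp_lfunE id_lfunE => ->.
pose pr : 'End(ET B) := (\1 - projv (@Esp R B I))%VF.
have prE e : (pr e == 0) = (e \in Esp I).
  rewrite /pr add_lfunE id_lfunE opp_lfunE subr_eq0; apply/eqP/idP => [->|eI].
    exact: memv_proj.
  by rewrite projv_id.
pose f (y : kU K J) := pr (ks y).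
have sf : smoothv f (kemb u) by exact: (smoothv_lin pr (ch_s_smooth (wa_chart wK iJ) (kemb u))).
have dvf : dv f (kemb u) = (pr \o dv (@ks R B X K J) (kemb u))%VF.
  apply: dv_isd => //; have := isd_lin pr (s_isd wK iJ (kemb u)); exact.
have := @zero_set_image_mfd R _ _ h (krho u) _ f; rewrite !hu => key.
have sh : smoothv (chart (kemb u) \o h) (krho u).
  have gg : good (g (krho u)) by rewrite gu.
  have se' : smoothv (chart (kemb u) \o @kemb R B X K I J) (g (krho u)) by rewrite gu.
  exact: (smoothv_comp gx gg cg sgv se').
have hf : nearM (krho u) (fun y => f (h y) = 0).
  apply: nearMS g2 => y _; apply/eqP; rewrite prE /h /= (cc_s hc).
  exact: (ch_s_val (wa_chart wK iI)).
have kh : lker (dm h (krho u)) = 0%VS.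
  rewrite dmh; exact: comp_lker0.
have fk : lker (dv f (kemb u)) = limg (dm h (krho u)).
  rewrite dvf dmh limg_comp lg; apply/vspaceP => v.
  by rewrite memv_ker comp_lfunE prE (ds_EI wK iI iJ IJ).
have := key gx gy bI bJ ch sh sf hf kh fk _ (nearM_forall _ (fun _ => Logic.I)).
apply: nearMS => y hy yI; have [|z _ <-] := hy; first by apply/eqP; rewrite prE.
by exists (g z).
Qed.

End InteriorImage.

(** * Openness of the triple overlaps *)

Section Agreement.
Variables (R : realType) (B : kbasic R) (X : topologicalType) (K : kdata B X) (d : int).
Hypothesis wK : is_watlas K d.
Local Notation N := (kN B).
Implicit Types I J L : {set 'I_N}.

Definition tU_image := forall I J, idx K I -> idx K J -> (I \proper J)%SET ->
  forall w : ktU K I J,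
    nearM (kemb w) (fun y : kU K J => ks y \in Esp I -> exists w' : ktU K I J, kemb w' = y).

(** On tilde U_IL the section s_L takes values in E_I, hence in E_J. Near u this puts the point into
    tilde U_JL, with a lift [v'] near v by the embedding property; then [krho v'] is near [kemb w]
    and its section value lies in E_I, so it lies in tilde U_IJ. *)
Lemma tU_image_agree : tU_image -> local_agree K.
Proof.
move=> im I J L iI iJ iL IJ JL u v w euv evw.
have hIL := proper_trans IJ JL.
have hJL := wa_change wK iJ iL JL.
have [_ _ _ embo] := cc_emb hJL.
pose P (v' : ktU K J L) := ks (krho v') \in Esp I -> exists w' : ktU K I J, kemb w' = krho v'.
have nP : nearM v P.
  have [cr _ _ _ _] := rho_facts wK iJ iL JL v.
  apply: (cr (fun y : kU K J => ks y \in Esp I -> exists w' : ktU K I J, kemb w' = y)).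
  by rewrite evw; exact: im.
have [Q nO hO] := embo v _ ((nearM_nbhs (cc_tU hJL) v P).1 nP).
have ce := emb_ncont wK iI iL hIL (u:=u).
have n1 : nearM u (fun u1 => Q (kemb u1)).
  by apply: (ce Q); rewrite euv; apply/(nearM_nbhs (wa_mfd wK iL)).
have n2 : nearM u (fun u1 => ks (kemb u1) \in Esp J -> exists v' : ktU K J L, kemb v' = kemb u1).
  apply: (ce (fun y : kU K L => ks y \in Esp J -> exists v' : ktU K J L, kemb v' = y)).
  by rewrite euv; exact: im.
apply: nearMS2 n1 n2 => u1 Ou h.
have sI : ks (kemb u1) \in Esp I.
  by rewrite (cc_s (wa_change wK iI iL hIL)); exact: (ch_s_val (wa_chart wK iI)).
have [|v' ev] := h; first by have /subvP := E_sub IJ; apply.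
have Pv : P v' by apply: hO; rewrite ev.
have [|w' ew] := Pv; first by rewrite -(cc_s hJL) ev.
by exists v', w'.
Qed.

Lemma weak_atlas_tU_image : (forall I, idx K I -> @bdry R (kU K I) = set0) -> tU_image.
Proof.
move=> b0 I J iI iJ IJ w.
by apply: (tU_image_interior wK iI iJ IJ); rewrite b0.
Qed.

End Agreement.

Section CobordismAgreement.
Variables (R : realType) (B : kbasic R) (Y : topologicalType) (C : cobdata B Y) (d : int).
Hypothesis wC : is_weak_cobordism C d.
Local Notation N := (kN B).
Implicit Types I J L : {set 'I_N}.

Lemma eps_gt0 : 0 < ceps C.
Proof. exact: cl_eps (cb_collared wC). Qed.

Lemma colA_endpoint a : colA a (ceps C) (endpoint R a).
Proof.
have e0 := eps_gt0.
by case: a => /=; rewrite in_itv /= ?lexx ?e0 // andbT ltrBlDr ltrDl.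
Qed.

Lemma cb_atlas a : is_watlas (cbK C a) (d - 1).
Proof. by have [] := cb_bdry wC a. Qed.

Lemma idx_bdry a I : idx (cbK C a) I -> idx C I.
Proof.
move=> [I0 [b hb]]; split=> //; exists (ciY (endpoint R a) b) => i iI.
by have := hb i iI; rewrite (cb_basic_foot wC).
Qed.

Lemma idx_cfoot a I : idx C I -> @cfoot _ _ _ C a I !=set0 -> idx (cbK C a) I.
Proof.
move=> iI [b hb]; split; first by case: iI.
exists b => i Ii; rewrite (cb_basic_foot wC).
by move: hb; rewrite /cfoot /= (wa_foot (cb_watlas wC) iI); apply.
Qed.

Lemma idx_sub (X : topologicalType) (K : kdata B X) I J : idx K J -> I != finset.set0 -> (I \proper J)%SET -> idx K I.
Proof.
move=> [_ [b hb]] I0 /proper_sub/fintype.subsetP IJ; split=> //.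
by exists b => i iI; apply: hb; exact: IJ.
Qed.

Lemma idx_pt a I (x : kU (cbK C a) I) : idx C I -> idx (cbK C a) I.
Proof.
move=> iI; apply: (idx_cfoot iI).
by apply/(co_empty (cb_chart wC iI)); exists x.
Qed.

(** Used by contraposition, to make [krho w] interior when [kemb w] is. A boundary point of U_IJ
    lifts into the collar of tilde U_IJ; the fibre of [krho] through this lift is an orbit, and the
    action preserves the boundary of U_J. *)
Lemma bdry_tU_image I J (w : ktU C I J) : idx C I -> idx C J -> (I \proper J)%SET ->
  @bdry R (kU C I) (krho w) -> @bdry R (kU C J) (kemb w).
Proof.
move=> iI iJ IJ; rewrite (co_bdry (cb_chart wC iI)) => -[a [x ex]].
have hx := cb_change wC iI iJ IJ; have hc := wa_change (cb_watlas wC) iI iJ IJ.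
have ca := colA_endpoint a.
have Ux : kUIJ J (ciU (endpoint R a) x).
  by rewrite -ex -(cc_rho_image hc); exists w.
have fJ : @cfoot _ _ _ C a J !=set0.
  by apply/set0P/negP => /eqP fJ; apply: (cx_away hx ca fJ) Ux.
have biJ := idx_cfoot iJ fJ; have biI := idx_sub biJ iI.1 IJ.
have bc := wa_change (cb_atlas a) biI biJ IJ.
have /(cx_UIJ hx x ca fJ) := Ux.
rewrite -(cc_rho_image bc) => -[u0 _ eu0].
have [u' [e1 e2]] := cx_tU hx u0 ca fJ.
have /(cc_rho_fibres hc)[g [gJ _ eg]] : krho u' = krho w by rewrite e2 eu0 ex.
rewrite (co_bdry (cb_chart wC iJ)) /=; exists a, (kaU g (kemb u0)).
by rewrite eg e1 (co_equiv (cb_chart wC iJ)).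
Qed.

Lemma collar_nbhs a I (z : collar a (ceps C) (kU (cbK C a) I)) P : idx (cbK C a) I ->
  colA a (ceps C) z.1 -> nearM z P -> nbhs z (fun w => colA a (ceps C) w.1 -> P w).
Proof. by move=> iI Az; have := collar_nearM (wa_mfd (cb_atlas a) iI) eps_gt0 (z:=z) P Az; case. Qed.

Lemma ciU_facts a I t (x : kU (cbK C a) I) : idx (cbK C a) I -> colA a (ceps C) t ->
  let z := (t, x) : collar a (ceps C) (kU (cbK C a) I) in
  [/\ ncont (@ciU' _ _ _ C a I) z, smoothv (chart (ciU t x) \o @ciU' _ _ _ C a I) z,
      lker (dm (@ciU' _ _ _ C a I) z) = 0%VS, limg (dm (@ciU' _ _ _ C a I) z) = fullv
    & forall P, nearM z P -> nearM (ciU t x : kU C I)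
        (fun y => exists w, [/\ colA a (ceps C) w.1, P w & @ciU' _ _ _ C a I w = y])].
Proof.
move=> iI At z; have iC := idx_bdry iI.
have gz : good z by apply: (collar_good (wa_mfd (cb_atlas a) iI) eps_gt0).
apply: (local_diffeo_facts gz) => //.
- by move=> P; apply: collar_nbhs.
- exact: (wa_mfd (cb_watlas wC) iC).
- exact: (co_diffeo (cb_chart wC iC)).
Qed.

(** At a boundary point of U_J the claim for the boundary atlas spreads over a collar neighbourhood,
    because there s_J does not depend on the collar parameter and tilde U_IJ is a product. *)
Lemma cobordism_tU_image : tU_image C.
Proof.
move=> I J iI iJ IJ w.
have wK := cb_watlas wC.
have [bw|nbw] := pselect (@bdry R (kU C J) (kemb w)); last first.
  by apply: (tU_image_interior wK) => // bw; apply: nbw; exact: bdry_tU_image.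
move: bw; rewrite (co_bdry (cb_chart wC iJ)) => -[a [y ey]].
have ca := colA_endpoint a.
have hx := cb_change wC iI iJ IJ.
have [u0 eu0] := cx_tU_inv hx ca ey.
have biJ := idx_pt y iJ; have biI := idx_sub biJ iI.1 IJ.
have fJ : @cfoot _ _ _ C a J !=set0 by apply/(co_empty (cb_chart wC iJ)); exists y.
have [_ b0 _] := cb_bdry wC a.
have im := weak_atlas_tU_image (cb_atlas a) b0 biI biJ IJ u0; rewrite eu0 in im.
have [_ _ _ _ op] := ciU_facts y biJ ca.
pose z0 : collar a (ceps C) (kU (cbK C a) J) := (endpoint R a, y).
have cs := @snd_ncont R a (ceps C) eps_gt0 _ z0 (wa_mfd (cb_atlas a) biJ) ca.
rewrite ey; have := op _ (cs _ im).
apply: nearMS => y1 [z [Az hz <-]] sy.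
have [|u1 eu1] := hz; first by move: sy; rewrite /ciU' (co_s (cb_chart wC iJ)).
have [u' [e1 _]] := cx_tU hx u1 Az fJ.
by exists u'; rewrite e1 eu1.
Qed.

End CobordismAgreement.

(** * Collars *)

Section CollarFrames.
Variable R : realType.

Lemma row_mx0_linear n : linear (fun b : 'rV[R]_n => row_mx 0 b : 'rV[R]_(1 + n)).
Proof. by move=> c x y; rewrite scale_row_mx add_row_mx scaler0 add0r. Qed.

Definition row_emb n : 'Hom('rV[R]_n, 'rV[R]_(1 + n)) :=
  linfun (HB.pack (fun b : 'rV[R]_n => row_mx 0 b : 'rV[R]_(1 + n))
    (GRing.isLinear.Build R _ _ _ _ (@row_mx0_linear n)) : {linear 'rV[R]_n -> 'rV[R]_(1 + n)}).

Lemma row_embE n b : row_emb n b = row_mx 0 b.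
Proof. by rewrite lfunE. Qed.

Definition collar_frame n m (D : 'Hom('rV[R]_(1 + n), 'rV[R]_m)) (v : seq 'rV[R]_n) : seq 'rV[R]_m :=
  D (row_mx 1 0) :: [seq D (row_mx 0 b) | b <- v].

Lemma collar_frameE n m (D : 'Hom('rV[R]_(1 + n), 'rV[R]_m)) v :
  collar_frame D v = D (row_mx 1 0) :: [seq (D \o row_emb n)%VF b | b <- v].
Proof. by congr (_ :: _); apply: eq_map => b; rewrite comp_lfunE row_embE. Qed.

(** The preimage of U under [rsubmx] is the sum of the collar line and U. *)
Lemma collar_frame_basis n m (D : 'Hom('rV[R]_(1 + n), 'rV[R]_m)) (U : {vspace 'rV[R]_n}) v :
  lker D = 0%VS -> basis_of U v ->
  basis_of (D @: (linfun (@rsubmx R 1 1 n) @^-1: U)) (collar_frame D v).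
Proof.
move=> D0 bv.
have -> : collar_frame D v = [seq D b | b <- row_mx 1 0 :: [seq row_emb n b | b <- v]].
  by rewrite collar_frameE /= -map_comp; congr (_ :: _); apply: eq_map => b; rewrite comp_lfunE.
apply: limg_basis_of; first by rewrite D0 capv0.
have e0 : lker (row_emb n) = 0%VS.
  apply/eqP; rewrite -subv0; apply/subvP => b; rewrite memv_ker row_embE memv0 => /eqP e.
  by apply/eqP; rewrite -(row_mxKr (0 : 'rV[R]_1) b) e linear0.
have be : basis_of (row_emb n @: U) [seq row_emb n b | b <- v].
  by apply: limg_basis_of bv; rewrite e0 capv0.
rewrite basisEfree; apply/and3P; split.
- rewrite free_cons (basis_free be) andbT (span_basis be); apply/negP => /memv_imgP[b _].
  rewrite row_embE => /eq_row_mx[/matrixP/(_ 0 0)]; rewrite !mxE eqxx => /eqP.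
  by rewrite oner_eq0.
- rewrite span_cons (span_basis be) subv_add; apply/andP; split.
    by rewrite -memvE -memv_preim lfunE /= row_mxKr mem0v.
  by apply/subvP => p /memv_imgP[b bU ->]; rewrite -memv_preim lfunE /= row_embE row_mxKr.
- apply: (leq_trans (dimvS (_ : (_ <= <<row_mx 1 0 :: [seq row_emb n b | b <- v]>>)%VS))); last exact: dim_span.
  apply/subvP => p; rewrite -memv_preim lfunE /= => pU.
  rewrite span_cons (span_basis be).
  have -> : p = lsubmx p 0 0 *: row_mx 1 0 + row_emb n (rsubmx p).
    rewrite row_embE scale_row_mx add_row_mx scaler0 add0r addr0 -[LHS]hsubmxK; congr (row_mx _ _).
    by apply/rowP => i; rewrite !ord1 !mxE eqxx mulr1.
  by apply: memv_add; [rewrite memvZ ?memv_line|rewrite memv_img].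
Qed.

Lemma linemap_collar n m (W : vectType R) (D : 'Hom('rV[R]_(1 + n), 'rV[R]_m)) K K' (H Z Z' : {vspace W}) v w :
  lker D = 0%VS -> K' = (D @: (linfun (@rsubmx R 1 1 n) @^-1: K))%VS -> Z' = Z ->
  dframe K H Z v w ->
  (linemap (fun v w v' w' => w' = w /\ v' = D (row_mx 1 0) :: [seq D (row_mx 0 b) | b <- v])
    (wedge K H Z v w) : detline K' H Z') = wedge K' H Z' (collar_frame D v) w.
Proof.
move=> D0 eK eZ fr; rewrite eZ {Z' eZ} eK {K' eK}.
pose S (v : seq 'rV[R]_n) := [seq D (row_mx 0 b) | b <- v].
have eS : S = (fun v => [seq (D \o row_emb n)%VF b | b <- v]).
  by apply/funext => s; apply: eq_map => b; rewrite comp_lfunE row_embE.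
transitivity (linemap (fun v w v' w' => w' = w /\ v' = D (row_mx 1 0) :: S v) (wedge K H Z v w)
  : detline (D @: (linfun (@rsubmx R 1 1 n) @^-1: K)) H Z); first by [].
rewrite eS linemap_cons ?collar_frameE // => v0 b0.
by rewrite -collar_frameE; exact: collar_frame_basis.
Qed.

End CollarFrames.

Section CollarBundle.
Variables (R : realType) (B : kbasic R) (Y : topologicalType) (C : cobdata B Y) (d : int).
Hypothesis wC : is_weak_cobordism C d.
Local Notation N := (kN B).
Implicit Types I J L : {set 'I_N}.
Local Notation col a I := (collar a (ceps C) (kU (cbK C a) I)).
Local Notation ciu a I := (@ciU' R B Y C a I).
Local Notation di a I t x := (dm (@ciU' R B Y C a I) ((t, x) : collar a (ceps C) (kU (cbK C a) I))).
Local Notation wK := (cb_watlas wC).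
Local Notation wb a := (cb_atlas wC a).

(** The collar vector stands in front, as in [detS_collar]. Since s is constant along the collar it
    becomes the first kernel vector of a frame adapted to C_ds, so the contractions match without a
    sign. *)
Definition detK_collar (Nb : normal_family C) (Nbb : forall a, normal_family (cbK C a)) :
    collar_maps (detK Nb) (fun a => detK (Nbb a)) :=
  fun a I t x => linemap (fun v w v' w' => w' = w /\
      v' = di a I t x (row_mx 1 0) :: [seq di a I t x (row_mx 0 b) | b <- v]).

Section Chart.
Variables (a : bool) (I : {set 'I_N}).
Hypothesis iI : idx (cbK C a) I.
Let iC : idx C I := idx_bdry wC iI.

Lemma col_good t (x : kU (cbK C a) I) : colA a (ceps C) t -> good ((t, x) : col a I).
Proof. by move=> At; apply: (collar_good (wa_mfd (wb a) iI) (eps_gt0 wC)). Qed.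

Lemma col_mfd_at t (x : kU (cbK C a) I) : colA a (ceps C) t -> mfd_at ((t, x) : col a I).
Proof. by move=> At; apply: (collar_mfd_at (wa_mfd (wb a) iI) (eps_gt0 wC)). Qed.

Lemma ciU_isd t (x : kU (cbK C a) I) : colA a (ceps C) t ->
  isd (chart (ciU t x : kU C I) \o ciu a I) ((t, x) : col a I) (di a I t x).
Proof.
by move=> At; have [_ s _ _ _] := ciU_facts wC x iI At; exact: smoothv_isd (col_good x At) s.
Qed.

Lemma ds_ciU t (x : kU (cbK C a) I) p : colA a (ceps C) t ->
  dv (@ks R B Y C I) (ciU t x) (di a I t x p) = dv (@ks R B _ (cbK C a) I) x (rsubmx p).
Proof.
move=> At; have gz := col_good x At.
have [c _ _ _ _] := ciU_facts wC x iI At.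
have gy := U_good wK iC (ciU t x).
have h1 := isd_comp gz gy c (ciU_isd x At) (s_isd wK iC (ciU t x)).
have h2 : isd (@ks R B _ (cbK C a) I \o (snd : col a I -> kU (cbK C a) I)) ((t, x) : col a I)
    (dv (@ks R B Y C I) (ciU t x) \o di a I t x)%VF.
  apply: isd_ext h1 => //; apply: nearMS (collar_nearA _) => z Az /=.
  by rewrite /ciU' (co_s (cb_chart wC iC)).
have h3 := snd_isd (z := (t, x) : col a I) (wa_mfd (wb a) iI) At (s_isd (wb a) iI x).
have e : (dv (@ks R B Y C I) (ciU t x) \o di a I t x)%VF =
    (dv (@ks R B _ (cbK C a) I) x \o linfun (@rsubmx R 1 1 _))%VF.
  by rewrite -(dv_isd gz h2); exact: (dv_isd gz h3).
by rewrite -comp_lfunE e comp_lfunE lfunE.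
Qed.

Lemma ds_collar_lker t (x : kU (cbK C a) I) : colA a (ceps C) t ->
  lker (dv (@ks R B Y C I) (ciU t x)) =
  (di a I t x @: (linfun (@rsubmx R 1 1 _) @^-1: lker (dv (@ks R B _ (cbK C a) I) x)))%VS.
Proof.
move=> At; have [_ _ _ df _] := ciU_facts wC x iI At.
apply/vspaceP => v; rewrite memv_ker; apply/idP/memv_imgP => [v0|[p pU ->]].
  have : v \in limg (di a I t x) by rewrite df memvf.
  move=> /memv_imgP[p _ e]; exists p => //.
  by rewrite -memv_preim lfunE /= memv_ker -(ds_ciU x p At) -e.
by move: pU; rewrite -memv_preim lfunE /= memv_ker (ds_ciU x p At).
Qed.

Lemma ds_collar_limg t (x : kU (cbK C a) I) : colA a (ceps C) t ->
  limg (dv (@ks R B Y C I) (ciU t x)) = limg (dv (@ks R B _ (cbK C a) I) x).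
Proof.
move=> At; have [_ _ _ df _] := ciU_facts wC x iI At.
apply/vspaceP => e; apply/memv_imgP/memv_imgP => -[v _ ->].
  have : v \in limg (di a I t x) by rewrite df memvf.
  by move=> /memv_imgP[p _ ->]; exists (rsubmx p); rewrite ?memvf // (ds_ciU x p At).
by exists (di a I t x (row_mx 0 v)); rewrite ?memvf // (ds_ciU x _ At) row_mxKr.
Qed.

Lemma collar_full_basis t (x : kU (cbK C a) I) v : colA a (ceps C) t -> basis_of fullv v ->
  basis_of fullv (collar_frame (di a I t x) v).
Proof.
move=> At bv; have [_ _ d0 df _] := ciU_facts wC x iI At.
have := collar_frame_basis d0 bv; congr (basis_of _ _).
rewrite -[RHS]df; congr (_ @: _)%VS; apply/eqP; rewrite eqEsubv subvf; apply/subvP => p _.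
by rewrite -memv_preim memvf.
Qed.

Lemma detK_collar_wedge Nb Nbb t (x : kU (cbK C a) I) v w : colA a (ceps C) t ->
  basis_of fullv v -> basis_of (Esp I) w ->
  @detK_collar Nb Nbb a I t x (wedge fullv (Esp I) 0 v w) =
  wedge fullv (Esp I) 0 (collar_frame (di a I t x) v) w.
Proof.
move=> At bv bw; have [_ _ d0 df _] := ciU_facts wC x iI At.
apply: linemap_collar => //; last by rewrite /dframe bv qbasis0.
rewrite -[LHS]df; congr (_ @: _)%VS; apply/esym/eqP; rewrite eqEsubv subvf; apply/subvP => p _.
by rewrite -memv_preim memvf.
Qed.

Lemma detS_collar_wedge t (x : kU (cbK C a) I) v w : colA a (ceps C) t ->
  dframe (lker (dv (@ks R B _ (cbK C a) I) x)) (Esp I) (limg (dv (@ks R B _ (cbK C a) I) x)) v w ->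
  detS_collar C a I t x (wedge (lker (dv (@ks R B _ (cbK C a) I) x)) (Esp I) (limg (dv (@ks R B _ (cbK C a) I) x)) v w) =
  wedge (lker (dv (@ks R B Y C I) (ciU t x))) (Esp I) (limg (dv (@ks R B Y C I) (ciU t x)))
    (collar_frame (di a I t x) v) w.
Proof.
move=> At fr; have [_ _ d0 df _] := ciU_facts wC x iI At.
by apply: linemap_collar => //; [exact: ds_collar_lker|exact: ds_collar_limg].
Qed.

Lemma detK_collar_iso Nb Nbb t (x : kU (cbK C a) I) : colA a (ceps C) t ->
  lin_iso (@detK_collar Nb Nbb a I t x).
Proof.
move=> At; have [v [w f]] := detK_frame_exists (cbK C a) I.
have bv : basis_of fullv v by case/andP: f.
have bw : basis_of (Esp I) w by move: f; rewrite /dframe qbasis0 => /andP[].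
apply: (line_iso _ f _ (detK_collar_wedge Nb Nbb x At bv bw)); first exact: linemap_linear.
by rewrite /dframe collar_full_basis // qbasis0.
Qed.

(** An adapted frame [v' ++ v2] on the boundary becomes an adapted frame on the collar: the collar
    vector joins the kernel part, and the values of ds on [v2] are unchanged. *)
Lemma PsiK_collar Nb Nbb t (x : kU (cbK C a) I) (c : detK_fib x) : colA a (ceps C) t ->
  detS_collar C a I t x (PsiK (cbK C a) I x c) = PsiK C I (ciU t x) (@detK_collar Nb Nbb a I t x c).
Proof.
move=> At; have [v' [v2 [w' [b1 b2 b3]]]] := PsiK_frame_exists (wb a) iI x.
have [f1 f2] := PsiK_frames (wb a) iI b1 b2 b3.
have [_ _ d0 _ _] := ciU_facts wC x iI At.
have bw : basis_of (Esp I) (w' ++ [seq dv (@ks R B _ (cbK C a) I) x b | b <- v2]).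
  by move: f1; rewrite /dframe qbasis0 => /andP[].
apply: (line_eq (T := fun c => detS_collar C a I t x (PsiK (cbK C a) I x c))
  (T' := fun c => PsiK C I (ciU t x) (@detK_collar Nb Nbb a I t x c)) _ _ f1).
- by move=> s y; rewrite (lin_isoZ _ _ (PsiK_iso (wb a) iI x)); exact: linemapZ.
- move=> s y; rewrite (lin_isoZ _ _ (detK_collar_iso Nb Nbb x At)).
  exact: (lin_isoZ _ _ (PsiK_iso wK iC (ciU t x))).
rewrite (PsiK_wedge (wb a) iI b1 b2 b3) detS_collar_wedge // detK_collar_wedge //.
have -> : collar_frame (di a I t x) (v' ++ v2) =
    collar_frame (di a I t x) v' ++ [seq di a I t x (row_mx 0 b) | b <- v2].
  by rewrite /collar_frame map_cat.
have -> : [seq dv (@ks R B _ (cbK C a) I) x b | b <- v2] =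
    [seq dv (@ks R B Y C I) (ciU t x) b | b <- [seq di a I t x (row_mx 0 b) | b <- v2]].
  by rewrite -map_comp; apply: eq_map => b /=; rewrite (ds_ciU x _ At) row_mxKr.
apply/esym/(PsiK_wedge wK iC).
- rewrite ds_collar_lker //; exact: collar_frame_basis.
- have := collar_full_basis x At b2; by rewrite /collar_frame map_cat.
- by rewrite ds_collar_limg.
Qed.

Lemma detK_collar_equiv Nb Nbb t g (x : kU (cbK C a) I) (l : detK_fib x) :
  colA a (ceps C) t -> g \in Gam I ->
  @detK_collar Nb Nbb a I t (kaU g x) (detK_act g (kaU g x) l) =
  @detK_act R B Y C I g (ciU t x) (ciU t (kaU g x)) (@detK_collar Nb Nbb a I t x l).
Proof.
move=> At gI.
have eg : ciU t (kaU g x) = kaU g (ciU t x) := co_equiv (cb_chart wC iC) x At gI.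
have gz := col_good x At; have [cz _ _ _ _] := ciU_facts wC x iI At.
have gy := U_good wK iC (ciU t x).
have tan : (dm (@kaU R B Y C I g) (ciU t x) \o di a I t x)%VF =
    (di a I t (kaU g x) \o hom_collar (dm (@kaU R B _ (cbK C a) I g) x))%VF.
  have h1 := isd_comp gz gy cz (ciU_isd x At) (act_isd wK iC (ciU t x) gI).
  pose cm : col a I -> col a I := collar_map (@kaU R B _ (cbK C a) I g).
  have cc : ncont cm ((t, x) : col a I).
    exact: (@collar_map_ncont R a (ceps C) (eps_gt0 wC) _ _ (@kaU R B _ (cbK C a) I g) (t, x)
      (wa_mfd (wb a) iI) (wa_mfd (wb a) iI) (act_ncont (wb a) iI gI) At).
  have ic := collar_map_isd (z := (t, x) : col a I) (wa_mfd (wb a) iI) At (act_isd (wb a) iI x gI).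
  have h2 := isd_comp gz (col_good (kaU g x) At : good (cm ((t, x) : col a I))) cc ic (ciU_isd (kaU g x) At).
  have h3 : isd (chart (kaU g (ciU t x) : kU C I) \o @kaU R B Y C I g \o ciu a I) ((t, x) : col a I)
      (di a I t (kaU g x) \o hom_collar (dm (@kaU R B _ (cbK C a) I g) x))%VF.
    apply: isd_ext h2 => //; apply: nearMS (collar_nearA _) => z Az /=.
    by rewrite eg /cm /collar_map /ciU' /= (co_equiv (cb_chart wC iC)).
  by rewrite -(dv_isd gz h3); apply/esym; exact: (dv_isd gz h1).
have [v [w f]] := detK_frame_exists (cbK C a) I.
have bv : basis_of fullv v by case/andP: f.
have bw : basis_of (Esp I) w by move: f; rewrite /dframe qbasis0 => /andP[].
have /andP[b1 b2] := act_frame (wb a) iI x gI f; rewrite qbasis0 in b2.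
apply: (line_eq (T := fun l => @detK_collar Nb Nbb a I t (kaU g x) (detK_act g (kaU g x) l))
  (T' := fun l => @detK_act R B Y C I g (ciU t x) (ciU t (kaU g x)) (@detK_collar Nb Nbb a I t x l)) _ _ f).
- by move=> s y; rewrite (lin_isoZ _ _ (act_iso (wb a) iI x gI)); exact: linemapZ.
- by move=> s y; rewrite (lin_isoZ _ _ (detK_collar_iso Nb Nbb x At)); exact: linemapZ.
rewrite (act_wedge (wb a) iI x gI f) detK_collar_wedge // detK_collar_wedge //.
have fc : dframe fullv (Esp I) 0 (collar_frame (di a I t x) v) w.
  by rewrite /dframe collar_full_basis // qbasis0.
rewrite [RHS](act_wedge wK iC (ciU t x) gI fc); congr (wedge _ _ _ _ _).
have tE p : dm (@kaU R B Y C I g) (ciU t x) (di a I t x p) =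
    di a I t (kaU g x) (hom_collar (dm (@kaU R B _ (cbK C a) I g) x) p).
  by rewrite -comp_lfunE tan comp_lfunE.
have te b : dm (@kaU R B Y C I g) (ciU t x) (di a I t x (row_mx 0 b)) =
    di a I t (kaU g x) (row_mx 0 (dm (@kaU R B _ (cbK C a) I g) x b)).
  by rewrite tE hom_collar_row.
have te1 : dm (@kaU R B Y C I g) (ciU t x) (di a I t x (row_mx 1 0)) = di a I t (kaU g x) (row_mx 1 0).
  by rewrite tE hom_collar_row (linear0 (dm (@kaU R B _ (cbK C a) I g) x)).
rewrite /collar_frame map_cons -2!map_comp; apply: f_equal2; first exact: esym te1.
by apply: eq_map => b; exact: esym (te b).
Qed.

End Chart.
End CollarBundle.
Arguments detK_collar {R B Y C} Nb Nbb a I t x.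

Section CollarTransition.
Variables (R : realType) (B : kbasic R) (Y : topologicalType) (C : cobdata B Y) (d : int).
Hypothesis wC : is_weak_cobordism C d.
Local Notation N := (kN B).
Implicit Types I J L : {set 'I_N}.
Local Notation col a I := (collar a (ceps C) (kU (cbK C a) I)).
Local Notation ciu a I := (@ciU' R B Y C a I).
Local Notation di a I t x := (dm (@ciU' R B Y C a I) ((t, x) : collar a (ceps C) (kU (cbK C a) I))).
Local Notation wK := (cb_watlas wC).
Local Notation wb a := (cb_atlas wC a).

Section Change.
Variables (a : bool) (I J : {set 'I_N}).
Hypotheses (iI : idx (cbK C a) I) (iJ : idx (cbK C a) J) (IJ : (I \proper J)%SET).
Local Notation tcol := (collar a (ceps C) (ktU (cbK C a) I J)).
Local Notation demb u := (dm (@kemb R B _ (cbK C a) I J) u).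
Local Notation drho u := (dm (@krho R B _ (cbK C a) I J) u).
Local Notation dembC u := (dm (@kemb R B Y C I J) u).
Local Notation drhoC u := (dm (@krho R B Y C I J) u).

(** V is the derivative of the collar map of tilde U_IJ. That map is not part of the data, only its
    values exist, so it is chosen pointwise and differentiated as a lift through [kemb]. V is
    invertible because the derivatives of [krho] and of the collars of U_I are. *)
Lemma collar_change_tangent t (u : ktU (cbK C a) I J) (u' : ktU C I J) : colA a (ceps C) t ->
  kemb u' = ciU t (kemb u) -> krho u' = ciU t (krho u) ->
  exists V : 'Hom('rV[R]_(1 + cdim (ktU (cbK C a) I J)), 'rV[R]_(cdim (ktU C I J))),
    [/\ (dembC u' \o V)%VF = (di a J t (kemb u) \o hom_collar (demb u))%VF,
        (drhoC u' \o V)%VF = (di a I t (krho u) \o hom_collar (drho u))%VF,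
        lker V = 0%VS & limg V = fullv].
Proof.
move=> At ee er.
have cI := idx_bdry wC iI; have cJ := idx_bdry wC iJ.
have hC := wa_change wK cI cJ IJ; have hb := wa_change (wb a) iI iJ IJ.
have mt := cc_tU hb; have mT := cc_tU hC.
have mI := wa_mfd wK cI; have mJ := wa_mfd wK cJ.
have e0 := eps_gt0 wC.
have [ein _ _ _] := cc_emb hC.
have fJ : @cfoot _ _ _ C a J !=set0.
  by apply/(co_empty (cb_chart wC cJ)); exists (kemb u).
pose P (z : tcol) (u1 : ktU C I J) := kemb u1 = ciU z.1 (kemb z.2) /\ krho u1 = ciU z.1 (krho z.2).
pose V (z : tcol) := if pselect (exists u1, P z u1) is left h then sval (cid h) else u'.
have VP z : colA a (ceps C) z.1 -> P z (V z).
  move=> Az; rewrite /V; case: pselect => [h|[]]; first exact: (svalP (cid h)).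
  exact: (cx_tU (cb_change wC cI cJ IJ) z.2 Az fJ).
pose z0 : tcol := (t, u).
have gz : good z0 by apply: (collar_good mt e0).
have Vz : V z0 = u' by apply: ein; rewrite (VP z0 At).1 ee.
pose ce : tcol -> col a J := collar_map (@kemb R B _ (cbK C a) I J).
pose cr : tcol -> col a I := collar_map (@krho R B _ (cbK C a) I J).
have [rc _ rk0 rfull _] := rho_facts (wb a) iI iJ IJ u.
have cce : ncont ce z0.
  exact: (@collar_map_ncont R a (ceps C) e0 _ _ (@kemb R B _ (cbK C a) I J) z0 mt (wa_mfd (wb a) iJ)
    (emb_ncont (wb a) iI iJ IJ (u:=u)) At).
have ccr : ncont cr z0 by 
  exact: (@collar_map_ncont R a (ceps C) e0 _ _ (@krho R B _ (cbK C a) I J) z0 mt (wa_mfd (wb a) iI) rc At).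
have [cJ' sJ' J0 Jf _] := ciU_facts wC (kemb u) iJ At.
have [cI' sI' I0 If _] := ciU_facts wC (krho u) iI At.
have nV : nearM z0 (fun z => kemb (V z) = (ciu a J \o ce) z).
  by apply: nearMS (collar_nearA _) => z /VP[].
have nR : nearM z0 (fun z => krho (V z) = (ciu a I \o cr) z).
  by apply: nearMS (collar_nearA _) => z /VP[].
have cK : ncont (ciu a J \o ce) z0 by exact: ncont_comp cce cJ'.
have cV : ncont V z0.
  by apply: (embedding_ncont mT mJ (cc_emb hC) nV _ cK); rewrite Vz ee.
have gJ := col_good wC iJ (kemb u) At; have gI := col_good wC iI (krho u) At.
have hK : isd (chart (kemb (V z0)) \o (ciu a J \o ce)) z0
    (di a J t (kemb u) \o hom_collar (demb u))%VF.
  rewrite Vz ee.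
  exact: (isd_comp gz (gJ : good (ce z0)) cce
    (collar_map_isd (z := z0) mt At (emb_isd (wb a) iI iJ IJ u)) (ciU_isd wC iJ (kemb u) At)).
have [dV eV] := cancel_isd gz (mfd_good mT (V z0)) (mfd_good mJ (kemb (V z0))) cV
  (emb_ncont wK cI cJ IJ (u:=V z0)) (emb_smooth wK cI cJ IJ (V z0))
  (emb_inj wK cI cJ IJ (V z0)) nV hK.
have [crC _ _ _ _] := rho_facts wK cI cJ IJ (V z0).
have h1 := isd_comp gz (mfd_good mT (V z0)) cV dV (rho_isd wK cI cJ IJ (V z0)).
have h2 : isd (chart (krho (V z0)) \o (ciu a I \o cr)) z0 (drhoC (V z0) \o dm V z0)%VF.
  by apply: isd_ext h1 => //; apply: nearMS nR => z /= ->.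
have h3 : isd (chart (krho (V z0)) \o (ciu a I \o cr)) z0
    (di a I t (krho u) \o hom_collar (drho u))%VF.
  rewrite Vz er.
  exact: (isd_comp gz (gI : good (cr z0)) ccr
    (collar_map_isd (z := z0) mt At (rho_isd (wb a) iI iJ IJ u)) (ciU_isd wC iI (krho u) At)).
have eR : (drhoC (V z0) \o dm V z0)%VF = (di a I t (krho u) \o hom_collar (drho u))%VF.
  by rewrite -(dv_isd gz h2); exact: (dv_isd gz h3).
rewrite Vz in eV eR.
have [_ _ rC0 rCf _] := rho_facts wK cI cJ IJ u'.
have eRE p : drhoC u' (dm V z0 p) = di a I t (krho u) (hom_collar (drho u) p).
  by rewrite -comp_lfunE eR comp_lfunE.
exists (dm V z0); split=> //.
  apply/eqP; rewrite -subv0; apply/subvP => p; rewrite memv_ker memv0 => /eqP p0.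
  have : hom_collar (drho u) p \in lker (di a I t (krho u)) by rewrite memv_ker -eRE p0 linear0.
  rewrite I0 memv0 hom_collarE -[0]row_mx0 => /eqP/eq_row_mx[l0 r0].
  rewrite -[p]hsubmxK l0.
  have : rsubmx p \in lker (drho u) by rewrite memv_ker r0.
  by rewrite rk0 memv0 => /eqP ->; rewrite row_mx0.
apply/eqP; rewrite eqEsubv subvf; apply/subvP => b _.
have : drhoC u' b \in limg (di a I t (krho u)) by rewrite If memvf.
move=> /memv_imgP[q _ eq].
have : rsubmx q \in limg (drho u) by rewrite rfull memvf.
move=> /memv_imgP[c _ ec].
have -> : b = dm V z0 (row_mx (lsubmx q) c); last by rewrite memv_img ?memvf.
have r00 : lker (drhoC u') == 0%VS by rewrite rC0.
apply: (lker0P r00).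
by rewrite eRE hom_collar_row -ec hsubmxK eq.
Qed.

(** V transports a frame of the boundary piece of tilde U_IJ, with the collar vector in front, to a
    frame of tilde U_IJ; the complement [v2] moves along the collar of U_J with unchanged values of
    ds_J. Both composites thus end in the same frame. *)
Lemma detK_collar_tr Nb Nbb t (u : ktU (cbK C a) I J) (u' : ktU C I J) (l : detK_fib (krho u)) :
  is_normal_choice Nb -> (forall a, is_normal_choice (Nbb a)) -> colA a (ceps C) t ->
  kemb u' = ciU t (kemb u) -> krho u' = ciU t (krho u) ->
  @detK_collar R B Y C Nb Nbb a J t (kemb u) (@detK_tr R B _ (cbK C a) (Nbb a) I J u (krho u) (kemb u) l) =
  @detK_tr R B Y C Nb I J u' (ciU t (krho u)) (ciU t (kemb u)) (@detK_collar R B Y C Nb Nbb a I t (krho u) l).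
Proof.
move=> hN hNb At ee er.
have cI := idx_bdry wC iI; have cJ := idx_bdry wC iJ.
have [V [eV eR V0 Vf]] := collar_change_tangent At ee er.
pose n := cdim (ktU (cbK C a) I J).
have ba := unit_rows_basis R n; set s := unit_rows R n in ba.
have [v2 bv2] := tr_frame_exists (wb a) iI iJ IJ u ba.
have bw : basis_of (@Esp R B I) (vbasis (@Esp R B I)) by exact: vbasisP.
set w : seq (ET B) := vbasis (@Esp R B I) in bw.
have [f1 f2] := tr_frames (wb a) iI iJ IJ ba bv2 bw.
have t1 := tr_iso (wb a) iI iJ IJ u (hNb a); have t2 := tr_iso wK cI cJ IJ u' hN.
apply: (line_eq (T := fun l => @detK_collar R B Y C Nb Nbb a J t (kemb u) (@detK_tr R B _ (cbK C a) (Nbb a) I J u (krho u) (kemb u) l))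
  (T' := fun l => @detK_tr R B Y C Nb I J u' (krho u') (kemb u') (@detK_collar R B Y C Nb Nbb a I t (krho u) l)) _ _ f2).
- by move=> c y; rewrite (lin_isoZ _ _ t1); exact: linemapZ.
- move=> c y; have -> : @detK_collar R B Y C Nb Nbb a I t (krho u) (c *: y) = c *: @detK_collar R B Y C Nb Nbb a I t (krho u) y.
    exact: linemapZ.
  exact: (lin_isoZ _ _ t2).
have bd : basis_of fullv [seq drho u x | x <- s] by case/andP: f2.
have bwJ : basis_of (Esp J) (w ++ [seq dv (@ks R B _ (cbK C a) J) (kemb u) x | x <- v2]).
  by move: f1; rewrite /dframe qbasis0 => /andP[].
rewrite (tr_wedge (wb a) iI iJ IJ (hNb a) ba bv2 bw) (detK_collar_wedge wC iJ) // (detK_collar_wedge wC iI) //.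
(* The frame of tilde U_IJ whose images under [krho] and [kemb] are the collar frames on the two
   sides. *)
pose s' := [seq V p | p <- row_mx 1 0 :: [seq row_mx 0 b | b <- s]].
have bs' : basis_of fullv s'.
  have b0 : basis_of fullv (collar_frame (\1%VF : 'End('rV[R]_(1 + n))) s).
    have := collar_frame_basis (lker_id _) ba; rewrite lim1g; congr (basis_of _ _).
    by apply/eqP; rewrite eqEsubv subvf; apply/subvP => p _; rewrite -memv_preim memvf.
  have := basis_map V0 Vf b0; congr (basis_of _ _).
  by rewrite /s' /collar_frame /= id_lfunE -!map_comp; congr (_ :: _); apply: eq_map => b /=; rewrite id_lfunE.
have eVE p : dembC u' (V p) = di a J t (kemb u) (hom_collar (demb u) p).
  by rewrite -comp_lfunE eV comp_lfunE.
have eRE p : drhoC u' (V p) = di a I t (krho u) (hom_collar (drho u) p).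
  by rewrite -comp_lfunE eR comp_lfunE.
have e1 : collar_frame (di a I t (krho u)) [seq drho u x | x <- s] = [seq drhoC u' x | x <- s'].
  rewrite /collar_frame /s' /= eRE hom_collar_row linear0 -!map_comp; congr (_ :: _).
  by apply: eq_map => b /=; rewrite eRE hom_collar_row.
pose v2' := [seq di a J t (kemb u) (row_mx 0 b) | b <- v2].
have e2 : collar_frame (di a J t (kemb u)) ([seq demb u x | x <- s] ++ v2) = [seq dembC u' x | x <- s'] ++ v2'.
  rewrite /collar_frame /s' map_cat /= eVE hom_collar_row linear0 -!map_comp; congr (_ :: _ ++ _).
  by apply: eq_map => b /=; rewrite eVE hom_collar_row.
have e3 : [seq dv (@ks R B _ (cbK C a) J) (kemb u) x | x <- v2] = [seq dv (@ks R B Y C J) (kemb u') x | x <- v2'].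
  by rewrite ee /v2' -map_comp; apply: eq_map => b /=; rewrite (ds_ciU wC iJ (kemb u) _ At) row_mxKr.
rewrite e1 e2 e3; apply/esym; apply: (tr_wedge wK cI cJ IJ hN bs' _ bw).
by rewrite -e2; exact: (collar_full_basis wC iJ (kemb u) At bv2).
Qed.

End Change.
End CollarTransition.

Section CollarProduct.
Variables (R : realType) (B : kbasic R) (Y : topologicalType) (C : cobdata B Y) (d : int).
Hypothesis wC : is_weak_cobordism C d.
Local Notation N := (kN B).
Implicit Types I J L : {set 'I_N}.
Local Notation col a I := (collar a (ceps C) (kU (cbK C a) I)).
Local Notation ciu a I := (@ciU' R B Y C a I).
Local Notation di a I t x := (dm (@ciU' R B Y C a I) ((t, x) : collar a (ceps C) (kU (cbK C a) I))).
Local Notation wK := (cb_watlas wC).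
Local Notation wb a := (cb_atlas wC a).

(** In the chart at [z0] the first coordinate of the field is the constant c and the remaining ones
    are those of Z in the chart at [z0.2]. *)
Lemma collar_field_smooth a (M : charted R) (e : R) (Z : M -> 'rV[R]_(cdim M)) (z0 : collar a e M) c :
  0 < e -> is_manifold_with_boundary M -> colA a e z0.1 -> smooth_field_along id Z z0.2 ->
  smooth_field_along id (fun z : collar a e M => row_mx c (Z z.2) : 'rV[R]_(1 + cdim M)) z0.
Proof.
move=> e0 mM Az sZ.
have gz := collar_good mM e0 Az; have gx := mfd_good mM z0.2; have mx := mfd_mfd_at mM z0.2.
have cs := @snd_ncont R a e e0 M z0 mM Az.
have ss := @snd_smooth R a e e0 M z0 mM Az.
pose F (x : M) : 'rV[R]_(1 + cdim M) := row_mx c 0 + row_emb R _ (dv (chart z0.2) x (Z x)).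
have sF : smoothv F z0.2.
  apply: smoothv_add; first exact: smoothv_cst.
  exact: (smoothv_lin (row_emb R _) sZ).
have sFs := smoothv_comp gz gx cs ss sF.
apply: smoothv_ext sFs.
have nz := cs _ (ma_chart mx).
apply: nearMS2 (collar_nearA z0) nz => z Azz sz /=.
have h : wd (@cmodel R M) (chart z0.2 \o cinv z.2) (rsubmx (chart z z)) (dv (chart z0.2) z.2).
  by rewrite row_mxKr; exact: (smoothv_isd (mfd_good mM z.2) sz).
have hc : isd (chart z0) z (hom_collar (dv (chart z0.2) z.2)).
  exact: (@wd_collar _ _ _ (colA a e) _ _ _ _ h).
rewrite (dv_isd (collar_good mM e0 Azz) hc) hom_collar_row /F row_embE add_row_mx addr0 add0r.
by [].
Qed.

Section Smooth.
Variables (Nb : normal_family C) (Nbb : forall a, normal_family (cbK C a)).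
Variables (a : bool) (I : {set 'I_N}) (t : R) (x : kU (cbK C a) I).
Hypotheses (iI : idx (cbK C a) I) (At : colA a (ceps C) t).

Lemma detK_collar_smooth :
  @smooth_bmap R (col a I) _ _ snd (ciu a I) (@detK_vb R B _ (cbK C a) I) (@detK_vb R B Y C I)
    (fun z => @detK_collar R B Y C Nb Nbb a I z.1 z.2) (t, x).
Proof.
have iC := idx_bdry wC iI; have e0 := eps_gt0 wC; have mM := wa_mfd (wb a) iI.
apply/smooth_bmap1 => F F' [Z [w [oF bw h eF]]] [Z' [w' [oF' bw' h' eF']]] Fx Fx'.
have [bZ sZ] := h x Fx; have [bZ' sZ'] := h' _ Fx'.
pose z0 : col a I := (t, x).
have gz : good z0 by exact: (col_good wC iI x At).
have mz : mfd_at z0 by exact: (col_mfd_at wC iI x At).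
have [cc sc d0 df _] := ciU_facts wC x iI At.
have gc := U_good wK iC (ciU t x); have mc := U_at wK iC (ciU t x).
(* The frame of the collar made of the unit vector field in the interval direction, in front, and of
   the fields Z lifted from the boundary. *)
pose fields := (fun z : col a I => row_mx 1 0 : 'rV[R]_(1 + cdim (kU (cbK C a) I)))
  :: [seq (fun z : col a I => row_mx 0 (Q z.2) : 'rV[R]_(1 + cdim (kU (cbK C a) I))) | Q <- enum_fields Z].
pose vs := [seq (fun z : col a I => dm (ciu a I) z (Q z)) | Q <- fields].
pose vs' := [seq Q \o ciu a I | Q <- enum_fields Z'].
have evs z : at_pt vs z = collar_frame (dm (ciu a I) z) [seq Z i z.2 | i <- enum 'I_(cdim (kU (cbK C a) I))].
  by rewrite /at_pt /vs /fields /collar_frame /enum_fields /= -!map_comp.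
have s0 : smooth_field_along id (fun _ : kU (cbK C a) I => 0 : 'rV[R]_(cdim (kU (cbK C a) I))) x.
  apply: (@smoothv_ext _ _ _ (fun=> 0)); last exact: smoothv_cst.
  by apply: nearM_forall => y; rewrite linear0.
have sfields : alls (fun X => smooth_field_along id X z0) fields.
  split; first exact: (@collar_field_smooth a _ _ _ z0 1 e0 mM At s0).
  rewrite /enum_fields; elim: (enum _) => //= i r IH; split=> //.
  exact: (@collar_field_smooth a _ _ _ z0 0 e0 mM At (sZ i)).
have [b [sb nb]] : exists b : col a I -> R, smR b z0 /\ nearM z0 (fun u =>
    [/\ basis_of fullv (at_pt vs u), basis_of (Esp I) (at_pt (csts (col a I) w) u),
        basis_of fullv (at_pt vs' u), b u != 0 &
        wedge fullv (Esp I) 0 (at_pt vs u) (at_pt (csts (col a I) w) u) =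
        b u *: wedge fullv (Esp I) 0 (at_pt vs' u) w']).
  apply: (@smooth_ratio _ _ _ (ciu a I)) => //; rewrite ?at_pt_csts //.
  - apply: alls_push => //; apply: nearMS (collar_nearA z0) => -[s y] As.
    by have [c1 c2 _ _ _] := ciU_facts wC y iI As.
  - by rewrite evs; exact: (collar_full_basis wC iI).
  - by apply: alls_pull => //; exact: alls_enum.
  - by rewrite /vs' at_pt_comp at_pt_enum.
  - exact: alls_csts.
  - by apply: nearM_forall => u; rewrite at_pt_csts; apply: mem_nth_sub.
exists b; split=> //.
have nF : nearM z0 (fun z => F.1 z.2).
  exact: (@snd_ncont R a _ e0 _ z0 mM At _ (U_near (wb a) iI oF Fx)).
apply: nearMS (nearMI (collar_nearA z0) (nearMI nb nF)) => -[s y] [As [[_ _ _ _ e] Fy]].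
have [bZy _] := h y Fy.
rewrite eF eF' /= (detK_collar_wedge wC iI) //.
by move: e; rewrite evs at_pt_csts /vs' at_pt_comp at_pt_enum.
Qed.

Lemma detS_collar_smooth :
  @smooth_bmap R (col a I) _ _ snd (ciu a I) (@detS_vb R B _ (cbK C a) I) (@detS_vb R B Y C I)
    (fun z => @detS_collar R B Y C a I z.1 z.2) (t, x).
Proof.
have iC := idx_bdry wC iI; have e0 := eps_gt0 wC; have mM := wa_mfd (wb a) iI.
pose z0 : col a I := (t, x).
have gz : good z0 by exact: (col_good wC iI x At).
have [cc sc d0 df _] := ciU_facts wC x iI At.
apply: (@smooth_transfer R (col a I) _ _ snd (ciu a I) z0 _ _ _ _ _ _ _ _
  (PsiK (cbK C a) I) (PsiK C I) (fun z => @detK_collar R B Y C Nb Nbb a I z.1 z.2)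
  (fun z => @detS_collar R B Y C a I z.1 z.2) gz (U_good (wb a) iI x) (U_good wK iC (ciU t x))
  (@snd_ncont R a _ e0 _ z0 mM At) (@snd_smooth R a _ e0 _ z0 mM At) cc sc
  (detK_cover_neq0 (wb a) iI x) (detK_cover wK iC (ciU t x))
  (PsiK_iso (wb a) iI) (PsiK_iso wK iC) _ (PsiK_smooth (wb a) iI (x:=x)) (PsiK_smooth wK iC (x:=ciU t x))
  detK_collar_smooth).
apply: nearMS (collar_nearA z0) => -[s y] As; split; first exact: linemapZ.
by move=> l; exact: (PsiK_collar wC iI).
Qed.

End Smooth.

Variables (Nb : normal_family C) (Nbb : forall a, normal_family (cbK C a)).
Hypotheses (hN : is_normal_choice Nb) (hNb : forall a, is_normal_choice (@Nbb a)).

Lemma detK_collar_product : is_product (detK_collar Nb Nbb).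
Proof.
exists (ceps C); first by rewrite (eps_gt0 wC) lexx.
split.
- by move=> a I t x iI At; exact: (detK_collar_iso wC iI).
- by move=> a I t x iI At; apply: detK_collar_smooth.
- by move=> a I t g x l iI At gI; exact: (detK_collar_equiv wC iI).
- by move=> a I J t u u' l iI iJ IJ At ee er; exact: (detK_collar_tr wC iI iJ IJ l hN hNb At ee er).
Qed.

Lemma detS_collar_product : is_product (detS_collar C).
Proof.
exists (ceps C); first by rewrite (eps_gt0 wC) lexx.
have sur a I (x : kU (cbK C a) I) (iI : idx (cbK C a) I) (l : detS_fib x) :
    exists c, PsiK (cbK C a) I x c = l.
  exact: lin_iso_sur (PsiK_iso (wb a) iI x).
split.
- move=> a I t x iI At; have iC := idx_bdry wC iI.
  apply: (lin_iso_conj (PsiK_iso (wb a) iI x) (PsiK_iso wK iC (ciU t x)) (detK_collar_iso wC iI Nb Nbb x At)).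
  by move=> l; exact: (PsiK_collar wC iI).
- by move=> a I t x iI At; apply: (detS_collar_smooth Nb Nbb).
- move=> a I t g x l iI At gI /=; have [c <-] := sur _ _ _ iI l; have iC := idx_bdry wC iI.
  have eg : ciU t (kaU g x) = kaU g (ciU t x) := co_equiv (cb_chart wC iC) x At gI.
  rewrite (PsiK_act_at (wb a) _ iI gI erefl) !(PsiK_collar wC iI Nb Nbb) //.
  rewrite (PsiK_act_at wK _ iC gI eg); congr (PsiK C I _ _).
  exact: (detK_collar_equiv wC iI).
- move=> a I J t u u' l iI iJ IJ At ee er /=; have [c <-] := sur _ _ _ iI l.
  have cI := idx_bdry wC iI; have cJ := idx_bdry wC iJ.
  rewrite (PsiK_tr_at (wb a) (@hNb a) _ iI iJ IJ erefl erefl) (PsiK_collar wC iI Nb Nbb) //.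
  rewrite (PsiK_collar wC iJ Nb Nbb) // (PsiK_tr_at wK hN _ cI cJ IJ (esym er) (esym ee)).
  by congr (PsiK C J _ _); exact: (detK_collar_tr wC iI iJ IJ c hN hNb At ee er).
Qed.

Lemma PsiK_collar_product :
  kiso_product (detK_collar Nb Nbb) (detS_collar C) (PsiK C) (fun a => PsiK (cbK C a)).
Proof.
exists (ceps C); first by rewrite (eps_gt0 wC) lexx.
by move=> a I t x l iI At; exact: (PsiK_collar wC iI).
Qed.

End CollarProduct.

Theorem proposition3p1p13 (R : realType) (B : kbasic R) (d : int) :
  (forall (X : topologicalType) (K : kdata B X),
     compact_metrizable R X -> is_weak_atlas K d ->
     forall Nb : normal_family K, is_normal_choice Nb ->
     [/\ forall Nb' : normal_family K, is_normal_choice Nb' ->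
           forall I J (u : ktU K I J), idx K I -> idx K J -> (I \proper J)%SET ->
           forall c, Ctilde Nb u c = Ctilde Nb' u c,
         forall I J (u : ktU K I J), idx K I -> idx K J -> (I \proper J)%SET ->
           lin_iso (Ctilde Nb u),
         is_line_kbundle (detK Nb),
         is_line_kbundle (detS K) &
         is_kiso (Lam := detK Nb) (Lam' := detS K) (PsiK K)])
  /\
  (forall (Y : topologicalType) (C : cobdata B Y),
     compact_metrizable R Y -> is_weak_cobordism C d ->
     forall (Nb : normal_family C) (Nbb : forall a, normal_family (cbK C a)),
     is_normal_choice Nb -> (forall a, is_normal_choice (Nbb a)) ->
     [/\ forall Nb' : normal_family C, is_normal_choice Nb' ->
           forall I J (u : ktU C I J), idx C I -> idx C J -> (I \proper J)%SET ->
           forall c, Ctilde Nb u c = Ctilde Nb' u c,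
         forall I J (u : ktU C I J), idx C I -> idx C J -> (I \proper J)%SET ->
           lin_iso (Ctilde Nb u),
         is_line_kbundle (detK Nb),
         is_line_kbundle (detS C) &
         is_kiso (Lam := detK Nb) (Lam' := detS C) (PsiK C)]
     /\
     is_product (detS_collar C) /\
     exists iL : collar_maps (detK Nb) (fun a => detK (Nbb a)),
       is_product iL /\
       kiso_product iL (detS_collar C) (PsiK C) (fun a => PsiK (cbK C a))).
Proof.
(* Atlases and cobordisms differ here only in how [tU_image] is obtained: by absence of boundary in
   the first case, through the collars in the second. *)
have main (X : topologicalType) (K : kdata B X) : is_watlas K d -> tU_image K ->
     forall Nb : normal_family K, is_normal_choice Nb ->
     [/\ forall Nb' : normal_family K, is_normal_choice Nb' ->
           forall I J (u : ktU K I J), idx K I -> idx K J -> (I \proper J)%SET ->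
           forall c, Ctilde Nb u c = Ctilde Nb' u c,
         forall I J (u : ktU K I J), idx K I -> idx K J -> (I \proper J)%SET ->
           lin_iso (Ctilde Nb u),
         is_line_kbundle (detK Nb),
         is_line_kbundle (detS K) &
         is_kiso (Lam := detK Nb) (Lam' := detS K) (PsiK K)].
  move=> wK im Nb hN; have la := tU_image_agree wK im; split.
  - by move=> Nb' hN' I J u iI iJ IJ c; exact: (Ctilde_indep wK).
  - by move=> I J u iI iJ IJ; exact: (Ctilde_iso wK iI iJ IJ u hN).
  - exact: (detK_is_line_kbundle wK la hN).
  - exact: (detS_is_line_kbundle wK la hN).
  - exact: (PsiK_kiso wK hN).
split.
  by move=> X K _ [wK b0 _]; exact: (main X K wK (weak_atlas_tU_image wK b0)).
move=> Y C _ wC Nb Nbb hN hNb; split.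
  exact: (main Y C (cb_watlas wC) (cobordism_tU_image wC) Nb hN).
split; first exact: (detS_collar_product wC hN hNb).
exists (detK_collar Nb Nbb); split; first exact: (detK_collar_product wC hN hNb).
exact: (PsiK_collar_product wC).
Qed.
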